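(* Let $N\geq 4$ be an integer, let $\Gamma_N\subset \mathrm{Sp}_4(\mathbb{R})$ be the monodromy group of the hypergeometric differential equation with parameters $\alpha=\left(\tfrac{N-3}{2N},\tfrac{N-1}{2N},\tfrac{N+1}{2N},\tfrac{N+3}{2N}\right)$ and $\beta=(1,1,1,1)$, let $P\Gamma_N\subset \mathrm{PSp}_4(\mathbb{R})$ be its image in the projectivized symplectic group, and let $R$ and $T$ be the monodromy around $\infty$ and around $1$ respectively. Then: (1) The projective monodromy group is, as an abstract group, isomorphic to $$P\Gamma_N\cong \langle R,T \mid R^N=1\rangle,$$ and it is a discrete subgroup of $\mathrm{PSp}_4(\mathbb{R})$. (2) The full monodromy group $\Gamma_N$ is isomorphic to $P\Gamma_N$ if $N$ is odd, and is a $\mathbb{Z}/2$ central extension of $P\Gamma_N$ if $N$ is even. It is a discrete subgroup of $\mathrm{Sp}_4(\mathbb{R})$. (3) Let $Y_N$ be the orbifold $\mathbb{P}^1(\mathbb{C})\setminus\{0,1\}$ with an orbifold point of order $N$ at $\infty$. Then the (projectivized) monodromy representation induces an isomorphism $\pi_1^{orb}(Y_N)\to P\Gamma_N$.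
   Context: With $D=z\,\partial_z$, the hypergeometric differential equation in question is the equation on $\mathbb{P}^1(\mathbb{C})\setminus\{0,1,\infty\}$ given by the operator $$D^4 - z\,(D+\alpha_1)(D+\alpha_2)(D+\alpha_3)(D+\alpha_4),\qquad (\alpha_1,\alpha_2,\alpha_3,\alpha_4)=\left(\tfrac{N-3}{2N},\tfrac{N-1}{2N},\tfrac{N+1}{2N},\tfrac{N+3}{2N}\right).$$ It has regular singular points at $0,1,\infty$. Its solutions form a local system of rank $4$. The monodromy matrices $g_0,g_1,g_\infty$ along simple loops around $0,1,\infty$ (standard generators of the fundamental group) have the following conjugacy classes: $\det(t-g_\infty)=\prod_j (t-e^{2\pi i\alpha_j})$; $g_0$ is maximally unipotent (a single Jordan block with eigenvalue $1$); $g_1-\mathrm{id}$ has rank $1$ and $\det g_1=1$. The local system is irreducible and is determined up to isomorphism by these conjugacy classes. The monodromy preserves a real structure and a symplectic form, so that the monodromy group $\Gamma_N$ (generated by $g_0,g_1,g_\infty$) is regarded as a subgroup of $\mathrm{Sp}_4(\mathbb{R})$. One sets $R=g_\infty$ and $T=g_1$; the same letters denote their images in $P\Gamma_N$. $\mathrm{PSp}_4(\mathbb{R})=\mathrm{Sp}_4(\mathbb{R})/\{\pm 1\}$. *)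

(* Defs.v *)
From HB Require Import structures.
From mathcomp Require Import all_boot all_order all_algebra.
From mathcomp Require Import complex lra.
From mathcomp Require Import all_classical all_reals all_analysis.

Set Implicit Arguments.
Unset Strict Implicit.
Unset Printing Implicit Defensive.

Import Order.TTheory GRing.Theory Num.Theory numFieldNormedType.Exports.

Local Open Scope classical_set_scope.
Local Open Scope ring_scope.
Local Open Scope complex_scope.
Local Open Scope quotient_scope.

HB.instance Definition _ (R : realType) := NormedModule.copy R[i] R[i]^o.

Section subgroups.
Local Open Scope group_scope.
Context {G H : groupType}.
Implicit Types (A : set G) (B : set H).

Definition is_subgroup A :=
  A 1 /\ forall x y, A x -> A y -> A (x * y^-1).

Definition is_normal_subgroup A :=
  is_subgroup A /\ forall x y, A x -> A (x ^ y).

Definition subgroup_isog A B :=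
  exists2 f : G -> H, {in A &, {morph f : x y / x * y}} & set_bij A B f.

(* Via [p], [A] is a central extension of [B] with kernel of order 2. *)
Definition is_Z2_central_extension (p : G -> H) A B :=
  [/\ {in A &, {morph p : x y / x * y}},
      p @` A = B &
      exists z, [/\ z != 1, A `&` p @^-1` [set 1] = [set 1; z] &
                    forall x, A x -> commute z x]].

End subgroups.

(* The subspace topology on [A] is discrete. *)
Definition is_discrete {T : topologicalType} (A : set T) := A `<=` isolated A.

Section quotient_group.
Local Open Scope group_scope.
Context {G : groupType} (S : set G).

Definition normal_closure : set G := smallest is_normal_subgroup S.

Lemma normal_closure1 : normal_closure 1.
Proof. by move=> A [[[]]]. Qed.

Lemma normal_closure_div x y :
  normal_closure x -> normal_closure y -> normal_closure (x * y^-1).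
Proof. by move=> nx ny A /[dup] -[[[_ +] _] _] nA; apply; [exact: nx|exact: ny]. Qed.

Lemma normal_closureV x : normal_closure x -> normal_closure x^-1.
Proof.
by move=> nx; rewrite -[x^-1]mul1g; exact: normal_closure_div normal_closure1 nx.
Qed.

Lemma normal_closureM x y :
  normal_closure x -> normal_closure y -> normal_closure (x * y).
Proof.
by move=> nx /normal_closureV ny; rewrite -[y]invgK; exact: normal_closure_div.
Qed.

Lemma normal_closureJ x y : normal_closure x -> normal_closure (x ^ y).
Proof. by move=> nx A /[dup] -[[_ +] _] nA; apply; exact: nx. Qed.

Definition coset_rel : rel G := fun x y => `[< normal_closure (x^-1 * y) >].

Lemma coset_rel_refl : reflexive coset_rel.
Proof. by move=> x; apply/asboolP; rewrite mulVg; exact: normal_closure1. Qed.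

Lemma coset_rel_sym : symmetric coset_rel.
Proof.
move=> x y; apply/asboolP/asboolP => /normal_closureV; by rewrite invgM invgK.
Qed.

Lemma coset_rel_trans : transitive coset_rel.
Proof.
move=> y x z /asboolP xy /asboolP yz; apply/asboolP.
by have := normal_closureM xy yz; rewrite mulgA mulgK.
Qed.

Definition coset_equiv : equiv_rel G :=
  EquivRel coset_rel coset_rel_refl coset_rel_sym coset_rel_trans.

(* The quotient of [G] by the normal subgroup generated by [S]. *)
Definition quotient_group := {eq_quot coset_equiv}.

HB.instance Definition _ := Quotient.on quotient_group.
HB.instance Definition _ := [Sub quotient_group of G by %/].
HB.instance Definition _ := [Choice of quotient_group by <:].

Definition quotg (x : G) : quotient_group := \pi_quotient_group x.

Lemma quotgP x y : quotg x = quotg y <-> normal_closure (x^-1 * y).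
Proof.
by split=> [/eqmodP/asboolP//|nxy]; apply/eqmodP/asboolP.
Qed.

Definition quotg_mul (a b : quotient_group) := quotg (repr a * repr b).
Definition quotg_inv (a : quotient_group) := quotg (repr a)^-1.

Lemma quotg_repr a : quotg (repr a) = a. Proof. exact: reprK. Qed.

Lemma quotg_mulE x y : quotg_mul (quotg x) (quotg y) = quotg (x * y).
Proof.
apply/quotgP; set x' := repr _; set y' := repr _.
have /quotgP nx : quotg x' = quotg x by exact: quotg_repr.
have /quotgP ny : quotg y' = quotg y by exact: quotg_repr.
have := normal_closureM (normal_closureJ y' nx) ny.
by rewrite /conjg invgM !mulgA mulgK.
Qed.

Lemma quotg_invE x : quotg_inv (quotg x) = quotg x^-1.
Proof.
apply/quotgP; set x' := repr _.
have /quotgP nx : quotg x' = quotg x by exact: quotg_repr.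
have := normal_closureJ x'^-1 (normal_closureV nx).
by rewrite /conjg !invgK invgM invgK !mulgA mulgK.
Qed.

Let quotgA : associative quotg_mul.
Proof.
by move=> a b c; rewrite -[a]quotg_repr -[b]quotg_repr -[c]quotg_repr
  !quotg_mulE mulgA.
Qed.

Let quot1g : left_id (quotg 1) quotg_mul.
Proof. by move=> a; rewrite -[a]quotg_repr quotg_mulE mul1g. Qed.

Let quotg1 : right_id (quotg 1) quotg_mul.
Proof. by move=> a; rewrite -[a]quotg_repr quotg_mulE mulg1. Qed.

Let quotVg : left_inverse (quotg 1) quotg_inv quotg_mul.
Proof. by move=> a; rewrite -[a]quotg_repr quotg_invE quotg_mulE mulVg. Qed.

Let quotgV : right_inverse (quotg 1) quotg_inv quotg_mul.
Proof. by move=> a; rewrite -[a]quotg_repr quotg_invE quotg_mulE mulgV. Qed.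

HB.instance Definition _ :=
  isGroup.Build quotient_group quotgA quot1g quotg1 quotVg quotgV.

Lemma quotgM : {morph quotg : x y / x * y}.
Proof. by move=> x y; rewrite -quotg_mulE. Qed.

HB.instance Definition _ := isMultiplicative.Build G quotient_group quotg quotgM.

End quotient_group.

Section free_group.
Context (X : choiceType).

(* The letter [(x, true)] stands for [x], the letter [(x, false)] for its
   inverse. *)
Local Notation word := (seq (X * bool)).
Implicit Types (u v w : word).

Inductive free_eq : word -> word -> Prop :=
| free_eq_refl u : free_eq u u
| free_eq_sym u v : free_eq u v -> free_eq v u
| free_eq_trans u v w : free_eq u v -> free_eq v w -> free_eq u w
| free_eq_cancel u v x b : free_eq (u ++ [:: (x, b); (x, ~~ b)] ++ v) (u ++ v).

Lemma free_eq_cat u u' v v' :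
  free_eq u u' -> free_eq v v' -> free_eq (u ++ v) (u' ++ v').
Proof.
move=> uu' vv'; apply: (@free_eq_trans _ (u' ++ v)).
  elim: uu' => [w|w w' _|w1 w2 w3 _ + _|w1 w2 x b].
  - exact: free_eq_refl.
  - exact: free_eq_sym.
  - exact: free_eq_trans.
  - by rewrite -!catA; exact: free_eq_cancel.
elim: vv' => [w|w w' _|w1 w2 w3 _ + _|w1 w2 x b].
- exact: free_eq_refl.
- exact: free_eq_sym.
- exact: free_eq_trans.
- by rewrite !(catA u'); exact: free_eq_cancel.
Qed.

Definition word_inv w : word := rev [seq (a.1, ~~ a.2) | a <- w].

Lemma word_inv_cat u v : word_inv (u ++ v) = word_inv v ++ word_inv u.
Proof. by rewrite /word_inv map_cat rev_cat. Qed.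

Lemma word_invK : involutive word_inv.
Proof.
move=> w; rewrite /word_inv map_rev revK -map_comp map_id_in// => -[x b] _ /=.
by rewrite negbK.
Qed.

Lemma free_eq_inv u v : free_eq u v -> free_eq (word_inv u) (word_inv v).
Proof.
elim=> [w|w w' _|w1 w2 w3 _ + _|w1 w2 x b].
- exact: free_eq_refl.
- exact: free_eq_sym.
- exact: free_eq_trans.
- rewrite !word_inv_cat -catA.
  by have := free_eq_cancel (word_inv w2) (word_inv w1) x b; rewrite -{1}[b]negbK.
Qed.

Lemma free_eqV u : free_eq (word_inv u ++ u) [::].
Proof.
elim: u => [|[x b] u IHu]; first exact: free_eq_refl.
rewrite -cat1s word_inv_cat -catA; apply: free_eq_trans IHu.
by have := free_eq_cancel (word_inv u) u x (~~ b); rewrite negbK.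
Qed.

Definition free_rel : rel word := fun u v => `[< free_eq u v >].

Lemma free_rel_refl : reflexive free_rel.
Proof. by move=> u; apply/asboolP; exact: free_eq_refl. Qed.

Lemma free_rel_sym : symmetric free_rel.
Proof. by move=> u v; apply/asboolP/asboolP; exact: free_eq_sym. Qed.

Lemma free_rel_trans : transitive free_rel.
Proof.
by move=> v u w /asboolP uv /asboolP vw; apply/asboolP; exact: free_eq_trans vw.
Qed.

Definition free_equiv : equiv_rel word :=
  EquivRel free_rel free_rel_refl free_rel_sym free_rel_trans.

Definition free_group := {eq_quot free_equiv}.

HB.instance Definition _ := Choice.on free_group.
HB.instance Definition _ := EqQuotient.on free_group.

Definition free_class w : free_group := \pi_free_group w.

Lemma free_classP u v : free_class u = free_class v <-> free_eq u v.
Proof. by split=> [/eqquotP/asboolP//|uv]; apply/eqquotP/asboolP. Qed.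

Lemma free_class_repr a : free_class (repr a) = a. Proof. exact: reprK. Qed.

Definition free_mul (a b : free_group) := free_class (repr a ++ repr b).
Definition free_inv (a : free_group) := free_class (word_inv (repr a)).

Lemma free_mulE u v : free_mul (free_class u) (free_class v) = free_class (u ++ v).
Proof. by apply/free_classP/free_eq_cat; apply/free_classP/free_class_repr. Qed.

Lemma free_invE u : free_inv (free_class u) = free_class (word_inv u).
Proof. by apply/free_classP/free_eq_inv; apply/free_classP/free_class_repr. Qed.

Let freeA : associative free_mul.
Proof.
by move=> a b c; rewrite -[a]free_class_repr -[b]free_class_repr
  -[c]free_class_repr !free_mulE catA.
Qed.

Let free1g : left_id (free_class [::]) free_mul.
Proof. by move=> a; rewrite -[a]free_class_repr free_mulE. Qed.

Let freeg1 : right_id (free_class [::]) free_mul.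
Proof. by move=> a; rewrite -[a]free_class_repr free_mulE cats0. Qed.

Let freeVg : left_inverse (free_class [::]) free_inv free_mul.
Proof.
move=> a; rewrite -[a]free_class_repr free_invE free_mulE.
exact/free_classP/free_eqV.
Qed.

Let freegV : right_inverse (free_class [::]) free_inv free_mul.
Proof.
move=> a; rewrite -[a]free_class_repr free_invE free_mulE; apply/free_classP.
by have := free_eqV (word_inv (repr a)); rewrite word_invK.
Qed.

HB.instance Definition _ :=
  isGroup.Build free_group freeA free1g freeg1 freeVg freegV.

Definition free_gen (x : X) : free_group := free_class [:: (x, true)].

End free_group.

Section symplectic.
Context {R : realType}.

Definition symp_form : 'M[R]_4 :=
  block_mx 0 1%:M (- 1%:M) 0 : 'M[R]_(2 + 2).

Definition is_symplectic (A : 'M[R]_4) := A^T *m symp_form *m A == symp_form.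

Record Sp4 := MkSp4 { Sp4_mx :> 'M[R]_4; _ : is_symplectic Sp4_mx }.

HB.instance Definition _ := [isSub for Sp4_mx].
HB.instance Definition _ := [Choice of Sp4 by <:].
HB.instance Definition _ := Topological.copy Sp4 (initial_topology Sp4_mx).

Lemma Sp4P (A : Sp4) : A^T *m symp_form *m A = symp_form.
Proof. exact/eqP/(valP A). Qed.

Lemma symp_form_sqr : symp_form *m symp_form = - 1%:M.
Proof.
rewrite /symp_form (@mulmx_block _ 2 2 2 2 2 2) !mulmx0 !mul0mx mulmx1 mul1mx.
rewrite !addr0 add0r [X in _ = - X](@scalar_mx_block _ 2 2 1).
by rewrite (@opp_block_mx _ 2 2 2 2) !oppr0.
Qed.

Definition Sp4_inv_mx (A : 'M[R]_4) : 'M[R]_4 :=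
  - (symp_form *m A^T *m symp_form).

Lemma Sp4_mulVmx (A : Sp4) : Sp4_inv_mx A *m A = 1%:M.
Proof.
by rewrite /Sp4_inv_mx mulNmx -!mulmxA (mulmxA A^T) Sp4P symp_form_sqr opprK.
Qed.

Lemma Sp4_mulmxV (A : Sp4) : A *m Sp4_inv_mx A = 1%:M.
Proof. exact/mulmx1C/Sp4_mulVmx. Qed.

Fact Sp4_mul_subproof (A B : Sp4) : is_symplectic (A *m B).
Proof.
apply/eqP; rewrite trmx_mul -[RHS](Sp4P B) -[in RHS](Sp4P A).
by rewrite !mulmxA.
Qed.

Fact Sp4_one_subproof : is_symplectic 1%:M.
Proof. by rewrite /is_symplectic trmx1 mul1mx mulmx1. Qed.

Fact Sp4_inv_subproof (A : Sp4) : is_symplectic (Sp4_inv_mx A).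
Proof.
apply/eqP; rewrite -[in LHS](Sp4P A) !mulmxA -trmx_mul Sp4_mulmxV trmx1 mul1mx.
by rewrite -mulmxA Sp4_mulmxV mulmx1.
Qed.

Fact Sp4_opp1_subproof : is_symplectic (- 1%:M).
Proof.
rewrite /is_symplectic.
have -> : (- 1%:M : 'M[R]_4)^T = - 1%:M by apply/matrixP => i j; rewrite !mxE eq_sym.
by rewrite mulNmx mul1mx mulmxN mulmx1 opprK.
Qed.

Definition Sp4_mul (A B : Sp4) := MkSp4 (Sp4_mul_subproof A B).
Definition Sp4_inv (A : Sp4) := MkSp4 (Sp4_inv_subproof A).
Definition Sp4_one := MkSp4 Sp4_one_subproof.
Definition Sp4_opp1 := MkSp4 Sp4_opp1_subproof.

Let Sp4A : associative Sp4_mul.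
Proof. by move=> A B C; apply/val_inj; rewrite /= mulmxA. Qed.

Let Sp41g : left_id Sp4_one Sp4_mul.
Proof. by move=> A; apply/val_inj; rewrite /= mul1mx. Qed.

Let Sp4g1 : right_id Sp4_one Sp4_mul.
Proof. by move=> A; apply/val_inj; rewrite /= mulmx1. Qed.

Let Sp4Vg : left_inverse Sp4_one Sp4_inv Sp4_mul.
Proof. by move=> A; apply/val_inj; exact: Sp4_mulVmx. Qed.

Let Sp4gV : right_inverse Sp4_one Sp4_inv Sp4_mul.
Proof. by move=> A; apply/val_inj; exact: Sp4_mulmxV. Qed.

HB.instance Definition _ := isGroup.Build Sp4 Sp4A Sp41g Sp4g1 Sp4Vg Sp4gV.

Definition PSp4 := quotient_group [set Sp4_opp1].

HB.instance Definition _ := Quotient.on PSp4.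
HB.instance Definition _ := Group.on PSp4.
HB.instance Definition _ := Topological.copy PSp4 (quotient_topology PSp4).

Lemma PSp4_openE (U : set PSp4) :
  open U = open ((quotg [set Sp4_opp1] : Sp4 -> PSp4) @^-1` U).
Proof. by []. Qed.

Definition Sp4_proj : Sp4 -> PSp4 := quotg [set Sp4_opp1].

HB.instance Definition _ := Multiplicative.on Sp4_proj.

End symplectic.

Arguments Sp4 : clear implicits.
Arguments PSp4 : clear implicits.

Section within_continuous.

Lemma within_continuous_comp {A B T : topologicalType} (D : set A) (E : set B)
    (f : A -> B) (g : B -> T) :
  {within D, continuous f} -> {within E, continuous g} ->
  (forall x, D x -> E (f x)) -> {within D, continuous (g \o f)}.
Proof.
move=> /subspace_continuousP cf /subspace_continuousP cg DE.
apply/subspace_continuousP => x Dx.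
have fE : f @ within D (nbhs x) --> within E (nbhs (f x)).
  move=> U EU; have := cf x Dx _ EU.
  rewrite !nbhs_simpl /= /within /=; apply: filterS => y Uy Dy.
  exact: Uy Dy (DE y Dy).
exact: cvg_comp fE (cg _ (DE x Dx)).
Qed.

Lemma within_continuous_if {R : realType} {A T : topologicalType} (D : set A)
    (h : A -> R) (c : R) (f g : A -> T) : closed D -> continuous h ->
  {within D `&` [set x | h x <= c], continuous f} ->
  {within D `&` [set x | c <= h x], continuous g} ->
  (forall x, D x -> h x = c -> f x = g x) ->
  {within D, continuous (fun x => if h x <= c then f x else g x)}.
Proof.
move=> cD ch cf cg fg.
have -> : D = (D `&` [set x | h x <= c]) `|` (D `&` [set x | c <= h x]).
  apply/seteqP; split=> [x Dx|x [] []//].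
  by have [hc|/ltW hc] := leP (h x) c; [left|right].
apply: withinU_continuous.
- apply: closedI => //; exact: ((continuous_closedP h).1 ch _ (@closed_le R c)).
- apply: closedI => //; exact: ((continuous_closedP h).1 ch _ (@closed_ge R c)).
- apply: (subspace_eq_continuous _ cf) => x; rewrite inE => -[_ hx]; by rewrite /from_subspace /= ifT.
- apply: (subspace_eq_continuous _ cg) => x; rewrite inE => -[Dx hx]; rewrite /from_subspace /=.
  by case: ifPn => // hx'; rewrite fg//; apply/eqP; rewrite eq_le hx hx'.
Qed.

Lemma continuous_pair {A B C : topologicalType} (f : A -> B) (g : A -> C) :
  continuous f -> continuous g -> continuous (fun x => (f x, g x)).
Proof. by move=> cf cg x; apply: cvg_pair; [exact: cf|exact: cg]. Qed.

Lemma continuous_identity {A : topologicalType} : continuous (@id A).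
Proof. by move=> x; exact: cvg_id. Qed.

Lemma continuous_fst {A B : topologicalType} : continuous (@fst A B).
Proof. by move=> x; exact: cvg_fst. Qed.

Lemma continuous_snd {A B : topologicalType} : continuous (@snd A B).
Proof. by move=> x; exact: cvg_snd. Qed.

Lemma continuous_scale {R : realType} {A : topologicalType} (h : A -> R) a :
  continuous h -> continuous (fun x => a * h x).
Proof. by move=> ch x; apply: (@cvgM R); [exact: cvg_cst|exact: ch]. Qed.

Lemma continuous_add {R : realType} {A : topologicalType} (h k : A -> R) :
  continuous h -> continuous k -> continuous (fun x => h x + k x).
Proof. by move=> ch ck x; apply: (@cvgD _ R^o); [exact: ch|exact: ck]. Qed.

Lemma continuous_sub {R : realType} {A : topologicalType} (h k : A -> R) :
  continuous h -> continuous k -> continuous (fun x => h x - k x).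
Proof. by move=> ch ck x; apply: (@cvgB _ R^o); [exact: ch|exact: ck]. Qed.

Lemma continuous_mul {R : realType} {A : topologicalType} (h k : A -> R) :
  continuous h -> continuous k -> continuous (fun x => h x * k x).
Proof. by move=> ch ck x; apply: (@cvgM R); [exact: ch|exact: ck]. Qed.

Lemma continuous_const {A B : topologicalType} (c : B) :
  continuous (fun _ : A => c).
Proof. by move=> x; exact: cvg_cst. Qed.

Lemma continuous_minr {R : realType} {A : topologicalType} (h k : A -> R) :
  continuous h -> continuous k -> continuous (fun x => Num.min (h x) (k x)).
Proof.
by move=> ch ck x; exact: (@continuous_min R A h k x (ch x) (ck x)).
Qed.

Lemma continuous_maxr {R : realType} {A : topologicalType} (h k : A -> R) :
  continuous h -> continuous k -> continuous (fun x => Num.max (h x) (k x)).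
Proof.
by move=> ch ck x; exact: (@continuous_max R A h k x (ch x) (ck x)).
Qed.

End within_continuous.

Section fundamental_group.
Context {R : realType} {T : topologicalType} (X : set T) (b : T).

Local Notation I := (`[0%R, 1%R]%classic : set R).

Record loop := MkLoop {
  loop_fun :> R -> T;
  _ : {within I, continuous loop_fun};
  _ : forall t, I t -> X (loop_fun t);
  _ : loop_fun 0 = b;
  _ : loop_fun 1 = b }.

HB.instance Definition _ := gen_eqMixin loop.
HB.instance Definition _ := gen_choiceMixin loop.

Implicit Types (p q r : loop).

Lemma loop_continuous p : {within I, continuous p}. Proof. by case: p. Qed.
Lemma loop_in p t : I t -> X (p t). Proof. by case: p => f /= _ + _ _; apply. Qed.
Lemma loop0 p : p 0 = b. Proof. by case: p. Qed.
Lemma loop1 p : p 1 = b. Proof. by case: p. Qed.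

Definition homotopic p q := exists H : R * R -> T,
  [/\ {within I `*` I, continuous H},
      forall s t, I s -> I t -> X (H (s, t)),
      forall t, I t -> H (0, t) = p t /\ H (1, t) = q t &
      forall s, I s -> H (s, 0) = b /\ H (s, 1) = b].

Lemma unit_itv0 : I 0. Proof. by rewrite /= in_itv /= lexx ler01. Qed.
Lemma unit_itv1 : I 1. Proof. by rewrite /= in_itv /= lexx ler01. Qed.

Lemma unit_itv_rev t : I t -> I (1 - t).
Proof. by rewrite /= !in_itv /=; lra. Qed.

Lemma closed_unit_square : closed (I `*` I).
Proof.
have -> : I `*` I = fst @^-1` I `&` snd @^-1` I by apply/seteqP; split.
apply: closedI; apply: (continuous_closedP _).1 (@itv_closed _ R 0 1).
  exact: continuous_fst.
exact: continuous_snd.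
Qed.

Lemma unit_itv_half_le t : I t -> t <= 2^-1 -> I (2 * t).
Proof. by rewrite /= !in_itv /=; lra. Qed.

Lemma unit_itv_half_ge t : I t -> 2^-1 <= t -> I (2 * t - 1).
Proof. by rewrite /= !in_itv /=; lra. Qed.

Lemma homotopic_reparam p (phi psi : R -> R) q r :
  continuous phi -> continuous psi ->
  (forall t, I t -> I (phi t)) -> (forall t, I t -> I (psi t)) ->
  phi 0 = psi 0 -> phi 1 = psi 1 ->
  (forall t, I t -> q t = p (phi t)) -> (forall t, I t -> r t = p (psi t)) ->
  homotopic q r.
Proof.
move=> cphi cpsi Iphi Ipsi e0 e1 qE rE.
pose h (st : R * R) := phi st.2 + st.1 * (psi st.2 - phi st.2).
have Ih st : (I `*` I) st -> I (h st).
  move=> [Is It]; have := Iphi _ It; have := Ipsi _ It; move: Is.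
  by rewrite /h /= !in_itv /=; nra.
have c2 (f : R -> R) : continuous f -> continuous (fun st : R * R => f st.2).
  by move=> cf x; apply: continuous_comp; [exact: continuous_snd|exact: cf].
exists (p \o h); split=> /=.
- apply: (within_continuous_comp _ (@loop_continuous p) Ih).
  apply: continuous_subspaceT; apply: continuous_add; first exact: c2.
  apply: continuous_mul; first exact: continuous_fst.
  by apply: continuous_sub; exact: c2.
- by move=> s t Is It; apply: loop_in; exact: Ih.
- move=> t It; rewrite /h /= mul0r addr0 mul1r addrC subrK.
  by rewrite qE// rE.
- move=> s Is; rewrite /h /= e0 e1 !subrr !mulr0 !addr0.
  by rewrite -!rE ?loop0 ?loop1//; [exact: unit_itv1|exact: unit_itv0].
Qed.

Lemma homotopic_eq p q : (forall t, I t -> p t = q t) -> homotopic p q.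
Proof.
move=> pq; apply: (@homotopic_reparam q id id) => //; exact: (@continuous_identity R).
Qed.

Lemma homotopic_refl p : homotopic p p.
Proof. exact: homotopic_eq. Qed.

Lemma homotopic_sym p q : homotopic p q -> homotopic q p.
Proof.
move=> [H [cH XH H01 Hb]]; exists (H \o (fun st => (1 - st.1, st.2))); split=> /=.
- apply: (within_continuous_comp _ cH); last by move=> x [/unit_itv_rev x1 x2].
  apply: continuous_subspaceT; apply: continuous_pair; last exact: continuous_snd.
  by apply: continuous_sub; [exact: continuous_const|exact: continuous_fst].
- by move=> s t /unit_itv_rev Is It; exact: XH.
- by move=> t It; rewrite subr0 subrr; have [] := H01 t It.
- by move=> s /unit_itv_rev Is; exact: Hb.
Qed.

Lemma homotopic_trans p q r : homotopic p q -> homotopic q r -> homotopic p r.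
Proof.
move=> [H [cH XH H01 Hb]] [K [cK XK K01 Kb]].
exists (fun st => if st.1 <= 2^-1 then (H \o (fun st => (2 * st.1, st.2))) st
                  else (K \o (fun st => (2 * st.1 - 1, st.2))) st); split.
- apply: within_continuous_if.
  + exact: closed_unit_square.
  + exact: continuous_fst.
  + apply: within_continuous_comp cH _; last first.
      by move=> x [[x1 x2] /= xh]; split=> //=; exact: unit_itv_half_le.
    apply: continuous_subspaceT; apply: continuous_pair; last exact: continuous_snd.
    by apply: continuous_scale; exact: continuous_fst.
  + apply: within_continuous_comp cK _; last first.
      by move=> x [[x1 x2] /= xh]; split=> //=; exact: unit_itv_half_ge.
    apply: continuous_subspaceT; apply: continuous_pair; last exact: continuous_snd.
    apply: continuous_sub; last exact: continuous_const.
    by apply: continuous_scale; exact: continuous_fst.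
  + move=> x [_ x2] /= ->; rewrite divff// subrr.
    by rewrite (H01 _ x2).2 (K01 _ x2).1.
- move=> s t Is It /=; case: ifPn => hs; first exact: XH (unit_itv_half_le Is hs) It.
  by apply: XK It; apply: unit_itv_half_ge => //; rewrite -ltNge in hs; exact: ltW.
- move=> t It /=; have [Ht _] := H01 t It; have [_ Kt] := K01 t It.
  rewrite mulr0 Ht mulr1 ifT ?invr_ge0// ifF; last by apply/negbTE; rewrite -ltNge; lra.
  by split=> //; rewrite -Kt; congr (K (_, _)); lra.
- move=> s Is /=; case: ifPn => hs; first exact: Hb (unit_itv_half_le Is hs).
  by apply: Kb; apply: unit_itv_half_ge => //; rewrite -ltNge in hs; exact: ltW.
Qed.

Definition path_cat (f g : R -> T) t :=
  if t <= 2^-1 then f (2 * t) else g (2 * t - 1).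

Fact loop_cat_continuous p q : {within I, continuous (path_cat p q)}.
Proof.
apply: within_continuous_if.
- exact: itv_closed.
- exact: continuous_identity.
- apply: (within_continuous_comp _ (@loop_continuous p)); last first.
    by move=> t [It /= th]; exact: unit_itv_half_le.
  by apply: continuous_subspaceT; apply: continuous_scale; exact: continuous_identity.
- apply: (within_continuous_comp _ (@loop_continuous q)); last first.
    by move=> t [It /= th]; exact: unit_itv_half_ge.
  apply: continuous_subspaceT; apply: continuous_sub; last exact: continuous_const.
  by apply: continuous_scale; exact: continuous_identity.
- by move=> t _ ->; rewrite divff// subrr loop1 loop0.
Qed.

Fact loop_cat_in p q t : I t -> X (path_cat p q t).
Proof.
rewrite /path_cat => It; case: ifPn => ht; apply: loop_in.
  exact: unit_itv_half_le.
by apply: unit_itv_half_ge => //; rewrite -ltNge in ht; exact: ltW.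
Qed.

Fact loop_cat0 p q : path_cat p q 0 = b.
Proof. by rewrite /path_cat invr_ge0 ler0n mulr0 loop0. Qed.

Fact loop_cat1 p q : path_cat p q 1 = b.
Proof.
rewrite /path_cat ifF; last by apply/negbTE; rewrite -ltNge; lra.
by rewrite mulr1 (_ : 2 - 1 = 1 :> R) ?loop1//; lra.
Qed.

Definition loop_cat p q :=
  MkLoop (@loop_cat_continuous p q) (@loop_cat_in p q) (loop_cat0 p q) (loop_cat1 p q).

Fact loop_rev_continuous p : {within I, continuous (fun t => p (1 - t))}.
Proof.
apply: (within_continuous_comp _ (@loop_continuous p) unit_itv_rev).
apply: continuous_subspaceT.
by apply: continuous_sub; [exact: continuous_const|exact: continuous_identity].
Qed.

Fact loop_rev_in p t : I t -> X (p (1 - t)).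
Proof. by move=> /unit_itv_rev; exact: loop_in. Qed.

Fact loop_rev0 p : p (1 - 0) = b. Proof. by rewrite subr0 loop1. Qed.
Fact loop_rev1 p : p (1 - 1) = b. Proof. by rewrite subrr loop0. Qed.

Definition loop_rev p :=
  MkLoop (@loop_rev_continuous p) (@loop_rev_in p) (loop_rev0 p) (loop_rev1 p).

Lemma homotopic_cat p p' q q' :
  homotopic p p' -> homotopic q q' -> homotopic (loop_cat p q) (loop_cat p' q').
Proof.
move=> [H [cH XH H01 Hb]] [K [cK XK K01 Kb]].
exists (fun st => if st.2 <= 2^-1 then (H \o (fun st => (st.1, 2 * st.2))) st
                  else (K \o (fun st => (st.1, 2 * st.2 - 1))) st); split.
- apply: within_continuous_if.
  + exact: closed_unit_square.
  + exact: continuous_snd.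
  + apply: within_continuous_comp cH _; last first.
      by move=> x [[x1 x2] /= xh]; split=> //=; exact: unit_itv_half_le.
    apply: continuous_subspaceT; apply: continuous_pair; first exact: continuous_fst.
    by apply: continuous_scale; exact: continuous_snd.
  + apply: within_continuous_comp cK _; last first.
      by move=> x [[x1 x2] /= xh]; split=> //=; exact: unit_itv_half_ge.
    apply: continuous_subspaceT; apply: continuous_pair; first exact: continuous_fst.
    apply: continuous_sub; last exact: continuous_const.
    by apply: continuous_scale; exact: continuous_snd.
  + move=> x [x1 _] /= ->; rewrite divff// subrr.
    by rewrite (Hb _ x1).2 (Kb _ x1).1.
- move=> s t Is It /=; case: ifPn => ht; first exact: XH Is (unit_itv_half_le It ht).
  by apply: XK Is _; apply: unit_itv_half_ge => //; rewrite -ltNge in ht; exact: ltW.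
- move=> t It; rewrite /= /path_cat; case: ifPn => ht.
    exact: H01 (unit_itv_half_le It ht).
  by apply: K01; apply: unit_itv_half_ge => //; rewrite -ltNge in ht; exact: ltW.
- move=> s Is /=; rewrite mulr0 invr_ge0 ler0n (Hb _ Is).1; split=> //.
  rewrite ifF; last by apply/negbTE; rewrite -ltNge; lra.
  by rewrite mulr1 (_ : 2 - 1 = 1 :> R) ?(Kb _ Is).2//; lra.
Qed.

Lemma homotopic_rev p p' : homotopic p p' -> homotopic (loop_rev p) (loop_rev p').
Proof.
move=> [H [cH XH H01 Hb]]; exists (H \o (fun st => (st.1, 1 - st.2))); split=> /=.
- apply: (within_continuous_comp _ cH); last by move=> x [x1 /unit_itv_rev x2].
  apply: continuous_subspaceT; apply: continuous_pair; first exact: continuous_fst.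
  by apply: continuous_sub; [exact: continuous_const|exact: continuous_snd].
- by move=> s t Is /unit_itv_rev It; exact: XH.
- by move=> t /unit_itv_rev It; exact: H01.
- by move=> s Is; rewrite subr0 subrr; have [] := Hb s Is.
Qed.

Lemma homotopic_catA p q r :
  homotopic (loop_cat p (loop_cat q r)) (loop_cat (loop_cat p q) r).
Proof.
apply: homotopic_sym.
pose phi (t : R) := Num.min (Num.min (2 * t) (t + 4^-1)) (2^-1 * t + 2^-1).
apply: (@homotopic_reparam (loop_cat p (loop_cat q r)) phi id).
- have c1 : continuous (fun t : R => 2 * t).
    by apply: continuous_scale; exact: continuous_identity.
  have c2 : continuous (fun t : R => t + 4^-1).
    by apply: continuous_add; [exact: continuous_identity|exact: continuous_const].
  have c3 : continuous (fun t : R => 2^-1 * t + 2^-1).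
    apply: continuous_add; last exact: continuous_const.
    by apply: continuous_scale; exact: continuous_identity.
  apply: continuous_minr; last exact: c3.
  by apply: continuous_minr; [exact: c1|exact: c2].
- exact: continuous_identity.
- move=> t; rewrite /= !in_itv /= /phi.
  by case: (leP (2 * t)) => ?; case: (leP _ (2^-1 * _ + _)) => ?; lra.
- by [].
- by rewrite /phi; case: (leP (2 * 0)) => ?; case: leP => ?; lra.
- by rewrite /phi; case: (leP (2 * 1)) => ?; case: leP => ?; lra.
- move=> t; rewrite /= in_itv /= => /andP[t0 t1]; rewrite /path_cat /=.
  rewrite /path_cat.
  have F (x y : R) : y < x -> (x <= y) = false by rewrite ltNge => /negbTE.
  have [ta|ta] := leP t 4^-1.
    have -> : phi t = 2 * t.
      by rewrite /phi; case: (leP (2 * t)) => ?;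
        case: (leP _ (2^-1 * _ + _)) => ?; lra.
    have -> : t <= 2^-1 by lra.
    by have -> : 2 * t <= 2^-1 by lra.
  have [tb|tb] := leP t 2^-1.
    have -> : phi t = t + 4^-1.
      by rewrite /phi; case: (leP (2 * t)) => ?;
        case: (leP _ (2^-1 * _ + _)) => ?; lra.
    have -> : (2 * t <= 2^-1) = false by apply: F; lra.
    have -> : (t + 4^-1 <= 2^-1) = false by apply: F; lra.
    have -> : 2 * (t + 4^-1) - 1 <= 2^-1 by lra.
    by congr (q _); lra.
  have -> : phi t = 2^-1 * t + 2^-1.
    by rewrite /phi; case: (leP (2 * t)) => ?; case: (leP _ (2^-1 * _ + _)) => ?;
       lra.
  have -> : (2^-1 * t + 2^-1 <= 2^-1) = false by apply: F; lra.
  have -> : (2 * (2^-1 * t + 2^-1) - 1 <= 2^-1) = false by apply: F; lra.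
  by congr (r _); lra.
- by [].
Qed.

Lemma homotopic_catV p (c : loop) : (forall t, c t = b) ->
  homotopic (loop_cat p (loop_rev p)) c.
Proof.
move=> cb; pose phi (t : R) := Num.min (2 * t) (2 - 2 * t).
apply: (@homotopic_reparam p phi (fun=> 0)).
- have c1 : continuous (fun t : R => 2 * t).
    by apply: continuous_scale; exact: continuous_identity.
  have c2 : continuous (fun t : R => 2 - 2 * t).
    by apply: continuous_sub; [exact: continuous_const|exact: c1].
  by apply: continuous_minr; [exact: c1|exact: c2].
- exact: continuous_const.
- move=> t; rewrite /= !in_itv /= /phi minEle.
  by case: ifP => ?; lra.
- by move=> t _; exact: unit_itv0.
- by rewrite /phi minEle; case: ifP => ?; lra.
- by rewrite /phi minEle; case: ifP => ?; lra.
- move=> t _; rewrite /= /path_cat /phi minEle.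
  by case: ifP => ?; case: ifP => ?; congr (p _); lra.
- by move=> t _; rewrite cb loop0.
Qed.

Lemma homotopic_catVl p (c : loop) : (forall t, c t = b) ->
  homotopic (loop_cat (loop_rev p) p) c.
Proof.
move=> cb; have := homotopic_catV (loop_rev p) cb; apply: homotopic_trans.
apply: homotopic_cat; first exact: homotopic_refl.
by apply: homotopic_eq => t _ /=; rewrite subKr.
Qed.

Lemma homotopic_cat1 p (c : loop) : (forall t, c t = b) -> homotopic (loop_cat p c) p.
Proof.
move=> cb; pose phi (t : R) := Num.min (2 * t) 1.
apply: (@homotopic_reparam p phi id).
- have c1 : continuous (fun t : R => 2 * t).
    by apply: continuous_scale; exact: continuous_identity.
  by apply: continuous_minr; [exact: c1|exact: continuous_const].
- exact: continuous_identity.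
- move=> t; rewrite /= !in_itv /= /phi minEle.
  by case: ifP => ?; lra.
- by [].
- by rewrite /phi minEle; case: ifP => ?; lra.
- by rewrite /phi minEle; case: ifP => ?; lra.
- move=> t _; rewrite /= /path_cat /phi minEle cb.
  have [ht|ht] := leP t 2^-1; first by rewrite ifT//; lra.
  by rewrite ifF ?loop1//; apply/negbTE; rewrite -ltNge; lra.
- by [].
Qed.

Lemma homotopic_cat1l p (c : loop) : (forall t, c t = b) -> homotopic (loop_cat c p) p.
Proof.
move=> cb; pose phi (t : R) := Num.max (2 * t - 1) 0.
apply: (@homotopic_reparam p phi id).
- have c1 : continuous (fun t : R => 2 * t - 1).
    apply: continuous_sub; last exact: continuous_const.
    by apply: continuous_scale; exact: continuous_identity.
  by apply: continuous_maxr; [exact: c1|exact: continuous_const].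
- exact: continuous_identity.
- move=> t; rewrite /= !in_itv /= /phi maxEle.
  by case: ifP => ?; lra.
- by [].
- by rewrite /phi maxEle; case: ifP => ?; lra.
- by rewrite /phi maxEle; case: ifP => ?; lra.
- move=> t _; rewrite /= /path_cat /phi maxEle cb.
  have [ht|ht] := leP t 2^-1; first by rewrite ifT ?loop0//; lra.
  by rewrite ifF//; apply/negbTE; rewrite -ltNge; lra.
- by [].
Qed.

Definition homotopic_rel : rel loop := fun p q => `[< homotopic p q >].

Lemma homotopic_rel_refl : reflexive homotopic_rel.
Proof. by move=> p; apply/asboolP; exact: homotopic_refl. Qed.

Lemma homotopic_rel_sym : symmetric homotopic_rel.
Proof. by move=> p q; apply/asboolP/asboolP; exact: homotopic_sym. Qed.

Lemma homotopic_rel_trans : transitive homotopic_rel.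
Proof.
by move=> q p r /asboolP pq /asboolP qr; apply/asboolP; exact: homotopic_trans qr.
Qed.

Definition homotopic_equiv : equiv_rel loop :=
  EquivRel homotopic_rel homotopic_rel_refl homotopic_rel_sym homotopic_rel_trans.

Section group.
Hypothesis Xb : X b.

Definition loop_const : loop :=
  MkLoop (continuous_subspaceT (@continuous_const R T b)) (fun t _ => Xb)
    erefl erefl.

(* The base point is required to lie in [X], so that the constant loop exists;
   the product follows its first factor first. *)
Definition pi1 of X b := {eq_quot homotopic_equiv}.

Local Notation pi1X := (pi1 Xb).

HB.instance Definition _ := Choice.on pi1X.
HB.instance Definition _ := EqQuotient.on pi1X.

Definition pi1_class p : pi1X := \pi_pi1X p.

Lemma pi1_classP p q : pi1_class p = pi1_class q <-> homotopic p q.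
Proof. by split=> [/eqquotP/asboolP//|pq]; apply/eqquotP/asboolP. Qed.

Lemma pi1_class_repr a : pi1_class (repr a) = a. Proof. exact: reprK. Qed.

Definition pi1_mul (a c : pi1X) := pi1_class (loop_cat (repr a) (repr c)).
Definition pi1_inv (a : pi1X) := pi1_class (loop_rev (repr a)).

Lemma pi1_mulE p q : pi1_mul (pi1_class p) (pi1_class q) = pi1_class (loop_cat p q).
Proof. by apply/pi1_classP/homotopic_cat; apply/pi1_classP/pi1_class_repr. Qed.

Lemma pi1_invE p : pi1_inv (pi1_class p) = pi1_class (loop_rev p).
Proof. by apply/pi1_classP/homotopic_rev; apply/pi1_classP/pi1_class_repr. Qed.

Let pi1A : associative pi1_mul.
Proof.
move=> x y z; rewrite -[x]pi1_class_repr -[y]pi1_class_repr -[z]pi1_class_repr.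
by rewrite !pi1_mulE; apply/pi1_classP/homotopic_catA.
Qed.

Let pi11g : left_id (pi1_class loop_const) pi1_mul.
Proof.
move=> x; rewrite -[x]pi1_class_repr pi1_mulE.
exact/pi1_classP/homotopic_cat1l.
Qed.

Let pi1g1 : right_id (pi1_class loop_const) pi1_mul.
Proof.
move=> x; rewrite -[x]pi1_class_repr pi1_mulE.
exact/pi1_classP/homotopic_cat1.
Qed.

Let pi1Vg : left_inverse (pi1_class loop_const) pi1_inv pi1_mul.
Proof.
move=> x; rewrite -[x]pi1_class_repr pi1_invE pi1_mulE.
exact/pi1_classP/homotopic_catVl.
Qed.

Let pi1gV : right_inverse (pi1_class loop_const) pi1_inv pi1_mul.
Proof.
move=> x; rewrite -[x]pi1_class_repr pi1_invE pi1_mulE.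
exact/pi1_classP/homotopic_catV.
Qed.

HB.instance Definition _ := isGroup.Build pi1X pi1A pi11g pi1g1 pi1Vg pi1gV.

End group.
End fundamental_group.

Arguments loop R {T} X b.
Arguments pi1 R {T X b} Xb.
Arguments pi1_class {R T X b} Xb p.

Section complex_topology.
Context {R : realType}.

Lemma real_complex_continuous : continuous (fun x : R => x%:C : R[i]).
Proof.
move=> x; apply/(@cvgrPdist_lt R[i] R[i]) => e e0.
have eE : e = (complex.Re e)%:C by rewrite -(ger0_norm (ltW e0)) normc_def.
have re0 : 0 < complex.Re e by rewrite eE ltcR in e0.
have : \forall y \near x, `|x - y| < complex.Re e.
  exact: (@cvgr_dist_lt _ R^o _ _ _ id x cvg_id).
apply: filterS => y xy.
by rewrite -raddfB /= normc_def /= expr0n addr0 sqrtr_sqr eE ltcR.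
Qed.

Lemma Complex_continuous {A : topologicalType} (f g : A -> R) :
  continuous f -> continuous g -> continuous (fun x => f x +i* g x : R[i]).
Proof.
move=> cf cg.
have -> : (fun x => f x +i* g x : R[i]) = (fun x => (f x)%:C + 'i * (g x)%:C).
  by apply/funext => x; simpc.
move=> x; apply: (@cvgD R[i] R[i]).
  by apply: continuous_comp; [exact: cf|exact: real_complex_continuous].
apply: (@cvgM R[i]); first exact: cvg_cst.
by apply: continuous_comp; [exact: cg|exact: real_complex_continuous].
Qed.

End complex_topology.

Section standard_loops.
Context {R : realType}.

Definition punctured_plane : set R[i] := [set z | z != 0 /\ z != 1].
Definition base_point : R[i] := (3 / 2)%:C.

Fact base_point_in : punctured_plane base_point.
Proof.
split; apply/eqP => /eqP; rewrite eq_complex /= ?eqxx ?andbT => /eqP; lra.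
Qed.

Definition C01_loop := loop R punctured_plane base_point.
Definition pi1_C01 := pi1 R base_point_in.

Definition around1_fun (t : R) : R[i] :=
  (1 + 2^-1 * cos (2 * pi * t)) +i* (2^-1 * sin (2 * pi * t)).
Definition around_infty_fun (t : R) : R[i] :=
  (3 / 2 * cos (2 * pi * t)) -i* (3 / 2 * sin (2 * pi * t)).

Let c2pi (f : R -> R) : continuous f -> continuous (fun t : R => f (2 * pi * t)).
Proof.
move=> cf x; apply: continuous_comp; last exact: cf.
by apply: continuous_scale; exact: continuous_identity.
Qed.

Fact around1_continuous : continuous around1_fun.
Proof.
apply: Complex_continuous.
  apply: continuous_add; first exact: continuous_const.
  by apply: continuous_scale; apply: c2pi; exact: continuous_cos.
by apply: continuous_scale; apply: c2pi; exact: continuous_sin.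
Qed.

Fact around_infty_continuous : continuous around_infty_fun.
Proof.
apply: Complex_continuous.
  by apply: continuous_scale; apply: c2pi; exact: continuous_cos.
move=> x; apply: (@cvgN _ R^o); move: x.
by apply: continuous_scale; apply: c2pi; exact: continuous_sin.
Qed.

Fact around1_in t : punctured_plane (around1_fun t).
Proof.
have := cos2Dsin2 (2 * pi * t); have := cos_geN1 (2 * pi * t).
rewrite /around1_fun; set c := cos _; set s := sin _ => c1 cs.
by split; apply/eqP => -[] h1 h2; nra.
Qed.

Fact around_infty_in t : punctured_plane (around_infty_fun t).
Proof.
have := cos2Dsin2 (2 * pi * t).
rewrite /around_infty_fun; set c := cos _; set s := sin _ => cs.
by split; apply/eqP => -[] h1 h2; nra.
Qed.

Fact around1_0 : around1_fun 0 = base_point.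
Proof.
rewrite /around1_fun mulr0 cos0 sin0.
by apply/eqP; rewrite eq_complex /=; apply/andP; split; apply/eqP; lra.
Qed.

Fact around1_1 : around1_fun 1 = base_point.
Proof.
rewrite /around1_fun mulr1 (_ : 2 * pi = pi *+ 2); last by rewrite mulr_natl.
rewrite cos2pi sin2pi.
by apply/eqP; rewrite eq_complex /=; apply/andP; split; apply/eqP; lra.
Qed.

Fact around_infty_0 : around_infty_fun 0 = base_point.
Proof.
rewrite /around_infty_fun mulr0 cos0 sin0.
by apply/eqP; rewrite eq_complex /=; apply/andP; split; apply/eqP; lra.
Qed.

Fact around_infty_1 : around_infty_fun 1 = base_point.
Proof.
rewrite /around_infty_fun mulr1 (_ : 2 * pi = pi *+ 2); last by rewrite mulr_natl.
rewrite cos2pi sin2pi.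
by apply/eqP; rewrite eq_complex /=; apply/andP; split; apply/eqP; lra.
Qed.

(* The circle of radius 1/2 about 1, run counterclockwise. *)
Definition loop_around1 : C01_loop :=
  MkLoop (continuous_subspaceT around1_continuous) (fun t _ => around1_in t)
    around1_0 around1_1.

(* The circle of radius 3/2 about 0, which encloses 0 and 1, run clockwise,
   hence once positively around infinity. *)
Definition loop_around_infty : C01_loop :=
  MkLoop (continuous_subspaceT around_infty_continuous)
    (fun t _ => around_infty_in t) around_infty_0 around_infty_1.

End standard_loops.

Section hypergeometric_equation.
Context {R : realType}.
Implicit Types (g h : R[i] -> R[i]) (z : R[i]) (f : 'I_4 -> R[i] -> R[i]).

(* [D + a], where [D = z d/dz]. *)
Definition euler (a : R[i]) g : R[i] -> R[i] :=
  fun z => z * derive1 g z + a * g z.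

Definition hypergeometric_op (N : nat) g : R[i] -> R[i] :=
  let n : R[i] := N%:R in
  fun z =>
    iter 4 (euler 0) g z
    - z * euler ((n - 3) / (2 * n)) (euler ((n - 1) / (2 * n))
           (euler ((n + 1) / (2 * n)) (euler ((n + 3) / (2 * n)) g))) z.

(* [derive1] is total, so the existence of the four complex derivatives
   involved has to be required explicitly. *)
Definition local_solution N z g := \forall w \near z,
  (forall k, (k < 4)%N -> derivable (derive1n k g) w 1) /\
  hypergeometric_op N g w = 0.

Definition germ_eq z g h := \forall w \near z, g w = h w.

(* The germ of [h] at [p 1] is the analytic continuation along [p] of the germ
   of the solution [g] at [p 0]. *)
Definition continues N (p : R -> R[i]) g h :=
  exists F : R -> R[i] -> R[i],
  [/\ forall t : R, t \in `[0, 1] -> local_solution N (p t) (F t),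
      forall t : R, t \in `[0, 1] ->
        \forall s \near t, s \in `[0, 1] -> germ_eq (p s) (F s) (F t),
      germ_eq (p 0) (F 0) g &
      germ_eq (p 1) (F 1) h].

Definition solution_basis N f :=
  (forall i, local_solution N base_point (f i)) /\
  forall g, local_solution N base_point g ->
    exists! c : 'rV[R[i]]_4,
      germ_eq base_point g (fun z => \sum_i c 0 i * f i z).

(* The rows of [M] give the continued basis in terms of the basis, so that
   following [p] and then [q] has matrix [M_p *m M_q]. *)
Definition monodromy_mx N f (p : C01_loop) (M : 'M[R[i]]_4) :=
  forall i, continues N p (f i) (fun z => \sum_j M i j * f j z).

Definition monodromy N f (p : C01_loop) (A : Sp4 R) :=
  monodromy_mx N f p (map_mx (real_complex R) A).

(* A basis in which the monodromy is real and preserves the standard symplectic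
   form; it identifies the monodromy group with a subgroup of Sp_4(R). *)
Definition real_symplectic_basis N f :=
  solution_basis N f /\ forall p, exists A, monodromy N f p A.

(* Monodromies along all loops, that is, the image of the fundamental group. *)
Definition Gamma N f : set (Sp4 R) := [set A | exists p, monodromy N f p A].

Definition PGamma N f : set (PSp4 R) := Sp4_proj @` Gamma N f.

(* Orbifold fundamental group of the projective line minus 0 and 1 with a cone
   point of order [N] at infinity: the [N]-th power of the loop around infinity
   is killed. *)
Definition pi1_orb N :=
  quotient_group
    [set (pi1_class base_point_in loop_around_infty ^+ N)%g : @pi1_C01 R].

HB.instance Definition _ N := Group.on (pi1_orb N).

Definition pi1_orb_class N (p : C01_loop) : pi1_orb N :=
  quotg _ (pi1_class base_point_in p).

End hypergeometric_equation.

Arguments pi1_orb R N : clear implicits.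

Variant RT_letter := letter_R | letter_T.

HB.instance Definition _ := gen_eqMixin RT_letter.
HB.instance Definition _ := gen_choiceMixin RT_letter.

(* The group presented by generators R, T and the single relation R^N = 1. *)
Definition RT_group (N : nat) :=
  quotient_group [set (free_gen letter_R ^+ N)%g].

HB.instance Definition _ N := Group.on (RT_group N).

Definition RT_gen N (x : RT_letter) : RT_group N := quotg _ (free_gen x).

(* Main.v *)
Require Import Defs.
From HB Require Import structures.
From mathcomp Require Import all_boot all_order all_algebra.
From mathcomp Require Import complex ring lra.
From mathcomp Require Import all_classical all_reals all_analysis.

Set Implicit Arguments.
Unset Strict Implicit.
Unset Printing Implicit Defensive.

Import Order.TTheory GRing.Theory Num.Theory numFieldNormedType.Exports.

Local Open Scope classical_set_scope.
Local Open Scope ring_scope.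
Local Open Scope complex_scope.

(** The monodromy group is found by rigidity and then shown to be free of
    unexpected relations by a game of ping-pong on real cones.

    The analytic part supplies three local facts. A solution is the first entry
    of a row of jets that satisfies a first-order system, so that the solutions
    near a point of the punctured plane form a four-dimensional space and can be
    continued along paths, with a result that depends only on the homotopy class
    ([local_system], [continues_homotopic]). Frobenius series at the three
    singular points then give the local monodromies: at infinity the
    eigenvalues are the numbers exp(2 i pi alpha_j) ([char_poly_infinity]); at 1
    there are three independent holomorphic solutions, so that the monodromy
    differs from the identity by a matrix of rank at most one
    ([fixed_around1]); at 0 the monodromy is unipotent ([char_poly_zero]). The
    loops around infinity and 1 generate the fundamental group
    ([pi1_generated]), and their product is inverse to a loop around 0.

    Such a triple of matrices is determined up to conjugation: [levelt] brings
    the monodromy around infinity to - S, where S is the companion matrix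
    [model_S] of the polynomial with the roots exp(i pi k / N) for k in
    {-3, -1, 1, 3}, and the monodromy around 1 to the transvection
    v => v + al v *: H, where al v is the first coordinate of v and H is the
    vector [model_H]. These matrices are real, and they preserve the symplectic
    form [model_form]. A Darboux basis of this form gives the real symplectic
    basis of solutions ([symplectic_basis_exists]).

    A row vector is read as a sequence, namely as a combination of four
    consecutive translates of the sequence u(x) = s(x - 1) s(x) s(x + 1) with
    s(x) = sin (pi x / N). In this description S is the shift, S ^ N = - 1, and
    the first coordinate is, up to a positive factor, minus the value at 0. There
    is an explicit simplicial cone K, spanned by H and three other vectors, with
    the property that for 0 < j < N the transvection maps K S^j into - K, and
    its inverse maps K S^j into the image of K under the reflection x => - x, up
    to sign. Since H lies in K, the other nonzero powers behave in the same way.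
    Hence the union X of K, its reflection and their negatives satisfies
    T^n (X S^j) <= X whenever n <> 0 and N does not divide j ([pingpong]), while
    the interior of K does not meet X S^j for these j ([cells_disjoint]).

    Every element of <R, T | R^N = 1> is a power of R or an alternating word in
    powers of R and T ([nf_all]). By ping-pong such a word sends some rotated
    copy of an interior point of K into a rotated copy of X, where the word 1
    could not send it; so an element that keeps a suitable finite set of
    test points in their open cones is trivial ([sectors_fixed]). This gives the
    presentation, and, the condition being open, discreteness as well. Finally
    R^N = (- S)^N is 1 for odd N and - 1 for even N, which decides whether the
    full group contains the central element - 1; and the orbifold fundamental
    group is a quotient of <R, T | R^N = 1> through which the
    isomorphism onto the projective group factors. *)

(** * Complex differentiation with a real-valued modulus *)

Section modulus.
Context {R : realType}.
Implicit Types (z w h : R[i]) (f g : R[i] -> R[i]).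

Definition modulus z : R := complex.Re `|z|.
Local Notation m := modulus.

Lemma modulus_normc z : `|z| = (m z)%:C.
Proof. by rewrite /modulus normc_def. Qed.

Lemma modulusE z : m z = Num.sqrt ((complex.Re z) ^+ 2 + (complex.Im z) ^+ 2).
Proof. by rewrite /modulus normc_def. Qed.

Lemma modulus_ge0 z : 0 <= m z.
Proof. by rewrite modulusE sqrtr_ge0. Qed.

Lemma modulusM z w : m (z * w) = m z * m w.
Proof. by rewrite /modulus normrM !modulus_normc -rmorphM. Qed.

Lemma modulusD z w : m (z + w) <= m z + m w.
Proof. by have := ler_normD z w; rewrite !modulus_normc -rmorphD lecR. Qed.

Lemma modulusN z : m (- z) = m z.
Proof. by rewrite /modulus normrN. Qed.

Lemma modulusB z w : m (z - w) = m (w - z).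
Proof. by rewrite -modulusN opprB. Qed.

Lemma modulus0 : m 0 = 0.
Proof. by rewrite /modulus normr0. Qed.

Lemma modulus1 : m 1 = 1.
Proof. by rewrite /modulus normr1. Qed.

Lemma modulusX z n : m (z ^+ n) = m z ^+ n.
Proof. by elim: n => [|n IH]; rewrite ?expr0 ?modulus1// !exprS modulusM IH. Qed.

Lemma modulus_eq0 z : (m z == 0) = (z == 0).
Proof. by rewrite -[in RHS]normr_eq0 modulus_normc; apply/eqP/eqP => [->//|[]]. Qed.

Lemma modulus_gt0 z : (0 < m z) = (z != 0).
Proof. by rewrite lt_neqAle modulus_ge0 andbT eq_sym modulus_eq0. Qed.

Lemma modulusV z : m z^-1 = (m z)^-1.
Proof. by rewrite {1}/modulus normfV modulus_normc -fmorphV. Qed.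

Lemma modulus_real (x : R) : m x%:C = `|x|.
Proof. by rewrite modulusE /= expr0n addr0 sqrtr_sqr. Qed.

Lemma modulus_nat (n : nat) : m n%:R = n%:R.
Proof. by rewrite /modulus normr_nat -(rmorph_nat (real_complex R)). Qed.

Lemma Re_le_modulus z : `|complex.Re z| <= m z.
Proof. by rewrite modulusE -sqrtr_sqr ler_wsqrtr// lerDl sqr_ge0. Qed.

Lemma Im_le_modulus z : `|complex.Im z| <= m z.
Proof. by rewrite modulusE -sqrtr_sqr ler_wsqrtr// lerDr sqr_ge0. Qed.

Lemma modulus_le_ReIm z : m z <= `|complex.Re z| + `|complex.Im z|.
Proof.
case: z => a b; rewrite [X in m X <= _](_ : _ = a%:C + 'i * b%:C); last by simpc.
rewrite (le_trans (modulusD _ _))// modulusM !modulus_real.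
by rewrite (_ : m 'i = 1) ?mul1r// modulusE /= expr0n expr1n add0r sqrtr1.
Qed.

Lemma nbhs_modulusP z (P : set R[i]) :
  nbhs z P <-> exists2 r : R, 0 < r & forall w, m (w - z) < r -> P w.
Proof.
split.
  move=> /(@nbhs_ballP R[i]) [e /= e0 H].
  have eE : e = (complex.Re e)%:C by rewrite -(ger0_norm (ltW e0)) modulus_normc.
  exists (complex.Re e); first by rewrite eE ltcR in e0.
  by move=> w wz; apply: H; rewrite -ball_normE /= distrC modulus_normc eE ltcR.
move=> [r r0 H]; apply/(@nbhs_ballP R[i]); exists r%:C; first by rewrite /= ltcR.
move=> w; rewrite -ball_normE /= distrC modulus_normc ltcR; exact: H.
Qed.

Definition cderiv f z d := forall e : R, 0 < e ->
  exists2 r : R, 0 < r & forall h, m h < r -> m (f (z + h) - f z - h * d) <= e * m h.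

Lemma cderivP f z d : cderiv f z d <-> is_derive z (1 : R[i]) f d.
Proof.
split=> [H|[df <-]].
  suff cv : (fun h => h^-1 *: ((f \o shift z) (h *: (1 : R[i])) - f z)) @ 0^' --> d.
    have df : derivable f z 1 by apply: cvgP cv.
    by apply: DeriveDef => //; apply: cvg_lim cv; exact: norm_hausdorff.
  apply/(@cvgrPdist_le R[i] R[i]) => e e0.
  have eE : e = (complex.Re e)%:C by rewrite -(ger0_norm (ltW e0)) modulus_normc.
  have e0' : 0 < complex.Re e by rewrite eE ltcR in e0.
  have [r r0 Hr] := H _ e0'.
  rewrite /= near_withinE; apply/nbhs_modulusP; exists r => // h; rewrite subr0 => hr h0.
  rewrite /= eE modulus_normc lecR /shift.
  rewrite (_ : d - _ = - (h^-1 * (f (z + h) - f z - h * d))); last first.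
    rewrite /GRing.scale /= mulr1 (addrC h z) [in RHS]mulrBr mulrA mulVf// mul1r opprB//.
  rewrite modulusN modulusM modulusV mulrC ler_pdivrMr ?modulus_gt0//; exact: Hr.
move=> e e0.
have := df; move/(@cvgrPdist_le R[i] R[i])/(_ e%:C); rewrite ltcR => /(_ e0).
rewrite /= near_withinE => /nbhs_modulusP [r r0 Hr]; exists r => // h hr.
have [->|h0] := eqVneq h 0; first by rewrite addr0 mul0r subrr subr0 modulus0 mulr0.
have := Hr h; rewrite subr0 => /(_ hr h0); rewrite modulus_normc lecR => /=.
rewrite /shift /= [X in m (_ - X)](_ : _ = h^-1 * (f (z + h) - f z)); last first.
  by rewrite /GRing.scale /= mulr1 (addrC h z).
move=> Hh; rewrite (_ : _ - _ - _ = - (h * ('D_1 f z - h^-1 * (f (z + h) - f z)))); last first.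
  by rewrite mulrBr mulrA mulfV// mul1r opprB.
rewrite modulusN modulusM mulrC ler_wpM2r ?modulus_ge0//.
Qed.

Lemma cderiv_continuous f z d : cderiv f z d -> {for z, continuous f}.
Proof.
by move=> /cderivP [/derivable1_diffP/differentiable_continuous].
Qed.

Lemma cderiv_unique f z d1 d2 : cderiv f z d1 -> cderiv f z d2 -> d1 = d2.
Proof. by move=> /cderivP [_ <-] /cderivP [_ <-]. Qed.

Lemma cderiv_near f g z d : (\forall w \near z, f w = g w) -> cderiv f z d -> cderiv g z d.
Proof.
move=> /nbhs_modulusP [r r0 fg] fd e e0; have [s s0 Hs] := fd _ e0.
exists (Num.min r s); first by rewrite lt_min r0.
move=> h; rewrite lt_min => /andP[hr hs].
by rewrite -!fg ?subrr ?modulus0//; [exact: Hs|rewrite addrC addKr].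
Qed.

Lemma cderiv_cst c z : cderiv (fun=> c) z 0.
Proof. by apply/cderivP; exact: is_derive_cst. Qed.

Lemma cderiv_id z : cderiv id z 1.
Proof. by apply/cderivP; exact: is_derive_id. Qed.

Lemma cderivD f g z a b : cderiv f z a -> cderiv g z b ->
  cderiv (fun w => f w + g w) z (a + b).
Proof. by move=> /cderivP fa /cderivP gb; apply/cderivP; exact: is_deriveD. Qed.

Lemma cderivB f g z a b : cderiv f z a -> cderiv g z b ->
  cderiv (fun w => f w - g w) z (a - b).
Proof. by move=> /cderivP fa /cderivP gb; apply/cderivP; exact: is_deriveB. Qed.

Lemma cderivM f g z a b : cderiv f z a -> cderiv g z b ->
  cderiv (fun w => f w * g w) z (a * g z + f z * b).
Proof.
move=> /cderivP fa /cderivP gb; apply/cderivP.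
have := @is_deriveM R[i] R[i] f g z 1 a b fa gb.
by rewrite /GRing.scale /= [f z * b + _]addrC [g z * a]mulrC.
Qed.

Lemma cderivZ f z c a : cderiv f z a -> cderiv (fun w => c * f w) z (c * a).
Proof. by move=> fa; have := cderivM (cderiv_cst c z) fa; rewrite mul0r add0r. Qed.

Lemma cderiv_ext f g z d : f =1 g -> cderiv f z d -> cderiv g z d.
Proof. by move=> /funext ->. Qed.

Lemma cderiv_sum (I : Type) (r : seq I) (F : I -> R[i] -> R[i]) (D : I -> R[i]) z :
  (forall i, cderiv (F i) z (D i)) ->
  cderiv (fun w => \sum_(i <- r) F i w) z (\sum_(i <- r) D i).
Proof.
move=> H; elim: r => [|i r IH].
  rewrite big_nil; apply: (cderiv_ext _ (cderiv_cst 0 z)).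
  by move=> w; rewrite big_nil.
rewrite big_cons; apply: (cderiv_ext _ (cderivD (H i) IH)).
by move=> w; rewrite big_cons.
Qed.

Lemma cderiv_comp f g z a b : cderiv f z a -> cderiv g (f z) b ->
  cderiv (g \o f) z (b * a).
Proof.
move=> fa gb e e0.
pose c := m a + 1; pose k := m b + 1 + c.
have a0 := modulus_ge0 a; have b0 := modulus_ge0 b.
have c0 : 0 < c by rewrite /c; lra.
have k0 : 0 < k by rewrite /k; lra.
pose e' := Num.min 1 (e / k).
have e'0 : 0 < e' by rewrite lt_min ltr01 divr_gt0.
have [r r0 Hr] := fa _ e'0; have [s s0 Hs] := gb _ e'0.
exists (Num.min r (s / c)); first by rewrite lt_min r0 divr_gt0.
move=> h; rewrite lt_min => /andP[hr hs].
pose u := f (z + h) - f z.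
have h0 := modulus_ge0 h.
have e'1 : e' <= 1 by rewrite ge_min lexx.
have e'k : e' * k <= e by rewrite -ler_pdivlMr// ge_min lexx orbT.
have Hh := Hr h hr.
have um : m u <= c * m h.
  rewrite (_ : u = (u - h * a) + h * a); last by rewrite subrK.
  rewrite (le_trans (modulusD _ _))// modulusM /c.
  rewrite mulrDl mul1r addrC (mulrC (m h)) lerD2l (le_trans Hh)//.
  by rewrite -[leRHS]mul1r ler_wpM2r.
have us : m u < s by apply: (le_lt_trans um); rewrite mulrC -ltr_pdivlMr.
have Gu := Hs u us.
rewrite /= (_ : f (z + h) = f z + u); last by rewrite /u [RHS]addrC subrK.
rewrite (_ : _ - _ - _ = (g (f z + u) - g (f z) - u * b) + b * (u - h * a)); last first.
  ring.
rewrite (le_trans (modulusD _ _))// modulusM.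
apply: (@le_trans _ _ (e' * (c * m h) + m b * (e' * m h))).
  apply: lerD; first by rewrite (le_trans Gu)// ler_wpM2l// ltW.
  by rewrite ler_wpM2l.
rewrite (_ : _ + _ = e' * (c + m b) * m h); last by ring.
rewrite ler_wpM2r// (le_trans _ e'k)// ler_wpM2l ?(ltW e'0)// /k; lra.
Qed.

Lemma cderivV z : z != 0 -> cderiv (fun w => w^-1) z (- (z ^+ 2)^-1).
Proof.
move=> z0 e e0.
have mz : 0 < m z by rewrite modulus_gt0.
exists (Num.min (m z / 2) (e * (m z ^+ 3 / 2))).
  by rewrite lt_min divr_gt0// mulr_gt0// divr_gt0// exprn_gt0.
move=> h; rewrite lt_min => /andP[h1 h2].
have mzh : m z / 2 <= m (z + h).
  have := modulusD (z + h) (- h); rewrite addrK modulusN; lra.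
have zh0 : z + h != 0 by rewrite -modulus_gt0 (lt_le_trans _ mzh)// divr_gt0.
rewrite (_ : _ - _ = h * h * ((z + h)^-1 * (z ^+ 2)^-1)); last by field; rewrite zh0 z0.
rewrite !modulusM !modulusV modulusX [m h * m h * _]mulrAC ler_wpM2r ?modulus_ge0//.
apply: (@le_trans _ _ (m h * ((m z / 2)^-1 * (m z ^+ 2)^-1))).
  rewrite ler_wpM2l ?modulus_ge0// ler_wpM2r ?invr_ge0 ?exprn_ge0 ?modulus_ge0//.
  by rewrite lef_pV2 ?posrE// ?(lt_le_trans _ mzh)// divr_gt0.
rewrite (_ : _^-1 * _^-1 = (m z ^+ 3 / 2)^-1); last by field; rewrite gt_eqF.
by rewrite ler_pdivrMr ?divr_gt0 ?exprn_gt0// ltW.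
Qed.

End modulus.

(** * Convergent sums and power series *)

Section real_derivative.
Context {R : realType}.

Lemma rderivP (f : R -> R) (t d : R) : is_derive t (1 : R) f d <->
  forall e : R, 0 < e -> exists2 r : R, 0 < r &
    forall h, `|h| < r -> `|f (t + h) - f t - h * d| <= e * `|h|.
Proof.
split=> [[df <-] e e0|H].
  have := df; move/(@cvgrPdist_le _ R^o)/(_ e e0).
  rewrite /= near_withinE => -[r /= r0 Hr]; exists r => // h hr.
  have [->|h0] := eqVneq h 0; first by rewrite addr0 mul0r subrr subr0 normr0 mulr0.
  have := Hr h; rewrite /= sub0r normrN => /(_ hr h0).
  rewrite /GRing.scale /= mulr1 (addrC h t) => Hh.
  rewrite (_ : _ - _ - _ = - (h * ('D_1 f t - h^-1 * (f (t + h) - f t)))); last first.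
    by rewrite mulrBr mulrA mulfV// mul1r opprB.
  by rewrite normrN normrM mulrC ler_wpM2r.
suff cv : (fun h => h^-1 *: ((f \o shift t) (h *: (1 : R)) - f t)) @ 0^' --> d.
  have df : derivable f t 1 by apply: cvgP cv.
  by apply: DeriveDef => //; apply: cvg_lim cv; exact: norm_hausdorff.
apply/(@cvgrPdist_le _ R^o) => e e0; have [r r0 Hr] := H _ e0.
rewrite /= near_withinE; exists r => // h; rewrite /= sub0r normrN => hr h0.
rewrite (_ : d - _ = - (h^-1 * (f (t + h) - f t - h * d))); last first.
  rewrite /GRing.scale /= mulr1 (addrC h t) [in RHS]mulrBr mulrA mulVf// mul1r opprB//.
by rewrite normrN normrM normfV mulrC ler_pdivrMr ?normr_gt0//; exact: Hr.
Qed.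

End real_derivative.

Section constant.
Context {R : realType}.
Implicit Types (z w : R[i]) (f : R[i] -> R[i]) (D : set R[i]).
Local Notation m := modulus.

Definition cconvex D := forall z w (t : R), D z -> D w -> 0 <= t <= 1 ->
  D (z + t%:C * (w - z)).

Lemma cconvex_disc z0 r : cconvex [set z | m (z - z0) < r].
Proof.
move=> z w t /= zr wr /andP[t0 t1].
rewrite (_ : _ - z0 = (1 - t)%:C * (z - z0) + t%:C * (w - z0)); last first.
  by rewrite rmorphB rmorph1; ring.
rewrite (le_lt_trans (modulusD _ _))// !modulusM !modulus_real !ger0_norm ?subr_ge0//.
have [->|t0'] := eqVneq t 0; first by rewrite mul0r addr0 subr0 mul1r.
have : 0 < t by rewrite lt_neqAle eq_sym t0'.
nra.
Qed.

Let line_const D f z w : cconvex D -> (forall x, D x -> cderiv f x 0) -> D z -> D w ->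
  complex.Re (f w) = complex.Re (f z).
Proof.
move=> cD df Dz Dw.
pose g (t : R) := complex.Re (f (z + t%:C * (w - z))).
have dg (t : R) : 0 <= t <= 1 -> is_derive t (1 : R) g 0.
  move=> t01; apply/rderivP => e e0.
  have k0 : 0 < m (w - z) + 1 by rewrite ltr_pwDr// modulus_ge0.
  have [r r0 Hr] := df _ (cD z w t Dz Dw t01) (e / (m (w - z) + 1)) (divr_gt0 e0 k0).
  exists (r / (m (w - z) + 1)); first exact: divr_gt0.
  move=> h hr; rewrite mulr0 subr0 /g.
  have mh : m (h%:C * (w - z)) <= `|h| * (m (w - z) + 1).
    by rewrite modulusM modulus_real ler_wpM2l// lerDl.
  have := Hr (h%:C * (w - z)); rewrite mulr0 subr0 => Hh.
  rewrite -raddfB (le_trans (Re_le_modulus _))//.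
  rewrite rmorphD mulrDl addrA (le_trans (Hh _))//.
    by rewrite (le_lt_trans mh)// -ltr_pdivlMr.
  rewrite -mulrA ler_pM2l// mulrC ler_pdivrMr//.
have [||c _] := @MVT_segment R g (fun=> 0) 0 1 ler01.
- by move=> x; rewrite in_itv /= => /andP[/ltW a /ltW b]; apply: dg; rewrite a.
- apply: derivable_within_continuous => x; rewrite in_itv /= => x01.
  by have [] := dg _ x01.
have -> : g 1 = complex.Re (f w) by rewrite /g mul1r addrC subrK.
have -> : g 0 = complex.Re (f z) by rewrite /g mul0r addr0.
rewrite mul0r => /eqP.
by rewrite subr_eq0 => /eqP.
Qed.

Lemma cderiv0_const D f z w : cconvex D -> (forall x, D x -> cderiv f x 0) ->
  D z -> D w -> f w = f z.
Proof.
move=> cD df Dz Dw; apply/eqP; rewrite eq_complex (line_const cD df Dz Dw) eqxx /=.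
have df' x : D x -> cderiv (fun z => - 'i * f z) x 0.
  by move=> Dx; have := cderivZ (- 'i) (df _ Dx); rewrite mulr0.
have := line_const cD df' Dz Dw.
case: (f w) (f z) => a b [c d] /=.
by rewrite !oppr0 !mul0r !sub0r !mulN1r !opprK => ->.
Qed.

End constant.

Section sums.
Context {R : realType}.
Implicit Types (a b : nat -> R[i]) (s t : R[i]).
Local Notation m := modulus.

Definition sums a s := forall e : R, 0 < e ->
  exists N, forall n, (N <= n)%N -> m (s - \sum_(k < n) a k) <= e.

Lemma sums_bound a s M : sums a s -> (forall n, m (\sum_(k < n) a k) <= M) -> m s <= M.
Proof.
move=> sa H; apply/ler_addgt0Pr => e e0; have [N HN] := sa _ e0.
rewrite -[s](subrK (\sum_(k < N) a k)) addrC addrC (le_trans (modulusD _ _))// addrC.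
by apply: lerD; [exact: H|exact: HN].
Qed.

Lemma sums_ext a b s : a =1 b -> sums a s -> sums b s.
Proof. by move=> /funext ->. Qed.

Lemma sumsD a b s t : sums a s -> sums b t -> sums (fun n => a n + b n) (s + t).
Proof.
move=> sa sb e e0; have e2 : 0 < e / 2 by rewrite divr_gt0.
have [N HN] := sa _ e2; have [M HM] := sb _ e2; exists (maxn N M) => n.
rewrite geq_max => /andP[nN nM].
rewrite big_split /= opprD addrACA (le_trans (modulusD _ _))//.
by rewrite [e]splitr lerD// ?HN ?HM.
Qed.

Lemma sumsZ a s c : sums a s -> sums (fun n => c * a n) (c * s).
Proof.
move=> sa e e0; have k0 : 0 < m c + 1 by rewrite ltr_pwDr// modulus_ge0.
have [N HN] := sa _ (divr_gt0 e0 k0); exists N => n nN.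
rewrite -mulr_sumr -mulrBr modulusM.
apply: (@le_trans _ _ ((m c + 1) * (e / (m c + 1)))).
  by rewrite ler_pM ?modulus_ge0// ?HN// lerDl.
by rewrite mulrC divfK// gt_eqF.
Qed.

Lemma sums_unique a s t : sums a s -> sums a t -> s = t.
Proof.
move=> sa ta; apply/eqP; rewrite -subr_eq0 -modulus_eq0 eq_le modulus_ge0 andbT.
have := sumsD sa (sumsZ (-1) ta); rewrite mulN1r => /sums_bound; apply=> n.
by rewrite big1 ?modulus0// => i _; rewrite mulN1r subrr.
Qed.

Lemma sums_shift a s : sums (fun n => a n.+1) s <-> sums a (a 0%N + s).
Proof.
split=> sa e e0; have [N HN] := sa _ e0.
  exists N.+1 => -[//|n] nN; rewrite big_ord_recl /= opprD addrACA subrr add0r.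
  exact: HN.
exists N => n nN; have := HN n.+1 (leqW nN).
by rewrite big_ord_recl /= opprD addrACA subrr add0r.
Qed.

Lemma sums_pad a s : a 0%N = 0 -> sums (fun n => a n.+1) s -> sums a s.
Proof. by move=> a0 /sums_shift; rewrite a0 add0r. Qed.

Lemma sums_exists a (u : nat -> R) : (forall n, m (a n) <= u n) ->
  cvgn (series u) -> exists s, sums a s.
Proof.
move=> au cu.
have part (f : R[i] -> R) : (forall z, `|f z| <= m z) ->
    cvgn (series (fun n => f (a n))).
  move=> fm; apply: normed_cvg; apply: series_le_cvg cu => n /=.
  - by [].
  - by rewrite (le_trans _ (au n))// modulus_ge0.
  - exact: le_trans (fm _) (au n).
have cre := part (@complex.Re R) (@Re_le_modulus R).
have cim := part (@complex.Im R) (@Im_le_modulus R).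
exists (limn (series (fun n => complex.Re (a n))) +i* limn (series (fun n => complex.Im (a n)))).
move=> e e0; have e2 : 0 < e / 2 by rewrite divr_gt0.
have /(@cvgrPdist_le _ R^o)/(_ _ e2)[N _ HN] := cre.
have /(@cvgrPdist_le _ R^o)/(_ _ e2)[M _ HM] := cim.
exists (maxn N M) => n; rewrite geq_max => /andP[nN nM].
rewrite (le_trans (modulus_le_ReIm _))// [e]splitr lerD// raddfB raddf_sum /=.
  by have := HN n nN; rewrite /series /= big_mkord.
by have := HM n nM; rewrite /series /= big_mkord.
Qed.

Definition csum a : R[i] := xget 0 (sums a).

Lemma csumE a s : sums a s -> csum a = s.
Proof. by move=> sa; rewrite /csum; case: xgetP => [t _ ta|/(_ s)//]; exact: sums_unique ta sa. Qed.

End sums.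

Section power_series.
Context {R : realType}.
Implicit Types (a b : nat -> R[i]) (z w : R[i]).
Local Notation m := modulus.

Definition psconv (rho : R) a :=
  forall r, 0 <= r < rho -> exists C, forall n, m (a n) * r ^+ n <= C.

Definition ps a z := csum (fun n => a n * z ^+ n).

Lemma psconv_geo (rho : R) a : psconv rho a -> forall r, 0 <= r < rho ->
  exists C q, [/\ 0 <= C, 0 <= q < 1 & forall n, m (a n) * r ^+ n <= C * q ^+ n].
Proof.
move=> ha r /andP[r0 rr]; pose r' := (r + rho) / 2.
have r'0 : 0 < r' by rewrite /r'; lra.
have [C HC] : exists C, forall n, m (a n) * r' ^+ n <= C by apply: ha; rewrite /r'; lra.
exists C, (r / r'); split.
- by rewrite (le_trans _ (HC 0%N))// mulr_ge0// modulus_ge0.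
- by rewrite divr_ge0 ?(ltW r'0)//= ltr_pdivrMr// mul1r /r'; lra.
- move=> n; rewrite expr_div_n mulrA ler_pdivlMr ?exprn_gt0// mulrAC.
  by rewrite ler_wpM2r ?exprn_ge0.
Qed.

Lemma cvg_geo (C q : R) : 0 <= q < 1 -> cvgn (series (fun n => C * q ^+ n)).
Proof.
move=> /andP[q0 q1]; apply: (@is_cvg_geometric_series R C q).
by rewrite ger0_norm.
Qed.

Lemma ps_sums (rho : R) a z : psconv rho a -> m z < rho ->
  sums (fun n => a n * z ^+ n) (ps a z).
Proof.
move=> ha zr; have mz := modulus_ge0 z.
have [|C [q [C0 q1 HC]]] := psconv_geo ha (r := m z); first by rewrite mz.
have [|s sa] := sums_exists _ (@cvg_geo C q q1) (a := fun n => a n * z ^+ n).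
  by move=> n; rewrite modulusM modulusX; exact: HC.
by rewrite /ps (csumE sa).
Qed.

Lemma ps_partial_bound (rho : R) a r : psconv rho a -> 0 <= r < rho ->
  exists M, forall n, \sum_(k < n) m (a k) * r ^+ k <= M.
Proof.
move=> ha rr; have [C [q [C0 q1 HC]]] := psconv_geo ha rr.
case/andP: q1 => q0 q1.
exists (C / (1 - q)) => n.
apply: (@le_trans _ _ (\sum_(k < n) C * q ^+ k)); first by apply: ler_sum => k _; exact: HC.
rewrite -mulr_sumr ler_wpM2l// -[leRHS]mul1r ler_pdivlMr ?subr_gt0//.
by rewrite mulrC -opprB mulNr -subrX1 opprB gerBl exprn_ge0.
Qed.

Lemma psconv_deriv (rho : R) a : psconv rho a -> psconv rho (fun n => n.+1%:R * a n.+1).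
Proof.
move=> ha r /andP[r0 rr]; pose r' := (r + rho) / 2.
have r'0 : 0 < r' by rewrite /r'; lra.
have r'r : r < r' by rewrite /r'; lra.
have [C HC] : exists C, forall n, m (a n) * r' ^+ n <= C by apply: ha; rewrite /r'; lra.
have C0 : 0 <= C by rewrite (le_trans _ (HC 0%N))// mulr_ge0// modulus_ge0.
pose x := r / r'.
have x0 : 0 <= x by rewrite divr_ge0// ltW.
have x1 : x < 1 by rewrite ltr_pdivrMr// mul1r.
exists (C / r' / (1 - x)) => n.
have bd : n.+1%:R * x ^+ n <= (1 - x)^-1.
  rewrite -[leRHS]mul1r ler_pdivlMr ?subr_gt0//.
  apply: (@le_trans _ _ ((\sum_(k < n.+1) x ^+ k) * (1 - x))).
    have -> : n.+1%:R * x ^+ n = \sum_(k < n.+1) x ^+ n.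
      by rewrite sumr_const card_ord mulr_natl.
    rewrite ler_wpM2r ?subr_ge0 ?(ltW x1)//; apply: ler_sum => k _.
    by apply: ler_wiXn2l => //; [exact: ltW|rewrite -ltnS].
  by rewrite mulrC -opprB mulNr -subrX1 opprB gerBl exprn_ge0.
rewrite modulusM modulus_nat.
have -> : n.+1%:R * m (a n.+1) * r ^+ n = (m (a n.+1) * r' ^+ n.+1) / r' * (n.+1%:R * x ^+ n).
  have gen (A B M D E : R) : D != 0 -> B != 0 -> E * M * A = M * (D * B) / D * (E * (A / B)).
    by move=> D0 B0; field; rewrite ?D0 ?B0.
  by rewrite /x (expr_div_n r r') (exprS r'); apply: gen; rewrite ?expf_neq0 ?gt_eqF.
apply: ler_pM => //.
- by rewrite divr_ge0 ?(ltW r'0)// mulr_ge0 ?modulus_ge0// exprn_ge0// ltW.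
- by rewrite mulr_ge0// exprn_ge0.
- by rewrite ler_wpM2r ?invr_ge0 ?(ltW r'0)//.
Qed.

Let rem z h n : R[i] := (z + h) ^+ n - z ^+ n - h * (n%:R * z ^+ n.-1).

Let rem_le z h (r : R) n : m z + m h <= r ->
  m (rem z h n.+2) <= n.+2%:R * n.+1%:R * r ^+ n * m h ^+ 2.
Proof.
move=> zr; have h0 := modulus_ge0 h; have z0 := modulus_ge0 z.
have r0 : 0 <= r by lra.
elim: n => [|n IH].
  rewrite /rem (_ : _ - _ = h ^+ 2); last by rewrite /=; ring.
  by rewrite modulusX expr0 mulr1 ler_peMl ?exprn_ge0// -natrM ler1n.
have -> : rem z h n.+3 = (z + h) * rem z h n.+2 + n.+2%:R * z ^+ n.+1 * h ^+ 2.
  rewrite /rem /= -[n.+3%:R]natr1 !exprS; ring.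
rewrite (le_trans (modulusD _ _))// !modulusM modulus_nat !modulusX.
apply: (@le_trans _ _ (r * (n.+2%:R * n.+1%:R * r ^+ n * m h ^+ 2) +
                       n.+2%:R * r ^+ n.+1 * m h ^+ 2)).
  apply: lerD.
    by apply: ler_pM => //; rewrite ?modulus_ge0// (le_trans (modulusD _ _)).
  apply: ler_wpM2r; first by rewrite ?mulr_ge0 ?exprn_ge0.
  by apply: ler_wpM2l => //; apply: lerXn2r; rewrite ?nnegrE//; lra.
have -> : r * (n.+2%:R * n.+1%:R * r ^+ n * m h ^+ 2) + n.+2%:R * r ^+ n.+1 * m h ^+ 2 =
   n.+2%:R * n.+2%:R * r ^+ n.+1 * m h ^+ 2.
  rewrite (exprS r) -!natr1; ring.
apply: ler_wpM2r; first by rewrite ?mulr_ge0 ?exprn_ge0.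
apply: ler_wpM2r; first by rewrite ?mulr_ge0 ?exprn_ge0.
by apply: ler_wpM2r => //; rewrite ler_nat.
Qed.

Lemma ps_cderiv (rho : R) a z : psconv rho a -> m z < rho ->
  cderiv (ps a) z (ps (fun n => n.+1%:R * a n.+1) z).
Proof.
move=> ha zr; have z0 := modulus_ge0 z.
have ha1 := psconv_deriv ha; have ha2 := psconv_deriv ha1.
pose r := (m z + rho) / 2; have rr : 0 <= r < rho by rewrite /r; lra.
have [M HM] := ps_partial_bound ha2 rr.
have M0 : 0 <= M by rewrite (le_trans _ (HM 0%N))// big_ord0.
move=> e e0; exists (Num.min (r - m z) (e / (M + 1))).
  rewrite lt_min; apply/andP; split; first by rewrite /r; lra.
  by rewrite divr_gt0// ltr_wpDl.
move=> h; rewrite lt_min => /andP[hr he].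
have h0 := modulus_ge0 h.
have S1 : m (z + h) < rho by rewrite (le_lt_trans (modulusD _ _))//; rewrite /r in hr; lra.
have T0 := sumsD (sumsD (ps_sums ha S1) (sumsZ (-1) (ps_sums ha zr)))
  (sumsZ (- h) (sums_pad (a := fun n => n%:R * a n * z ^+ n.-1) _ (ps_sums ha1 zr))).
have {}T0 : sums (fun n => a n * rem z h n)
    (ps a (z + h) - ps a z - h * ps (fun n => n.+1%:R * a n.+1) z).
  rewrite -mulN1r -mulNr; apply: sums_ext (T0 _) => [n|]; last by rewrite !mul0r.
  by rewrite /rem; ring.
apply: (@le_trans _ _ (M * m h ^+ 2)); last first.
  rewrite expr2 mulrA ler_wpM2r// mulrC.
  have : m h * (M + 1) <= e by rewrite -ler_pdivlMr ?ltW// ltr_wpDl.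
  lra.
have {}T0 : sums (fun n => a n.+2 * rem z h n.+2)
    (ps a (z + h) - ps a z - h * ps (fun n => n.+1%:R * a n.+1) z).
  apply/(@sums_shift _ (fun n => a n.+1 * rem z h n.+1)).
  rewrite (_ : a 1%N * _ = 0) ?add0r; last by rewrite /rem /=; ring.
  apply/(@sums_shift _ (fun n => a n * rem z h n)).
  by rewrite (_ : a 0%N * _ = 0) ?add0r; last by rewrite /rem /=; ring.
apply: (sums_bound T0) => n.
apply: (@le_trans _ _ (\sum_(k < n) m (a k.+2) * m (rem z h k.+2))).
  elim: n => [|n IH]; first by rewrite !big_ord0 modulus0.
  rewrite !big_ord_recr /= (le_trans (modulusD _ _))// lerD// modulusM//.
apply: (@le_trans _ _ ((\sum_(k < n) m (k.+1%:R * (k.+2%:R * a k.+2)) * r ^+ k) * m h ^+ 2)).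
  rewrite mulr_suml; apply: ler_sum => k _; rewrite !modulusM !modulus_nat.
  rewrite (_ : _ * r ^+ k * _ = m (a k.+2) * (k.+2%:R * k.+1%:R * r ^+ k * m h ^+ 2)); last by ring.
  rewrite ler_wpM2l ?modulus_ge0//; apply: rem_le; rewrite /r in hr *; lra.
by rewrite ler_wpM2r ?exprn_ge0.
Qed.

End power_series.

(** * Exponential and logarithm *)

Section growth.
Context {R : realType}.

Lemma eventually_noninc_bounded (v : nat -> R) n0 :
  (forall n, (n0 <= n)%N -> v n.+1 <= v n) -> exists C, forall n, v n <= C.
Proof.
move=> H; exists (\sum_(k < n0.+1) `|v k|) => n.
have B k : (k <= n0)%N -> v k <= \sum_(k < n0.+1) `|v k|.
  move=> kn; rewrite (bigD1 (inord k : 'I_n0.+1))//= inordK// ler_wpDr ?ler_norm//.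
  by apply: sumr_ge0.
have [|nn] := leqP n n0; first exact: B.
rewrite -(subnKC (ltnW nn)); elim: (n - n0)%N => [|k IH]; first by rewrite addn0 B.
by rewrite addnS (le_trans (H _ _))// leq_addr.
Qed.

Lemma growth_bounded (u : nat -> R) K r : 0 <= K -> 0 <= r < 1 ->
  (forall n, 0 <= u n) ->
  (forall n, u n.+1 <= (1 + K / n.+1%:R) * u n) ->
  exists C, forall n, u n * r ^+ n <= C.
Proof.
move=> K0 /andP[r0 r1] u0 H.
have [n0 Hn0] : exists n0 : nat, K <= (1 - r) * n0%:R.
  exists (Num.bound (K / (1 - r))).
  by rewrite mulrC -ler_pdivrMr ?subr_gt0// ltW// archi_boundP// divr_ge0// subr_ge0 ltW.
apply: (@eventually_noninc_bounded _ n0) => n nn.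
rewrite exprS mulrA; apply: ler_wpM2r; first by rewrite exprn_ge0.
apply: (@le_trans _ _ ((1 + K / n.+1%:R) * r * u n)).
  by rewrite mulrAC; apply: ler_wpM2r.
rewrite -[leRHS]mul1r; apply: ler_wpM2r => //.
have [->|r00] := eqVneq r 0; first by rewrite mulr0 ler01.
have rp : 0 < r by rewrite lt_neqAle eq_sym r00.
have n1 : 0 < n.+1%:R :> R by rewrite ltr0n.
have : K <= (1 - r) * n.+1%:R.
  rewrite (le_trans Hn0)// ler_wpM2l ?subr_ge0 ?(ltW r1)// ler_nat (leq_trans nn)//.
rewrite -ler_pdivrMr//; set k := K / _ => hk; nra.
Qed.

End growth.

Section exponential.
Context {R : realType}.
Implicit Types (z w h : R[i]).
Local Notation m := modulus.

Definition cexp z : R[i] :=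
  (expR (complex.Re z) * cos (complex.Im z)) +i* (expR (complex.Re z) * sin (complex.Im z)).

Lemma cexpD z w : cexp (z + w) = cexp z * cexp w.
Proof.
case: z w => a b [c d]; rewrite /cexp /= expRD sinD cosD.
apply/eqP; rewrite eq_complex /=; apply/andP; split; apply/eqP; ring.
Qed.

Lemma cexp0 : cexp 0 = 1.
Proof. by rewrite /cexp /= expR0 cos0 sin0 mulr1 mulr0. Qed.

Lemma cexp_neq0 z : cexp z != 0.
Proof.
by apply/eqP => e; have := cexpD z (- z); rewrite subrr cexp0 e mul0r => /eqP; rewrite oner_eq0.
Qed.

Lemma cexp_i (t : R) : cexp ('i * t%:C) = cos t +i* sin t.
Proof. by rewrite /cexp /= !mul0r !mul1r !subr0 !add0r expR0 !mul1r. Qed.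

Let cexp_near0 (e : R) : 0 < e -> exists2 r : R, 0 < r &
  forall h, m h < r -> m (cexp h - 1 - h) <= e * m h.
Proof.
move=> e0; pose e' := Num.min 1 (e / 10).
have e'0 : 0 < e' by rewrite lt_min ltr01 divr_gt0.
have e'1 : e' <= 1 by rewrite ge_min lexx.
have e'8 : 10 * e' <= e by rewrite mulrC -ler_pdivlMr// ge_min lexx orbT.
have [r1 r10 H1] := (rderivP _ _ _).1 (@is_derive_expR R 0) _ e'0.
have [r2 r20 H2] := (rderivP _ _ _).1 (@is_derive_cos R 0) _ e'0.
have [r3 r30 H3] := (rderivP _ _ _).1 (@is_derive_sin R 0) _ e'0.
exists (Num.min e' (Num.min r1 (Num.min r2 r3))); first by rewrite lt_min e'0 lt_min r10 lt_min r20 r30.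
move=> h; rewrite !lt_min => /and4P[hk h1 h2 h3].
apply: (le_trans (modulus_le_ReIm _)).
have := Re_le_modulus h; have := Im_le_modulus h; have h0 := modulus_ge0 h.
move: hk h1 h2 h3 h0; case: h => a b /=.
move: (m _) => mu hk h1 h2 h3 h0 bm am.
have := H1 a (le_lt_trans am h1); have := H2 b (le_lt_trans bm h2).
have := H3 b (le_lt_trans bm h3).
rewrite !add0r expR0 cos0 sin0 !subr0 oppr0 mulr0 subr0 !mulr1.
set E := expR a; set C := cos b; set S := sin b => HS HC HE.
have E1 : `|E - 1| <= 2 * mu.
  have : `|E - 1| <= `|E - 1 - a| + `|a| by rewrite -{1}[E - 1](subrK a) ler_normD.
  nra.
have E2 : `|E| <= 3.
  have : `|E| <= `|E - 1| + `|1| by rewrite -{1}[E](subrK 1) ler_normD.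
  rewrite normr1; nra.
have N1 : `|E * C - 1 - a| <= e' * `|a| + 3 * (e' * `|b|).
  rewrite (_ : _ - _ - _ = (E - 1 - a) + E * (C - 1)); last by ring.
  rewrite (le_trans (ler_normD _ _))// lerD// normrM.
  by apply: ler_pM => //; rewrite mulr_ge0// ltW.
have N2 : `|E * S - b| <= 3 * (e' * `|b|) + 2 * mu * `|b|.
  rewrite (_ : _ - _ = E * (S - b) + (E - 1) * b); last by ring.
  rewrite (le_trans (ler_normD _ _))// !normrM lerD//.
    by apply: ler_pM.
  by apply: ler_wpM2r.
have a0 := normr_ge0 a; have b0 := normr_ge0 b.
have {}hk : mu < e' by rewrite lt_min.
have be : `|b| <= e' by rewrite (le_trans bm)// ltW.
have N3 : mu * `|b| <= mu * e' by apply: ler_wpM2l.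
have N4 : e' * `|a| <= e' * mu by apply: ler_wpM2l => //; exact: ltW.
have N5 : e' * `|b| <= e' * mu by apply: ler_wpM2l => //; exact: ltW.
have N6 : 10 * e' * mu <= e * mu by apply: ler_wpM2r.
have N7 : 0 <= e' * mu by rewrite mulr_ge0// ltW.
rewrite -mulrA in N2; rewrite -mulrA in N6; rewrite (mulrC mu e') in N3.
lra.
Qed.

Lemma cexp_cderiv z : cderiv cexp z (cexp z).
Proof.
move=> e e0; have k0 : 0 < m (cexp z) by rewrite modulus_gt0 cexp_neq0.
have [r r0 Hr] := cexp_near0 (divr_gt0 e0 k0); exists r => // h hr.
rewrite cexpD (_ : _ - _ - _ = cexp z * (cexp h - 1 - h)); last by ring.
by rewrite modulusM mulrC -ler_pdivlMr// mulrAC Hr.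
Qed.

End exponential.

Section logarithm.
Context {R : realType}.
Implicit Types (z w h c l : R[i]).
Local Notation m := modulus.

Lemma ps0 (a : nat -> R[i]) : ps a 0 = a 0%N.
Proof.
apply: csumE => e e0; exists 1%N => -[//|n] _.
rewrite big_ord_recl /= expr0 mulr1 opprD addrA subrr sub0r big1 ?oppr0 ?modulus0 ?ltW//.
by move=> i _; rewrite expr0n /= mulr0.
Qed.

Definition clog1 : R[i] -> R[i] :=
  ps (fun n => if n is n'.+1 then (-1) ^+ n' / n%:R else 0).

Lemma clog1_psconv : psconv (1 : R) (fun n => if n is n'.+1 then (-1) ^+ n' / n%:R else 0 : R[i]).
Proof.
move=> r /andP[r0 r1]; exists 1 => -[|n]; first by rewrite modulus0 mul0r ler01.
rewrite modulusM modulusX modulusV modulusN modulus1 expr1n mul1r modulus_nat.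
apply: mulr_ile1; rewrite ?invr_ge0 ?ler0n ?exprn_ge0//.
  by rewrite invf_le1 ?ler1n// ltr0n.
by apply: exprn_ile1 => //; exact: ltW.
Qed.

Lemma onePneq0 w : m w < 1 -> 1 + w != 0.
Proof.
move=> w1; apply/eqP => e; move: w1; rewrite -modulusN (_ : - w = 1) ?modulus1 ?ltxx//.
by apply/eqP; rewrite eq_sym -subr_eq0 opprK e.
Qed.

Lemma clog1_cderiv w : m w < 1 -> cderiv clog1 w (1 + w)^-1.
Proof.
move=> w1; have := ps_cderiv clog1_psconv w1.
rewrite /ps (_ : csum _ = (1 + w)^-1)//; apply: csumE.
have S := ps_sums (psconv_deriv clog1_psconv) w1.
set s := ps _ _ in S.
have {}S : sums (fun n => (- w) ^+ n) s.
  apply: sums_ext S => n; rewrite mulrCA mulfV ?mulr1 ?pnatr_eq0//.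
  by rewrite -exprMn mulN1r.
have S2 : sums (fun n => (- w) ^+ n) (1 + - w * s).
  rewrite -[1](expr0 (- w)); apply/(@sums_shift _ (fun n => (- w) ^+ n)).
  by apply: sums_ext (sumsZ (- w) S) => n; rewrite exprS.
have e := sums_unique S S2.
have -> : (1 + w)^-1 = s.
  apply: (mulfI (onePneq0 w1)); rewrite mulfV ?onePneq0//.
  by rewrite mulrDl mul1r {1}e mulNr subrK.
apply: sums_ext S => n; rewrite mulrCA mulfV ?mulr1 ?pnatr_eq0//.
by rewrite -exprMn mulN1r.
Qed.

Lemma clog1_0 : clog1 0 = 0.
Proof. exact: ps0. Qed.

Lemma clog1_cexp : exists2 r : R, 0 < r & forall l, m l < r -> clog1 (cexp l - 1) = l.
Proof.
have [r r0 Hr] := @cexp_cderiv R 0 1 ltr01.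
pose r' := Num.min r (2^-1).
have r'0 : 0 < r' by rewrite lt_min r0 invr_gt0 ltr0n.
exists r' => // l lr.
have E x : m x < r' -> m (cexp x - 1) < 1.
  rewrite lt_min => /andP[xr x2]; have := Hr x xr.
  rewrite cexp0 mulr1 mul1r add0r => H.
  rewrite -[_ - 1](subrK x) (le_lt_trans (modulusD _ _))//; lra.
have D x : [set x | m (x - 0) < r'] x -> cderiv (fun x => clog1 (cexp x - 1) - x) x 0.
  rewrite /= subr0 => /E xr.
  have := cderivB (cderiv_comp (cderivB (cexp_cderiv x) (cderiv_cst 1 x)) (clog1_cderiv xr))
    (cderiv_id x).
  by rewrite subr0 (_ : 1 + _ = cexp x) ?mulVf ?cexp_neq0 ?subrr// [LHS]addrC subrK.
have z0 : [set x : R[i] | m (x - 0) < r'] 0 by rewrite /mkset subrr modulus0.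
have l0 : [set x : R[i] | m (x - 0) < r'] l by rewrite /mkset subr0.
have H : clog1 (cexp l - 1) - l = clog1 (cexp 0 - 1) - 0.
  exact: (cderiv0_const (@cconvex_disc R 0 r') D z0 l0).
by apply/eqP; rewrite -subr_eq0 H cexp0 subrr clog1_0 subr0.
Qed.

(** The branch of the logarithm on the disc of centre [c] and radius [m c]
    that takes the value [l] at [c]. *)
Definition logb c l z : R[i] := l + clog1 (z / c - 1).

Lemma logb_cderiv c l z : m (z - c) < m c -> cderiv (logb c l) z z^-1.
Proof.
move=> zc; have c0 : c != 0 by rewrite -modulus_gt0 (le_lt_trans _ zc)// modulus_ge0.
have E : m (z / c - 1) < 1.
  rewrite -[X in _ - X](mulfV c0) -mulrBl modulusM modulusV ltr_pdivrMr ?modulus_gt0//.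
  by rewrite mul1r.
have := cderivD (cderiv_cst l z)
  (cderiv_comp (cderivB (cderivM (cderiv_id z) (cderiv_cst c^-1 z)) (cderiv_cst 1 z)) (clog1_cderiv E)).
rewrite add0r mulr0 addr0 mul1r subr0.
rewrite (_ : (1 + _)^-1 * c^-1 = z^-1)//.
by rewrite (_ : 1 + _ = z / c) ?invfM ?invrK ?mulfK// [LHS]addrC subrK.
Qed.

Lemma logb_center c l : c != 0 -> logb c l c = l.
Proof. by move=> c0; rewrite /logb mulfV// subrr clog1_0 addr0. Qed.

Lemma logb_agree : exists2 d : R, 0 < d & forall c l l', c != 0 -> m (l' - l) < d ->
  \forall z \near c * cexp l', logb (c * cexp l') l' z = logb (c * cexp l) l z.
Proof.
have [r r0 Hr] := clog1_cexp.
have [s s0 Hs] := @cexp_cderiv R 0 1 ltr01.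
exists (Num.min r (Num.min s (2^-1))); first by rewrite !lt_min r0 s0 invr_gt0 ltr0n.
move=> c l l' c0; rewrite !lt_min => /and3P[d1 d2 d3].
set p' := c * cexp l'; set p := c * cexp l.
have p0 : p != 0 by rewrite mulf_neq0 ?cexp_neq0.
have p'0 : p' != 0 by rewrite mulf_neq0 ?cexp_neq0.
have pp : p' = p * cexp (l' - l) by rewrite /p /p' -mulrA -cexpD (addrC l) subrK.
pose D := [set z | m (z - p) < m p] `&` [set z | m (z - p') < m p'].
have cD : cconvex D.
  by move=> z w t [z1 z2] [w1 w2] t01; split; apply: cconvex_disc.
have Dp' : D p'.
  split; rewrite /= ?subrr ?modulus0 ?modulus_gt0//.
  rewrite pp -[X in _ - X](mulr1 p) -mulrBr modulusM -[ltRHS]mulr1 ltr_pM2l ?modulus_gt0//.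
  have := Hs _ d2; rewrite cexp0 mulr1 mul1r add0r => H.
  rewrite -[_ - 1](subrK (l' - l)) (le_lt_trans (modulusD _ _))//; lra.
have dd z : D z -> cderiv (fun z => logb p' l' z - logb p l z) z 0.
  by move=> [z1 z2]; have := cderivB (logb_cderiv l' z2) (logb_cderiv l z1); rewrite subrr.
have e0 : logb p' l' p' - logb p l p' = 0.
  rewrite logb_center// /logb {1}pp mulrAC mulfV// mul1r Hr//.
  by rewrite (addrC l) subrK subrr.
apply/nbhs_modulusP; exists (Num.min (m p') (m p - m (p' - p))).
  by rewrite lt_min modulus_gt0 p'0 subr_gt0; case: Dp'.
move=> z; rewrite lt_min => /andP[z1 z2].
have Dz : D z.
  split=> //=; rewrite -[z](subrK p') -addrA (le_lt_trans (modulusD _ _))//.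
  by rewrite -ltrBrDr.
by apply/eqP; rewrite -subr_eq0 -e0; apply/eqP; exact: (cderiv0_const cD dd).
Qed.

End logarithm.

(** * Solutions as jets of a first-order system *)

Section field_identities.
Variable F : fieldType.
Implicit Types w b : F.

Lemma euler_field1 w b1 b2 : w != 0 -> 1 * b1 + w * b2 = (w * b1 + w ^+ 2 * b2) / w.
Proof. by move=> w0; field. Qed.

Lemma euler_field2 w b1 b2 b3 : w != 0 ->
  1 * b1 + w * b2 + (2%:R * w ^+ 1 * b2 + w ^+ 2 * b3) =
  (w * b1 + 3 * w ^+ 2 * b2 + w ^+ 3 * b3) / w.
Proof. by move=> w0; field. Qed.

Lemma euler_field3 w b1 b2 b3 b4 : w != 0 ->
  1 * b1 + w * b2 + 3 * (2%:R * w ^+ 1 * b2 + w ^+ 2 * b3) + (3%:R * w ^+ 2 * b3 + w ^+ 3 * b4) =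
  (w * b1 + 7 * w ^+ 2 * b2 + 6 * w ^+ 3 * b3 + w ^+ 4 * b4) / w.
Proof. by move=> w0; field. Qed.

End field_identities.

Section jets.
Context {R : realType}.
Variable N : nat.
Implicit Types (z w : R[i]) (f g : R[i] -> R[i]).
Local Notation m := modulus.
Local Notation n := (N%:R : R[i]).

Definition expo (j : nat) : R[i] :=
  match j with
  | 0 => (n - 3) / (2 * n) | 1 => (n - 1) / (2 * n)
  | 2 => (n + 1) / (2 * n) | _ => (n + 3) / (2 * n)
  end.
Local Notation a := expo.

(** The coefficients of [(X + a_0)(X + a_1)(X + a_2)(X + a_3)]. *)
Definition ecoef (k : nat) : R[i] :=
  match k with
  | 0 => a 0 * a 1 * a 2 * a 3
  | 1 => a 0 * a 1 * a 2 + a 0 * a 1 * a 3 + a 0 * a 2 * a 3 + a 1 * a 2 * a 3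
  | 2 => a 0 * a 1 + a 0 * a 2 + a 0 * a 3 + a 1 * a 2 + a 1 * a 3 + a 2 * a 3
  | 3 => a 0 + a 1 + a 2 + a 3
  | _ => 1
  end.

Lemma sum5 (V : zmodType) (F : nat -> V) :
  \sum_(k < 5) F k = F 0%N + F 1%N + F 2%N + F 3%N + F 4%N.
Proof. by rewrite !big_ord_recr big_ord0 /= add0r. Qed.

Lemma sum4 (V : zmodType) (F : nat -> V) :
  \sum_(k < 4) F k = F 0%N + F 1%N + F 2%N + F 3%N.
Proof. by rewrite !big_ord_recr big_ord0 /= add0r. Qed.

(** [y k] stands for [D^k (y 0)], with [D = z d/dz]. *)
Definition jet_eq (y : nat -> R[i] -> R[i]) w :=
  (forall k, (k < 4)%N -> cderiv (y k) w (y k.+1 w / w)) /\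
  y 4 w = w * \sum_(k < 5) ecoef k * y k w.

Definition jet_at z y := \forall w \near z, jet_eq y w.

Lemma near_neq z c : z != c -> \forall w \near z, w != c.
Proof.
move=> zc; apply/nbhs_modulusP; exists (m (z - c)); first by rewrite modulus_gt0 subr_eq0.
move=> w; apply: contraTneq => ->; by rewrite modulusB ltxx.
Qed.

Lemma near_join z (P : set R[i]) : (\forall w \near z, P w) ->
  \forall w \near z, \forall x \near w, P x.
Proof. by move=> H; apply/nbhs_interior. Qed.

Lemma derive1_cderiv f w d : cderiv f w d -> derive1 f w = d.
Proof. by move=> /cderivP [_ <-]; rewrite derive1E. Qed.

Lemma derivable_cderiv f w : derivable f w 1 -> cderiv f w (derive1 f w).
Proof. by move=> H; apply/cderivP; rewrite derive1E; exact: derivableP. Qed.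

Definition eulerd z (f f1 : R[i] -> R[i]) := \forall w \near z, cderiv f w (f1 w / w).

Lemma eulerdD z c f f1 g g1 : eulerd z f f1 -> eulerd z g g1 ->
  eulerd z (fun w => f w + c * g w) (fun w => f1 w + c * g1 w).
Proof.
apply: filterS2 => w fw gw; rewrite mulrDl -mulrA.
by apply: cderivD => //; exact: cderivZ.
Qed.

Lemma euler_step z c (F f f1 : R[i] -> R[i]) : z != 0 ->
  (\forall w \near z, F w = f w) -> eulerd z f f1 ->
  \forall w \near z, euler c F w = f1 w + c * f w.
Proof.
move=> z0 Ff fd; apply: filterS3 (near_neq z0) (near_join Ff) fd => w w0 Fw fw.
have Fd : cderiv F w (f1 w / w).
  by apply: cderiv_near fw; apply: filterS Fw => x ->.
rewrite /euler (derive1_cderiv Fd) mulrCA mulfV// mulr1.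
by congr (_ + _ * _); exact: nbhs_singleton Fw.
Qed.

Lemma op_jet z (g : R[i] -> R[i]) (y : nat -> R[i] -> R[i]) : z != 0 ->
  (forall k, (k < 4)%N -> eulerd z (y k) (y k.+1)) ->
  (\forall w \near z, g w = y 0 w) ->
  (forall k, (k <= 4)%N -> \forall w \near z, iter k (euler 0) g w = y k w) /\
  \forall w \near z, hypergeometric_op N g w = y 4 w - w * \sum_(k < 5) ecoef k * y k w.
Proof.
move=> z0 yd gy.
have it k : (k <= 4)%N -> \forall w \near z, iter k (euler 0) g w = y k w.
  elim: k => [//|k IH] k4.
  have := euler_step 0 z0 (IH (ltnW k4)) (yd k k4).
  by apply: filterS => w; rewrite mul0r addr0.
split=> //.
have y0 := yd 0%N isT; have y1 := yd 1%N isT; have y2 := yd 2%N isT; have y3 := yd 3%N isT.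
have E1 := euler_step (a 3) z0 gy y0.
have d1 := eulerdD (a 3) y1 y0; have d1' := eulerdD (a 3) y2 y1.
have d1'' := eulerdD (a 3) y3 y2.
have E2 := euler_step (a 2) z0 E1 d1.
have d2 := eulerdD (a 2) d1' d1; have d2' := eulerdD (a 2) d1'' d1'.
have E3 := euler_step (a 1) z0 E2 d2.
have d3 := eulerdD (a 1) d2' d2.
have E4 := euler_step (a 0) z0 E3 d3.
apply: filterS2 (it 4 isT) E4 => w Y4 E.
rewrite /hypergeometric_op Y4; congr (_ - w * _).
rewrite (sum5 (fun k => ecoef k * y k w)) /ecoef.
apply: etrans E _.
move: (a 0) (a 1) (a 2) (a 3) => b0 b1 b2 b3; ring.
Qed.

Lemma sol_jet z g : z != 0 -> local_solution N z g -> jet_at z (fun k => iter k (euler 0) g).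
Proof.
move=> z0 sg.
pose d k := derive1n k g.
have dd k : (k < 4)%N -> \forall w \near z, cderiv (d k) w (d k.+1 w).
  move=> k4; apply: filterS sg => w [H _].
  by rewrite /d derive1nS; apply: derivable_cderiv; exact: H.
pose y k w := match k with
  | 0 => d 0%N w | 1 => w * d 1%N w | 2 => w * d 1%N w + w ^+ 2 * d 2%N w
  | 3 => w * d 1%N w + 3 * w ^+ 2 * d 2%N w + w ^+ 3 * d 3%N w
  | _ => w * d 1%N w + 7 * w ^+ 2 * d 2%N w + 6 * w ^+ 3 * d 3%N w + w ^+ 4 * d 4%N w end.
have pw k w : cderiv (fun w => w ^+ k.+1) w (k.+1%:R * w ^+ k).
  elim: k => [|k IH]; first by rewrite expr0 mulr1; apply: cderiv_ext (cderiv_id w) => x; rewrite expr1.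
  have := cderivM (cderiv_id w) IH; rewrite -[k.+2%:R]natr1 exprS.
  rewrite (_ : 1 * _ + _ = (k.+1%:R + 1) * (w * w ^+ k)); last by ring.
  by apply: cderiv_ext => x; rewrite [in RHS]exprS.
have yd k : (k < 4)%N -> eulerd z (y k) (y k.+1).
  case: k => [|[|[|[|//]]]] _ /=.
  - apply: filterS2 (near_neq z0) (dd 0%N isT) => w w0 H.
    by rewrite /= mulrAC mulfV// mul1r.
  - apply: filterS2 (near_neq z0) (dd 1%N isT) => w w0 H.
    have := cderivM (cderiv_id w) H.
    by rewrite euler_field1.
  - apply: filterS3 (near_neq z0) (dd 1%N isT) (dd 2%N isT) => w w0 H1 H2.
    have := cderivD (cderivM (cderiv_id w) H1) (cderivM (pw 1%N w) H2).
    by rewrite euler_field2.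
  - apply: filterS2 (filterI (near_neq z0) (dd 1%N isT)) (filterI (dd 2%N isT) (dd 3%N isT)).
    move=> w [w0 H1] [H2 H3].
    have := cderivD (cderivD (cderivM (cderiv_id w) H1) (cderivZ 3 (cderivM (pw 1%N w) H2)))
      (cderivM (pw 2%N w) H3).
    rewrite euler_field3//.
    by apply: cderiv_ext => x; rewrite /= mulrA.
have [it opE] : (forall k, (k <= 4)%N -> \forall w \near z, iter k (euler 0) g w = y k w) /\
    \forall w \near z, hypergeometric_op N g w = y 4 w - w * \sum_(k < 5) ecoef k * y k w.
  by apply: op_jet => //; exact: (@filterE _ (nbhs z)).
have itk : \forall w \near z, forall k, (k <= 4)%N -> iter k (euler 0) g w = y k w.
  apply: filterS3 (it 0%N isT) (it 1%N isT)
    (filterI (it 2%N isT) (filterI (it 3%N isT) (it 4%N isT))) => w i0 i1 [i2 [i3 i4]].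
  move=> [|[|[|[|[|k]]]]] H.
  - exact: i0.
  - exact: i1.
  - exact: i2.
  - exact: i3.
  - exact: i4.
  - by case: (notF H).
have ydk : \forall w \near z, forall k, (k < 4)%N -> cderiv (y k) w (y k.+1 w / w).
  apply: filterS3 (yd 0%N isT) (yd 1%N isT) (filterI (yd 2%N isT) (yd 3%N isT)).
  move=> w i0 i1 [i2 i3] [|[|[|[|k]]]] H.
  - exact: i0.
  - exact: i1.
  - exact: i2.
  - exact: i3.
  - by case: (notF H).
apply: filterS2 (filterI ydk opE) (filterI (near_join itk) sg) => w [H1 H2] [H3 [_ H4]].
have H3w := nbhs_singleton H3.
split=> [k k4|].
  rewrite H3w//; apply: cderiv_near (H1 k k4).
  by apply: filterS H3 => x ->//; exact: ltnW.
rewrite H3w//; move: H2; rewrite H4 => /esym/eqP; rewrite subr_eq0 => /eqP ->.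
by congr (w * _); apply: eq_bigr => k _; rewrite H3w// -ltnS.
Qed.

Lemma jet_sol z y : z != 0 -> jet_at z y -> local_solution N z (y 0%N).
Proof.
move=> z0 jy.
have yd k : (k < 4)%N -> eulerd z (y k) (y k.+1).
  by move=> k4; apply: filterS jy => w [H _]; exact: H.
have [_ opE] : (forall k, (k <= 4)%N -> \forall w \near z, iter k (euler 0) (y 0%N) w = y k w) /\
    \forall w \near z, hypergeometric_op N (y 0%N) w = y 4 w - w * \sum_(k < 5) ecoef k * y k w.
  by apply: op_jet => //; apply: filterE.
have op0 : \forall w \near z, hypergeometric_op N (y 0%N) w = 0.
  by apply: filterS2 jy opE => w [_ ->] ->; rewrite subrr.
pose d k w := match k with
  | 0 => y 0%N w | 1 => y 1%N w * w^-1 | 2 => (y 2%N w - y 1%N w) * (w^-1 * w^-1)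
  | _ => (y 3%N w - 3 * y 2%N w + 2 * y 1%N w) * (w^-1 * w^-1 * w^-1) end.
have step k f f1 : (\forall w \near z, derive1n k (y 0%N) w = f w) ->
    (\forall w \near z, cderiv f w (f1 w)) ->
    (\forall w \near z, derivable (derive1n k (y 0%N)) w 1) /\
    (\forall w \near z, derive1n k.+1 (y 0%N) w = f1 w).
  move=> kf fd.
  have H : \forall w \near z, cderiv (derive1n k (y 0%N)) w (f1 w).
    apply: filterS2 (near_join kf) fd => w kw; apply: cderiv_near.
    by apply: filterS kw => x ->.
  split; apply: filterS H => w.
    by move=> /cderivP [].
  by rewrite derive1nS; exact: derive1_cderiv.
have [D0 E0] : (\forall w \near z, derivable (derive1n 0 (y 0%N)) w 1) /\
    (\forall w \near z, derive1n 1 (y 0%N) w = y 1%N w * w^-1).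
  by apply: step (yd 0%N isT); apply: filterE.
have dV w : w != 0 -> cderiv (fun w => w^-1) w (- (w^-1 * w^-1)).
  by move=> w0; rewrite -invfM; exact: cderivV.
have [D1 E1] : (\forall w \near z, derivable (derive1n 1 (y 0%N)) w 1) /\
    (\forall w \near z, derive1n 2 (y 0%N) w = (y 2%N w - y 1%N w) * (w^-1 * w^-1)).
  apply: step E0 _; apply: filterS2 (near_neq z0) (yd 1%N isT) => w w0 H.
  have := cderivM H (dV w w0).
  by rewrite (_ : _ + _ = (y 2%N w - y 1%N w) * (w^-1 * w^-1))//; ring.
have [D2 E2] : (\forall w \near z, derivable (derive1n 2 (y 0%N)) w 1) /\
    (\forall w \near z, derive1n 3 (y 0%N) w = (y 3%N w - 3 * y 2%N w + 2 * y 1%N w) * (w^-1 * w^-1 * w^-1)).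
  apply: step E1 _; apply: filterS3 (near_neq z0) (yd 1%N isT) (yd 2%N isT) => w w0 H1 H2.
  have := cderivM (cderivB H2 H1) (cderivM (dV w w0) (dV w w0)).
  by rewrite (_ : _ + _ = (y 3%N w - 3 * y 2%N w + 2 * y 1%N w) * (w^-1 * w^-1 * w^-1))//; ring.
have [D3 _] : (\forall w \near z, derivable (derive1n 3 (y 0%N)) w 1) /\
    (\forall w \near z, derive1n 4 (y 0%N) w =
      (y 4%N w / w - 3 * (y 3%N w / w) + 2 * (y 2%N w / w)) * (w^-1 * w^-1 * w^-1) +
      (y 3%N w - 3 * y 2%N w + 2 * y 1%N w) *
        ((- (w^-1 * w^-1) * w^-1 + w^-1 * - (w^-1 * w^-1)) * w^-1 + w^-1 * w^-1 * - (w^-1 * w^-1))).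
  apply: step E2 _.
  apply: filterS2 (filterI (near_neq z0) (yd 1%N isT)) (filterI (yd 2%N isT) (yd 3%N isT)).
  move=> w [w0 H1] [H2 H3].
  exact: (cderivM (cderivD (cderivB H3 (cderivZ 3 H2)) (cderivZ 2 H1))
    (cderivM (cderivM (dV w w0) (dV w w0)) (dV w w0))).
apply: filterS2 (filterI (filterI D0 D1) (filterI D2 D3)) op0 => w [[i0 i1] [i2 i3]] o0.
split=> [[|[|[|[|k]]]] H|]; last exact: o0.
- exact: i0.
- exact: i1.
- exact: i2.
- exact: i3.
- by case: (notF H).
Qed.

End jets.

(** * Local solution spaces at ordinary points *)

Section power_series_algebra.
Context {R : realType}.
Implicit Types (a b : nat -> R[i]) (z : R[i]).
Local Notation m := modulus.

Definition shift_seq (V : nmodType) (a : nat -> V) n := if n is n'.+1 then a n' else 0.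

Lemma psconvD (rho : R) a b : psconv rho a -> psconv rho b -> psconv rho (fun n => a n + b n).
Proof.
move=> ha hb r rr; have [C HC] := ha r rr; have [D HD] := hb r rr; exists (C + D) => n.
have r0 : 0 <= r by case/andP: rr.
apply: le_trans (lerD (HC n) (HD n)); rewrite -mulrDl ler_wpM2r ?exprn_ge0//.
exact: modulusD.
Qed.

Lemma psconvZ (rho : R) a c : psconv rho a -> psconv rho (fun n => c * a n).
Proof.
move=> ha r rr; have [C HC] := ha r rr; exists (m c * C) => n.
by rewrite modulusM -mulrA ler_wpM2l ?modulus_ge0.
Qed.

Lemma psconv_shift (rho : R) a : psconv rho a -> psconv rho (shift_seq a).
Proof.
move=> ha r rr; have [C HC] := ha r rr; have r0 : 0 <= r by case/andP: rr.
have C0 : 0 <= C by rewrite (le_trans _ (HC 0%N))// mulr_ge0// modulus_ge0.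
exists (r * C) => -[|n] /=; first by rewrite modulus0 mul0r mulr_ge0.
by rewrite exprS mulrCA ler_wpM2l.
Qed.

Lemma psconv_ext (rho : R) a b : a =1 b -> psconv rho a -> psconv rho b.
Proof. by move=> /funext ->. Qed.

Lemma psconv_sum (rho : R) (I : Type) (r : seq I) (A : I -> nat -> R[i]) :
  (forall i, psconv rho (A i)) -> psconv rho (fun n => \sum_(i <- r) A i n).
Proof.
move=> hA; elim: r => [|i r IH].
  move=> s _; exists 0 => n; by rewrite big_nil modulus0 mul0r.
by apply: psconv_ext (psconvD (hA i) IH) => n; rewrite big_cons.
Qed.

Lemma ps_ext a b z : a =1 b -> ps a z = ps b z.
Proof. by move=> /funext ->. Qed.

Lemma psD (rho : R) a b z : psconv rho a -> psconv rho b -> m z < rho ->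
  ps (fun n => a n + b n) z = ps a z + ps b z.
Proof.
move=> ha hb zr; apply: csumE; apply: sums_ext (sumsD (ps_sums ha zr) (ps_sums hb zr)).
by move=> n; rewrite mulrDl.
Qed.

Lemma psZ (rho : R) a c z : psconv rho a -> m z < rho -> ps (fun n => c * a n) z = c * ps a z.
Proof.
move=> ha zr; apply: csumE; apply: sums_ext (sumsZ c (ps_sums ha zr)).
by move=> n; rewrite mulrA.
Qed.

Lemma ps_shift (rho : R) a z : psconv rho a -> m z < rho -> ps (shift_seq a) z = z * ps a z.
Proof.
move=> ha zr; apply: csumE; rewrite -[z * _]add0r -[0](mul0r (z ^+ 0)).
apply/(@sums_shift _ (fun n => shift_seq a n * z ^+ n)).
by apply: sums_ext (sumsZ z (ps_sums ha zr)) => n /=; rewrite exprS mulrCA.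
Qed.

Lemma ps_sum (rho : R) (I : Type) (r : seq I) (A : I -> nat -> R[i]) z :
  (forall i, psconv rho (A i)) -> m z < rho ->
  ps (fun n => \sum_(i <- r) A i n) z = \sum_(i <- r) ps (A i) z.
Proof.
move=> hA zr; elim: r => [|i r IH].
  rewrite big_nil; apply: csumE => e e0; exists 0%N => n _.
  by rewrite big1 ?subr0 ?modulus0 ?ltW// => k _; rewrite big_nil mul0r.
rewrite big_cons -IH -(psD (hA i) (psconv_sum r hA) zr).
by apply: ps_ext => n; rewrite big_cons.
Qed.

End power_series_algebra.

Section linear_system.
Context {R : realType}.
Implicit Types (z w t : R[i]) (v : 'rV[R[i]]_4).
Local Notation m := modulus.

Definition vnorm v : R := \sum_i m (v 0 i).
Definition mnorm (M : 'M[R[i]]_4) : R := \sum_i \sum_j m (M i j).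

Lemma vnorm_ge0 v : 0 <= vnorm v.
Proof. by apply: sumr_ge0 => i _; exact: modulus_ge0. Qed.

Lemma mnorm_ge0 M : 0 <= mnorm M.
Proof. by apply: sumr_ge0 => i _; apply: sumr_ge0 => j _; exact: modulus_ge0. Qed.

Lemma vnormD u v : vnorm (u + v) <= vnorm u + vnorm v.
Proof. by rewrite /vnorm -big_split; apply: ler_sum => i _; rewrite mxE modulusD. Qed.

Lemma vnormZ c v : vnorm (c *: v) = m c * vnorm v.
Proof. by rewrite /vnorm mulr_sumr; apply: eq_bigr => i _; rewrite mxE modulusM. Qed.

Lemma vnorm_coord v i : m (v 0 i) <= vnorm v.
Proof.
by rewrite /vnorm (bigD1 i)//= lerDl; apply: sumr_ge0 => j _; exact: modulus_ge0.
Qed.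

Lemma modulus_sum (I : Type) (r : seq I) (F : I -> R[i]) :
  m (\sum_(i <- r) F i) <= \sum_(i <- r) m (F i).
Proof.
elim: r => [|i r IH]; first by rewrite !big_nil modulus0.
by rewrite !big_cons (le_trans (modulusD _ _))// lerD.
Qed.

Lemma vnormM v M : vnorm (v *m M) <= vnorm v * mnorm M.
Proof.
rewrite /vnorm.
apply: (@le_trans _ _ (\sum_j \sum_k m (v 0 k) * m (M k j))).
  apply: ler_sum => j _; rewrite mxE (le_trans (modulus_sum _ _))//.
  by apply: ler_sum => k _; rewrite modulusM.
rewrite exchange_big mulr_suml; apply: ler_sum => k _.
rewrite -mulr_sumr ler_wpM2l ?modulus_ge0// /mnorm [leRHS](bigD1 k)//= lerDl.
by apply: sumr_ge0 => i _; apply: sumr_ge0 => j _; exact: modulus_ge0.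
Qed.

Section recursion.
Variables (q0 q1 q2 : R[i]) (M0 M1 : 'M[R[i]]_4) (v : 'rV[R[i]]_4).
Hypothesis q00 : q0 != 0.

Let step n (c c' : 'rV[R[i]]_4) : 'rV[R[i]]_4 :=
  (q0 * n.+1%:R)^-1 *: (c *m M0 + c' *m M1 - (q1 * n%:R) *: c - (q2 * n.-1%:R) *: c').

Fixpoint coefs n : 'rV[R[i]]_4 * 'rV[R[i]]_4 :=
  if n is n'.+1 then (step n' (coefs n').1 (coefs n').2, (coefs n').1) else (v, 0).

Definition coef_seq n := (coefs n).1.

Lemma coef_seqS n : coef_seq n.+1 = step n (coef_seq n) (shift_seq coef_seq n).
Proof. by rewrite /coef_seq /=; case: n. Qed.

Let K : R := (m q0)^-1 * (mnorm M0 + mnorm M1 + m q1 + m q2).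

Lemma coef_bound n : vnorm (coef_seq n) <= vnorm v * (2 * K + 1) ^+ n.
Proof.
have K0 : 0 <= K.
  by rewrite mulr_ge0 ?invr_ge0 ?modulus_ge0// !addr_ge0 ?mnorm_ge0 ?modulus_ge0.
suff H : vnorm (coef_seq n) <= vnorm v * (2 * K + 1) ^+ n /\
         vnorm (shift_seq coef_seq n) <= vnorm v * (2 * K + 1) ^+ n by case: H.
elim: n => [|n [IH1 IH2]].
  rewrite expr0 mulr1; split=> //=; rewrite (_ : vnorm 0 = 0) ?vnorm_ge0//.
  by rewrite /vnorm big1// => i _; rewrite mxE modulus0.
set B := vnorm v * _ ^+ n in IH1 IH2.
have B0 : 0 <= B by rewrite mulr_ge0 ?vnorm_ge0// exprn_ge0//; lra.
rewrite (_ : vnorm v * _ = (2 * K + 1) * B); last by rewrite exprS mulrCA.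
split; last by rewrite /= (le_trans IH1)// ler_peMl//; lra.
rewrite coef_seqS vnormZ modulusV modulusM modulus_nat.
set c := coef_seq n in IH1 *; set c' := shift_seq _ n in IH2 *.
have n0 : 0 < n.+1%:R :> R by rewrite ltr0n.
have n1 : 1 <= n.+1%:R :> R by rewrite ler1n.
have n2 : n%:R <= n.+1%:R :> R by rewrite ler_nat.
have n3 : n.-1%:R <= n.+1%:R :> R by rewrite ler_nat (leq_trans (leq_pred _)).
have A1 : vnorm (c *m M0 + c' *m M1 - (q1 * n%:R) *: c - (q2 * n.-1%:R) *: c') <=
    n.+1%:R * ((mnorm M0 + mnorm M1 + m q1 + m q2) * B).
  rewrite -(scaleNr (q1 * _)) -(scaleNr (q2 * _)) (le_trans (vnormD _ _))// (_ : n.+1%:R * _ =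
    n.+1%:R * (mnorm M0 + mnorm M1) * B + m q1 * n.+1%:R * B + m q2 * n.+1%:R * B); last by ring.
  apply: lerD; last first.
    rewrite vnormZ modulusN modulusM modulus_nat; apply: ler_pM => //.
    - by rewrite mulr_ge0 ?modulus_ge0.
    - exact: vnorm_ge0.
    - by rewrite ler_wpM2l ?modulus_ge0.
  rewrite (le_trans (vnormD _ _))//; apply: lerD; last first.
    rewrite vnormZ modulusN modulusM modulus_nat; apply: ler_pM => //.
    - by rewrite mulr_ge0 ?modulus_ge0.
    - exact: vnorm_ge0.
    - by rewrite ler_wpM2l ?modulus_ge0.
  apply: (@le_trans _ _ ((mnorm M0 + mnorm M1) * B)); last first.
    by rewrite -mulrA ler_peMl// mulr_ge0// addr_ge0 ?mnorm_ge0.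
  rewrite (le_trans (vnormD _ _))// mulrDl lerD// (le_trans (vnormM _ _))// mulrC.
    by rewrite ler_wpM2l ?mnorm_ge0.
  by rewrite ler_wpM2l ?mnorm_ge0.
rewrite mulrC ler_pdivrMr; last by rewrite mulr_gt0// modulus_gt0.
rewrite (le_trans A1)// /K.
set S := mnorm M0 + mnorm M1 + m q1 + m q2.
have S0 : 0 <= S by rewrite !addr_ge0 ?mnorm_ge0 ?modulus_ge0.
have mq : m q0 != 0 by rewrite modulus_eq0.
rewrite (_ : _ * (m q0 * _) = n.+1%:R * ((2 * S + m q0) * B)); last by field.
rewrite ler_wpM2l// ler_wpM2r//; have := modulus_ge0 q0; lra.
Qed.

Lemma coef_psconv : exists2 rho : R, 0 < rho & forall k, psconv rho (fun n => coef_seq n 0 k).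
Proof.
have K0 : 0 <= K.
  by rewrite mulr_ge0 ?invr_ge0 ?modulus_ge0// !addr_ge0 ?mnorm_ge0 ?modulus_ge0.
have k0 : 0 < 2 * K + 1 by lra.
exists (2 * K + 1)^-1; first by rewrite invr_gt0.
move=> k r /andP[r0 rr]; exists (vnorm v) => n.
apply: (@le_trans _ _ (vnorm v * (2 * K + 1) ^+ n * r ^+ n)).
  by rewrite ler_wpM2r ?exprn_ge0// (le_trans (vnorm_coord _ _))// coef_bound.
rewrite -mulrA -exprMn ler_piMr ?vnorm_ge0// exprn_ile1 ?mulr_ge0 ?(ltW k0)//.
by rewrite mulrC -ler_pdivlMr// mul1r ltW.
Qed.

Lemma coef_solves (rho : R) t k : (forall k, psconv rho (fun n => coef_seq n 0 k)) -> m t < rho ->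
  (q0 + q1 * t + q2 * t ^+ 2) * ps (fun n => n.+1%:R * coef_seq n.+1 0 k) t =
  ((\row_i ps (fun n => coef_seq n 0 i) t) *m (M0 + t *: M1)) 0 k.
Proof.
move=> hc tr.
pose d n := n.+1%:R * coef_seq n.+1 0 k.
have hd : psconv rho d by exact: (psconv_deriv (hc k)).
have hs := psconv_shift hd; have hss := psconv_shift hs.
have L : ps (fun n => (q0 * d n + q1 * shift_seq d n) + q2 * shift_seq (shift_seq d) n) t =
    (q0 + q1 * t + q2 * t ^+ 2) * ps d t.
  rewrite (psD (psconvD (psconvZ q0 hd) (psconvZ q1 hs)) (psconvZ q2 hss) tr).
  rewrite (psD (psconvZ q0 hd) (psconvZ q1 hs) tr) !(psZ _ _ tr)//.
  by rewrite (ps_shift hs tr) !(ps_shift hd tr); ring.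
rewrite -[LHS]L.
have hc' i : psconv rho (shift_seq (fun n => coef_seq n 0 i)) by exact: psconv_shift.
have hR i : psconv rho (fun n => M0 i k * coef_seq n 0 i +
    M1 i k * shift_seq (fun n => coef_seq n 0 i) n).
  exact: psconvD (psconvZ _ (hc i)) (psconvZ _ (hc' i)).
rewrite mxE (eq_bigr (fun i => ps (fun n => M0 i k * coef_seq n 0 i +
    M1 i k * shift_seq (fun n => coef_seq n 0 i) n) t)); last first.
  move=> i _; rewrite (psD (psconvZ _ (hc i)) (psconvZ _ (hc' i)) tr).
  rewrite (psZ _ (hc i) tr) (psZ _ (hc' i) tr) (ps_shift (hc i) tr) !mxE; ring.
rewrite -(ps_sum _ hR tr); apply: ps_ext => n; rewrite /d.
have -> : coef_seq n.+1 0 k = (q0 * n.+1%:R)^-1 *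
    (\sum_i (M0 i k * coef_seq n 0 i + M1 i k * shift_seq (fun n => coef_seq n 0 i) n)
     - (q1 * n%:R) * coef_seq n 0 k - (q2 * n.-1%:R) * shift_seq (fun n => coef_seq n 0 k) n).
  have E i : shift_seq coef_seq n 0 i = shift_seq (fun n => coef_seq n 0 i) n.
    by case: n => [|n] //=; rewrite mxE.
  rewrite coef_seqS /step !mxE !E big_split /=; congr (_ * (_ + _ - _ - _)).
    by apply: eq_bigr => i _; rewrite mulrC.
  by apply: eq_bigr => i _; rewrite mulrC E.
have n0 : (n.+1%:R : R[i]) != 0 by rewrite pnatr_eq0.
have -> : q1 * shift_seq (fun n => n.+1%:R * coef_seq n.+1 0 k) n = q1 * n%:R * coef_seq n 0 k.
  by case: n {n0} => [|n] /=; rewrite ?mulr0 ?mul0r// mulrA.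
have -> : q2 * shift_seq (shift_seq (fun n => n.+1%:R * coef_seq n.+1 0 k)) n =
    q2 * n.-1%:R * shift_seq (fun n => coef_seq n 0 k) n.
  by case: n {n0} => [|[|n]] /=; rewrite ?mulr0 ?mul0r// mulrA.
rewrite !mulrA.
set A := \sum_i _; set B := q1 * _ * _; set C := q2 * _ * _.
by rewrite mulfV ?mulf_neq0// mul1r; ring.
Qed.

End recursion.

(** Power series solution of [q x' = x (A0 + w A1)] at a point where [q] does
    not vanish. *)
Lemma system_exists (q : R[i] -> R[i]) (A0 A1 : 'M[R[i]]_4) z0 (q0 q1 q2 : R[i]) :
  q0 != 0 -> (forall t, q (z0 + t) = q0 + q1 * t + q2 * t ^+ 2) ->
  forall v, exists2 rho : R, 0 < rho & exists2 x : R[i] -> 'rV[R[i]]_4, x z0 = v &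
    forall w, m (w - z0) < rho -> q w != 0 ->
    forall k, cderiv (fun w => x w 0 k) w ((x w *m (A0 + w *: A1)) 0 k / q w).
Proof.
move=> q00 qE v.
pose M0 := A0 + z0 *: A1; pose c := coef_seq q0 q1 q2 M0 A1 v.
have [rho rho0 hc] := coef_psconv q1 q2 M0 A1 v q00.
exists rho => //; exists (fun w => \row_k ps (fun n => c n 0 k) (w - z0)).
  by apply/rowP => k; rewrite mxE subrr ps0.
move=> w wr qw k.
have -> : ((\row_i ps (fun n => c n 0 i) (w - z0)) *m (A0 + w *: A1)) 0 k / q w =
    ps (fun n => n.+1%:R * c n.+1 0 k) (w - z0).
  have E := coef_solves q00 k hc wr.
  have -> : A0 + w *: A1 = M0 + (w - z0) *: A1.
    by rewrite /M0 -addrA -scalerDl [z0 + _]addrC subrK.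
  by rewrite -E -qE [z0 + _]addrC subrK mulrAC mulfV// mul1r.
have := cderiv_comp (cderivB (cderiv_id w) (cderiv_cst z0 w)) (ps_cderiv (hc k) wr).
by rewrite subr0 mulr1; apply: cderiv_ext => x; rewrite /= mxE.
Qed.

End linear_system.

Section local_basis.
Context {R : realType}.
Variable N : nat.
Implicit Types (z w : R[i]) (v : 'rV[R[i]]_4) (x : R[i] -> 'rV[R[i]]_4).
Local Notation m := modulus.
Local Notation e := (@ecoef R N).

Definition sysC0 : 'M[R[i]]_4 := \matrix_(i, k) (i == k.+1 :> nat)%:R.
Definition sysC1 : 'M[R[i]]_4 :=
  \matrix_(i, k) ((k == 3 :> nat)%:R * e i - (i == k.+1 :> nat)%:R).
Definition sysC w : 'M[R[i]]_4 := sysC0 + w *: sysC1.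

(** [x] is a row of jets of a solution: [w (1 - w) x' = x C(w)]. *)
Definition rsys x w := forall k, cderiv (fun u => x u 0 k) w ((x w *m sysC w) 0 k / (w * (1 - w))).

Definition jet_of x (k : nat) w : R[i] :=
  if (k < 4)%N then x w 0 (inord k) else w / (1 - w) * \sum_(i < 4) e i * x w 0 i.

Definition row_of (y : nat -> R[i] -> R[i]) w : 'rV[R[i]]_4 := \row_k y k w.

Lemma sysC_coord v w (k : 'I_4) : (v *m sysC w) 0 k =
  if (k < 3)%N then (1 - w) * v 0 (inord k.+1) else w * \sum_(i < 4) e i * v 0 i.
Proof.
rewrite mxE; case: ifPn => k3.
  rewrite (bigD1 (inord k.+1))//= !mxE inordK// eqxx.
  rewrite (_ : (k == 3 :> nat) = false) ?mul0r ?sub0r; last by apply/negbTE; rewrite neq_ltn k3.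
  rewrite big1 ?addr0 /= ?mulrN ?mulr1; first by rewrite mulrC.
  move=> i ik; rewrite !mxE (_ : (i == k.+1 :> nat) = false); last first.
    by apply/negbTE; apply: contra ik => /eqP ik; apply/eqP/val_inj; rewrite /= inordK.
  rewrite (_ : (k == 3 :> nat) = false) ?mul0r ?subr0 ?mulr0 ?addr0 ?mulr0//.
  by apply/negbTE; rewrite neq_ltn k3.
have k3' : k = 3 :> nat by move: (ltn_ord k) k3; case: (nat_of_ord k) => [|[|[|[|]]]].
rewrite mulr_sumr; apply: eq_bigr => i _; rewrite !mxE k3' eqxx mul1r.
rewrite (_ : (i == 4 :> nat) = false); last by apply/negbTE; rewrite neq_ltn ltn_ord.
by rewrite subr0 add0r mulrCA [v 0 i * _]mulrC.
Qed.

Lemma rsys_jet x w : w != 0 -> w != 1 -> rsys x w -> jet_eq N (jet_of x) w.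
Proof.
move=> w0 w1 xs; have w1' : 1 - w != 0 by rewrite subr_eq0 eq_sym.
split=> [k k4|].
  have := xs (inord k); rewrite sysC_coord inordK//.
  have jE : jet_of x k = fun u => x u 0 (inord k) by apply/funext => u; rewrite /jet_of k4.
  rewrite jE; congr cderiv; rewrite /jet_of (_ : (k.+1 < 4)%N = (k < 3)%N)//.
  case: ifP => _.
    by move: (x w 0 _) => t; field; rewrite w0.
  by move: (\sum_(_ < _) _) => s; field; rewrite w0.
have J4 : jet_of x 4 w = w / (1 - w) * \sum_(i < 4) e i * x w 0 i by [].
rewrite big_ord_recr /= J4 mul1r.
rewrite [X in _ = w * (X + _)](eq_bigr (fun i : 'I_4 => e i * x w 0 i)); last first.
  by move=> i _; rewrite /jet_of ltn_ord inord_val.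
by move: (\sum_(_ < _) _) => s; field.
Qed.

Lemma jet_rsys y w : w != 0 -> w != 1 -> jet_eq N y w -> rsys (row_of y) w.
Proof.
move=> w0 w1 [yd y4] k; have w1' : 1 - w != 0 by rewrite subr_eq0 eq_sym.
have := yd k (ltn_ord k); rewrite sysC_coord.
suff -> : (if (k < 3)%N then (1 - w) * row_of y w 0 (inord k.+1)
   else w * (\sum_(i < 4) e i * row_of y w 0 i)) / (w * (1 - w)) = y k.+1 w / w.
  by apply: cderiv_ext => u; rewrite mxE.
case: ifPn => k3.
  by rewrite mxE inordK//; move: (y _ _) => t; field; rewrite w0.
have -> : k = 3 :> nat by move: (ltn_ord k) k3; case: (nat_of_ord k) => [|[|[|[|]]]].
move: y4; rewrite big_ord_recr /= mul1r => y4.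
rewrite (eq_bigr (fun i : 'I_4 => e i * y i w)); last by move=> i _; rewrite mxE.
move: y4; move: (\sum_(_ < _) _) (y 4 w) => s t y4.
have -> : w * s = (1 - w) * t by rewrite mulrBl mul1r {1}y4 mulrDr addrK.
by field; rewrite w0.
Qed.

Lemma rsys_mul (c : 'rV[R[i]]_4) (F : R[i] -> 'M[R[i]]_4) w :
  (forall i, rsys (fun u => row i (F u)) w) -> rsys (fun u => c *m F u) w.
Proof.
move=> Fs k.
have := cderiv_sum (index_enum 'I_4) (fun i => cderivZ (c 0 i) (Fs i k)).
rewrite (_ : \sum_i c 0 i * _ = (c *m F w *m sysC w) 0 k / (w * (1 - w))).
  by apply: cderiv_ext => u; rewrite mxE; apply: eq_bigr => i _; rewrite mxE.
rewrite -mulmxA mxE mulr_suml; apply: eq_bigr => i _.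
by rewrite -mulrA -row_mul mxE.
Qed.

Definition fundamental (D : set R[i]) (F : R[i] -> 'M[R[i]]_4) :=
  [/\ forall w, D w -> w != 0 /\ w != 1,
      forall w i, D w -> rsys (fun u => row i (F u)) w,
      forall w, D w -> F w \in unitmx &
      forall w x, D w -> (\forall u \near w, rsys x u) ->
        exists c, \forall u \near w, x u = c *m F u].

Lemma disc_open z0 (r : R) w : m (w - z0) < r -> \forall u \near w, m (u - z0) < r.
Proof.
move=> wr; apply/nbhs_modulusP; exists (r - m (w - z0)); first by rewrite subr_gt0.
move=> u uw; rewrite -[u](subrK w) -addrA (le_lt_trans (modulusD _ _))//.
by rewrite -ltrBrDr.
Qed.

Lemma near_const (F : R[i] -> R[i]) w : (\forall u \near w, cderiv F u 0) ->
  \forall u \near w, F u = F w.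
Proof.
move=> /nbhs_modulusP [r r0 H]; apply/nbhs_modulusP; exists r => // u ur.
apply: (cderiv0_const (@cconvex_disc R w r)) => //=.
by rewrite subrr modulus0.
Qed.

Lemma min_exists (I : finType) (r : I -> R) : (forall i, 0 < r i) ->
  exists2 s : R, 0 < s & forall i, s <= r i.
Proof.
move=> r0; suff [s s0 H] : exists2 s : R, 0 < s & forall i, i \in index_enum I -> s <= r i.
  by exists s => // i; apply: H; exact: mem_index_enum.
elim: (index_enum I) => [|i s [t t0 Ht]]; first by exists 1.
exists (Num.min (r i) t); first by rewrite lt_min r0.
by move=> j; rewrite inE => /predU1P[->|/Ht jt]; rewrite ge_min ?lexx// jt orbT.
Qed.

(** The inverse of the fundamental matrix solves the adjoint system. *)
Lemma local_basis z0 : z0 != 0 -> z0 != 1 -> exists2 r : R, 0 < r &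
  exists F, fundamental [set w | m (w - z0) < r] F.
Proof.
move=> z00 z01.
pose q w : R[i] := w * (1 - w).
have q00 : q z0 != 0 by rewrite mulf_neq0// subr_eq0 eq_sym.
have qE t : q (z0 + t) = q z0 + (1 - 2 * z0) * t + (-1) * t ^+ 2 by rewrite /q; ring.
have [r1 r10 H1] : exists2 r : R, 0 < r & forall w, m (w - z0) < r -> w != 0 /\ w != 1.
  exists (Num.min (m (z0 - 0)) (m (z0 - 1))); first by rewrite lt_min !modulus_gt0 !subr_eq0 z00.
  move=> w; rewrite lt_min => /andP[a b].
  by split; [apply: contraTneq a|apply: contraTneq b] => ->; rewrite modulusB ltxx.
have [X HX] := choice (fun i : 'I_4 => let: ex_intro2 rho rho0 (ex_intro2 x x0 Hx) :=
  system_exists sysC0 sysC1 q00 qE (row i 1%:M) in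
  ex_intro (fun p : R * (R[i] -> 'rV[R[i]]_4) => [/\ 0 < p.1, p.2 z0 = row i 1%:M &
    forall w, m (w - z0) < p.1 -> q w != 0 -> rsys p.2 w]) (rho, x) (And3 rho0 x0 Hx)).
have [Y HY] := choice (fun i : 'I_4 => let: ex_intro2 rho rho0 (ex_intro2 x x0 Hx) :=
  system_exists (- sysC0^T) (- sysC1^T) q00 qE (row i 1%:M) in
  ex_intro (fun p : R * (R[i] -> 'rV[R[i]]_4) => [/\ 0 < p.1, p.2 z0 = row i 1%:M &
    forall w, m (w - z0) < p.1 -> q w != 0 ->
    forall k, cderiv (fun u => p.2 u 0 k) w ((p.2 w *m (- sysC0^T + w *: - sysC1^T)) 0 k / q w)])
    (rho, x) (And3 rho0 x0 Hx)).
have [r2 r20 H2] := min_exists (r := fun i => (X i).1) (fun i => let: And3 a _ _ := HX i in a).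
have [r3 r30 H3] := min_exists (r := fun i => (Y i).1) (fun i => let: And3 a _ _ := HY i in a).
pose r := Num.min r1 (Num.min r2 r3).
have r0 : 0 < r by rewrite lt_min r10 lt_min r20 r30.
pose D := [set w : R[i] | m (w - z0) < r].
have DP w : D w -> [/\ m (w - z0) < r1, m (w - z0) < r2 & m (w - z0) < r3].
  by rewrite /D /= !lt_min => /and3P.
pose F w : 'M[R[i]]_4 := \matrix_i (X i).2 w.
pose G w : 'M[R[i]]_4 := (\matrix_i (Y i).2 w)^T.
have q0 w : D w -> q w != 0.
  by move=> /DP[/H1[w0 w1] _ _]; rewrite mulf_neq0// subr_eq0 eq_sym.
have Fs w i : D w -> rsys (fun u => row i (F u)) w.
  move=> Dw; have [_ _] := HX i; move/(_ w) => Hx.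
  have -> : (fun u => row i (F u)) = (X i).2 by apply/funext => u; rewrite rowK.
  apply: Hx; last exact: q0.
  by case: (DP _ Dw) => _ /lt_le_trans /(_ (H2 i)).
have Gs w j k : D w -> cderiv (fun u => G u k j) w (- (sysC w *m G w) k j / q w).
  move=> Dw; have [_ _] := HY j; move/(_ w) => Hy.
  have {}Hy := Hy (lt_le_trans (let: And3 _ _ a := DP _ Dw in a) (H3 j)) (q0 _ Dw) k.
  rewrite (_ : - (sysC w *m G w) k j = ((Y j).2 w *m (- sysC0^T + w *: - sysC1^T)) 0 k).
    by apply: cderiv_ext Hy => u; rewrite !mxE.
  have -> : - sysC0^T + w *: - sysC1^T = - (sysC w)^T.
    by apply/matrixP => a b; rewrite !mxE mulrN opprD.
  rewrite mulmxN mxE [in RHS]mxE; congr (- _); rewrite mxE; apply: eq_bigr => i _.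
  by rewrite !mxE mulrC.
have yG x w j : D w -> rsys x w -> cderiv (fun u => (x u *m G u) 0 j) w 0.
  move=> Dw xs.
  have := cderiv_sum (index_enum 'I_4) (fun k => cderivM (xs k) (Gs w j k Dw)).
  rewrite (_ : \sum_k _ = 0); first by apply: cderiv_ext => u; rewrite mxE.
  rewrite big_split /=.
  have -> : \sum_k (x w *m sysC w) 0 k / (w * (1 - w)) * G w k j =
     (x w *m sysC w *m G w) 0 j / q w.
    by rewrite [in RHS]mxE mulr_suml; apply: eq_bigr => k _; rewrite /q mulrAC.
  have -> : \sum_k x w 0 k * (- (sysC w *m G w) k j / q w) =
     - ((x w *m (sysC w *m G w)) 0 j / q w).
    rewrite [in RHS]mxE mulr_suml -sumrN; apply: eq_bigr => k _.
    by rewrite mulNr mulrN mulrA.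
  by rewrite mulmxA subrr.
have Dz0 : D z0 by rewrite /D /= subrr modulus0.
have F0 : F z0 = 1%:M by apply/row_matrixP => i; rewrite rowK; case: (HX i).
have G0 : G z0 = 1%:M.
  rewrite /G (_ : (\matrix_i (Y i).2 z0) = 1%:M) ?trmx1//.
  by apply/row_matrixP => i; rewrite rowK; case: (HY i).
have FG w : D w -> F w *m G w = 1%:M.
  move=> Dw; rewrite -[RHS](mulmx1 1%:M) -{1}F0 -G0; apply/matrixP => i j.
  have E u : (F u *m G u) i j = (row i (F u) *m G u) 0 j by rewrite -row_mul [RHS]mxE.
  rewrite !E.
  have dd u : D u -> cderiv (fun u => (row i (F u) *m G u) 0 j) u 0.
    by move=> Du; exact: yG _ u j Du (Fs u i Du).
  exact: (cderiv0_const (@cconvex_disc R z0 r) dd Dz0 Dw).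
exists r => //; exists F; split=> //.
- by move=> w /DP[/H1].
- by move=> w Dw; have [] := mulmx1_unit (FG w Dw).
- move=> w x Dw xs.
  exists (x w *m G w).
  have nD : \forall u \near w, D u by exact: disc_open.
  have H j : \forall u \near w, (x u *m G u) 0 j = (x w *m G w) 0 j.
    by apply: near_const; apply: filterS2 nD xs => u; exact: yG.
  apply: filterS3 (filterI (H (inord 0)) (H (inord 1))) (filterI (H (inord 2)) (H (inord 3))) nD.
  move=> u [h0 h1] [h2 h3] Du.
  have -> : x w *m G w = x u *m G u.
    apply/rowP => j; rewrite -(inord_val j).
    by case: j => [[|[|[|[|j]]]] Hj] //=; rewrite ?h0 ?h1 ?h2 ?h3.
  by rewrite -mulmxA (mulmx1C (FG u Du)) mulmx1.
Qed.

End local_basis.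

Local Opaque local_solution germ_eq.

(** * Analytic continuation along paths *)

Section germs.
Context {R : realType}.
Variable N : nat.
Implicit Types (z w : R[i]) (g h : R[i] -> R[i]).
Local Notation m := modulus.
Local Notation X := (@punctured_plane R).

Lemma germ_refl z g : germ_eq z g g.
Proof. exact: (@filterE _ (nbhs z)). Qed.

Lemma germ_sym z g h : germ_eq z g h -> germ_eq z h g.
Proof. by apply: filterS => w ->. Qed.

Lemma germ_trans z g h k : germ_eq z g h -> germ_eq z h k -> germ_eq z g k.
Proof. by apply: filterS2 => w -> ->. Qed.

Lemma germ_near z g h : germ_eq z g h -> \forall w \near z, germ_eq w g h.
Proof. exact: near_join. Qed.

Lemma lsol_germ z g h : z != 0 -> germ_eq z g h -> local_solution N z g -> local_solution N z h.
Proof.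
move=> z0 gh /(sol_jet z0) js.
pose y k := if k is 0 then h else iter k (euler 0) g.
have E k w : h w = g w -> y k w = iter k (euler 0) g w by case: k.
apply: (jet_sol (y := y)) => //.
apply: filterS2 (germ_near gh) js => w gw [j1 j2].
have hw : h w = g w by have := nbhs_singleton gw => ->.
split=> [k k4|].
  rewrite E//; apply: cderiv_near (j1 k k4); apply: filterS gw => u gu.
  by rewrite E.
by rewrite E// j2; congr (_ * _); apply: eq_bigr => k _; rewrite E.
Qed.

Definition fsol (F : R[i] -> 'M[R[i]]_4) (c : 'rV[R[i]]_4) : R[i] -> R[i] :=
  fun u => (c *m F u) 0 0.

Section in_disc.
Variables (D : set R[i]) (F : R[i] -> 'M[R[i]]_4).
Hypotheses (fF : fundamental N D F) (oD : forall w, D w -> \forall u \near w, D u).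

Lemma fsol_rsys w c : D w -> rsys N (fun u => c *m F u) w.
Proof. by case: fF => _ Fs _ _ Dw; apply: rsys_mul => i; exact: Fs. Qed.

Lemma fsol_jet w c : D w -> jet_at N w (jet_of N (fun u => c *m F u)).
Proof.
move=> Dw; apply: filterS (oD Dw) => u Du; case: fF => /(_ _ Du)[u0 u1] _ _ _.
by apply: rsys_jet => //; exact: fsol_rsys.
Qed.

Lemma jet_of0 (x : R[i] -> 'rV[R[i]]_4) u : jet_of N x 0 u = x u 0 0.
Proof. by rewrite /jet_of /=; congr (x u _ _); apply/val_inj; rewrite /= inordK. Qed.

Lemma fsol_local w c : D w -> local_solution N w (fsol F c).
Proof.
move=> Dw; case: (fF) => /(_ _ Dw)[w0 _] _ _ _.
have := jet_sol w0 (fsol_jet c Dw).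
rewrite (_ : jet_of N (fun u => c *m F u) 0 = fsol F c)//.
by apply/funext => u; rewrite jet_of0.
Qed.

Lemma local_fsol w g : D w -> local_solution N w g -> exists c, germ_eq w g (fsol F c).
Proof.
move=> Dw; case: fF => nz _ _ comp; have [w0 w1] := nz _ Dw.
move=> /(sol_jet w0) js.
have [|c Hc] := comp w (row_of (fun k => iter k (euler 0) g)) Dw.
  apply: filterS2 (oD Dw) js => u Du; have [u0 u1] := nz _ Du.
  exact: jet_rsys.
by exists c; apply: filterS Hc => u Hu; rewrite /fsol -Hu mxE.
Qed.

Lemma fsol_inj w c c' : D w -> germ_eq w (fsol F c) (fsol F c') -> c = c'.
Proof.
move=> Dw H; pose d := c - c'.
pose y := jet_of N (fun u => d *m F u).
have js : jet_at N w y by exact: fsol_jet.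
have y0 : \forall u \near w, y 0%N u = 0.
  apply: filterS H => u; rewrite /y jet_of0 /d mulmxBl !mxE /fsol => Hu.
  by move: Hu; rewrite !mxE => ->; rewrite subrr.
have yk k : (k < 4)%N -> \forall u \near w, y k u = 0.
  elim: k => [//|k IH] k4; have k4' := ltnW k4.
  apply: filterS3 (near_join (IH k4')) js (oD Dw) => u yu [j _] Du.
  case: fF => /(_ _ Du)[u0 _] _ _ _.
  have := cderiv_unique (j k k4') (cderiv_near _ (cderiv_cst 0 u)).
  have E : \forall v \near u, 0 = y k v by apply: filterS yu => v ->.
  move=> /(_ E) /eqP; rewrite mulf_eq0 invr_eq0 (negbTE u0) orbF => /eqP //.
have dF : d *m F w = 0.
  apply/rowP => k; rewrite [RHS]mxE.
  have := nbhs_singleton (yk k (ltn_ord k)); rewrite /y /jet_of ltn_ord.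
  by rewrite inord_val.
case: fF => _ _ /(_ _ Dw) Fu _.
by apply/eqP; rewrite -subr_eq0; apply/eqP; rewrite -/d -[d](mulmxK Fu) dF mul0mx.
Qed.

End in_disc.

(** Around each point of the punctured plane the solutions form a constant
    sheaf of rank 4. *)
Lemma local_system z : X z -> exists D F, [/\ D z, forall w, D w -> \forall u \near w, D u &
  fundamental N D F].
Proof.
move=> [z0 z1]; have [r r0 [F fF]] := local_basis N z0 z1.
exists [set w | m (w - z) < r], F; split=> //=; first by rewrite subrr modulus0.
by move=> w; exact: disc_open.
Qed.

Lemma fsol_sum (I : Type) (s : seq I) F (a : I -> R[i]) (c : I -> 'rV[R[i]]_4) u :
  fsol F (\sum_(i <- s) a i *: c i) u = \sum_(i <- s) a i * fsol F (c i) u.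
Proof.
rewrite /fsol mulmx_suml summxE; apply: eq_bigr => i _.
by rewrite -scalemxAl mxE.
Qed.

Lemma germ_sum z (a : 'I_4 -> R[i]) (f h : 'I_4 -> R[i] -> R[i]) :
  (forall i, germ_eq z (f i) (h i)) ->
  germ_eq z (fun u => \sum_i a i * f i u) (fun u => \sum_i a i * h i u).
Proof.
move=> fh; apply: filterS3 (filterI (fh (inord 0)) (fh (inord 1))) (fh (inord 2)) (fh (inord 3)).
move=> u [h0 h1] h2 h3; apply: eq_bigr => i _; congr (_ * _); rewrite -(inord_val i).
by case: i => [[|[|[|[|j]]]] Hj].
Qed.

Lemma lsol_sum z (a : 'I_4 -> R[i]) (f : 'I_4 -> R[i] -> R[i]) : X z ->
  (forall i, local_solution N z (f i)) -> local_solution N z (fun u => \sum_i a i * f i u).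
Proof.
move=> Xz fs; have [D [F [Dz oD fF]]] := local_system Xz.
have [c Hc] := choice (fun i => local_fsol fF oD Dz (fs i)).
have := fsol_local fF oD (\sum_i a i *: c i) Dz; apply: lsol_germ; first by case: Xz.
apply: germ_sym; apply: germ_trans (germ_sum a Hc) _.
by apply: (@filterE _ (nbhs z)) => u; rewrite fsol_sum.
Qed.

End germs.

Section propagation.
Context {R : realType}.
Local Notation I := (`[0%R, 1%R]%classic : set R).

Lemma propagation (P : R -> Prop) :
  (forall t, I t -> exists2 d : R, 0 < d & forall s1 s2, I s1 -> I s2 ->
     `|s1 - t| < d -> `|s2 - t| < d -> P s1 -> P s2) ->
  P 0 -> forall t, I t -> P t.
Proof.
move=> H P0.
have C : connected I by exact: (@segment_connected R 0 1).
suff -> : I = [set t | I t /\ P t] by move=> t [].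
apply/esym/C.
- by exists 0; split=> //; exact: unit_itv0.
- exists (interior [set x | I x -> P x]); first exact: open_interior.
  apply/seteqP; split=> t.
    move=> [It Pt]; split=> //; have [d d0 Hd] := H _ It.
    exists d => //= s; rewrite /= distrC => sd Is.
    by apply: (Hd t s) => //; rewrite subrr normr0.
  by move=> [It] /nbhs_singleton /=; split=> //; auto.
- exists (~` interior [set x | I x -> ~ P x]); first exact/open_closedC/open_interior.
  apply/seteqP; split=> t.
    by move=> [It Pt]; split=> // /nbhs_singleton /= /(_ It).
  move=> [It nP]; split=> //; apply: contrapT => nPt; apply: nP.
  have [d d0 Hd] := H _ It; exists d => //= s; rewrite /= distrC => sd Is Ps.
  by apply: nPt; apply: (Hd s t) => //; rewrite subrr normr0.
Qed.

Lemma path_near (T : topologicalType) (p : R -> T) t (Q : set T) :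
  {within I, continuous p} -> I t -> (\forall z \near p t, Q z) ->
  exists2 d : R, 0 < d & forall s, I s -> `|s - t| < d -> Q (p s).
Proof.
move=> /subspace_continuousP cp It nQ.
have := cp _ It _ nQ; rewrite /nbhs /= /within => -[d /= d0 Hd].
by exists d => // s Is sd; apply: (Hd s) => //=; rewrite distrC.
Qed.

End propagation.

Section continuation.
Context {R : realType}.
Variable N : nat.
Implicit Types (z w : R[i]) (g h : R[i] -> R[i]) (p q : R -> R[i]).
Local Notation m := modulus.
Local Notation X := (@punctured_plane R).
Local Notation I := (`[0%R, 1%R]%classic : set R).

Definition germ_path p (F : R -> R[i] -> R[i]) :=
  (forall t, I t -> local_solution N (p t) (F t)) /\
  (forall t, I t -> exists2 d : R, 0 < d &
     forall s, I s -> `|s - t| < d -> germ_eq (p s) (F s) (F t)).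

Lemma continuesP p g h : continues N p g h <->
  exists F, [/\ germ_path p F, germ_eq (p 0) (F 0) g & germ_eq (p 1) (F 1) h].
Proof.
split=> [[F [Fs Fc F0 F1]]|[F [[Fs Fc] F0 F1]]]; exists F; split.
- split; first exact: Fs.
  move=> t It; have := Fc t It => -[d /= d0 Hd].
  exists d; first exact: d0.
  move=> s Is st; apply: (Hd s _ Is); by rewrite /= distrC.
- exact: F0.
- exact: F1.
- exact: Fs.
- move=> t It; have [d d0 Hd] := Fc t It; exists d; first exact: d0.
  by move=> s; rewrite /ball_ /= distrC => st Is; exact: Hd.
- exact: F0.
- exact: F1.
Qed.

Section path.
Variable p : R -> R[i].
Hypotheses (cp : {within I, continuous p}) (Xp : forall t, I t -> X (p t)).

(** On a parameter interval mapped to a disc with a fundamental system, a germ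
    path has constant coordinates. *)
Lemma germ_path_coord F D G (s1 : R) c : germ_path p F -> fundamental N D G ->
  (forall w, D w -> \forall u \near w, D u) ->
  I s1 -> germ_eq (p s1) (F s1) (fsol G c) -> forall s2, I s2 ->
  (forall s, I s -> (s1 <= s <= s2) || (s2 <= s <= s1) -> D (p s)) ->
  germ_eq (p s2) (F s2) (fsol G c).
Proof.
move=> [Fs Fc] fG oD Is1 H1 s2 Is2 HD.
pose l (x : R) := s1 + x * (s2 - s1).
have Il x : I x -> I (l x).
  move: Is1 Is2; rewrite /= !in_itv /= /l => /andP[a b] /andP[c' d] /andP[x0 x1].
  by apply/andP; split; nra.
have Dl x : I x -> D (p (l x)).
  move=> Ix; apply: HD; first exact: Il.
  move: Ix; rewrite /= in_itv /= /l => /andP[x0 x1].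
  by have [s12|s21] := leP s1 s2; apply/orP; [left|right]; apply/andP; split; nra.
have k0 : 0 < `|s2 - s1| + 1 by rewrite ltr_wpDl.
have ll x y d : `|x - y| < d / (`|s2 - s1| + 1) -> `|l x - l y| < d.
  move=> xy; rewrite (_ : l x - l y = (x - y) * (s2 - s1)); last by rewrite /l; ring.
  rewrite normrM; rewrite ltr_pdivlMr// in xy; apply: le_lt_trans xy.
  by rewrite ler_wpM2l// lerDl.
suff : germ_eq (p (l 1)) (F (l 1)) (fsol G c) by rewrite (_ : l 1 = s2) // /l; ring.
apply: (@propagation _ (fun x => germ_eq (p (l x)) (F (l x)) (fsol G c))); last exact: unit_itv1.
  move=> x Ix; have Ilx := Il _ Ix.
  have [c' Hc'] := local_fsol fG oD (Dl _ Ix) (Fs _ Ilx).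
  have [d1 d10 Hd1] := Fc _ Ilx.
  have [d2 d20 Hd2] := path_near cp Ilx (germ_near Hc').
  exists (Num.min d1 d2 / (`|s2 - s1| + 1)); first by rewrite divr_gt0// lt_min d10.
  have W y : I y -> `|y - x| < Num.min d1 d2 / (`|s2 - s1| + 1) ->
      germ_eq (p (l y)) (F (l y)) (fsol G c').
    move=> Iy /ll; rewrite lt_min => /andP[y1 y2].
    exact: germ_trans (Hd1 _ (Il _ Iy) y1) (Hd2 _ (Il _ Iy) y2).
  move=> y1 y2 Iy1 Iy2 xy1 xy2 Py1.
  suff -> : c = c' by exact: W.
  apply: (fsol_inj fG oD (Dl _ Iy1)).
  exact: germ_trans (germ_sym Py1) (W _ Iy1 xy1).
by rewrite /l mul0r addr0.
Qed.

Lemma germ_path_unique F F' : germ_path p F -> germ_path p F' ->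
  germ_eq (p 0) (F 0) (F' 0) -> forall t, I t -> germ_eq (p t) (F t) (F' t).
Proof.
move=> [Fs Fc] [Fs' Fc']; apply: propagation => t It.
have [D [G [Dt oD fG]]] := local_system N (Xp It).
have [c Hc] := local_fsol fG oD Dt (Fs _ It).
have [c' Hc'] := local_fsol fG oD Dt (Fs' _ It).
have [d1 d10 Hd1] := Fc _ It; have [d2 d20 Hd2] := Fc' _ It.
have [d3 d30 Hd3] := path_near cp It (filterI (germ_near Hc) (filterI (germ_near Hc') (oD _ Dt))).
exists (Num.min d1 (Num.min d2 d3)); first by rewrite lt_min d10 lt_min d20.
move=> s1 s2 I1 I2; rewrite !lt_min => /and3P[a1 a2 a3] /and3P[b1 b2 b3] H.
have [h1 [h1' D1]] := Hd3 _ I1 a3; have [h2 [h2' D2]] := Hd3 _ I2 b3.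
have cc : c = c'.
  apply: (fsol_inj fG oD D1).
  apply: germ_trans (germ_sym (germ_trans (Hd1 _ I1 a1) h1)) _.
  exact: germ_trans H (germ_trans (Hd2 _ I1 a2) h1').
apply: germ_trans (germ_trans (Hd1 _ I2 b1) h2) _; rewrite cc.
exact: germ_sym (germ_trans (Hd2 _ I2 b2) h2').
Qed.

Lemma germ_path_exists g : local_solution N (p 0) g ->
  exists2 F, germ_path p F & germ_eq (p 0) (F 0) g.
Proof.
move=> gs.
pose J (t : R) := [set s : R | 0 <= s <= t].
pose P (t : R) := exists F : R -> R[i] -> R[i],
  [/\ forall s, J t s -> local_solution N (p s) (F s),
      forall s, J t s -> exists2 d : R, 0 < d &
        forall s', J t s' -> `|s' - s| < d -> germ_eq (p s') (F s') (F s) &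
      germ_eq (p 0) (F 0) g].
suff : P 1.
  move=> [F [Fs Fc F0]]; exists F; last exact: F0.
  have IJ t : I t -> J 1 t by rewrite /J /= in_itv.
  split=> [t /IJ It|t /IJ It]; first exact: Fs.
  by have [d d0 Hd] := Fc t It; exists d => // s /IJ; exact: Hd.
apply: (@propagation _ P); last exact: unit_itv1.
  move=> t It; have [D [G [Dt oD fG]]] := local_system N (Xp It).
  have [d d0 Hd] := path_near cp It (oD _ Dt); exists d => // s1 s2 I1 I2 a1 a2 [F [Fs Fc F0]].
  have [s21|s12] := leP s2 s1.
    have J21 s : J s2 s -> J s1 s by move=> /andP[a b]; rewrite /J /= a (le_trans b).
    exists F; split; last exact: F0.
      by move=> s /J21; exact: Fs.
    move=> s /J21 Js; have [d' d'0 Hd'] := Fc s Js.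
    by exists d'; [exact: d'0|move=> s' /J21; exact: Hd'].
  have J1 : J s1 s1 by move: I1; rewrite /J /= in_itv /= lexx andbT => /andP[].
  have [c Hc] := local_fsol fG oD (Hd _ I1 a1) (Fs _ J1).
  have s10 : 0 <= s1 by case/andP: J1.
  have s21 : s2 <= 1 by move: I2; rewrite /= in_itv /= => /andP[].
  have DD s : s1 <= s <= s2 -> D (p s).
    move=> /andP[b1 b2]; apply: Hd.
      by rewrite /= in_itv /= (le_trans s10)//= (le_trans b2).
    by move: a1 a2; rewrite !ltr_norml => /andP[? ?] /andP[? ?]; apply/andP; split; lra.
  exists (fun s => if s <= s1 then F s else fsol G c); split; last by rewrite s10.
    move=> s /andP[s0 ss2]; case: leP => ss1; first by apply: Fs; rewrite /J /= s0.
    by apply: (fsol_local fG oD); apply: DD; rewrite ltW.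
  move=> s /andP[s0 ss2]; have [ss1|ss1] := ltP s s1.
    have [|d' d'0 Hd'] := Fc s; first by rewrite /J /= s0 ltW.
    exists (Num.min d' (s1 - s)); first by rewrite lt_min d'0 subr_gt0.
    move=> s' /andP[s'0 _]; rewrite lt_min => /andP[e1 e2].
    have s's1 : s' <= s1 by move: e2; rewrite ltr_norml => /andP[? ?]; lra.
    by rewrite s's1 (ltW ss1); apply: Hd' => //; rewrite /J /= s'0.
  have [s1s|ss1'] := ltP s1 s.
    exists (s - s1); first by rewrite subr_gt0.
    move=> s' /andP[s'0 _] e2.
    have A : (s' <= s1) = false.
      by apply/negbTE; rewrite -ltNge; move: e2; rewrite ltr_norml => /andP[? ?]; lra.
    by rewrite A; exact: germ_refl.
  have -> : s = s1 by apply/eqP; rewrite eq_le ss1 ss1'.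
  have [d1 d10 Hd1] := Fc s1 J1.
  have [d2 d20 Hd2] := path_near cp I1 (germ_near Hc).
  exists (Num.min d1 d2); first by rewrite lt_min d10.
  move=> s' /andP[s'0 s'2]; rewrite lt_min => /andP[e1 e2].
  case: leP => s's1.
    by apply: (Hd1 s' _ e1); rewrite /J /= s'0.
  apply: germ_sym; apply: (Hd2 s' _ e2).
  by rewrite /= in_itv /= s'0 (le_trans s'2).
exists (fun=> g); split; last exact: germ_refl.
  move=> s; rewrite /J /= -eq_le => /eqP <-; exact: gs.
by move=> s _; exists 1; [exact: ltr01|move=> s' _ _; exact: germ_refl].
Qed.

Lemma continues_exists g : local_solution N (p 0) g -> exists h, continues N p g h.
Proof.
move=> /germ_path_exists [F FP F0]; exists (F 1); apply/continuesP; exists F.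
by split; [exact: FP|exact: F0|exact: germ_refl].
Qed.

Lemma continues_unique g g' h h' : continues N p g h -> continues N p g' h' ->
  germ_eq (p 0) g g' -> germ_eq (p 1) h h'.
Proof.
move=> /continuesP[F [FP F0 F1]] /continuesP[F' [FP' F0' F1']] gg'.
apply: germ_trans (germ_sym F1) (germ_trans _ F1').
apply: (germ_path_unique FP FP' _ (@unit_itv1 R)).
exact: germ_trans F0 (germ_trans gg' (germ_sym F0')).
Qed.

Lemma continues_sum (a : 'I_4 -> R[i]) (f h : 'I_4 -> R[i] -> R[i]) :
  (forall i, continues N p (f i) (h i)) ->
  continues N p (fun u => \sum_i a i * f i u) (fun u => \sum_i a i * h i u).
Proof.
move=> H; have [F HF] := choice (fun i => (continuesP _ _ _).1 (H i)).
apply/continuesP; exists (fun t u => \sum_i a i * F i t u); split.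
- split=> t It; first by apply: lsol_sum => [|i]; [exact: Xp|have [[Fs _] _ _] := HF i; exact: Fs].
  have [d Hd] := choice (fun i => let: And3 (conj _ Fc) _ _ := HF i in
    let: ex_intro2 d d0 Hd := Fc t It in ex_intro (fun d : R => 0 < d /\
     forall s, I s -> `|s - t| < d -> germ_eq (p s) (F i s) (F i t)) d (conj d0 Hd)).
  have [e e0 He] := min_exists (fun i => (Hd i).1).
  exists e; first exact: e0.
  move=> s Is st; apply: germ_sum => i.
  exact: (Hd i).2 s Is (lt_le_trans st (He i)).
- by apply: germ_sum => i; have [_ F0 _] := HF i; exact: F0.
- by apply: germ_sum => i; have [_ _ F1] := HF i; exact: F1.
Qed.

Lemma continues_end g h : continues N p g h -> local_solution N (p 1) h.
Proof.
move=> /continuesP[F [[Fs _] _ F1]]; apply: lsol_germ F1 (Fs _ (@unit_itv1 R)).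
by have [] := Xp (@unit_itv1 R).
Qed.

End path.

Lemma continues_germ p g g' h h' : germ_eq (p 0) g g' -> germ_eq (p 1) h h' ->
  continues N p g h -> continues N p g' h'.
Proof.
move=> gg hh /continuesP[F [FP F0 F1]]; apply/continuesP; exists F; split.
- exact: FP.
- exact: germ_trans F0 gg.
- exact: germ_trans F1 hh.
Qed.

Lemma continues_cat p q g h k : {within I, continuous q} -> p 1 = q 0 ->
  continues N p g h -> continues N q h k -> continues N (path_cat p q) g k.
Proof.
move=> cq pq /continuesP[F [[Fs Fc] F0 F1]] /continuesP[G [[Gs Gc] G0 G1]].
apply/continuesP; exists (fun t => if t <= 2^-1 then F (2 * t) else G (2 * t - 1)); split.
- have half t : I t -> t <= 2^-1 -> I (2 * t) by exact: unit_itv_half_le.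
  have half' t : I t -> 2^-1 <= t -> I (2 * t - 1) by exact: unit_itv_half_ge.
  split=> t It; rewrite /path_cat.
    case: leP => t2; first exact: Fs (half _ It t2).
    exact: Gs (half' _ It (ltW t2)).
  have [t2|t2] := ltP t 2^-1.
    have [d d0 Hd] := Fc _ (half _ It (ltW t2)).
    exists (Num.min (d / 2) (2^-1 - t)); first by rewrite lt_min divr_gt0//= subr_gt0.
    move=> s Is; rewrite lt_min !ltr_norml => /andP[/andP[a1 a2] /andP[b1 b2]].
    rewrite (ltW t2) (_ : s <= 2^-1); last by lra.
    apply: Hd; first by apply: half => //; lra.
    by rewrite ltr_norml; apply/andP; split; lra.
  have [t2'|t2'] := ltP 2^-1 t.
    have [d d0 Hd] := Gc _ (half' _ It t2).
    exists (Num.min (d / 2) (t - 2^-1)); first by rewrite lt_min divr_gt0//= subr_gt0.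
    move=> s Is; rewrite lt_min !ltr_norml => /andP[/andP[a1 a2] /andP[b1 b2]].
    rewrite !ifF; try by apply/negbTE; rewrite -ltNge; lra.
    apply: Hd; first by apply: half' => //; lra.
    by rewrite ltr_norml; apply/andP; split; lra.
  have -> : t = 2^-1 by apply/eqP; rewrite eq_le t2 t2'.
  rewrite divff//.
  have [d d0 Hd] := Fc _ (@unit_itv1 R); have [d' d'0 Hd'] := Gc _ (@unit_itv0 R).
  have FG : germ_eq (p 1) (F 1) (G 0).
    by apply: germ_trans F1 _; rewrite pq; exact: germ_sym.
  have FG' : germ_eq (q 0) (F 1) (G 0) by rewrite -pq.
  have [d3 d30 Hd3] := path_near cq (@unit_itv0 R) (germ_near FG').
  exists (Num.min (d / 2) (Num.min (d' / 2) (d3 / 2))).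
    by rewrite lt_min divr_gt0//= lt_min !divr_gt0.
  move=> s Is; rewrite !lt_min !ltr_norml.
  move=> /and3P[/andP[a1 a2] /andP[b1 b2] /andP[c1 c2]].
  case: leP => s2.
    by apply: Hd; [exact: half|rewrite ltr_norml; apply/andP; split; lra].
  have I2 := half' _ Is (ltW s2).
  apply: germ_trans (Hd' _ I2 _) (germ_sym (Hd3 _ I2 _)); rewrite ltr_norml; apply/andP; split; lra.
- have z0 : (0 : R) <= 2^-1 by rewrite invr_ge0.
  rewrite /path_cat z0 mulr0; exact: F0.
- have o1 : ((1 : R) <= 2^-1) = false by apply/negbTE; rewrite -ltNge; lra.
  have o2 : 2 * 1 - 1 = 1 :> R by lra.
  rewrite /path_cat o1 o2; exact: G1.
Qed.

Lemma continues_rev p g h : continues N p g h -> continues N (fun t => p (1 - t)) h g.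
Proof.
move=> /continuesP[F [[Fs Fc] F0 F1]]; apply/continuesP; exists (fun t => F (1 - t)); split.
- split=> t /unit_itv_rev It; first exact: Fs.
  have [d d0 Hd] := Fc _ It; exists d; first exact: d0.
  move=> s /unit_itv_rev Is st; apply: (Hd _ Is).
  by rewrite opprB addrCA addrAC subrr add0r distrC.
- by rewrite !subr0; exact: F1.
- by rewrite !subrr; exact: F0.
Qed.

Lemma continues_single p g : (forall t, I t -> local_solution N (p t) g) -> continues N p g g.
Proof.
move=> gs; apply/continuesP; exists (fun=> g); split; try exact: germ_refl.
split; first exact: gs.
by move=> t It; exists 1; [exact: ltr01|move=> s _ _; exact: germ_refl].
Qed.

End continuation.

Section homotopy_invariance.
Context {R : realType}.
Variable N : nat.
Local Notation X := (@punctured_plane R).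
Local Notation I := (`[0%R, 1%R]%classic : set R).

Lemma within_slice (H : R * R -> R[i]) s : {within I `*` I, continuous H} -> I s ->
  {within I, continuous (fun t => H (s, t))}.
Proof.
move=> cH Is.
have DE t : I t -> (I `*` I) (s, t) by move=> It; split.
have cs : {within I, continuous (fun t : R => (s, t))}.
  apply: continuous_subspaceT; apply: continuous_pair; first exact: continuous_const.
  exact: continuous_identity.
exact: (Defs.within_continuous_comp cs cH DE).
Qed.

Lemma square_near (H : R * R -> R[i]) s t (Q : set R[i]) : {within I `*` I, continuous H} ->
  I s -> I t -> (\forall z \near H (s, t), Q z) ->
  exists2 d : R, 0 < d & forall s' t', I s' -> I t' -> `|s' - s| < d -> `|t' - t| < d ->
    Q (H (s', t')).
Proof.
move=> /subspace_continuousP cH Is It nQ.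
have := cH (s, t) (conj Is It) _ nQ; rewrite /nbhs /= /within /= => -[[A B] /= [[d1 /= d10 H1] [d2 /= d20 H2]] HAB].
exists (Num.min d1 d2); first by rewrite lt_min d10.
move=> s' t' Is' It'; rewrite !lt_min => /andP[a1 a2] /andP[b1 b2].
apply: (HAB (s', t')) => //=; split; [apply: H1|apply: H2]; by rewrite /= distrC.
Qed.

(** The coordinates of the continuation along [H (s, -)] in a fundamental
    system over a disc depend only locally on [s]. *)
Lemma continues_homotopic (b : R[i]) (p q : loop R X b) g h h' : homotopic p q ->
  continues N p g h -> continues N q g h' -> germ_eq b h h'.
Proof.
move=> [H [cH XH H01 Hb]] pc qc.
have gs : local_solution N b g.
  have [F [[Fs _] F0 _]] := (continuesP _ _ _ _).1 pc.
  have := Fs 0 (@unit_itv0 R); rewrite loop0 => Fs0.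
  apply: lsol_germ Fs0; last by rewrite -{1}(loop0 p).
  by have [] := loop_in p (@unit_itv0 R); rewrite loop0.
have ex s : I s -> exists F, germ_path N (fun t => H (s, t)) F /\ germ_eq b (F 0) g.
  move=> Is; have gs' : local_solution N (H (s, 0)) g by rewrite (Hb s Is).1.
  have [F FP F0] := germ_path_exists (within_slice cH Is) (fun t => XH s t Is) gs'.
  exists F; split; first exact: FP.
  by rewrite -(Hb s Is).1; exact: F0.
have exh s : exists F, I s -> germ_path N (fun t => H (s, t)) F /\ germ_eq b (F 0) g.
  have [Is|nIs] := pselect (I s); last by exists (fun=> g) => Is; case: (nIs Is).
  by have [F HF] := ex s Is; exists F => _; exact: HF.
have [F HF] := choice exh.
suff : germ_eq b (F 0 1) (F 1 1).
  have J0 := @unit_itv0 R; have J1 := @unit_itv1 R.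
  have [[FP0 F00] [FP1 F10]] := (HF 0 J0, HF 1 J1).
  have E0 : continues N p (F 0 0) (F 0 1).
    apply/continuesP; exists (F 0); split; try exact: germ_refl.
    have e t : I t -> H (0, t) = p t by move=> It; exact: (H01 t It).1.
    case: FP0 => a a'; split=> t It; first by rewrite -(e t It); exact: a.
    have [d d0 Hd] := a' t It; exists d; first exact: d0.
    by move=> s Is st; rewrite -(e s Is); exact: Hd.
  have E1 : continues N q (F 1 0) (F 1 1).
    apply/continuesP; exists (F 1); split; try exact: germ_refl.
    have e t : I t -> H (1, t) = q t by move=> It; exact: (H01 t It).2.
    case: FP1 => a a'; split=> t It; first by rewrite -(e t It); exact: a.
    have [d d0 Hd] := a' t It; exists d; first exact: d0.
    by move=> s Is st; rewrite -(e s Is); exact: Hd.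
  have U0 := continues_unique (@loop_continuous _ _ _ _ p) (@loop_in _ _ _ _ p) E0 pc.
  have U1 := continues_unique (@loop_continuous _ _ _ _ q) (@loop_in _ _ _ _ q) E1 qc.
  rewrite loop0 loop1 in U0; rewrite loop0 loop1 in U1.
  by move=> E; apply: germ_trans (germ_sym (U0 F00)) (germ_trans E (U1 F10)).
apply: (@propagation _ (fun s => germ_eq b (F 0 1) (F s 1))); [|exact: germ_refl|exact: unit_itv1].
move=> s Is; have [FP F0] := HF s Is.
suff : forall t, I t -> exists2 d : R, 0 < d & forall s', I s' -> `|s' - s| < d ->
    germ_eq (H (s', t)) (F s' t) (F s t).
  move=> /(_ 1 (@unit_itv1 R)) [d d0 Hd]; exists d; first exact: d0.
  move=> s1 s2 I1 I2 a1 a2 E.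
  have := Hd _ I1 a1; have := Hd _ I2 a2; rewrite (Hb _ I1).2 (Hb _ I2).2 => e2 e1.
  exact: germ_trans E (germ_trans e1 (germ_sym e2)).
apply: propagation.
  move=> t It; have [D [G [Dt oD fG]]] := local_system N (XH s t Is It).
  have [c Hc] := local_fsol fG oD Dt (FP.1 t It).
  have [d1 d10 Hd1] := square_near cH Is It (filterI (germ_near Hc) (oD _ Dt)).
  have [d2 d20 Hd2] := FP.2 t It.
  exists (Num.min d1 d2); first by rewrite lt_min d10 d20.
  move=> t1 t2 I1 I2; rewrite !lt_min => /andP[a1 a2] /andP[b1 b2] [d d0 Hd].
  have W t' : I t' -> `|t' - t| < d1 -> `|t' - t| < d2 -> exists2 d3 : R, 0 < d3 &
      forall s', I s' -> `|s' - s| < d3 -> germ_eq (H (s', t')) (F s t') (fsol G c).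
    move=> It' e1 e2.
    have Hst : germ_eq (H (s, t')) (F s t') (fsol G c).
      apply: germ_trans (Hd2 _ It' e2) _.
      have ss : `|s - s| < d1 by rewrite subrr normr0.
      by have [+ _] := Hd1 s t' Is It' ss e1; exact.
    have [d3 d30 Hd3] := square_near cH Is It' (germ_near Hst).
    exists d3; first exact: d30.
    have tt : `|t' - t'| < d3 by rewrite subrr normr0.
    by move=> s' Is' s's; exact: Hd3.
  have [d3 d30 Hd3] := W _ I1 a1 a2; have [d4 d40 Hd4] := W _ I2 b1 b2.
  exists (Num.min (Num.min d d1) (Num.min d3 d4)); first by rewrite !lt_min d0 d10 d30.
  move=> s' Is'; rewrite !lt_min => /andP[/andP[e1 e2] /andP[e3 e4]].
  have [FP' _] := HF s' Is'.
  apply: germ_trans _ (germ_sym (Hd4 _ Is' e4)).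
  apply: (germ_path_coord (within_slice cH Is') FP' fG oD I1 _ I2).
    exact: germ_trans (Hd _ Is' e1) (Hd3 _ Is' e3).
  move=> x Ix Hx; have xt : `|x - t| < d1.
    move: a1 b1; rewrite !ltr_norml => /andP[? ?] /andP[? ?].
    by case/orP: Hx => /andP[? ?]; apply/andP; split; lra.
  by have [_ +] := Hd1 s' x Is' Ix e2 xt; exact.
exists 1; first exact: ltr01.
move=> s' Is' _; rewrite (Hb s' Is').1.
by apply: germ_trans (HF s' Is').2 (germ_sym F0).
Qed.

End homotopy_invariance.

Local Transparent local_solution germ_eq.

(** * Frobenius series at the ends of the plane *)

Section frobenius_growth.
Context {R : realType}.
Local Notation m := modulus.
Implicit Types (u : 'rV[R[i]]_4) (B : 'M[R[i]]_4).

Lemma inverse_decay B : (forall n : nat, n.+1%:R%:M + B \in unitmx) ->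
  exists2 K : R, 0 <= K & forall n u,
    vnorm (u *m invmx (n.+1%:R%:M + B)) <= K / n.+1%:R * vnorm u.
Proof.
move=> BU; pose b := mnorm B.
have [n0 Hn0] : exists n0 : nat, 2 * b <= n0%:R.
  by exists (Num.bound (2 * b)); apply/ltW/archi_boundP; rewrite mulr_ge0// mnorm_ge0.
pose K := 2 + \sum_(k < n0) k.+1%:R * mnorm (invmx (k.+1%:R%:M + B)).
have T0 k : 0 <= k.+1%:R * mnorm (invmx (k.+1%:R%:M + B)) by rewrite mulr_ge0// mnorm_ge0.
have S0 : 0 <= \sum_(k < n0) k.+1%:R * mnorm (invmx (k.+1%:R%:M + B)) by exact: sumr_ge0.
exists K => [|n u]; first by rewrite addr_ge0.
have n1 : 0 < n.+1%:R :> R by [].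
rewrite mulrAC ler_pdivlMr//.
have [nn0|nn0] := ltnP n n0.
  apply: (@le_trans _ _ (vnorm u * mnorm (invmx (n.+1%:R%:M + B)) * n.+1%:R)).
    by rewrite ler_wpM2r// vnormM.
  rewrite -mulrA mulrC ler_wpM2r ?vnorm_ge0// /K (bigD1 (Ordinal nn0))//= [X in X <= _]mulrC.
  by rewrite addrCA lerDl addr_ge0// sumr_ge0.
set v := u *m _.
have E : n.+1%:R *: v = u - v *m B.
  rewrite -[in RHS](mulmxKV (BU n) u) -/v mulmxDr mul_mx_scalar.
  by rewrite addrK.
have := vnormZ (n.+1%:R) v; rewrite E modulus_nat => E'.
have h1 := vnormD u (- (v *m B)); rewrite {1}E' in h1.
have h2 : vnorm (- (v *m B)) = vnorm (v *m B).
  by rewrite -scaleN1r vnormZ modulusN modulus1 mul1r.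
have h3 := vnormM v B; rewrite h2 in h1.
have n2 : 2 * b <= n.+1%:R by apply: le_trans Hn0 _; rewrite ler_nat; exact: leqW.
have v0 := vnorm_ge0 v; have u0 := vnorm_ge0 u.
have K2 : 2 <= K by rewrite lerDl.
rewrite -/b in h3; clear - h1 h3 n2 v0 u0 K2.
set x := vnorm v in h1 h3 v0 *; set y := vnorm u in h1 u0 *; set n' := n.+1%:R in h1 n2 *.
nra.
Qed.

Variables (beta : nat -> R[i]) (B : nat -> 'M[R[i]]_4).
Hypothesis BU : forall j n, n.+1%:R%:M + B j \in unitmx.

Definition frob_factor n j : 'M[R[i]]_4 := 1%:M + beta j *: invmx (n.+1%:R%:M + B j).
Definition frob_step n := frob_factor n 0 *m frob_factor n 1 *m frob_factor n 2 *m frob_factor n 3.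

Fixpoint frob_seq (v : 'rV[R[i]]_4) n := if n is n'.+1 then frob_seq v n' *m frob_step n' else v.

Lemma pow4_le (K t : R) : 0 <= K -> 0 <= t -> t <= 1 -> (1 + K * t) ^+ 4 <= 1 + ((1 + K) ^+ 4 - 1) * t.
Proof.
move=> K0 t0 t1.
have -> : (1 + K * t) ^+ 4 = 1 + t * (4 * K + 6 * K ^+ 2 * t + 4 * K ^+ 3 * t ^+ 2 + K ^+ 4 * t ^+ 3) by ring.
have -> : 1 + ((1 + K) ^+ 4 - 1) * t = 1 + t * (4 * K + 6 * K ^+ 2 + 4 * K ^+ 3 + K ^+ 4) by ring.
rewrite lerD2l ler_wpM2l//.
have t2 n : t ^+ n <= 1 by exact: exprn_ile1.
have X c n : 0 <= c -> c * t ^+ n <= c by move=> c0; rewrite ler_piMr.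
have h1 := X (6 * K ^+ 2) 1%N; have h2 := X (4 * K ^+ 3) 2%N; have h3 := X (K ^+ 4) 3%N.
rewrite expr1 in h1.
apply: lerD; last by apply: h3; rewrite exprn_ge0.
apply: lerD; last by apply: h2; rewrite mulr_ge0 ?exprn_ge0.
by apply: lerD => //; apply: h1; rewrite mulr_ge0 ?exprn_ge0.
Qed.

Lemma frob_psconv v i : psconv 1 (fun n => frob_seq v n 0 i).
Proof.
have [K Hk] : exists K : R, 0 <= K /\ forall j n u, (j < 4)%N ->
    vnorm (u *m frob_factor n j) <= (1 + K / n.+1%:R) * vnorm u.
  have Hj j : exists K : R, 0 <= K /\ forall n u,
      vnorm (u *m frob_factor n j) <= (1 + K / n.+1%:R) * vnorm u.
    have [K K0 HK] := inverse_decay (BU j); exists (m (beta j) * K); split.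
      by rewrite mulr_ge0// modulus_ge0.
    move=> n u; rewrite /frob_factor mulmxDr mulmx1 -scalemxAr.
    apply: le_trans (vnormD _ _) _; rewrite mulrDl mul1r lerD2l vnormZ -!mulrA.
    by rewrite ler_wpM2l ?modulus_ge0// mulrA.
  have [K HK] := choice Hj; exists (K 0%N + K 1%N + K 2%N + K 3%N).
  have k0 := (HK 0%N).1; have k1 := (HK 1%N).1; have k2 := (HK 2%N).1; have k3 := (HK 3%N).1.
  split=> [|j n u j4]; first by lra.
  apply: le_trans ((HK j).2 n u) _; rewrite ler_wpM2r ?vnorm_ge0// lerD2l ler_wpM2r ?invr_ge0//.
  by case: j j4 => [|[|[|[|j]]]] //= _; lra.
case: Hk => K0 HK.
pose K' := (1 + K) ^+ 4 - 1.
have K'0 : 0 <= K' by rewrite /K' subr_ge0 exprn_ege1// lerDl.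
have st n : vnorm (frob_seq v n.+1) <= (1 + K' / n.+1%:R) * vnorm (frob_seq v n).
  set u := frob_seq v n; rewrite /= -/u /frob_step.
  rewrite !mulmxA; set q := 1 + K / n.+1%:R.
  have n1 : 0 <= (n.+1%:R : R)^-1 by rewrite invr_ge0.
  have q0 : 0 <= q by rewrite addr_ge0// mulr_ge0.
  have h0 := HK 0%N n u isT; have h1 := HK 1%N n (u *m frob_factor n 0) isT.
  have h2 := HK 2%N n (u *m frob_factor n 0 *m frob_factor n 1) isT.
  have h3 := HK 3%N n (u *m frob_factor n 0 *m frob_factor n 1 *m frob_factor n 2) isT.
  apply: (@le_trans _ _ (q ^+ 4 * vnorm u)).
    apply: le_trans h3 _; rewrite exprS -mulrA ler_wpM2l//.
    apply: le_trans h2 _; rewrite exprS -mulrA ler_wpM2l//.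
    apply: le_trans h1 _; rewrite exprS -mulrA ler_wpM2l//.
  rewrite ler_wpM2r ?vnorm_ge0//; apply: pow4_le => //.
  by rewrite invf_le1// ler1n.
move=> r /andP[r0 r1].
have [|C HC] := growth_bounded K'0 _ (fun n => vnorm_ge0 (frob_seq v n)) st (r := r); first by rewrite r0.
exists C => n; apply: le_trans (HC n); rewrite ler_wpM2r ?exprn_ge0//.
exact: vnorm_coord.
Qed.

(** The factors commute when the [B j] differ by scalars, so that the step is a
    quotient of two products. *)
Lemma frob_stepE n (C : 'M[R[i]]_4) (b : nat -> R[i]) : (forall j, B j = C + (b j)%:M) ->
  let Y j := n.+1%:R%:M + B j in
  frob_step n *m (Y 0%N *m Y 1%N *m Y 2%N *m Y 3%N) =
  (Y 0%N + (beta 0%N)%:M) *m (Y 1%N + (beta 1%N)%:M) *m (Y 2%N + (beta 2%N)%:M) *m (Y 3%N + (beta 3%N)%:M).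
Proof.
move=> BE Y.
have YU j : Y j \is a GRing.unit by exact: BU.
have sC (a : R[i]) (M : 'M[R[i]]_4) : GRing.comm M a%:M.
  by rewrite /GRing.comm -!mulmxE; exact: comm_mx_scalar.
have YC i j : GRing.comm (Y i) (Y j).
  rewrite /Y !BE !addrA; apply: commrD; last exact: sC.
  apply/commr_sym; apply: commrD; last exact: sC.
  exact: commr_refl.
have FY j : frob_factor n j * Y j = Y j + (beta j)%:M.
  rewrite /frob_factor -/(Y j) mulrDl mul1r; congr (_ + _).
  rewrite -scalerAl -scalemx1; congr (_ *: _); exact: mulVr.
have FC i j : GRing.comm (Y j) (frob_factor n i).
  rewrite /frob_factor; apply: commrD; first exact: commr1.
  rewrite -mul_scalar_mx mulmxE; apply: commrM; first exact: sC.
  by apply: commrV; exact: YC.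
rewrite -!FY /frob_step -!mulmxE; move: (FC); rewrite /GRing.comm -!mulmxE => FC'.
move: (frob_factor n 0) (frob_factor n 1) (frob_factor n 2) (frob_factor n 3) (Y 0%N) (Y 1%N) (Y 2%N) (Y 3%N)
  (FC' 1 0)%N (FC' 2 0)%N (FC' 3 0)%N (FC' 2 1)%N (FC' 3 1)%N (FC' 3 2)%N.
move=> f0 f1 f2 f3 y0 y1 y2 y3 c10 c20 c30 c21 c31 c32.
rewrite !mulmxA -(mulmxA _ f3 y0) -c30 !mulmxA -(mulmxA _ f2 y0) -c20 !mulmxA -(mulmxA _ f1 y0) -c10.
rewrite !mulmxA -(mulmxA _ f3 y1) -c31 !mulmxA -(mulmxA _ f2 y1) -c21.
by rewrite !mulmxA -(mulmxA _ f3 y2) -c32 !mulmxA.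
Qed.

End frobenius_growth.

Section euler_of_series.
Context {R : realType}.
Local Notation m := modulus.
Implicit Types (a : nat -> R[i]).

Lemma euler_shift a : (fun n => n%:R * a n) =1 shift_seq (fun n => n.+1%:R * a n.+1).
Proof. by case=> [|n] /=; rewrite ?mul0r. Qed.

Lemma psconv_euler (rho : R) a : psconv rho a -> psconv rho (fun n => n%:R * a n).
Proof.
move=> ca; apply: (psconv_ext (fun n => esym (euler_shift a n))).
exact/psconv_shift/psconv_deriv.
Qed.

Lemma ps_euler (rho : R) a z : psconv rho a -> m z < rho ->
  ps (fun n => n%:R * a n) z = z * ps (fun n => n.+1%:R * a n.+1) z.
Proof.
by move=> ca zr; rewrite (ps_ext _ (euler_shift a)) (ps_shift (psconv_deriv ca) zr).
Qed.

End euler_of_series.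

Section frobenius_solutions.
Context {R : realType}.
Variable N : nat.
Local Notation m := modulus.
Local Notation X := (@punctured_plane R).
Local Notation I := (`[0%R, 1%R]%classic : set R).
Variables (s : R[i]) (A : 'M[R[i]]_4) (E : R[i] -> 'M[R[i]]_4) (x : R[i] -> R[i]).
Hypothesis dE : forall l i j, cderiv (fun u => E u i j) l ((A *m E l) i j).
Hypothesis dx : forall w, w != 0 -> cderiv x w (s * x w / w).
Implicit Types (c d : nat -> 'rV[R[i]]_4).

Definition frob_conv c := forall j, psconv 1 (fun n => c n 0 j).

(** A Frobenius series: the matrix exponential [E l], for a logarithm [l] of
    [z], plays the part of the power of [z] with matrix exponent [A]. *)
Definition frob c l z : 'rV[R[i]]_4 := (\row_j ps (fun n => c n 0 j) z) *m E l.

Definition frob_euler c n : 'rV[R[i]]_4 := c n *m ((s * n%:R)%:M + A).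

Lemma frob_eulerE c n j : frob_euler c n 0 j = s * (n%:R * c n 0 j) + \sum_i A i j * c n 0 i.
Proof.
rewrite /frob_euler mulmxDr mxE mul_mx_scalar mxE mulrA; congr (_ + _).
by rewrite mxE; apply: eq_bigr => i _; rewrite mulrC.
Qed.

Lemma frob_euler_conv c : frob_conv c -> frob_conv (frob_euler c).
Proof.
move=> cc j; apply: (psconv_ext (fun n => esym (frob_eulerE c n j))).
apply: psconvD; first exact/psconvZ/psconv_euler.
by apply: psconv_sum => i; exact: psconvZ.
Qed.

Lemma frob_euler_iter c k n : iter k frob_euler c n = c n *m ((s * n%:R)%:M + A) ^+ k.
Proof.
elim: k => [|k IH]; first by rewrite expr0 mulmx1.
by rewrite iterS {1}/frob_euler IH -mulmxA mulmxE -exprSr.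
Qed.

Lemma iter_conv c k : frob_conv c -> frob_conv (iter k frob_euler c).
Proof. by move=> cc; elim: k => [|k IH] //; rewrite iterS; exact: frob_euler_conv. Qed.

Lemma frob_cderiv c l w k : frob_conv c -> w != 0 -> m (x w) < 1 -> cderiv l w w^-1 ->
  cderiv (fun u => frob c (l u) (x u) 0 k) w (frob (frob_euler c) (l w) (x w) 0 k / w).
Proof.
move=> cc w0 xw dl.
pose P u := \row_j ps (fun n => c n 0 j) u.
pose Q := \row_j (s * (x w * ps (fun n => n.+1%:R * c n.+1 0 j) (x w))).
have -> : frob (frob_euler c) (l w) (x w) 0 k / w =
  \sum_j (ps (fun n => n.+1%:R * c n.+1 0 j) (x w) * (s * x w / w) * E (l w) j k
    + ps (fun n => c n 0 j) (x w) * ((A *m E (l w)) j k * w^-1)).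
  have -> : frob (frob_euler c) (l w) (x w) = Q *m E (l w) + P (x w) *m (A *m E (l w)).
    rewrite mulmxA -mulmxDl; congr (_ *m _); apply/rowP => j.
    rewrite !mxE (ps_ext _ (fun n => frob_eulerE c n j)).
    rewrite (psD (rho := 1)) //; last 2 first.
    - exact/psconvZ/psconv_euler.
    - by apply: psconv_sum => i; exact: psconvZ.
    rewrite (psZ _ (psconv_euler (cc j)) xw) (ps_euler (cc j) xw); congr (_ + _).
    rewrite (ps_sum (rho := 1)) //; last by move=> i; exact: psconvZ.
    by apply: eq_bigr => i _; rewrite (psZ _ (cc i) xw) !mxE mulrC.
  rewrite mxE mulrDl !mxE !mulr_suml -big_split; apply: eq_bigr => j _ /=; rewrite !mxE.
  congr (_ + _); last by rewrite mulrA.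
  move: (ps _ _) (E _ _ _) w^-1 => p e v; ring.
apply: (cderiv_ext (f := fun u => \sum_j ps (fun n => c n 0 j) (x u) * E (l u) j k)).
  by move=> u; rewrite mxE; apply: eq_bigr => j _; rewrite mxE.
apply: cderiv_sum => j.
apply: cderivM.
  exact: (cderiv_comp (dx w0) (ps_cderiv (cc j) xw)).
exact: (cderiv_comp dl (dE (l w) j k)).
Qed.

Lemma frob_sum (a : nat -> R[i]) (d : nat -> nat -> 'rV[R[i]]_4) r l z : (forall k, frob_conv (d k)) ->
  m z < 1 ->
  frob (fun n => \sum_(k < r) a k *: d k n) l z = \sum_(k < r) a k *: frob (d k) l z.
Proof.
move=> dc z1; rewrite /frob.
have -> : \row_j ps (fun n => (\sum_(k < r) a k *: d k n) 0 j) z =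
          \sum_(k < r) a k *: \row_j ps (fun n => d k n 0 j) z.
  apply/rowP => j; rewrite mxE summxE.
  rewrite (ps_ext _ (b := fun n => \sum_(k < r) a k * d k n 0 j)); last first.
    by move=> n; rewrite summxE; apply: eq_bigr => k _; rewrite mxE.
  rewrite (ps_sum (rho := 1)) //; last by move=> k; exact/psconvZ/dc.
  by apply: eq_bigr => k _; rewrite !mxE (psZ _ (dc k j) z1).
by rewrite mulmx_suml; apply: eq_bigr => k _; rewrite scalemxAl.
Qed.

Lemma frob_shift d l z : frob_conv d -> m z < 1 -> frob (shift_seq d) l z = z *: frob d l z.
Proof.
move=> dc z1; rewrite /frob scalemxAl; congr (_ *m _); apply/rowP => j; rewrite !mxE.
rewrite (ps_ext _ (b := shift_seq (fun n => d n 0 j))); last by case=> [|n] /=; rewrite ?mxE.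
by rewrite (ps_shift (dc j) z1).
Qed.

Lemma frob_ext c d l z : c =1 d -> frob c l z = frob d l z.
Proof. by move=> /funext ->. Qed.

Definition frob_solves c := forall l w, w != 0 -> m (x w) < 1 ->
  frob (iter 4 frob_euler c) l (x w) = w *: \sum_(k < 5) ecoef N k *: frob (iter k frob_euler c) l (x w).

Hypothesis EM : forall l k, E (l + k) = E l *m E k.

Variables (l0 kappa : R[i]) (p : R -> R[i]) (c : nat -> 'rV[R[i]]_4).
Hypothesis pE : forall t, p t = cexp (l0 + t%:C * kappa).
Hypothesis kappa1 : cexp kappa = 1.
Hypothesis px : forall t, m (x (p t)) < 1.
Hypotheses (cc : frob_conv c) (cs : frob_solves c).

Let g l i u := frob c l (x u) 0 i.

Lemma p_neq0 t : p t != 0. Proof. by rewrite pE; exact: cexp_neq0. Qed.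

Lemma frob_local i t : local_solution N (p t) (fun u => frob c (logb (p t) (l0 + t%:C * kappa) u) (x u) 0 i).
Proof.
set l := logb _ _; have p0 := p_neq0 t.
pose y k u := frob (iter k frob_euler c) (l u) (x u) 0 i.
apply: (jet_sol (y := y) p0).
have n1 : \forall w \near p t, m (w - p t) < m (p t).
  by apply/nbhs_modulusP; exists (m (p t)) => //; rewrite modulus_gt0.
have n2 : \forall w \near p t, m (x w) < 1.
  have xc := cderiv_continuous (dx p0).
  have : \forall v \near x (p t), m v < 1.
    apply: filterS (disc_open (z0 := 0) (r := 1) _); last by rewrite subr0.
    by move=> v /=; rewrite subr0.
  by move=> /xc.
apply: filterS3 n1 n2 (near_neq p0) => w w1 w2 w0.
split=> [k _|].
  rewrite {2}/y iterS; apply: frob_cderiv => //; first exact: iter_conv.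
  exact: logb_cderiv.
rewrite /y cs// mxE summxE; congr (_ * _); apply: eq_bigr => k _.
by rewrite mxE.
Qed.

Lemma frob_continues i : continues N p
  (fun u => frob c (logb (p 0) l0 u) (x u) 0 i)
  (fun u => \sum_j E kappa j i * frob c (logb (p 0) l0 u) (x u) 0 j).
Proof.
apply/continuesP; exists (fun t u => frob c (logb (p t) (l0 + t%:C * kappa) u) (x u) 0 i); split.
- split=> t It; first exact: frob_local.
  have [d d0 Hd] := @logb_agree R.
  exists (d / (m kappa + 1)); first by rewrite divr_gt0// ltr_wpDl// modulus_ge0.
  move=> s' Is st.
  have : m ((l0 + s'%:C * kappa) - (l0 + t%:C * kappa)) < d.
    have -> : (l0 + s'%:C * kappa) - (l0 + t%:C * kappa) = (s' - t)%:C * kappa.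
      by rewrite rmorphB; ring.
    rewrite modulusM modulus_real; rewrite ltr_pdivlMr in st; last by rewrite ltr_wpDl// modulus_ge0.
    by apply: le_lt_trans st; rewrite ler_wpM2l// lerDl.
  move=> /(Hd 1 _ _ (oner_neq0 _)); rewrite !mul1r -!pE.
  by apply: filterS => z ->.
- apply: (@filterE _ (nbhs (p 0))) => u; rewrite rmorph0 mul0r addr0; exact: erefl.
- apply: (@filterE _ (nbhs (p 1))) => u; rewrite rmorph1 mul1r.
  have p1 : p 1 = p 0 by rewrite !pE rmorph1 rmorph0 mul1r mul0r addr0 cexpD kappa1 mulr1.
  rewrite p1; have -> : logb (p 0) (l0 + kappa) u = logb (p 0) l0 u + kappa.
    by rewrite /logb addrAC.
  by rewrite /frob EM mulmxA mxE; apply: eq_bigr => j _; rewrite mulrC.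
Qed.

End frobenius_solutions.

Section exponents.
Context {R : realType}.
Local Notation m := modulus.

Lemma modulus_cexp (z : R[i]) : m (cexp z) = expR (complex.Re z).
Proof.
rewrite modulusE /cexp /= !exprMn -mulrDr cos2Dsin2 mulr1 sqrtr_sqr.
by rewrite ger0_norm ?expR_ge0.
Qed.

Lemma cexp_polar (r t : R) : 0 < r -> cexp ((ln r) +i* t) = r%:C * (cos t +i* sin t).
Proof.
by move=> r0; rewrite /cexp /= lnK ?posrE//; apply/eqP; rewrite eq_complex /= !mul0r subr0 addr0 !eqxx.
Qed.

Lemma ps_pos_neq0 (a : nat -> R[i]) (z : R[i]) : psconv (1 : R) a -> m z < 1 -> 0 <= z ->
  a 0%N = 1 -> (forall n, 0 <= a n) -> ps a z != 0.
Proof.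
move=> ca z1 z0 a0 an; apply/eqP => E.
have := ps_sums ca z1; rewrite E => /(_ 2^-1) [|n0 H]; first by rewrite invr_gt0.
have := H n0.+1 (leqnSn _); rewrite sub0r modulusN big_ord_recl expr0 mulr1 a0.
set S := \sum_(i < n0) _.
have S0 : 0 <= S by apply: sumr_ge0 => i _; rewrite mulr_ge0// exprn_ge0.
have : 1%:C <= (m (1 + S))%:C by rewrite -modulus_normc ger0_norm ?addr_ge0// lerDl.
by rewrite lecR => h1 h2; have := le_trans h1 h2; lra.
Qed.

Variable N : nat.
Hypothesis N4 : (4 <= N)%N.

Definition expoR (j : nat) : R :=
  match j with
  | 0 => (N%:R - 3) / (2 * N%:R) | 1 => (N%:R - 1) / (2 * N%:R)
  | 2 => (N%:R + 1) / (2 * N%:R) | _ => (N%:R + 3) / (2 * N%:R)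
  end.

Lemma N4R : 4 <= N%:R :> R.
Proof. by rewrite (ler_nat R 4). Qed.

Lemma expoE j : @expo R N j = (expoR j)%:C.
Proof.
have n : N%:R = (N%:R : R)%:C by rewrite rmorph_nat.
have E (a b : R) : (a / b)%:C = a%:C / b%:C by rewrite rmorphM fmorphV.
case: j => [|[|[|j]]]; rewrite /expo /expoR n E rmorphM rmorph_nat; congr (_ / _);
  by rewrite ?rmorphB ?rmorphD ?rmorph_nat ?rmorph1.
Qed.

Lemma expoR_itv j : 0 < expoR j < 1.
Proof.
have := N4R; case: j => [|[|[|j]]]; rewrite /expoR => h;
  by rewrite divr_gt0 ?ltr_pdivrMr; lra.
Qed.

Lemma expoR_step j : (j < 3)%N -> expoR j.+1 = expoR j + N%:R^-1.
Proof.
have h := N4R; have n0 : N%:R != 0 :> R by apply/eqP; lra.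
by case: j => [|[|[|j]]] //= _; field.
Qed.

Lemma ecoef_prod_mx (M : 'M[R[i]]_4) : \sum_(k < 5) ecoef N k *: M ^+ k =
  (M + (expo N 0)%:M) *m (M + (expo N 1)%:M) *m (M + (expo N 2)%:M) *m (M + (expo N 3)%:M).
Proof.
have P : \sum_(k < 5) ecoef N k *: 'X^k = ('X + (expo N 0)%:P) * ('X + (expo N 1)%:P) *
   ('X + (expo N 2)%:P) * ('X + (expo N 3)%:P) :> {poly R[i]}.
  rewrite (sum5 (fun k => ecoef N k *: 'X^k)) /ecoef -!mul_polyC !rmorphD !rmorphM expr0 expr1.
  ring.
have F j : horner_mx M ('X + (expo N j)%:P) = M + (expo N j)%:M.
  by rewrite raddfD /= horner_mx_X horner_mx_C.
have HM p q : horner_mx M (p * q) = horner_mx M p *m horner_mx M q by exact: rmorphM.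
have := congr1 (horner_mx M) P; rewrite !HM !F => <-.
transitivity (\sum_(k < 5) horner_mx M (ecoef N k *: 'X^k)); last first.
  exact: esym (raddf_sum (horner_mx M) _ _ _).
by apply: eq_bigr => k _; rewrite horner_mxZ rmorphXn /= horner_mx_X.
Qed.

End exponents.

Section infinity.
Context {R : realType}.
Variable N : nat.
Hypothesis N4 : (4 <= N)%N.
Local Notation m := modulus.
Local Notation b := (@base_point R).
Local Notation a := (@expo R N).

Let D : 'M[R[i]]_4 := diag_mx (\row_j a j).
Let B (j : nat) : 'M[R[i]]_4 := D + (- a j)%:M.

Lemma diag_scalar (d : 'rV[R[i]]_4) t : diag_mx d + t%:M = diag_mx (d + const_mx t).
Proof. by rewrite -diag_const_mx -linearD. Qed.

Lemma expo_gap n (i j : nat) : 0 < n.+1%:R + a i - a j.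
Proof.
have -> : n.+1%:R + a i - a j = (n.+1%:R + expoR N i - expoR N j)%:C.
  by rewrite !expoE rmorphB rmorphD rmorph_nat.
rewrite ltcR.
have /andP[h1 h2] := @expoR_itv R N N4 i; have /andP[h3 h4] := @expoR_itv R N N4 j.
have : (1 : R) <= n.+1%:R by rewrite ler1n.
lra.
Qed.

Lemma BE n j : n.+1%:R%:M + B j = diag_mx (\row_i (n.+1%:R + a i - a j)).
Proof.
rewrite /B addrC -addrA -raddfD /= diag_scalar; congr diag_mx.
by apply/rowP => i; rewrite !mxE; ring.
Qed.

Lemma BU j n : n.+1%:R%:M + B j \in unitmx.
Proof.
rewrite BE unitmxE det_diag unitfE; apply/prodf_neq0 => i _.
by rewrite mxE; apply: lt0r_neq0; exact: expo_gap.
Qed.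

Let beta (j : nat) : R[i] := a j - 1.
Let c : nat -> 'rV[R[i]]_4 := frob_seq beta B (const_mx 1).

Lemma c_rec n i : c n.+1 0 i * ((n.+1%:R + a i - a 0) * (n.+1%:R + a i - a 1) * (n.+1%:R + a i - a 2) * (n.+1%:R + a i - a 3)) = c n 0 i * (n%:R + a i) ^+ 4.
Proof.
have := frob_stepE beta BU n (C := D) (b := fun j => - a j) (fun j => erefl).
rewrite /= !BE !diag_scalar => /(congr1 (fun M => (c n *m M) 0 i)).
rewrite (mulmxA (c n)) -[c n *m frob_step _ _ _]/(c n.+1) !mulmxA !mul_mx_diag !mxE /beta => E.
rewrite !mulrA E.
rewrite -!mulrA; congr (_ * _); move: (a 0) (a 1) (a 2) (a 3) (a i) => x0 x1 x2 x3 x.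
rewrite (_ : n.+1%:R = n%:R + 1 :> R[i]); last by rewrite -addn1 natrD.
by move: (n%:R : R[i]) => t; ring.
Qed.

Lemma c_pos n i : 0 <= c n 0 i.
Proof.
elim: n => [|n IH]; first by rewrite mxE ler01.
have P : 0 < (n.+1%:R + a i - a 0) * (n.+1%:R + a i - a 1) * (n.+1%:R + a i - a 2) * (n.+1%:R + a i - a 3)
  by rewrite !mulr_gt0// expo_gap.
rewrite -(pmulr_lge0 _ P) c_rec mulr_ge0// exprn_ge0// addr_ge0//.
by rewrite expoE lecR; have /andP[/ltW] := @expoR_itv R N N4 i.
Qed.

Let A : 'M[R[i]]_4 := - D.
Let E (l : R[i]) : 'M[R[i]]_4 := diag_mx (\row_j cexp (- (a j * l))).

Lemma dE l i j : cderiv (fun u => E u i j) l ((A *m E l) i j).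
Proof.
rewrite /A /E /D mulNmx mulmx_diag !mxE.
case: eqVneq => [<-|ij]; last first.
  apply: (cderiv_ext (f := fun=> 0)); first by move=> u; rewrite !mxE (negbTE ij) mulr0n.
  by rewrite mulr0n oppr0; exact: cderiv_cst.
apply: (cderiv_ext (f := cexp \o (fun u => (- a i) * u))).
  by move=> u /=; rewrite !mxE eqxx mulr1n mulNr.
have -> : - (a i * cexp (- (a i * l)) *+ 1) = cexp (- a i * l) * (- a i * 1).
  by rewrite mulr1n mulr1 mulrN mulrC mulNr.
by apply: cderiv_comp; [apply: cderivZ; exact: cderiv_id|exact: cexp_cderiv].
Qed.

Lemma EM l k : E (l + k) = E l *m E k.
Proof.
rewrite /E mulmx_diag; congr diag_mx; apply/rowP => j; rewrite !mxE -cexpD.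
by rewrite mulrDr opprD.
Qed.

Let x (w : R[i]) : R[i] := w^-1.

Lemma dx w : w != 0 -> cderiv x w ((-1) * x w / w).
Proof.
move=> w0; rewrite (_ : _ / w = - (w ^+ 2)^-1); first exact: cderivV.
by rewrite /x mulN1r mulNr -invfM expr2.
Qed.

Lemma c_conv : frob_conv c.
Proof. by move=> j; apply: frob_psconv => i n; exact: BU. Qed.

Lemma c_solves : frob_solves N (-1) A E x c.
Proof.
move=> l w w0 xw.
pose d k := iter k (frob_euler (-1) A) c.
have dc k : frob_conv (d k) by apply: iter_conv; exact: c_conv.
rewrite -(frob_sum E (fun k => ecoef N k) 5 l dc xw).
have -> : frob E (fun n => \sum_(k < 5) ecoef N k *: d k n) l (x w) = frob E (shift_seq (d 4)) l (x w).
  apply: frob_ext => n.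
  under eq_bigr => k _ do rewrite /d frob_euler_iter scalemxAr.
  rewrite -mulmx_sumr ecoef_prod_mx /A.
  have H (k : nat) t : (-1 * k%:R)%:M - D + t%:M = - diag_mx (\row_i (k%:R + a i - t)).
    rewrite [_ - D]addrC -addrA -raddfD /= /D -linearN diag_scalar -linearN; congr diag_mx.
    by apply/rowP => i; rewrite !mxE; ring.
  have H0 (k : nat) : (-1 * k%:R)%:M - D = - diag_mx (\row_i (k%:R + a i)).
    have := H k 0; rewrite raddf0 addr0 => ->; congr (- diag_mx _).
    by apply/rowP => i; rewrite !mxE subr0.
  rewrite !H; apply/rowP => i; case: n => [|n].
    rewrite -[shift_seq _ _]/(0 : 'rV[R[i]]_4) !mulNmx !mulmxN !mulNmx !opprK !mulmxA !mul_mx_diag !mxE !add0r.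
    by case: i => [[|[|[|[|i]]]] hi] //=; rewrite subrr ?(mul0r, mulr0).
  rewrite -[shift_seq _ _]/(iter 4 (frob_euler (-1) A) c n) frob_euler_iter H0.
  have F (M : 'M[R[i]]_4) : (- M) ^+ 4 = M *m M *m M *m M.
    by rewrite !exprS expr0 mulr1 -!mulmxE !mulNmx !mulmxN !opprK !mulmxA.
  move: (c n.+1) (c n) (c_rec n i) => v u Ec.
  rewrite F !mulNmx !mulmxN !mulNmx !opprK !mulmxA !mul_mx_diag !mxE.
  by move: Ec; rewrite !mulrA => ->.
rewrite (frob_shift E l (dc 4%N) xw) scalerA /x divff// scale1r.
by [].
Qed.

Definition infinity_sol (i : 'I_4) : R[i] -> R[i] :=
  fun u => frob E c (logb b (ln (3 / 2))%:C u) (x u) 0 i.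

Let kappa : R[i] := (0 -i* (2 * pi)).
Let l0 : R[i] := (ln (3 / 2))%:C.

Lemma circleE t : around_infty_fun t = cexp (l0 + t%:C * kappa).
Proof.
rewrite (_ : l0 + _ = (ln (3 / 2)) +i* (- (2 * pi * t))); last first.
  by apply/eqP; rewrite eq_complex /= !mul0r !mulr0 ?subr0 ?addr0 ?add0r ?mulrN eqxx /= mulrC.
rewrite cexp_polar// cosN sinN /around_infty_fun.
by apply/eqP; rewrite eq_complex /= !mul0r subr0 addr0 mulrN !eqxx.
Qed.

Lemma circle_bound t : m (x (around_infty_fun t)) < 1.
Proof.
rewrite /x modulusV circleE modulus_cexp /= !mul0r !mulr0 subrr addr0 lnK ?posrE//; lra.
Qed.

Lemma kappa1 : cexp kappa = 1.
Proof.
have e : 2 * pi = pi *+ 2 :> R by rewrite mulr_natl.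
by rewrite /cexp /= expR0 !mul1r cosN sinN e cos2pi sin2pi oppr0.
Qed.

Lemma infinity_local i : local_solution N b (infinity_sol i).
Proof.
have := frob_local dE dx circleE circle_bound c_conv c_solves i 0.
rewrite rmorph0 mul0r addr0 around_infty_0; exact.
Qed.

Lemma infinity_continues i : continues N (@loop_around_infty R) (infinity_sol i)
  (fun u => cexp ('i * (2 * pi)%:C * a i) * infinity_sol i u).
Proof.
have := frob_continues dE dx EM circleE kappa1 circle_bound c_conv c_solves i.
rewrite around_infty_0 -/l0 => H; apply: continues_germ H; first exact: germ_refl.
apply: (@filterE _ (nbhs _)) => u; rewrite (bigD1 i)//= big1 ?addr0; last first.
  by move=> j ji; rewrite mxE (negbTE ji) mulr0n mul0r.
have -> : E kappa i i = cexp ('i * (2 * pi)%:C * a i).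
  rewrite mxE eqxx mulr1n mxE; congr cexp; rewrite -mulrN mulrC; congr (_ * _).
  by apply/eqP; rewrite eq_complex /=; apply/andP; split; apply/eqP; lra.
exact: erefl.
Qed.

Lemma infinity_neq0 i : infinity_sol i b != 0.
Proof.
rewrite /infinity_sol /frob mul_mx_diag !mxE mulf_neq0 ?cexp_neq0//.
have b23 : x b = (2 / 3)%:C by rewrite /x /base_point -fmorphV invf_div.
rewrite b23; apply: ps_pos_neq0.
- exact: c_conv.
- rewrite modulus_real ger0_norm; lra.
- by rewrite lecR; lra.
- by rewrite mxE.
- by move=> n; exact: c_pos.
Qed.

End infinity.

Section zero.
Context {R : realType}.
Variable N : nat.
Hypothesis N4 : (4 <= N)%N.
Local Notation m := modulus.
Local Notation a := (@expo R N).

Let J : 'M[R[i]]_4 := \matrix_(i, j) (i == j.+1 :> nat)%:R.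
Let B (j : nat) : 'M[R[i]]_4 := J.

Lemma J_coord (v : 'rV[R[i]]_4) : (v *m J) 0 (inord 3) = 0.
Proof.
rewrite mxE big1// => j _; rewrite mxE inordK//.
by rewrite (ltn_eqF (ltn_ord j)) mulr0.
Qed.

Lemma top_coord (v : 'rV[R[i]]_4) t : (v *m (t%:M + J)) 0 (inord 3) = v 0 (inord 3) * t.
Proof. by rewrite mulmxDr mxE J_coord addr0 mul_mx_scalar mxE mulrC. Qed.

Lemma nilp_unit j n : n.+1%:R%:M + B j \in unitmx.
Proof.
have T : is_trig_mx (n.+1%:R%:M + B j).
  apply/is_trig_mxP => i k ik; rewrite !mxE.
  have -> : (i == k.+1 :> nat) = false by apply/negbTE; rewrite neq_ltn ltnS (ltnW ik).
  have -> : (i == k) = false by apply/negbTE/eqP => e; rewrite e ltnn in ik.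
  by rewrite !mulr0n addr0.
rewrite unitmxE det_trig// unitfE; apply/prodf_neq0 => i _; rewrite !mxE eqxx.
have -> : (i == i.+1 :> nat) = false by rewrite eqn_leq ltnn andbF.
by rewrite mulr1n addr0 pnatr_eq0.
Qed.

Let beta (j : nat) : R[i] := a j - 1.
Let c : nat -> 'rV[R[i]]_4 := frob_seq beta B (const_mx 1).

Lemma zero_conv : frob_conv c.
Proof. by move=> j; apply: frob_psconv => i n; exact: nilp_unit. Qed.

Lemma zero_rec (n : nat) : c n.+1 *m (n.+1%:R%:M + J) ^+ 4 =
  c n *m \sum_(k < 5) ecoef N k *: (n%:R%:M + J) ^+ k.
Proof.
have BJ j : B j = J + 0%:M by rewrite raddf0 addr0.
have cS : c n.+1 = c n *m frob_step beta B n by [].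
have pow4 (M : 'M[R[i]]_4) : M ^+ 4 = M *m M *m M *m M.
  by rewrite !exprS expr0 mulr1 -!mulmxE !mulmxA.
have S j : n.+1%:R%:M + B j + (beta j)%:M = n%:R%:M + J + (a j)%:M.
  rewrite /B addrAC -raddfD /= [RHS]addrAC -raddfD /=; congr (_%:M + _).
  by rewrite /beta -addn1 natrD; ring.
have := frob_stepE beta nilp_unit n (C := J) BJ; rewrite /= !S => H.
by rewrite cS -(mulmxA (c n)) pow4 ecoef_prod_mx -H.
Qed.

Lemma zero_top (n : nat) : c n.+1 0 (inord 3) * n.+1%:R ^+ 4 =
  c n 0 (inord 3) * ((n%:R + a 0) * (n%:R + a 1) * (n%:R + a 2) * (n%:R + a 3)).
Proof.
have := congr1 (fun v : 'rV_4 => v 0 (inord 3)) (zero_rec n).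
rewrite ecoef_prod_mx !exprS expr0 mulr1 -!mulmxE !mulmxA.
have S t : n%:R%:M + J + t%:M = (n%:R + t)%:M + J by rewrite addrAC -raddfD.
by rewrite !S !top_coord !mulrA expr0 mulr1.
Qed.

Lemma zero_pos n : 0 <= c n 0 (inord 3).
Proof.
elim: n => [|n IH]; first by rewrite mxE ler01.
have P : 0 < n.+1%:R ^+ 4 :> R[i] by rewrite exprn_gt0// ltr0n.
have Q j : 0 <= n%:R + a j.
  by rewrite addr_ge0// expoE lecR; have /andP[/ltW] := @expoR_itv R N N4 j.
by rewrite -(pmulr_lge0 _ P) zero_top !mulr_ge0.
Qed.

Definition exp_term (k : nat) (l : R[i]) : R[i] :=
  match k with 0 => 1 | 1 => l | 2 => l ^+ 2 / 2 | _ => l ^+ 3 / 6 end.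

Definition nilp_exp (l : R[i]) : 'M[R[i]]_4 :=
  \matrix_(i, j) if (j <= i)%N then exp_term (i - j) l else 0.
Let E := nilp_exp.

Lemma exp_term_cderiv k l : (k < 4)%N ->
  cderiv (exp_term k) l (if k is k'.+1 then exp_term k' l else 0).
Proof.
have two : (2 : R[i]) != 0 by rewrite pnatr_eq0.
have three : (3 : R[i]) != 0 by rewrite pnatr_eq0.
have six : (6 : R[i]) != 0 by rewrite pnatr_eq0.
have D2 : cderiv (fun u : R[i] => u * u) l (1 * l + l * 1) by apply: cderivM; exact: cderiv_id.
case: k => [|[|[|[|k]]]] // _ /=; first exact: cderiv_cst; first exact: cderiv_id.
  have D : l = 2^-1 * (1 * l + l * 1) by field.
  rewrite [X in cderiv _ _ X]D.
  by apply: (cderiv_ext (f := fun u => 2^-1 * (u * u))); [move=> u; rewrite /= expr2 mulrC|exact: (cderivZ _ D2)].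
have -> : l ^+ 2 / 2 = 6^-1 * ((1 * l + l * 1) * l + l * l * 1) by field.
apply: (cderiv_ext (f := fun u => 6^-1 * (u * u * u))); first by move=> u; rewrite /= !exprS expr0 mulr1 mulrC mulrA.
by apply: cderivZ; apply: cderivM => //; exact: cderiv_id.
Qed.

Lemma zero_dE l i j : cderiv (fun u => E u i j) l ((J *m E l) i j).
Proof.
rewrite mxE; case: i => [[|i] hi].
  rewrite big1 => [|k _]; last by rewrite !mxE mul0r.
  case: j => [[|j] hj].
    by apply: (cderiv_ext (f := fun=> 1)); [move=> u; rewrite mxE|exact: cderiv_cst].
  by apply: (cderiv_ext (f := fun=> 0)); [move=> u; rewrite mxE|exact: cderiv_cst].
rewrite (bigD1 (Ordinal (ltnW hi)))//= big1 ?addr0; last first.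
  move=> k kn; rewrite !mxE /= eqSS; case: eqVneq => [e|]; last by rewrite mul0r.
  by case/eqP: kn; apply: val_inj => /=.
rewrite !mxE /= eqxx mul1r; have [ji|ij] := leqP j i.
  apply: (cderiv_ext (f := exp_term (i.+1 - j))).
    by move=> u; rewrite mxE /= (leqW ji).
  have := @exp_term_cderiv (i.+1 - j) l; rewrite subSn// => H; apply: H.
  by rewrite -subSn// (leq_ltn_trans (leq_subr _ _)).
have [e|ne] := eqVneq (j : nat) i.+1.
  apply: (cderiv_ext (f := fun=> 1)); last exact: cderiv_cst.
  by move=> u; rewrite mxE /= e leqnn subnn.
apply: (cderiv_ext (f := fun=> 0)); last exact: cderiv_cst.
by move=> u; rewrite mxE /= ifF//; apply/negbTE; rewrite -ltnNge ltn_neqAle eq_sym ne.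
Qed.

Lemma exp_term_add (F : fieldType) (l k : F) : (2 : F) != 0 -> (3 : F) != 0 -> (6 : F) != 0 ->
  (l + k) ^+ 2 / 2 = l ^+ 2 / 2 + l * k + k ^+ 2 / 2 /\
  (l + k) ^+ 3 / 6 = l ^+ 3 / 6 + l ^+ 2 / 2 * k + l * (k ^+ 2 / 2) + k ^+ 3 / 6.
Proof. by move=> h2 h3 h6; split; field; rewrite ?h2 ?h3 ?h6. Qed.

Lemma zero_EM l k : E (l + k) = E l *m E k.
Proof.
have [h2 h3] : (l + k) ^+ 2 / 2 = l ^+ 2 / 2 + l * k + k ^+ 2 / 2 /\
  (l + k) ^+ 3 / 6 = l ^+ 3 / 6 + l ^+ 2 / 2 * k + l * (k ^+ 2 / 2) + k ^+ 3 / 6.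
  by apply: exp_term_add; rewrite pnatr_eq0.
apply/matrixP => i j; rewrite [RHS]mxE.
under eq_bigr => x _ do rewrite !mxE.
pose g (x : nat) := (if (x <= i)%N then exp_term (i - x) l else 0) *
  (if (j <= x)%N then exp_term (x - j) k else 0).
rewrite -[RHS]/(\sum_(x < 4) g x) (sum4 g) /g {g} !mxE.
case: i => [[|[|[|[|i]]]] hi] //; case: j => [[|[|[|[|j]]]] hj] //=;
  rewrite ?(subnn, mul0r, mulr0, add0r, addr0, mul1r, mulr1) //= ?h2 ?h3 ?mul1r ?mulr1; try ring.
Qed.

Lemma zero_dx (w : R[i]) : w != 0 -> cderiv id w (1 * w / w).
Proof. by move=> w0; rewrite mul1r divff//; exact: cderiv_id. Qed.

Lemma J4 : J ^+ 4 = 0.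
Proof.
have M (k : nat) : J ^+ k = \matrix_(i, j) (i == (j + k)%N :> nat)%:R.
  elim: k => [|k IH]; first by apply/matrixP => i j; rewrite expr0 !mxE addn0.
  rewrite exprS IH; apply/matrixP => i j; rewrite !mxE.
  case: i => [[|i] hi].
    by rewrite addnS big1// => x _; rewrite !mxE mul0r.
  rewrite (bigD1 (Ordinal (ltnW hi)))//= big1 ?addr0; last first.
    move=> x xn; rewrite !mxE /= eqSS; case: eqVneq => [e|]; last by rewrite mul0r.
    by case/eqP: xn; apply: val_inj => /=.
  by rewrite !mxE /= eqxx mul1r addnS eqSS.
rewrite M; apply/matrixP => i j; rewrite !mxE.
by rewrite (ltn_eqF (leq_trans (ltn_ord i) (leq_addl _ _))).
Qed.

Lemma zero_solves : frob_solves N 1 J E id c.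
Proof.
move=> l w w0 xw.
pose d k := iter k (frob_euler 1 J) c.
have dc k : frob_conv (d k) by apply: iter_conv; exact: zero_conv.
rewrite -(frob_sum E (fun k => ecoef N k) 5 l dc xw).
rewrite -(frob_shift E l _ xw); last first.
  move=> j; apply: (psconv_ext (a := fun n => \sum_(k < 5) ecoef N k * d k n 0 j)).
    by move=> n; rewrite summxE; apply: eq_bigr => k _; rewrite mxE.
  by apply: psconv_sum => k; exact/psconvZ/dc.
apply: frob_ext => -[|n].
  rewrite -[shift_seq _ _]/(0 : 'rV[R[i]]_4) frob_euler_iter mulr0.
  by rewrite (raddf0 (@scalar_mx _ 4)) add0r J4 mulmx0.
rewrite -[shift_seq _ _]/(\sum_(k < 5) ecoef N k *: d k n) frob_euler_iter mul1r zero_rec.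
rewrite mulmx_sumr; apply: eq_bigr => k _.
by rewrite /d frob_euler_iter mul1r scalemxAr.
Qed.

Let l0 : R[i] := (ln (2^-1))%:C.
Let kappa : R[i] := (0 +i* (2 * pi)).
Definition zero_center : R[i] := (2^-1 : R)%:C.

Definition zero_circle (t : R) : R[i] :=
  (2^-1 * cos (2 * pi * t)) +i* (2^-1 * sin (2 * pi * t)).

Definition zero_sol (i : 'I_4) : R[i] -> R[i] := fun u => frob E c (logb zero_center l0 u) u 0 i.

Lemma zero_circleE t : zero_circle t = cexp (l0 + t%:C * kappa).
Proof.
rewrite (_ : l0 + _ = (ln (2^-1)) +i* (2 * pi * t)); last first.
  by apply/eqP; rewrite eq_complex /= !mul0r !mulr0 ?subr0 ?addr0 ?add0r eqxx /= mulrC.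
rewrite cexp_polar//.
by apply/eqP; rewrite eq_complex /= !mul0r subr0 addr0 !eqxx.
Qed.

Lemma zero_circle_bound t : m (id (zero_circle t)) < 1.
Proof.
rewrite zero_circleE modulus_cexp /= !mulr0 mul0r subrr addr0 lnK ?posrE ?invr_gt0//; lra.
Qed.

Lemma zero_circle0 : zero_circle 0 = zero_center.
Proof. by rewrite /zero_circle mulr0 cos0 sin0 mulr1 mulr0. Qed.

Lemma zero_circle1 : zero_circle 1 = zero_center.
Proof.
have e : 2 * pi = pi *+ 2 :> R by rewrite mulr_natl.
by rewrite /zero_circle mulr1 e cos2pi sin2pi mulr1 mulr0.
Qed.

Lemma zero_kappa1 : cexp kappa = 1.
Proof.
have e : 2 * pi = pi *+ 2 :> R by rewrite mulr_natl.
by rewrite /cexp /= expR0 !mul1r e cos2pi sin2pi.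
Qed.

Lemma zero_local i : local_solution N zero_center (zero_sol i).
Proof.
have := frob_local zero_dE zero_dx zero_circleE zero_circle_bound zero_conv zero_solves i 0.
rewrite rmorph0 mul0r addr0 zero_circle0; exact.
Qed.

Lemma zero_continues i : continues N zero_circle (zero_sol i)
  (fun u => \sum_j nilp_exp (0 +i* (2 * pi)) j i * zero_sol j u).
Proof.
have := frob_continues zero_dE zero_dx zero_EM zero_circleE zero_kappa1 zero_circle_bound
  zero_conv zero_solves i.
by rewrite zero_circle0 -/l0.
Qed.

Lemma zero_neq0 : zero_sol (inord 3) zero_center != 0.
Proof.
rewrite /zero_sol /frob mxE (bigD1 (inord 3))//= big1 ?addr0; last first.
  move=> j jn; rewrite [E _ _ _]mxE inordK// ifF ?mulr0//; apply/negbTE; rewrite -ltnNge.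
  have := ltn_ord j; rewrite ltnS leq_eqVlt => /orP[/eqP e|//].
  by case/eqP: jn; apply: val_inj; rewrite /= inordK.
rewrite [E _ _ _]mxE leqnn subnn mulr1 mxE; apply: ps_pos_neq0.
- exact: zero_conv.
- rewrite modulus_real ger0_norm ?invr_ge0//; lra.
- by rewrite lecR invr_ge0.
- by rewrite mxE.
- by move=> n; exact: zero_pos.
Qed.

End zero.

Local Opaque local_solution germ_eq.

Section one.
Context {R : realType}.
Variable N : nat.
Hypothesis N4 : (4 <= N)%N.
Local Notation m := modulus.
Local Notation e := (@ecoef R N).
Local Notation b := (@base_point R).
Local Notation I := (`[0%R, 1%R]%classic : set R).

Lemma expo_sum : e 3 = 2.
Proof.
have n0 : (N%:R : R[i]) != 0 by rewrite pnatr_eq0 -lt0n (leq_trans _ N4).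
have two : (2 : R[i]) != 0 by rewrite pnatr_eq0.
by rewrite /ecoef /expo; field; rewrite ?n0 ?two.
Qed.

Definition one_row (n : nat) (u : nat -> R[i]) (k : nat) : R[i] :=
  if (k < 3)%N then u k else - (e 0 * u 0%N + e 1 * u 1%N + e 2 * u 2%N) / (n%:R + 2).

Fixpoint one_seq (v : nat -> R[i]) (n : nat) : nat -> R[i] :=
  if n is n'.+1 then
    one_row n (fun k => (one_seq v n' k.+1 - n'%:R * one_seq v n' k) / n%:R)
  else one_row 0 v.

Variable v : nat -> R[i].
Local Notation x := (one_seq v).

Lemma one_rec n k : (k < 3)%N -> n.+1%:R * x n.+1 k = x n k.+1 - n%:R * x n k.
Proof.
move=> k3; by rewrite [x n.+1]/= /one_row k3 mulrC divfK// pnatr_eq0.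
Qed.

Lemma one_last n : (n%:R + 2) * x n 3 = - (e 0 * x n 0 + e 1 * x n 1 + e 2 * x n 2).
Proof.
have n2 : (n%:R + 2 : R[i]) != 0 by rewrite -natrD addn2 pnatr_eq0.
by case: n n2 => [|n] n2; rewrite /= {1}/one_row /= mulrC divfK.
Qed.

Let C : R := m (e 0) + m (e 1) + m (e 2).
Let T n : R := m (x n 0) + m (x n 1) + m (x n 2).

Lemma T_ge0 n : 0 <= T n. Proof. by rewrite !addr_ge0 ?modulus_ge0. Qed.
Lemma C_ge0 : 0 <= C. Proof. by rewrite !addr_ge0 ?modulus_ge0. Qed.

Lemma one_last_le n : m (x n 3) <= C * T n.
Proof.
have := congr1 m (one_last n); rewrite modulusM modulusN -natrD modulus_nat => H.
have h1 := modulusD (e 0 * x n 0 + e 1 * x n 1) (e 2 * x n 2).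
have h2 := modulusD (e 0 * x n 0) (e 1 * x n 1).
rewrite (modulusM (e 2)) in h1; rewrite (modulusM (e 0)) (modulusM (e 1)) in h2.
have k1 : 1 <= (n + 2)%:R :> R by rewrite ler1n addn2.
have x3 := modulus_ge0 (x n 3); rewrite /C /T.
have h0 : m (x n 3) <= (n + 2)%:R * m (x n 3) by rewrite ler_peMl.
apply: (le_trans h0); rewrite H; apply: (le_trans h1).
have P i k : 0 <= m (e i) * m (x n k) by rewrite mulr_ge0 ?modulus_ge0.
have p01 := P 0%N 1%N; have p02 := P 0%N 2%N; have p10 := P 1%N 0%N; have p12 := P 1%N 2%N.
have p20 := P 2%N 0%N; have p21 := P 2%N 1%N.
move: p01 p02 p10 p12 p20 p21 h1 h2; clear; move: (m (_ + _)) (m (e 0)) (m (e 1)) (m (e 2)) (m (x n 0%N)) (m (x n 1%N)) (m (x n 2%N)) => s a1 a2 a3 b1 b2 b3. nra.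
Qed.

Lemma one_growth n : T n.+1 <= (1 + (1 + C) / n.+1%:R) * T n.
Proof.
have n1 : 0 < n.+1%:R :> R by [].
have A k : (k < 3)%N -> n.+1%:R * m (x n.+1 k) <= m (x n k.+1) + n%:R * m (x n k).
  move=> k3; rewrite -(modulus_nat n.+1) -modulusM one_rec//.
  by apply: le_trans (modulusD _ _) _; rewrite modulusN modulusM modulus_nat.
have a0 := A 0%N isT; have a1 := A 1%N isT; have a2 := A 2%N isT; have a3 := one_last_le n.
have E t : n.+1%:R * ((1 + (1 + C) / n.+1%:R) * t) = (n.+1%:R + 1 + C) * t.
  by rewrite mulrA mulrDr mulr1 [n.+1%:R * _]mulrC divfK ?gt_eqF// addrA.
rewrite -(ler_pM2l n1) E.
have nE : n.+1%:R = n%:R + 1 :> R by rewrite -addn1 natrD.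
rewrite nE in a0 a1 a2 *; have x0 := modulus_ge0 (x n 0%N).
have x1 := modulus_ge0 (x n 1%N); have x2 := modulus_ge0 (x n 2%N).
have : 0 <= C * T n by rewrite mulr_ge0 ?C_ge0 ?T_ge0.
move: a0 a1 a2 a3 x0 x1 x2; rewrite /T; move: C (m (x n.+1 _)) (m (x n.+1 _)) (m (x n.+1 _)) => c z0 z1 z2.
clear; move: (m (x n 0%N)) (m (x n 1%N)) (m (x n 2%N)) (m (x n 3%N)) (n%:R : R) => x0 x1 x2 x3 q.
nra.
Qed.

Lemma one_conv k : (k < 4)%N -> psconv (1 : R) (fun n => x n k).
Proof.
move=> k4 r /andP[r0 r1].
have [||M HM] := growth_bounded (K := 1 + C) (r := r) _ _ T_ge0 one_growth.
- by rewrite addr_ge0// C_ge0.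
- by rewrite r0.
have M' n : T n * r ^+ n <= M by exact: HM.
have B n : m (x n k) <= (1 + C) * T n.
  have CT : 0 <= C * T n by rewrite mulr_ge0 ?C_ge0 ?T_ge0.
  have x3 := one_last_le n.
  have := modulus_ge0 (x n 0%N); have := modulus_ge0 (x n 1%N); have := modulus_ge0 (x n 2%N).
  have E : (1 + C) * T n = m (x n 0%N) + m (x n 1%N) + m (x n 2%N) + C * T n.
    by rewrite mulrDl mul1r.
  rewrite {}E; move: (C * T n) CT x3 => ct.
  by case: k k4 => [|[|[|[|k]]]] //= _; lra.
exists ((1 + C) * M) => n; apply: (@le_trans _ _ ((1 + C) * T n * r ^+ n)).
  by rewrite ler_wpM2r ?exprn_ge0.
by rewrite -mulrA ler_wpM2l// addr_ge0// C_ge0.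
Qed.

Definition one_jet (k : nat) (w : R[i]) : R[i] :=
  if (k < 4)%N then ps (fun n => x n k) (w - 1)
  else w * ps (fun n => n.+1%:R * x n.+1 3) (w - 1).

Lemma one_jet_cderiv k w : (k < 4)%N -> m (w - 1) < 1 ->
  cderiv (one_jet k) w (ps (fun n => n.+1%:R * x n.+1 k) (w - 1)).
Proof.
move=> k4 w1.
apply: (cderiv_ext (f := ps (fun n => x n k) \o (fun u => u - 1))).
  by move=> u; rewrite /one_jet k4.
rewrite -[X in cderiv _ _ X]mulr1; apply: cderiv_comp; last exact: ps_cderiv (one_conv k4) w1.
by rewrite -[X in cderiv _ _ X]subr0; apply: cderivB; [exact: cderiv_id|exact: cderiv_cst].
Qed.

Lemma one_jet_eq w : w != 0 -> m (w - 1) < 1 -> jet_eq N one_jet w.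
Proof.
move=> w0 w1.
have S k : (k < 4)%N -> ps (fun n => n%:R * x n k) (w - 1) =
    (w - 1) * ps (fun n => n.+1%:R * x n.+1 k) (w - 1).
  by move=> k4; exact: (ps_euler (one_conv k4) w1).
split=> [k k4|].
  rewrite (_ : _ / w = ps (fun n => n.+1%:R * x n.+1 k) (w - 1)); first exact: one_jet_cderiv.
  apply: (mulIf w0); rewrite divfK//; move: k4; rewrite leq_eqVlt eqSS => /orP[/eqP->|k3].
    by rewrite /one_jet /= mulrC.
  have k4 := ltnW k3; rewrite /one_jet k3.
  rewrite (ps_ext (b := fun n => n.+1%:R * x n.+1 k + n%:R * x n k)); last first.
    by move=> n; rewrite one_rec// subrK.
  rewrite (psD (rho := 1))//; last 2 first.
  - exact: psconv_deriv (one_conv k4).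
  - exact: psconv_euler (one_conv k4).
  rewrite S// mulrBl mul1r [X in _ + X]addrC addrA subrr.
  by rewrite ?add0r mulrC.
have S3 := S 3%N isT.
have E : ps (fun n => n%:R * x n 3) (w - 1) = - (\sum_(k < 4) e k * one_jet k w).
  have Jk (k : nat) : (k < 4)%N -> one_jet k w = ps (fun n => x n k) (w - 1) by rewrite /one_jet => ->.
  have cZ (k : 'I_4) : psconv (1 : R) (fun n => e k * x n k) by exact/psconvZ/one_conv/ltn_ord.
  have -> : \sum_(k < 4) e k * one_jet k w = ps (fun n => \sum_(k < 4) e k * x n k) (w - 1).
    rewrite (ps_sum _ cZ w1); apply: eq_bigr => k _.
    by rewrite (Jk k (ltn_ord k)) (psZ _ (one_conv (ltn_ord k)) w1).
  have cS : psconv (1 : R) (fun n => \sum_(k < 4) e k * x n k) by exact: psconv_sum.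
  rewrite -[RHS]mulN1r -(psZ (-1) cS w1).
  apply: ps_ext => n; rewrite mulN1r (sum4 (fun k => e k * x n k)) expo_sum; have := one_last n.
  move: (x n 3) (e 0 * _ + _ + _) => z s; rewrite mulrDl => H.
  by rewrite opprD -H; ring.
rewrite (sum5 (fun k => e k * one_jet k w)) -(sum4 (fun k => e k * one_jet k w)).
rewrite S3 in E; rewrite /one_jet ltnn [e 4]/= mul1r; congr (w * _).
have -> : \sum_(k < 4) e k * one_jet k w = (1 - w) * ps (fun n => n.+1%:R * x n.+1 3) (w - 1).
  by rewrite -[LHS]opprK -E -mulNr opprB.
by move: (ps _ _) => z; ring.
Qed.

Definition one_sol : R[i] -> R[i] := one_jet 0.

Lemma one_jet_at w : w != 0 -> m (w - 1) < 1 -> jet_at N w one_jet.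
Proof.
move=> w0 w1; apply: filterS2 (near_neq w0) (disc_open w1) => u u0 u1.
exact: one_jet_eq.
Qed.

Lemma one_local w : w != 0 -> m (w - 1) < 1 -> local_solution N w one_sol.
Proof. by move=> w0 w1; exact: jet_sol w0 (one_jet_at w0 w1). Qed.

Lemma around1_disc t : m (@around1_fun R t - 1) < 1.
Proof.
rewrite modulusE /around1_fun /= oppr0 addr0 (_ : 1 + _ - 1 = 2^-1 * cos (2 * pi * t)); last by ring.
rewrite !exprMn -mulrDr cos2Dsin2 mulr1 sqrtr_sqr ger0_norm ?invr_ge0//; lra.
Qed.

Lemma one_continues : continues N (@loop_around1 R) one_sol one_sol.
Proof.
apply: continues_single => t It; apply: one_local; last exact: around1_disc.
by have [] := @around1_in R t.
Qed.

End one.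

Section vanishing.
Context {R : realType}.
Variable N : nat.
Local Notation m := modulus.
Local Notation X := (@punctured_plane R).
Local Notation I := (`[0%R, 1%R]%classic : set R).

Lemma jet_zero (w : R[i]) (y : nat -> R[i] -> R[i]) : jet_at N w y -> w != 0 ->
  (\forall u \near w, y 0%N u = 0) -> forall k, (k < 4)%N -> \forall u \near w, y k u = 0.
Proof.
move=> js w0 y0; elim=> [//|k IH] k4; have k4' := ltnW k4.
apply: filterS3 (near_join (IH k4')) js (near_neq w0) => u yu [j _] u0.
have E : \forall v \near u, 0 = y k v by apply: filterS yu => v ->.
have := cderiv_unique (j k k4') (cderiv_near E (cderiv_cst 0 u)).
by move=> /eqP; rewrite mulf_eq0 invr_eq0 (negbTE u0) orbF => /eqP.
Qed.

Lemma zero_lsol (w : R[i]) : w != 0 -> local_solution N w (fun=> 0).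
Proof.
move=> w0; apply: (jet_sol (y := fun _ _ => 0) w0); apply: (@filterE _ (nbhs w)) => u.
split=> [k _|]; first by rewrite mul0r; exact: cderiv_cst.
by rewrite big1 ?mulr0// => k _; rewrite mulr0.
Qed.

Lemma continues0 (p : R -> R[i]) : (forall t, I t -> X (p t)) -> continues N p (fun=> 0) (fun=> 0).
Proof. by move=> Xp; apply: continues_single => t /Xp[p0 _]; exact: zero_lsol. Qed.

Lemma continues_zero (p : R -> R[i]) (g h : R[i] -> R[i]) : {within I, continuous p} -> (forall t, I t -> X (p t)) ->
  continues N p g h -> germ_eq (p 0) g (fun=> 0) -> germ_eq (p 1) h (fun=> 0).
Proof.
move=> cp Xp gh g0; have z := continues0 Xp.
have H := continues_unique cp Xp gh z. exact: H g0. Qed.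

End vanishing.

(** * Monodromy matrices *)

Section monodromy_matrices.
Context {R : realType}.
Variable N : nat.
Local Notation m := modulus.
Local Notation X := (@punctured_plane R).
Local Notation I := (`[0%R, 1%R]%classic : set R).
Local Notation b := (@base_point R).
Implicit Types (p q : @C01_loop R) (M : 'M[R[i]]_4) (c d : 'rV[R[i]]_4).

Lemma base_neq0 : b != 0. Proof. by have [] := @base_point_in R. Qed.

Definition lin (f : 'I_4 -> R[i] -> R[i]) c : R[i] -> R[i] := fun u => \sum_i c 0 i * f i u.

Lemma lin_lin (f : 'I_4 -> R[i] -> R[i]) M c u : lin (fun i => lin f (row i M)) c u = lin f (c *m M) u.
Proof.
rewrite /lin; under eq_bigr => i _ do rewrite mulr_sumr.
rewrite exchange_big; apply: eq_bigr => j _; rewrite mxE mulr_suml.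
by apply: eq_bigr => i _; rewrite mxE mulrA.
Qed.

Lemma solution_basis_exists : exists f : 'I_4 -> R[i] -> R[i], solution_basis N f.
Proof.
have [D [F [Db oD fF]]] := local_system N (@base_point_in R).
have E c u : fsol F c u = lin (fun i => fsol F (delta_mx 0 i)) c u.
  by rewrite {1}(row_sum_delta c) fsol_sum.
exists (fun i => fsol F (delta_mx 0 i)); split=> [i|g gs]; first exact: (fsol_local fF oD _ Db).
have [c Hc] := local_fsol fF oD Db gs; exists c; split.
  apply: germ_trans Hc _; apply: (@filterE _ (nbhs b)) => u; exact: E.
move=> c' Hc'; apply: (fsol_inj fF oD Db); apply: germ_trans (germ_sym Hc) _.
apply: germ_trans Hc' _; apply: (@filterE _ (nbhs b)) => u; exact: esym (E _ _).
Qed.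

Variable f : 'I_4 -> R[i] -> R[i].
Hypothesis fb : solution_basis N f.

Lemma lin_local c : local_solution N b (lin f c).
Proof. by apply: lsol_sum => [|i]; [exact: base_point_in|exact: fb.1]. Qed.

Lemma lin_inj c d : germ_eq b (lin f c) (lin f d) -> c = d.
Proof.
move=> H; have [e [_ He]] := fb.2 _ (lin_local c).
by rewrite -(He c (germ_refl _ _)) (He d H).
Qed.

Lemma lin_coord g : local_solution N b g -> exists c, germ_eq b g (lin f c).
Proof. by move=> /fb.2 [c [Hc _]]; exists c. Qed.

Lemma mono_exists p : exists M, monodromy_mx N f p M.
Proof.
have ex i : exists c, continues N p (f i) (lin f c).
  have fs : local_solution N (p 0) (f i) by rewrite loop0; exact: fb.1.
  have [h Hh] := continues_exists (@loop_continuous _ _ _ _ p) (@loop_in _ _ _ _ p) fs.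
  have hs : local_solution N b h.
    by have := continues_end (@loop_in _ _ _ _ p) Hh; rewrite loop1; exact.
  have [c Hc] := lin_coord hs; exists c.
  by apply: continues_germ Hh; [exact: germ_refl|rewrite loop1].
have [c Hc] := choice ex; exists (\matrix_(i, j) c i 0 j) => i.
rewrite (_ : (fun z => _) = lin f (c i)); first exact: Hc.
by apply/funext => u; apply: eq_bigr => j _; rewrite mxE.
Qed.

Lemma mono_lin p M c : monodromy_mx N f p M -> continues N p (lin f c) (lin f (c *m M)).
Proof.
move=> HM; have := continues_sum (@loop_in _ _ _ _ p) (fun i => c 0 i) HM.
rewrite (_ : (fun u => \sum_i c 0 i * (\sum_j M i j * f j u)) = lin f (c *m M))//.
apply/funext => u; rewrite -lin_lin; apply: eq_bigr => i _; congr (_ * _).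
by apply: eq_bigr => j _; rewrite mxE.
Qed.

Lemma mono_apply p M c d g h : monodromy_mx N f p M -> continues N p g h ->
  germ_eq b g (lin f c) -> germ_eq b h (lin f d) -> d = c *m M.
Proof.
move=> HM gh gc hd; apply: lin_inj; apply: germ_trans (germ_sym hd) _.
have := continues_unique (@loop_continuous _ _ _ _ p) (@loop_in _ _ _ _ p) gh (mono_lin c HM).
by rewrite loop0 loop1; exact.
Qed.

Lemma mono_homotopic p q M M' : homotopic p q -> monodromy_mx N f p M ->
  monodromy_mx N f q M' -> M = M'.
Proof.
move=> pq HM HM'; apply/row_matrixP => i; rewrite !rowE.
apply: lin_inj; exact: (continues_homotopic pq (mono_lin _ HM) (mono_lin _ HM')).
Qed.

Lemma mono_cat p q M M' : monodromy_mx N f p M -> monodromy_mx N f q M' ->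
  monodromy_mx N f (loop_cat p q) (M *m M').
Proof.
move=> HM HM' i.
have pq : p 1 = q 0 by rewrite loop0 loop1.
have L (K : 'M[R[i]]_4) : (fun z => \sum_j K i j * f j z) = lin f (delta_mx 0 i *m K).
  by apply/funext => u; apply: eq_bigr => j _; rewrite -rowE mxE.
have H := HM i; rewrite L in H; rewrite L mulmxA.
exact: continues_cat (@loop_continuous _ _ _ _ q) pq H (mono_lin _ HM').
Qed.

Lemma mono_const p : (forall t, p t = b) -> monodromy_mx N f p 1%:M.
Proof.
move=> pb i; rewrite (_ : (fun z => _) = f i).
  by apply: continues_single => t _; rewrite pb; exact: fb.1.
apply/funext => u; rewrite (bigD1 i)//= mxE eqxx mul1r big1 ?addr0// => j ji.
by rewrite mxE eq_sym (negbTE ji) mul0r.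
Qed.

Lemma eigen_row p M g (w : R[i]) : monodromy_mx N f p M -> local_solution N b g -> g b != 0 ->
  continues N p g (fun u => w * g u) -> eigenvalue M w.
Proof.
move=> HM gs g0 gw; have [c Hc] := lin_coord gs.
apply/eigenvalueP; exists c.
  rewrite -(mono_apply (d := w *: c) HM gw Hc)//.
  apply: filterS Hc => u ->; rewrite mulr_sumr; apply: eq_bigr => j _.
  by rewrite mxE mulrA.
apply/eqP => c0; move/eqP: g0; apply; have := nbhs_singleton Hc => ->.
by rewrite c0 /lin big1// => i _; rewrite mxE mul0r.
Qed.

End monodromy_matrices.

Section spectrum.
Context {R : realType}.
Variable N : nat.
Hypothesis N4 : (4 <= N)%N.
Local Notation m := modulus.
Local Notation X := (@punctured_plane R).
Local Notation I := (`[0%R, 1%R]%classic : set R).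
Local Notation b := (@base_point R).
Implicit Types (M : 'M[R[i]]_4).

Lemma oneC : (1 : R[i]) = 1%:C. Proof. by []. Qed.

Definition omega (j : nat) : R[i] := cexp ('i * (2 * pi)%:C * expo N j).

Lemma omegaE j : omega j = cexp ('i * (2 * pi * expoR N j)%:C).
Proof. by rewrite /omega expoE -mulrA -rmorphM. Qed.

Lemma cexp_i_inj (s t : R) : 0 < s < 2 * pi -> 0 < t < 2 * pi ->
  cexp ('i * s%:C) = cexp ('i * t%:C) -> s = t.
Proof.
move=> /andP[s0 s1] /andP[t0 t1]; rewrite !cexp_i => -[] cc ss.
wlog st : s t s0 s1 t0 t1 cc ss / s <= t.
  move=> H; have [st|/ltW ts] := leP s t; first exact: H.
  by apply/esym/H.
apply/eqP; rewrite eq_le st /= leNgt; apply/negP => lt.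
have c1 : cos (t - s) = 1 by rewrite cosB cc ss -!expr2 cos2Dsin2.
have [x xE] : exists x, t - s = x *+ 2 by exists ((t - s) / 2); rewrite mulr2n -splitr.
have x2 : t - s = x + x by rewrite xE mulr2n.
have s2 : 0 < sin x by apply: sin_gt0_pi; apply/andP; split; lra.
have cs := cos2Dsin2 x; move: c1; rewrite xE cos_mulr2n => c1.
have : 0 < sin x ^+ 2 by exact: exprn_gt0.
by move: c1 cs; rewrite -mulr_natr; nra.
Qed.

Lemma omega_uniq : uniq [seq omega j | j <- iota 0 4].
Proof.
have B j : 0 < 2 * pi * (expoR N j : R) < 2 * pi.
  have /andP[h1 h2] := @expoR_itv R N N4 j; have p := pi_gt0 R.
  have q0 : 0 < 2 * pi :> R by lra.
  apply/andP; split; first exact: (mulr_gt0 q0 h1).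
  by rewrite -[X in _ < X]mulr1 ltr_pM2l.
have st (j : nat) : (j < 3)%N -> expoR N j < expoR N j.+1 :> R.
  move=> j3; rewrite (expoR_step N4 j3) ltrDl invr_gt0 ltr0n.
  exact: leq_trans _ N4.
have h0 := st 0%N isT; have h1 := st 1%N isT; have h2 := st 2%N isT.
have D (i j : nat) : expoR N i < expoR N j :> R -> omega i != omega j.
  move=> ij; apply/eqP; rewrite !omegaE => /(cexp_i_inj (B i) (B j)) e.
  have q0 : 2 * pi != 0 :> R by apply: lt0r_neq0; rewrite mulr_gt0// pi_gt0.
  by move: ij; rewrite (mulfI q0 e) ltxx.
by rewrite /= !inE !negb_or !D//; lra.
Qed.

Variable f : 'I_4 -> R[i] -> R[i].
Hypothesis fb : solution_basis N f.

(** Each exponent at infinity carries a Frobenius series, which is an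
    eigenvector; the four eigenvalues are distinct. *)
Lemma char_poly_infinity M : monodromy_mx N f (@loop_around_infty R) M ->
  char_poly M = \prod_(j < 4) ('X - (omega j)%:P).
Proof.
move=> HM.
have ev (j : 'I_4) : eigenvalue M (omega j).
  by apply: (eigen_row fb HM (infinity_local N4 j) (infinity_neq0 N4 j)); exact: infinity_continues.
have := @all_roots_prod_XsubC _ (char_poly M) [seq omega j | j <- iota 0 4].
rewrite size_char_poly => /(_ erefl) ->.
- rewrite (monicP (char_poly_monic M)) scale1r big_map -{1}[4%N]subn0.
  by rewrite -/(index_iota 0 4) big_mkord.
- apply/allP => z /mapP[j]; rewrite mem_iota => /andP[_ j4] ->.
  by rewrite -eigenvalue_root_char; exact: (ev (Ordinal j4)).
- by rewrite uniq_rootsE; exact: omega_uniq.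
Qed.

Lemma jet_eq_sum w (I0 : Type) (s : seq I0) (c : I0 -> R[i]) (y : I0 -> nat -> R[i] -> R[i]) :
  (forall i, jet_eq N (y i) w) -> jet_eq N (fun k u => \sum_(i <- s) c i * y i k u) w.
Proof.
move=> H; split=> [k k4|].
  rewrite mulr_suml; apply: cderiv_sum => i; rewrite -mulrA.
  by apply: cderivZ; exact: (H i).1 k k4.
under [in RHS]eq_bigr => k _ do rewrite mulr_sumr.
rewrite exchange_big mulr_sumr; apply: eq_bigr => i _ /=.
have [_ ->] := H i; rewrite mulrCA mulr_sumr; congr (_ * _).
by apply: eq_bigr => k _; rewrite mulrCA.
Qed.

Definition unit_seq (i k : nat) : R[i] := (k == i)%:R.

(** Near 1 there is a three-dimensional space of holomorphic solutions, whose
    values at 1 are arbitrary. *)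
Lemma one_sol_free (c : 'I_3 -> R[i]) :
  germ_eq b (fun u => \sum_i c i * one_sol N (unit_seq i) u) (fun=> 0) -> forall i, c i = 0.
Proof.
move=> H0 k0; pose y (k : nat) (u : R[i]) := \sum_i c i * one_jet N (unit_seq i) k u.
have js w : w != 0 -> m (w - 1) < 1 -> jet_at N w y.
  move=> wn w1; apply: filterS2 (near_neq wn) (disc_open w1) => u u0 u1.
  by apply: jet_eq_sum => i; exact: one_jet_eq.
have ls w : w != 0 -> m (w - 1) < 1 -> local_solution N w (y 0%N).
  by move=> wn w1; exact: jet_sol wn (js w wn w1).
have van (e : R) : 0 < e -> e <= 2^-1 -> y k0 (1 + e%:C) = 0.
  move=> e0 e1; pose p (t : R) : R[i] := (3 / 2 - t * (2^-1 - e))%:C.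
  have cp : {within I, continuous p}.
    apply: continuous_subspaceT => t; apply: continuous_comp; last exact: real_complex_continuous.
    apply: continuous_sub; first exact: continuous_const.
    under eq_fun => s do rewrite mulrC.
    by apply: continuous_scale; exact: continuous_identity.
  have pt t : I t -> 1 < 3 / 2 - t * (2^-1 - e) <= 3 / 2.
    by rewrite /= in_itv /= => /andP[t0 t1]; apply/andP; split; nra.
  have P1 t : I t -> p t != 0 /\ m (p t - 1) < 1.
    move=> It; have /andP[h1 h2] := pt t It; rewrite /p; split.
      by rewrite fmorph_eq0; apply: lt0r_neq0; lra.
    by rewrite oneC -rmorphB modulus_real ger0_norm; lra.
  have Xp t : I t -> X (p t).
    move=> It; have [h0 _] := P1 t It; split; first exact: h0.
    have /andP[h1 h2] := pt t It; rewrite oneC (inj_eq (@complexI R)).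
    by apply/eqP => h; rewrite h ltxx in h1.
  have p0 : p 0 = b by rewrite /p mul0r subr0.
  have p1 : p 1 = 1 + e%:C by rewrite /p oneC -rmorphD; congr (_%:C); lra.
  have cont : continues N p (y 0%N) (y 0%N).
    by apply: continues_single => t /P1[h0 h1]; exact: ls.
  have := continues_zero cp Xp cont; rewrite p0 p1 => /(_ H0) G.
  have [n0 n1] := P1 1 (@unit_itv1 R); rewrite p1 in n0 n1.
  have k4 : (k0 < 4)%N by exact: leq_trans (ltn_ord k0) _.
  exact: nbhs_singleton (jet_zero (js _ n0 n1) n0 G k4).
have yk : y k0 1 = c k0.
  rewrite /y (bigD1 k0)//= big1 ?addr0.
    rewrite /one_jet (ltn_trans (ltn_ord k0))// subrr ps0 /= /one_row ltn_ord.
    by rewrite /unit_seq eqxx mulr1.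
  move=> i ik; rewrite /one_jet (ltn_trans (ltn_ord k0))// subrr ps0 /= /one_row ltn_ord.
  have ki : (k0 == i :> nat) = false by apply/negbTE; rewrite eq_sym; exact: ik.
  by rewrite /unit_seq ki mulr0.
have m1 : m (1 - 1 : R[i]) < 1 by rewrite subrr modulus0.
have k4 : (k0 < 4)%N by exact: leq_trans (ltn_ord k0) _.
have [J _] : jet_eq N y 1 by apply: jet_eq_sum => i; apply: one_jet_eq => //; exact: oner_neq0.
have cy := cderiv_continuous (J k0 k4).
apply/eqP; rewrite -modulus_eq0; apply/negPn/negP => ck.
have ck0 : 0 < m (c k0) by rewrite lt_neqAle eq_sym ck modulus_ge0.
have : \forall v \near y k0 1, m (v - y k0 1) < m (c k0).
  by apply/nbhs_modulusP; exists (m (c k0)).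
move=> /cy /nbhs_modulusP[r r0 Hr].
pose e := Num.min (r / 2) 2^-1.
have e0 : 0 < e by rewrite lt_min divr_gt0//= invr_gt0.
have e1 : e <= 2^-1 by rewrite ge_min lexx orbT.
have er : e < r by apply: (@le_lt_trans _ _ (r / 2)); [rewrite ge_min lexx|lra].
have := Hr (1 + e%:C); rewrite /= van// yk sub0r modulusN ltxx.
by rewrite addrAC subrr add0r modulus_real ger0_norm ?ltW// => /(_ er).
Qed.

(** The holomorphic solutions at 1 do not change along a circle about 1. *)
Lemma fixed_around1 M : monodromy_mx N f (@loop_around1 R) M ->
  exists2 P : 'M[R[i]]_(3, 4), row_free P & P *m M = P.
Proof.
move=> HM.
have b0 : b != 0 by exact: base_neq0.
have b1 : m (b - 1) < 1.
  by rewrite /base_point oneC -rmorphB modulus_real ger0_norm; lra.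
have ls (i : 'I_3) := one_local N4 (unit_seq i) b0 b1.
have [c Hc] := choice (fun i : 'I_3 => lin_coord fb (ls i)).
exists (\matrix_(i, j) c i 0 j); last first.
  apply/row_matrixP => i; rewrite row_mul.
  have -> : row i (\matrix_(i, j) c i 0 j) = c i by apply/rowP => j; rewrite !mxE.
  by rewrite -(mono_apply fb HM (one_continues N4 (unit_seq i)) (Hc i) (Hc i)).
rewrite -kermx_eq0; apply/eqP/row_matrixP => j; rewrite row0.
set d := row j _; have : d *m (\matrix_(i, j) c i 0 j) = 0 by apply/sub_kermxP; exact: row_sub.
move=> dP; apply/rowP => k; rewrite [RHS]mxE.
apply: (one_sol_free (c := fun i => d 0 i)).
have G : \forall u \near b, forall i : 'I_3, one_sol N (unit_seq i) u = lin f (c i) u.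
  apply: filterS3 (Hc 0) (Hc 1) (Hc (inord 2)) => u h0 h1 h2 i.
  have H3 : [\/ i = 0, i = 1 | i = inord 2].
    case: i => [[|[|[|k']]] hi] //; [apply: Or31|apply: Or32|apply: Or33]; apply: val_inj => //=.
    by rewrite inordK.
  by case: H3 => ->.
apply: filterS G => u Hu; under eq_bigr => i _ do rewrite Hu.
transitivity (lin f (d *m (\matrix_(i, j) c i 0 j)) u); last first.
  by rewrite dP /lin big1// => i _; rewrite mxE mul0r.
rewrite /lin; under eq_bigr => i _ do rewrite mulr_sumr.
rewrite exchange_big; apply: eq_bigr => i _ /=; rewrite [in RHS]mxE mulr_suml.
by apply: eq_bigr => l _; rewrite !mxE mulrA.
Qed.

End spectrum.

Lemma char_poly_intertwine (F : fieldType) n (A B P : 'M[F]_n) :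
  P \in unitmx -> A *m P = P *m B -> char_poly A = char_poly B.
Proof.
move=> PU AP; rewrite /char_poly.
have E : char_poly_mx A *m map_mx polyC P = map_mx polyC P *m char_poly_mx B.
  rewrite /char_poly_mx mulmxBl mulmxBr -!map_mxM AP; congr (_ - _).
  by apply/esym; exact: comm_mx_scalar.
have := congr1 determinant E; rewrite !det_mulmx [RHS]mulrC; apply: mulIf.
by rewrite det_map_mx polyC_eq0 -unitfE -unitmxE.
Qed.

Section zero_spectrum.
Context {R : realType}.
Variable N : nat.
Hypothesis N4 : (4 <= N)%N.
Local Notation m := modulus.
Local Notation X := (@punctured_plane R).
Local Notation I := (`[0%R, 1%R]%classic : set R).
Local Notation b := (@base_point R).
Local Notation kappa := (0 +i* (2 * pi) : R[i]).

Variable f : 'I_4 -> R[i] -> R[i].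
Hypothesis fb : solution_basis N f.
Variables (sigma : R -> R[i]) (p : @C01_loop R) (M : 'M[R[i]]_4).
Hypotheses (cs : {within I, continuous sigma}) (Xs : forall t, I t -> X (sigma t)).
Hypotheses (s0 : sigma 0 = b) (s1 : sigma 1 = zero_center).
Hypothesis pE : loop_fun p = path_cat (path_cat sigma (@zero_circle R)) (fun t => sigma (1 - t)).
Hypothesis HM : monodromy_mx N f p M.

Lemma zero_circle_continuous : {within I, continuous (@zero_circle R)}.
Proof.
apply: continuous_subspaceT.
have c2 (g : R -> R) : continuous g -> continuous (fun t : R => g (2 * pi * t)).
  move=> cg x; apply: continuous_comp; last exact: cg.
  by apply: continuous_scale; exact: continuous_identity.
by apply: Complex_continuous; apply: continuous_scale; apply: c2;
  [exact: continuous_cos|exact: continuous_sin].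
Qed.

Lemma rev_continuous : {within I, continuous (fun t => sigma (1 - t))}.
Proof.
apply: (Defs.within_continuous_comp _ cs (@unit_itv_rev R)).
apply: continuous_subspaceT.
by apply: continuous_sub; [exact: continuous_const|exact: continuous_identity].
Qed.

Lemma transported : exists h : 'I_4 -> R[i] -> R[i],
  [/\ forall i, local_solution N b (h i),
      forall i, continues N p (h i) (fun u => \sum_j nilp_exp kappa j i * h j u) &
      ~ germ_eq b (h (inord 3)) (fun=> 0)].
Proof.
pose tau t := sigma (1 - t).
have Xtau t : I t -> X (tau t) by move=> /unit_itv_rev; exact: Xs.
have t0 : tau 0 = zero_center by rewrite /tau subr0.
have t1 : tau 1 = b by rewrite /tau subrr.
have ex i : exists h, continues N tau (zero_sol N i) h.
  by apply: (continues_exists rev_continuous Xtau); rewrite subr0 s1; exact: zero_local.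
have [h Hh] := choice ex.
have rr : (fun t => tau (1 - t)) = sigma by apply/funext => t; rewrite /tau subKr.
have back i : continues N sigma (h i) (zero_sol N i).
  by rewrite -rr; exact: continues_rev (Hh i).
exists h; split.
- by move=> i; have := continues_end Xtau (Hh i); rewrite t1; exact.
- move=> i; rewrite pE; apply: (continues_cat rev_continuous).
  + have o1 : ((1 : R) <= 2^-1) = false by apply/negbTE; rewrite -ltNge; lra.
    have o2 : 2 * 1 - 1 = 1 :> R by lra.
    by rewrite /path_cat o1 o2 zero_circle1 subr0 s1.
  + apply: (continues_cat zero_circle_continuous _ (back i)); last exact: zero_continues.
    by rewrite s1 zero_circle0.
  + exact: (continues_sum Xtau (fun j => nilp_exp kappa j i) Hh).
- move=> h0; have := continues_zero cs Xs (back (inord 3)); rewrite s0 s1 => /(_ h0) /nbhs_singleton.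
  by move/eqP; apply/negP; exact: zero_neq0.
Qed.

(** Along the circle the logarithm grows by [kappa], so that the transported
    Frobenius basis is multiplied by the exponential of a nilpotent matrix. *)
Lemma char_poly_zero : char_poly M = ('X - 1) ^+ 4.
Proof.
have [h [hs hc h3]] := transported.
have [c Hc] := choice (fun i => lin_coord fb (hs i)).
pose P : 'M[R[i]]_4 := \matrix_(i, j) c i 0 j; pose E := (nilp_exp kappa)^T.
have rP i : row i P = c i by apply/rowP => j; rewrite !mxE.
have EP : E *m P = P *m M.
  apply/row_matrixP => i; rewrite !row_mul rP.
  apply: (mono_apply fb HM (hc i) (Hc i)).
  apply: germ_trans (germ_sum (fun j => nilp_exp kappa j i) Hc) _.
  apply: (@filterE _ (nbhs b)) => u; rewrite -lin_lin /lin.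
  by apply: eq_bigr => j _; rewrite !mxE rP.
have k0 : kappa != 0.
  rewrite eq_complex /= eqxx /=; apply: lt0r_neq0; rewrite mulr_gt0//; exact: pi_gt0.
have P3 : row (inord 3) P != 0.
  rewrite rP; apply/eqP => c0; apply: h3; apply: germ_trans (Hc _) _.
  apply: (@filterE _ (nbhs b)) => u; rewrite c0 /lin big1// => i _; by rewrite mxE mul0r.
have sh (w : 'rV[R[i]]_4) (k : nat) : (k < 3)%N -> (forall i : 'I_4, (i < k)%N -> w 0 i = 0) ->
    (forall i : 'I_4, (i < k.+1)%N -> (w *m E - w) 0 i = 0) /\
    (w *m E - w) 0 (inord k.+1) = kappa * w 0 (inord k).
  move=> k3 w0.
  have D (i : 'I_4) : (w *m E) 0 i = \sum_(j < 4 | (j <= i)%N) w 0 j * exp_term (i - j) kappa.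
    rewrite mxE [RHS]big_mkcond; apply: eq_bigr => j _; rewrite !mxE.
    by case: ifP; rewrite ?mulr0.
  have k4 : (k < 4)%N by exact: ltnW.
  have ik : inord k = Ordinal k4 by apply: val_inj; rewrite /= inordK.
  have k34 : (k.+1 < 4)%N by [].
  have ik1 : inord k.+1 = Ordinal k34 by apply: val_inj; rewrite /= inordK.
  have B (i : 'I_4) : (w *m E - w) 0 i = (w *m E) 0 i - w 0 i by rewrite [LHS]mxE [X in _ + X]mxE.
  split=> [i ik'|].
    rewrite B D (bigD1 i)//= subnn mulr1 big1 ?addr0 ?subrr// => j /andP[ji jn].
    rewrite w0 ?mul0r//; apply: (@leq_trans i); last by rewrite -ltnS.
    by rewrite ltn_neqAle ji andbT; exact: jn.
  rewrite B D ik1 (bigD1 (Ordinal k34))//= subnn mulr1 [X in X - _]addrC addrK.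
  rewrite (bigD1 (Ordinal k4)) /=; last by rewrite leqnSn -val_eqE /= neq_ltn ltnSn.
  rewrite subSnn /= ik mulrC big1 ?addr0// => j /andP[/andP[j1 j2] j3].
  rewrite w0 ?mul0r// ltn_neqAle -ltnS ltn_neqAle j1 andbT; apply/andP; split.
    by move: j3; rewrite -val_eqE.
  by move: j2; rewrite -val_eqE.
have Kst (w : 'rV[R[i]]_4) : w *m P = 0 -> (w *m E - w) *m P = 0.
  by move=> wP; rewrite mulmxBl -mulmxA EP mulmxA wP mul0mx subr0.
have C (d : nat) : forall k, (k + d = 3)%N -> forall w : 'rV[R[i]]_4, w *m P = 0 ->
    (forall i : 'I_4, (i < k)%N -> w 0 i = 0) -> w = 0.
  elim: d => [|d IH] k kd w wP w0.
    rewrite addn0 in kd; subst k.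
    have wE : w = w 0 (inord 3) *: delta_mx 0 (inord 3).
      apply/rowP => i; rewrite !mxE eqxx /=; case: eqVneq => [->|i3]; first by rewrite mulr1.
      rewrite mulr0 w0// ltn_neqAle -ltnS ltn_ord andbT.
      by apply: contra i3 => /eqP i3; apply/eqP/val_inj; rewrite /= inordK.
    move: wP; rewrite wE -scalemxAl -rowE => /eqP; rewrite scaler_eq0 (negbTE P3) orbF => /eqP ->.
    by rewrite scale0r.
  have k3 : (k < 3)%N by rewrite -kd addnS ltnS leq_addr.
  have [z1 z2] := sh w k k3 w0.
  have kd' : (k.+1 + d = 3)%N by rewrite addSn -addnS.
  have := IH _ kd' _ (Kst _ wP) z1.
  move=> /(congr1 (fun v : 'rV_4 => v 0 (inord k.+1))); rewrite z2 mxE => /eqP.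
  rewrite mulf_eq0 (negbTE k0) /= => /eqP wk.
  apply: (IH _ kd' _ wP) => i; rewrite ltnS leq_eqVlt => /orP[/eqP ik|]; last exact: w0.
  by rewrite (_ : i = inord k)//; apply: val_inj; rewrite /= inordK// ltnW.
have PU : P \in unitmx.
  rewrite -row_free_unit -kermx_eq0; apply/eqP/row_matrixP => j; rewrite row0.
  apply: (C 3%N 0%N erefl); last by [].
  by apply/sub_kermxP; exact: row_sub.
rewrite -(char_poly_intertwine PU EP).
have -> : char_poly E = char_poly (nilp_exp kappa).
  rewrite /char_poly -[RHS]det_tr; congr (\det _).
  by rewrite /char_poly_mx linearB /= tr_scalar_mx map_trmx.
have T : is_trig_mx (nilp_exp kappa).
  by apply/is_trig_mxP => i j ij; rewrite mxE leqNgt ij.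
rewrite (char_poly_trig T); under eq_bigr => i _ do rewrite mxE leqnn subnn.
by rewrite big_const_ord iter_mulr_1.
Qed.

End zero_spectrum.

(** * Generation of the fundamental group *)

Section families.
Context {R : realType}.
Local Notation X := (@punctured_plane R).
Local Notation I := (`[0%R, 1%R]%classic : set R).
Local Notation b := (@base_point R).
Implicit Types (f g p : R -> R[i]) (F G : R -> R -> R[i]).

Definition is_path f := {within I, continuous f} /\ forall t, I t -> X (f t).

Definition is_loop f := [/\ {within I, continuous f}, forall t, I t -> X (f t), f 0 = b & f 1 = b].

Definition mk_loop f (H : is_loop f) : @C01_loop R := let: And4 h1 h2 h3 h4 := H in MkLoop h1 h2 h3 h4.

Lemma mk_loopE f (H : is_loop f) : loop_fun (mk_loop H) = f.
Proof. by case: H. Qed.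

(** The homotopy class of a function, with junk value 1 when it is not a loop. *)
Definition cls f : @pi1_C01 R :=
  if pselect (is_loop f) is left H then pi1_class base_point_in (mk_loop H) else 1%g.

Lemma clsE (p : @C01_loop R) f : loop_fun p = f -> cls f = pi1_class base_point_in p.
Proof.
move=> pf; rewrite /cls; case: pselect => [H|[]].
  by apply/pi1_classP/homotopic_eq => t _; rewrite mk_loopE pf.
rewrite -pf; split; [exact: loop_continuous|exact: loop_in|exact: loop0|exact: loop1].
Qed.

Lemma cls_mk f (H : is_loop f) : cls f = pi1_class base_point_in (mk_loop H).
Proof. exact/clsE/mk_loopE. Qed.

Lemma is_loop_cat f g : is_loop f -> is_loop g -> is_loop (path_cat f g).
Proof.
move=> H H'; have := loop_cat (mk_loop H) (mk_loop H').
have E : loop_fun (loop_cat (mk_loop H) (mk_loop H')) = path_cat f g by rewrite /= !mk_loopE.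
move=> _; rewrite -E.
by split; [exact: loop_continuous|exact: loop_in|exact: loop0|exact: loop1].
Qed.

Lemma cls_cat f g : is_loop f -> is_loop g -> cls (path_cat f g) = (cls f * cls g)%g.
Proof.
move=> H H'; rewrite (cls_mk H) (cls_mk H').
rewrite (@clsE (loop_cat (mk_loop H) (mk_loop H'))) /= ?mk_loopE//.
exact/esym/pi1_mulE.
Qed.

Lemma cls_const : cls (fun=> b) = 1%g.
Proof. exact: (@clsE (loop_const base_point_in)). Qed.

Lemma is_loop_const : is_loop (fun=> b).
Proof.
split=> //; last by move=> t _; exact: base_point_in.
by apply: continuous_subspaceT; exact: continuous_const.
Qed.

Definition fam F := {within I `*` I, continuous (fun st : R * R => F st.1 st.2)} /\
  forall s t, I s -> I t -> X (F s t).

Lemma fam_path F s : fam F -> I s -> is_path (F s).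
Proof.
move=> [cF XF] Is; split; last by move=> t; exact: XF.
exact: (within_slice cF Is).
Qed.

Lemma fam_loop F s : fam F -> (forall s, I s -> F s 0 = b /\ F s 1 = b) -> I s -> is_loop (F s).
Proof.
by move=> fF Fb Is; have [c x] := fam_path fF Is; have [h0 h1] := Fb s Is; split.
Qed.

Lemma cls_fam F : fam F -> (forall s, I s -> F s 0 = b /\ F s 1 = b) -> cls (F 0) = cls (F 1).
Proof.
move=> fF Fb; have H0 := fam_loop fF Fb (@unit_itv0 R); have H1 := fam_loop fF Fb (@unit_itv1 R).
rewrite (cls_mk H0) (cls_mk H1); apply/pi1_classP; case: fF => cF XF.
by exists (fun st => F st.1 st.2); split; [exact: cF|exact: XF|move=> t _; rewrite !mk_loopE|exact: Fb].
Qed.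

Lemma fam_cat F G : fam F -> fam G -> (forall s, I s -> F s 1 = G s 0) ->
  fam (fun s => path_cat (F s) (G s)).
Proof.
move=> [cF XF] [cG XG] FG; split; last first.
  move=> s t Is It; rewrite /path_cat; case: leP => t2; [apply: XF|apply: XG] => //.
    exact: unit_itv_half_le.
  by apply: unit_itv_half_ge => //; exact: ltW.
pose H1 := (fun st : R * R => F st.1 st.2) \o (fun st : R * R => (st.1, 2 * st.2)).
pose H2 := (fun st : R * R => G st.1 st.2) \o (fun st : R * R => (st.1, 2 * st.2 - 1)).
apply: (@within_continuous_if _ _ _ _ snd 2^-1 H1 H2).
- exact: closed_unit_square.
- exact: continuous_snd.
- apply: (Defs.within_continuous_comp _ cF); last first.
    by move=> x [[x1 x2] /= xh]; split=> //=; exact: unit_itv_half_le.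
  apply: continuous_subspaceT; apply: continuous_pair; first exact: continuous_fst.
  by apply: continuous_scale; exact: continuous_snd.
- apply: (Defs.within_continuous_comp _ cG); last first.
    by move=> x [[x1 x2] /= xh]; split=> //=; exact: unit_itv_half_ge.
  apply: continuous_subspaceT; apply: continuous_pair; first exact: continuous_fst.
  apply: continuous_sub; last exact: continuous_const.
  by apply: continuous_scale; exact: continuous_snd.
- by move=> x [x1 _] /= x2; rewrite /H1 /H2 /= x2 divff// subrr FG.
Qed.

Lemma fam_reparam p (h : R * R -> R) : is_path p -> continuous h ->
  (forall s t, I s -> I t -> I (h (s, t))) -> fam (fun s t => p (h (s, t))).
Proof.
move=> [cp Xp] ch Ih; split; last by move=> s t Is It; apply: Xp; exact: Ih.
have ch' : {within I `*` I, continuous h} by exact: continuous_subspaceT.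
have E : forall x, (I `*` I) x -> I (h x) by move=> [s t] [Is It]; exact: Ih.
have := Defs.within_continuous_comp ch' cp E.
by rewrite (_ : p \o h = (fun st => p (h (st.1, st.2))))//; apply/funext => -[].
Qed.

Definition seg (z w : R[i]) (t : R) : R[i] := z + t%:C * (w - z).

Lemma fam_seg (x y : R -> R[i]) : {within I, continuous x} -> {within I, continuous y} ->
  (forall s t, I s -> I t -> X (seg (x s) (y s) t)) -> fam (fun s => seg (x s) (y s)).
Proof.
move=> cx cy H; split; last exact: H.
have W (z : R -> R[i]) : {within I, continuous z} -> {within I `*` I, continuous (z \o fst)}.
  move=> cz; apply: (Defs.within_continuous_comp _ cz); last by move=> [s t] [].
  by apply: continuous_subspaceT; exact: continuous_fst.
have T : {within I `*` I, continuous (fun st : R * R => st.2%:C : R[i])}.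
  apply: continuous_subspaceT => st; apply: continuous_comp; first exact: continuous_snd.
  exact: real_complex_continuous.
move=> st; apply: (@cvgD _ R[i]^o); first exact: (W _ cx).
apply: (@cvgM R[i]); first exact: T.
by apply: (@cvgB _ R[i]^o); [exact: (W _ cy)|exact: (W _ cx)].
Qed.

End families.

Section fan.
Context {R : realType}.
Local Notation X := (@punctured_plane R).
Local Notation I := (`[0%R, 1%R]%classic : set R).
Local Notation b := (@base_point R).
Implicit Types (f g p : R -> R[i]).

Lemma I0 : I 0. Proof. exact: unit_itv0. Qed.
Lemma I1 : I 1. Proof. exact: unit_itv1. Qed.

Lemma IM (s t : R) : I s -> I t -> I (s * t).
Proof.
rewrite /= !in_itv /= => /andP[s0 s1] /andP[t0 t1]; rewrite mulr_ge0//=.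
by rewrite mulr_ile1.
Qed.

Lemma path_cat0 f g : path_cat f g 0 = f 0.
Proof. by rewrite /path_cat invr_ge0 ler0n mulr0. Qed.

Lemma path_cat1 f g : path_cat f g 1 = g 1.
Proof.
have o1 : ((1 : R) <= 2^-1) = false by apply/negbTE; rewrite -ltNge; lra.
by rewrite /path_cat o1; congr g; lra.
Qed.

Lemma path_cat_ind f g (Q : R[i] -> Prop) : (forall t, I t -> Q (f t)) -> (forall t, I t -> Q (g t)) ->
  forall t, I t -> Q (path_cat f g t).
Proof.
move=> Qf Qg t It; rewrite /path_cat; case: leP => t2; [apply: Qf|apply: Qg].
  exact: unit_itv_half_le.
by apply: unit_itv_half_ge => //; exact: ltW.
Qed.

Lemma fam_const p : is_path p -> fam (fun _ : R => p).
Proof. by move=> pp; apply: (@fam_reparam _ p snd pp); [exact: continuous_snd|]. Qed.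

Lemma fam_rev (F : R -> R -> R[i]) : fam F -> fam (fun s t => F s (1 - t)).
Proof.
move=> [cF XF]; split; last by move=> s t Is /unit_itv_rev It; exact: XF.
have ch : {within I `*` I, continuous (fun st : R * R => (st.1, 1 - st.2))}.
  apply: continuous_subspaceT; apply: continuous_pair; first exact: continuous_fst.
  by apply: continuous_sub; [exact: continuous_const|exact: continuous_snd].
have E : forall x, (I `*` I) x -> (I `*` I) ((fun st : R * R => (st.1, 1 - st.2)) x).
  by move=> [s t] [Is /unit_itv_rev It]; split.
exact: (Defs.within_continuous_comp ch cF E).
Qed.

Lemma is_path_cat f g : is_path f -> is_path g -> f 1 = g 0 -> is_path (path_cat f g).
Proof.
move=> pf pg fg; have := fam_cat (fam_const pf) (fam_const pg) (fun s _ => fg).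
by move=> H; exact: (fam_path H I0).
Qed.

Lemma is_path_rev f : is_path f -> is_path (fun t => f (1 - t)).
Proof. by move=> pf; exact: (fam_path (fam_rev (fam_const pf)) I0). Qed.

Lemma is_loop_path f : is_path f -> f 0 = b -> f 1 = b -> is_loop f.
Proof. by case. Qed.

(** Insertion of a detour: going along [al], then back and forth along a path
    [s] from the base point, then along [be]. *)
Lemma cls_insert al be s : is_path al -> is_path be -> is_path s -> al 0 = b -> s 0 = b -> be 1 = b ->
  al 1 = be 0 -> s 1 = be 0 ->
  cls (path_cat al be) = (cls (path_cat al (fun t => s (1 - t))) * cls (path_cat s be))%g.
Proof.
move=> pa pb ps a0 s0 b1 ab sb.
have la : is_loop (path_cat al (fun t => s (1 - t))).
  apply: is_loop_path; rewrite ?path_cat0 ?path_cat1 ?subrr//.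
  by apply: is_path_cat => //; [exact: is_path_rev|rewrite subr0 ab].
have lb : is_loop (path_cat s be).
  by apply: is_loop_path; rewrite ?path_cat0 ?path_cat1//; exact: is_path_cat.
rewrite -cls_cat//.
have lab : is_path (path_cat al be) by exact: is_path_cat.
pose phi (t : R) := Num.max (Num.min (2 * t) 2^-1) (2 * t - 1).
have cphi : continuous phi.
  have c1 : continuous (fun t : R => 2 * t).
    by apply: continuous_scale; exact: continuous_identity.
  apply: continuous_maxr; last by apply: continuous_sub; [exact: c1|exact: continuous_const].
  by apply: continuous_minr; [exact: c1|exact: continuous_const].
have Iphi t : I t -> I (phi t).
  rewrite /= !in_itv /= /phi => /andP[t0 t1].
  by rewrite le_max le_min ge_max ge_min; apply/andP; split; apply/orP || apply/andP; [left|split];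
    rewrite ?invr_ge0 ?mulr_ge0//=; lra.
have p0 : phi 0 = 0.
  by rewrite /phi mulr0 (min_idPl _) ?invr_ge0// (max_idPl _)//; lra.
have p1 : phi 1 = 1.
  have e : Num.min (2 * 1) 2^-1 = 2^-1 :> R by apply/min_idPr; lra.
  by rewrite /phi e (max_idPr _); lra.
have c2 (g : R -> R) : continuous g -> continuous (fun st : R * R => g st.2).
  by move=> cg x; apply: continuous_comp; [exact: continuous_snd|exact: cg].
pose h (st : R * R) := st.2 + st.1 * (phi st.2 - st.2).
have ch : continuous h.
  apply: continuous_add; first exact: continuous_snd.
  apply: continuous_mul; first exact: continuous_fst.
  by apply: continuous_sub; [exact: c2|exact: continuous_snd].
have Ih r t : I r -> I t -> I (h (r, t)).
  move=> Ir It; have := Iphi _ It; move: Ir It.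
  by rewrite /h /= !in_itv /=; nra.
have F1 := fam_reparam lab ch Ih.
have E1 : cls (path_cat al be) = cls (fun t => path_cat al be (phi t)).
  have F1b r : I r -> path_cat al be (h (r, 0)) = b /\ path_cat al be (h (r, 1)) = b.
    by move=> Ir; rewrite /h /= p0 p1 !subrr !mulr0 !addr0 path_cat0 path_cat1.
  transitivity (cls (fun t => path_cat al be (h (0, t)))).
    by congr cls; apply/funext => t; congr (path_cat _ _ _); rewrite /h /=; ring.
  rewrite (cls_fam F1 F1b); congr cls; apply/funext => t; congr (path_cat _ _ _).
  by rewrite /h /=; ring.
have h1 : continuous (fun st : R * R => 1 - st.2 * st.1).
  apply: continuous_sub; first exact: continuous_const.
  by apply: continuous_mul; [exact: continuous_snd|exact: continuous_fst].
have h2 : continuous (fun st : R * R => 1 - st.1 + st.1 * st.2).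
  apply: continuous_add; last by apply: continuous_mul; [exact: continuous_fst|exact: continuous_snd].
  by apply: continuous_sub; [exact: continuous_const|exact: continuous_fst].
have G1 : fam (fun r t => s (1 - t * r)).
  by apply: (fam_reparam ps h1) => r t Ir It; apply: unit_itv_rev; exact: IM.
have G2 : fam (fun r t => s (1 - r + r * t)).
  apply: (fam_reparam ps h2) => r t; rewrite /= !in_itv /=; nra.
have G12 := fam_cat (fam_cat (fam_const pa) G1 _) (fam_cat G2 (fam_const pb) _) _.
have := cls_fam (G12 _ _ _); rewrite /= => E2.
rewrite E1; transitivity (cls (path_cat (path_cat al (fun t => s (1 - t * 0)))
   (path_cat (fun t => s (1 - 0 + 0 * t)) be))).
  congr cls; apply/funext => t.
  have F (x y : R) : y < x -> (x <= y) = false by rewrite ltNge => /negbTE.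
  rewrite /path_cat; have [t2|t2] := leP t 2^-1.
    have [t4|t4] := leP (2 * t) 2^-1.
      have -> : phi t = 2 * t by rewrite /phi (min_idPl _)// (max_idPl _)//; lra.
      by rewrite t4.
    have -> : phi t = 2^-1 by rewrite /phi (min_idPr _) ?ltW// (max_idPl _)//; lra.
    by rewrite lexx divff// mulr0 subr0 ab sb.
  have [t4|t4] := leP (2 * t - 1) 2^-1.
    have -> : phi t = 2^-1 by rewrite /phi (min_idPr _) ?(max_idPl _)//; lra.
    by rewrite lexx divff// mul0r subr0 addr0 ab sb.
  have -> : phi t = 2 * t - 1.
    have e : Num.min (2 * t) 2^-1 = 2^-1 by apply/min_idPr; lra.
    by rewrite /phi e (max_idPr _) ?ltW.
  by rewrite (F _ _ t4).
rewrite E2.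
- by congr cls; congr path_cat; congr path_cat; apply/funext => t; congr s; ring.
- by move=> r Ir; rewrite mul0r subr0 ab sb.
- by move=> r Ir; rewrite mulr1 subrK sb.
- by move=> r Ir; rewrite path_cat1 path_cat0 mul1r mulr0 addr0.
- by move=> r Ir; rewrite !path_cat0 !path_cat1 a0 b1.
Qed.

Lemma cls_retract s : is_path s -> s 0 = b ->
  cls (path_cat (path_cat s (fun=> s 1)) (fun t => s (1 - t))) = 1%g.
Proof.
move=> ps s0.
have h1 : continuous (fun st : R * R => st.2 * st.1).
  by apply: continuous_mul; [exact: continuous_snd|exact: continuous_fst].
have h2 : continuous (fun st : R * R => (1 - st.2) * st.1).
  apply: continuous_mul; last exact: continuous_fst.
  by apply: continuous_sub; [exact: continuous_const|exact: continuous_snd].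
have G1 : fam (fun r t => s (t * r)) by apply: (fam_reparam ps h1) => r t Ir It; exact: IM.
have G3 : fam (fun r t => s ((1 - t) * r)).
  by apply: (fam_reparam ps h2) => r t Ir It; apply: IM => //; exact: unit_itv_rev.
have G2 : fam (fun r _ : R => s r).
  by apply: (fam_reparam ps (h := fst)); [exact: continuous_fst|].
have G := fam_cat (fam_cat G1 G2 _) G3 _.
have := cls_fam (G _ _); rewrite /= => E.
transitivity (cls (path_cat (path_cat (fun t => s (t * 1)) (fun=> s 1)) (fun t => s ((1 - t) * 1)))).
  by congr cls; congr path_cat; [congr path_cat|]; apply/funext => t; rewrite mulr1.
rewrite -E.
- rewrite -cls_const; congr cls; apply/funext => t.
  by rewrite /path_cat !mulr0 s0; case: ifP => // _; case: ifP.
- by move=> r Ir; rewrite mul1r.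
- by move=> r Ir; rewrite path_cat1 subr0 mul1r.
- by move=> r Ir; rewrite !path_cat0 !path_cat1 subrr !mul0r s0.
Qed.

(** The straight-line homotopy to the base point stays in the punctured plane. *)
Lemma cls_star f : is_loop f -> (forall s t, I s -> I t -> X (b + s%:C * (f t - b))) -> cls f = 1%g.
Proof.
move=> [cf Xf f0 f1] H.
have F : fam (fun s t => b + (1 - s)%:C * (f t - b)).
  split; last by move=> s t /unit_itv_rev; exact: H.
  have W : {within I `*` I, continuous (f \o snd)}.
    apply: (Defs.within_continuous_comp _ cf); last by move=> [s t] [].
    by apply: continuous_subspaceT; exact: continuous_snd.
  have T : {within I `*` I, continuous (fun st : R * R => (1 - st.1)%:C : R[i])}.
    apply: continuous_subspaceT => st; apply: continuous_comp; last exact: real_complex_continuous.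
    by apply: continuous_sub; [exact: continuous_const|exact: continuous_fst].
  move=> st; apply: (@cvgD _ R[i]^o); first exact: cvg_cst.
  apply: (@cvgM R[i]); first exact: T.
  by apply: (@cvgB _ R[i]^o); [exact: W|exact: cvg_cst].
have := cls_fam F; rewrite subr0 subrr => E.
transitivity (cls (fun t => b + 1%:C * (f t - b))).
  by congr cls; apply/funext => t; rewrite mul1r addrC subrK.
rewrite E -?cls_const; first by congr cls; apply/funext => t; rewrite mul0r addr0.
by move=> s Is; rewrite f0 f1 subrr mulr0 addr0.
Qed.

End fan.

Section regions.
Context {R : realType}.
Local Notation X := (@punctured_plane R).
Local Notation I := (`[0%R, 1%R]%classic : set R).
Local Notation b := (@base_point R).
Local Notation Re := complex.Re.
Local Notation Im := complex.Im.
Implicit Types (p : R -> R[i]) (x y z w : R[i]).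

Variant region := right_half | upper_half | lower_half | left_half | strip.
Implicit Types (V W : region).

Definition inside V z : Prop :=
  match V with
  | right_half => 1 < Re z | upper_half => 0 < Im z | lower_half => Im z < 0
  | left_half => Re z < 0 | strip => 0 < Re z /\ Re z < 1
  end.

Definition upper_point : R[i] := (3 / 2) +i* 1.
Definition lower_point : R[i] := (3 / 2) -i* 1.

(** Convex pieces of the plane are reached from the base point by a polygon
    through these two vertices. *)
Definition via1 V : R[i] :=
  match V with right_half => b | lower_half => lower_point | _ => upper_point end.
Definition via2 V : R[i] :=
  match V with
  | right_half => b | upper_half => upper_point | lower_half => lower_point
  | left_half => (-1) +i* 1 | strip => 2^-1 +i* 1
  end.

Definition spoke V x : R -> R[i] :=
  path_cat (seg b (via1 V)) (path_cat (seg (via1 V) (via2 V)) (seg (via2 V) x)).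

Lemma segE x y (t : R) : Re (seg x y t) = Re x + t * (Re y - Re x) /\
  Im (seg x y t) = Im x + t * (Im y - Im x).
Proof. by case: x => a c; case: y => d e; rewrite /seg /=; split; ring. Qed.

Lemma lt_segment (a x y t : R) : a < x -> a < y -> 0 <= t -> t <= 1 -> a < x + t * (y - x).
Proof. by move=> ax ay t0 t1; have [xy|/ltW xy] := leP x y; nra. Qed.

Lemma segment_lt (a x y t : R) : x < a -> y < a -> 0 <= t -> t <= 1 -> x + t * (y - x) < a.
Proof. by move=> ax ay t0 t1; have [xy|/ltW xy] := leP x y; nra. Qed.

Lemma inside_convex V x y t : inside V x -> inside V y -> I t -> inside V (seg x y t).
Proof.
rewrite /= in_itv /= => hx hy /andP[t0 t1]; have [eR eI] := segE x y t.
by case: V hx hy; rewrite /= ?eR ?eI; [move=> h1 h2; exact: lt_segment|move=> h1 h2; exact: lt_segment|move=> h1 h2; exact: segment_lt|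
  move=> h1 h2; exact: segment_lt|move=> [a1 a2] [b1 b2]; split; [exact: lt_segment|exact: segment_lt]].
Qed.

Lemma inside_X V x : inside V x -> X x.
Proof.
by case: V; rewrite /= => h; split; apply/eqP => e; rewrite e /= in h; move: h; try case; lra.
Qed.

Lemma inside_b : inside right_half b.
Proof. by rewrite /inside /base_point /=; lra. Qed.

Lemma inside_cover x : X x -> exists V, inside V x.
Proof.
move=> [x0 x1]; have [i0|i0|i0] := ltgtP (Im x) 0.
- by exists lower_half.
- by exists upper_half.
have E (c : R) : Re x = c -> x = c%:C.
  by case: x i0 {x0 x1} => r s /= -> ->.
have [r0|r0|r0] := ltgtP (Re x) 0.
- by exists left_half.
- have [r1|r1|r1] := ltgtP (Re x) 1.
  + by exists strip.
  + by exists right_half.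
  + by case/eqP: x1; rewrite (E 1).
- by case/eqP: x0; rewrite (E 0).
Qed.

Lemma spoke_ind V x (Q : R[i] -> Prop) : (forall t, I t -> Q (seg b (via1 V) t)) ->
  (forall t, I t -> Q (seg (via1 V) (via2 V) t)) -> (forall t, I t -> Q (seg (via2 V) x t)) ->
  forall t, I t -> Q (spoke V x t).
Proof. by move=> h1 h2 h3; apply: path_cat_ind => //; exact: path_cat_ind. Qed.

Lemma inside_seg1 V t : I t -> inside right_half (seg b (via1 V) t).
Proof.
by move=> It; apply: inside_convex => //; first exact: inside_b; case: V; rewrite /=; lra.
Qed.

Lemma inside_seg2 V t : I t -> exists W, inside W (seg (via1 V) (via2 V) t).
Proof.
move=> It; case: V; [exists right_half|exists upper_half|exists lower_half|exists upper_half|exists upper_half];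
  apply: inside_convex => //=; lra.
Qed.

Lemma inside_via2 V : inside V (via2 V).
Proof. by case: V; rewrite /=; try lra; split; lra. Qed.

Lemma seg0 x y : seg x y 0 = x. Proof. by rewrite /seg mul0r addr0. Qed.
Lemma seg1 x y : seg x y 1 = y. Proof. by rewrite /seg mul1r addrC subrK. Qed.

Lemma spoke0 V x : spoke V x 0 = b.
Proof. by rewrite /spoke path_cat0 seg0. Qed.

Lemma spoke1 V x : spoke V x 1 = x.
Proof. by rewrite /spoke !path_cat1 seg1. Qed.

Lemma cont_cst (c : R[i]) : {within I, continuous (fun _ : R => c)}.
Proof. by apply: continuous_subspaceT; exact: continuous_const. Qed.

Lemma fam_spoke V (x : R -> R[i]) : {within I, continuous x} -> (forall s, I s -> inside V (x s)) ->
  fam (fun s => spoke V (x s)).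
Proof.
move=> cx Vx.
have F1 : fam (fun _ : R => seg b (via1 V)).
  apply: (fam_seg (x := fun=> b) (y := fun=> via1 V)); [exact: cont_cst|exact: cont_cst|].
  by move=> s t Is It; exact: inside_X (inside_seg1 V It).
have F2 : fam (fun _ : R => seg (via1 V) (via2 V)).
  apply: (fam_seg (x := fun=> via1 V) (y := fun=> via2 V)); [exact: cont_cst|exact: cont_cst|].
  by move=> s t Is It; have [W] := inside_seg2 V It; exact: inside_X.
have F3 : fam (fun s => seg (via2 V) (x s)).
  apply: (fam_seg (x := fun=> via2 V)); [exact: cont_cst|exact: cx|].
  move=> s t Is It; apply: (@inside_X V); apply: inside_convex => //; [exact: inside_via2|exact: Vx].
apply: (fam_cat F1 (fam_cat F2 F3 _)) => s _; first by rewrite seg1 seg0.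
by rewrite path_cat0 seg1 seg0.
Qed.

Lemma spoke_path V x : inside V x -> is_path (spoke V x).
Proof.
move=> Vx; have H : forall s : R, I s -> inside V ((fun=> x) s) by [].
have F := fam_spoke (@cont_cst x) H; exact: (fam_path F (@I0 R)). Qed.

Lemma spoke_b : spoke right_half b = (fun=> b).
Proof.
have S t : seg b b t = b by rewrite /seg subrr mulr0 addr0.
by apply/funext => t; rewrite /spoke /= /path_cat; case: ifP => _; [|case: ifP => _]; exact: S.
Qed.

Definition turn W V x := cls (path_cat (spoke W x) (fun t => spoke V x (1 - t))).

Lemma turn_loop W V x : inside W x -> inside V x ->
  is_loop (path_cat (spoke W x) (fun t => spoke V x (1 - t))).
Proof.
move=> Wx Vx; apply: is_loop_path; rewrite ?path_cat0 ?path_cat1 ?spoke0 ?subrr ?spoke0//.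
apply: is_path_cat; [exact: spoke_path|exact/is_path_rev/spoke_path|].
by rewrite subr0 !spoke1.
Qed.

Lemma turn_const W V x y : inside W x -> inside V x -> inside W y -> inside V y ->
  turn W V x = turn W V y.
Proof.
move=> Wx Vx Wy Vy.
have cz : {within I, continuous (seg x y)}.
  apply: continuous_subspaceT => t; apply: (@cvgD _ R[i]^o); first exact: cvg_cst.
  by apply: (@cvgM R[i]); [exact: real_complex_continuous|exact: cvg_cst].
have F1 := fam_spoke cz (fun t It => inside_convex Wx Wy It).
have F2 := fam_rev (fam_spoke cz (fun t It => inside_convex Vx Vy It)).
have F := fam_cat F1 F2 (fun s _ => _).
have := cls_fam (F _); rewrite seg0 seg1; apply=> [s|s]; first by rewrite subr0 !spoke1.
by rewrite path_cat0 path_cat1 subrr !spoke0.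
Qed.

Lemma turn_star W V x (Q : R[i] -> Prop) : inside W x -> inside V x ->
  (forall t, I t -> Q (spoke W x t)) -> (forall t, I t -> Q (spoke V x t)) ->
  (forall z t, I t -> Q z -> X (b + t%:C * (z - b))) -> turn W V x = 1%g.
Proof.
move=> Wx Vx QW QV QX; apply: cls_star; first exact: turn_loop.
move=> s t Is It; apply: QX => //; apply: path_cat_ind It => // u Iu.
by apply: QV; exact: unit_itv_rev.
Qed.

Definition near_right V := match V with upper_half | lower_half => true | _ => false end.

Lemma turn_right V x : near_right V -> inside V x -> inside right_half x ->
  turn V right_half x = 1%g /\ turn right_half V x = 1%g.
Proof.
move=> nV Vx Cx.
have QX z t : I t -> inside right_half z -> X (b + t%:C * (z - b)).
  by move=> It Cz; apply: (@inside_X right_half); exact: (inside_convex inside_b Cz It).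
have b1 : inside right_half (via1 V) by case: V nV {Vx}; rewrite /=; lra.
have b2 : inside right_half (via2 V) by case: V nV {Vx b1}; rewrite /=; lra.
have QV t : I t -> inside right_half (spoke V x t).
  by apply: spoke_ind => u Iu; apply: inside_convex => //; exact: inside_b.
have QC t : I t -> inside right_half (spoke right_half x t).
  by apply: spoke_ind => u Iu; apply: inside_convex => //; exact: inside_b.
by split; [exact: turn_star QV QC QX|exact: turn_star QC QV QX].
Qed.

Definition above V := match V with upper_half | left_half | strip => true | _ => false end.

Lemma turn_above V W x : above V -> above W -> inside V x -> inside W x -> inside upper_half x ->
  turn V W x = 1%g.
Proof.
move=> aV aW Vx Wx Ux; pose Q z := 0 < Im z \/ z = b.
have QX z t : I t -> Q z -> X (b + t%:C * (z - b)).
  rewrite /= in_itv /= => /andP[t0 t1] [z0|->]; last first.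
    by rewrite subrr mulr0 addr0; exact: base_point_in.
  have [->|tn] := eqVneq t 0; first by rewrite mul0r addr0; exact: base_point_in.
  have tp : 0 < t by rewrite lt_neqAle eq_sym tn.
  apply: (@inside_X upper_half); have [_ /= ->] := segE b z t.
  by rewrite subr0 add0r mulr_gt0.
have S Z : above Z -> inside Z x -> forall t, I t -> Q (spoke Z x t).
  move=> aZ Zx; have v1 : via1 Z = upper_point by case: Z aZ {Zx}.
  have v2 : 0 < Im (via2 Z) by case: Z aZ {Zx v1}; rewrite /=; lra.
  have u0 : 0 < Im upper_point by rewrite /=; lra.
  apply: spoke_ind => t It; rewrite ?v1.
  - have [t0|tn] := eqVneq t 0; first by right; rewrite t0 seg0.
    left; have [_ ->] := segE b upper_point t; move: It; rewrite /= in_itv /= => /andP[t0 t1].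
    by rewrite subr0 add0r mulr1 lt_neqAle eq_sym tn.
  - left; exact: (@inside_convex upper_half _ _ _ u0 v2 It).
  - left; exact: (@inside_convex upper_half _ _ _ v2 Ux It).
exact: (turn_star Vx Wx (S _ aV Vx) (S _ aW Wx) QX).
Qed.

Section track.
Variables (s0 p : R -> R[i]).
Hypotheses (ps0 : is_path s0) (pp : is_path p) (s00 : s0 0 = b) (s01 : s0 1 = p 0).

Definition track V (t : R) :=
  cls (path_cat (path_cat s0 (fun u => p (u * t))) (fun u => spoke V (p t) (1 - u))).

Lemma scaled_path t : I t -> is_path (fun u => p (u * t)).
Proof.
move=> It.
have h1 : continuous (fun st : R * R => st.2 * t).
  by apply: continuous_mul; [exact: continuous_snd|exact: continuous_const].
have F := fam_reparam pp h1 (fun s u _ Iu => IM Iu It).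
exact: (fam_path F (@I0 R)).
Qed.

Lemma track_stay V (t t' : R) : t <= t' -> I t -> I t' ->
  (forall s, t <= s <= t' -> inside V (p s)) -> track V t = track V t'.
Proof.
move=> tt It It' Vp.
pose l (s : R) := t + s * (t' - t).
have cl : continuous l.
  apply: continuous_add; first exact: continuous_const.
  by apply: continuous_mul; [exact: continuous_identity|exact: continuous_const].
have lt s : I s -> t <= l s <= t'.
  by rewrite /= in_itv /= /l => /andP[? ?]; apply/andP; split; nra.
have Il s : I s -> I (l s).
  move=> /lt /andP[h1 h2]; move: It It'; rewrite /= !in_itv /= => /andP[? ?] /andP[? ?].
  by apply/andP; split; lra.
have cpl : {within I, continuous (p \o l)}.
  by apply: (Defs.within_continuous_comp _ pp.1); [exact: continuous_subspaceT|exact: Il].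
have F3 := fam_rev (fam_spoke cpl (fun s Is => Vp _ (lt s Is))).
have h1 : continuous (fun st : R * R => st.2 * l st.1).
  apply: continuous_mul; first exact: continuous_snd.
  by move=> st; apply: continuous_comp; [exact: continuous_fst|exact: cl].
have F2 := fam_reparam pp h1 (fun s u Is Iu => IM Iu (Il s Is)).
have F12 := fam_cat (fam_const ps0) F2 (fun s _ => _).
have F := fam_cat (F12 _) F3 (fun s _ => _).
have l0 : l 0 = t by rewrite /l mul0r addr0.
have l1 : l 1 = t' by rewrite /l mul1r addrC subrK.
have := cls_fam (F _ _); rewrite /= l0 l1; apply=> [s|s|s].
- by rewrite mul0r.
- by rewrite path_cat1 mul1r subr0 spoke1.
- by rewrite !path_cat0 path_cat1 subrr spoke0 s00.
Qed.

Lemma track_turn V W t : I t -> inside V (p t) -> inside W (p t) ->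
  track V t = (track W t * turn W V (p t))%g.
Proof.
move=> It Vp Wp; rewrite /track /turn; apply: cls_insert.
- by apply: is_path_cat => //; [exact: scaled_path|rewrite mul0r].
- exact/is_path_rev/spoke_path.
- exact: spoke_path.
- by rewrite path_cat0.
- by rewrite spoke0.
- by rewrite subrr spoke0.
- by rewrite path_cat1 mul1r subr0 spoke1.
- by rewrite subr0 !spoke1.
Qed.

Lemma track_start V : inside V (p 0) -> s0 = spoke V (p 0) -> track V 0 = 1%g.
Proof.
move=> Vp s0E; rewrite /track -(cls_retract (spoke_path Vp) (spoke0 _ _)) -s0E.
by congr cls; congr path_cat; congr path_cat; apply/funext => u; rewrite mulr0 s01.
Qed.

End track.

Lemma turn_cocycle V W Z x : inside V x -> inside W x -> inside Z x ->
  turn V Z x = (turn V W x * turn W Z x)%g.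
Proof.
move=> Vx Wx Zx; have pV := spoke_path Vx; have pW := spoke_path Wx.
have pZ := is_path_rev (spoke_path Zx).
by apply: cls_insert => //; rewrite ?subrr ?subr0 ?spoke0 ?spoke1.
Qed.

Lemma turn_refl V x : inside V x -> turn V V x = 1%g.
Proof.
move=> Vx; have : (turn V V x * 1 = turn V V x * turn V V x)%g.
  by rewrite mulg1 -turn_cocycle.
by move=> /mulgI <-.
Qed.

Lemma turn_inv V W x : inside V x -> inside W x -> (turn V W x * turn W V x)%g = 1%g.
Proof. by move=> Vx Wx; rewrite -turn_cocycle// turn_refl. Qed.

End regions.

Section quadrants.
Context {R : realType}.
Local Notation c t := (cos (2 * pi * t) : R).
Local Notation s t := (sin (2 * pi * t) : R).

Lemma sin_first_half (t : R) : 0 < t < 2^-1 -> 0 < s t.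
Proof.
move=> /andP[t0 t1]; have p := pi_gt0 R.
by apply: sin_gt0_pi; apply/andP; split; nra.
Qed.

Lemma quarter (t : R) : c (t + 4^-1) = - s t /\ s (t + 4^-1) = c t.
Proof.
have -> : 2 * pi * (t + 4^-1) = 2 * pi * t + pi / 2 :> R by field.
by rewrite cosDpihalf sinDpihalf.
Qed.

Lemma sin_second_half (t : R) : 2^-1 < t < 1 -> s t < 0.
Proof.
move=> /andP[t0 t1]; have [q1 q2] := quarter (t - 4^-1); have [q3 q4] := quarter (t - 4^-1 - 4^-1).
rewrite !subrK in q1 q2 q3 q4; rewrite q2 q3 oppr_lt0.
by apply: sin_first_half; apply/andP; split; lra.
Qed.

Lemma cos_middle (t : R) : 4^-1 < t < 3 / 4 -> c t < 0.
Proof.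
move=> /andP[t0 t1]; have [q1 _] := quarter (t - 4^-1); rewrite subrK in q1.
by rewrite q1 oppr_lt0; apply: sin_first_half; apply/andP; split; lra.
Qed.

Lemma cos_first_eighth (t : R) : 0 <= t <= 8^-1 -> 2 / 3 < c t.
Proof.
move=> /andP[t0 t1]; have p := pi_gt0 R.
have c8 : 2 / 3 < c 8^-1.
  have c0 : 0 < c 8^-1 by apply: cos_gt0_pihalf; apply/andP; split; nra.
  have [x xE] : exists x, x = 2 * pi * 8^-1 :> R by exists (2 * pi * 8^-1).
  have : cos (x *+ 2) = 0 :> R.
    by rewrite (_ : x *+ 2 = pi / 2) ?cos_pihalf// xE mulr2n; field.
  move: c0; rewrite -xE => c0; rewrite cos_mulr2n -mulr_natr => h.
  by move: c0 h; move: (cos x) => y; nra.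
have [->//|ne] := eqVneq t 8^-1.
apply: (lt_trans c8); rewrite ltr_cos ?in_itv /=.
- by rewrite ltr_pM2l ?mulr_gt0// lt_neqAle ne.
- by apply/andP; split; nra.
- by apply/andP; split; nra.
Qed.

Lemma cos_last_eighth (t : R) : 7 / 8 <= t <= 1 -> 2 / 3 < c t.
Proof.
move=> /andP[t0 t1]; have := @cos_first_eighth (1 - t).
have -> : 2 * pi * (1 - t) = - (2 * pi * t) + pi *+ 2 by rewrite -mulr_natr; ring.
by rewrite cosD2pi cosN; apply; apply/andP; split; lra.
Qed.

End quadrants.

Section circles.
Context {R : realType}.
Local Notation X := (@punctured_plane R).
Local Notation I := (`[0%R, 1%R]%classic : set R).
Local Notation b := (@base_point R).
Local Notation C := (@right_half). Local Notation U := (@upper_half).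
Implicit Types (p : R -> R[i]).

Section cycle.
Variables (s0 p : R -> R[i]).
Hypotheses (ps0 : is_path s0) (pp : is_path p) (s00 : s0 0 = b) (s01 : s0 1 = p 0).
Variables V0 V1 V2 V3 : region.
Hypothesis h0 : forall t : R, 0 <= t <= 8^-1 -> inside V0 (p t).
Hypothesis h1 : forall t : R, 8^-1 <= t <= 3 / 8 -> inside V1 (p t).
Hypothesis h2 : forall t : R, 3 / 8 <= t <= 5 / 8 -> inside V2 (p t).
Hypothesis h3 : forall t : R, 5 / 8 <= t <= 7 / 8 -> inside V3 (p t).
Hypothesis h4 : forall t : R, 7 / 8 <= t <= 1 -> inside V0 (p t).

Lemma track_cycle : s0 = spoke V0 (p 0) -> track s0 p V0 1 =
  (turn V0 V1 (p 8^-1) * turn V1 V2 (p (3 / 8)) * turn V2 V3 (p (5 / 8)) * turn V3 V0 (p (7 / 8)))%g.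
Proof.
move=> s0E.
have IE (t : R) : 0 <= t -> t <= 1 -> I t by move=> a d; rewrite /= in_itv /= a d.
have E0 : track s0 p V0 0 = 1%g by apply: track_start => //; apply: h0; rewrite lexx /=; lra.
have S := track_stay ps0 pp s00 s01; have J := track_turn ps0 pp s00 s01.
have E1 : track s0 p V0 8^-1 = 1%g.
  by rewrite -E0; apply/esym/(S V0 0 8^-1 _ _ _ h0); [lra|apply: IE; lra|apply: IE; lra].
have F1 : track s0 p V1 8^-1 = turn V0 V1 (p 8^-1).
  by rewrite (J _ V0) ?E1 ?mul1g//; [apply: IE; lra|apply: h1; lra|apply: h0; lra].
have E2 : track s0 p V1 (3 / 8) = track s0 p V1 8^-1.
  by apply/esym/(S _ _ _ _ _ _ h1); [lra|apply: IE; lra|apply: IE; lra].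
have F2 : track s0 p V2 (3 / 8) = (turn V0 V1 (p 8^-1) * turn V1 V2 (p (3 / 8)))%g.
  by rewrite (J _ V1) ?E2 ?F1//; [apply: IE; lra|apply: h2; lra|apply: h1; lra].
have E3 : track s0 p V2 (5 / 8) = track s0 p V2 (3 / 8).
  by apply/esym/(S _ _ _ _ _ _ h2); [lra|apply: IE; lra|apply: IE; lra].
have F3 : track s0 p V3 (5 / 8) = (turn V0 V1 (p 8^-1) * turn V1 V2 (p (3 / 8)) * turn V2 V3 (p (5 / 8)))%g.
  by rewrite (J _ V2) ?E3 ?F2//; [apply: IE; lra|apply: h3; lra|apply: h2; lra].
have E4 : track s0 p V3 (7 / 8) = track s0 p V3 (5 / 8).
  by apply/esym/(S _ _ _ _ _ _ h3); [lra|apply: IE; lra|apply: IE; lra].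
have F4 : track s0 p V0 (7 / 8) = (turn V0 V1 (p 8^-1) * turn V1 V2 (p (3 / 8)) * turn V2 V3 (p (5 / 8)) * turn V3 V0 (p (7 / 8)))%g.
  by rewrite (J _ V3) ?E4 ?F3//; [apply: IE; lra|apply: h4; lra|apply: h3; lra].
by rewrite -F4; apply/esym/(S _ _ _ _ _ _ h4); [lra|apply: IE; lra|apply: IE; lra].
Qed.

Lemma cycle_corners : [/\ inside V0 (p 8^-1) /\ inside V1 (p 8^-1),
  inside V1 (p (3 / 8)) /\ inside V2 (p (3 / 8)), inside V2 (p (5 / 8)) /\ inside V3 (p (5 / 8)) &
  inside V3 (p (7 / 8)) /\ inside V0 (p (7 / 8))].
Proof. by split; split; [apply: h0|apply: h1|apply: h1|apply: h2|apply: h2|apply: h3|apply: h3|apply: h4]; lra. Qed.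

End cycle.

Lemma track_loop (p : @C01_loop R) : track (spoke right_half b) p right_half 1 = pi1_class base_point_in p.
Proof.
rewrite /track loop1 spoke_b.
have E : (fun u : R => p (u * 1)) = p by apply/funext => u; rewrite mulr1.
rewrite E; have lp : is_loop p.
  by split; [exact: loop_continuous|exact: loop_in|exact: loop0|exact: loop1].
have c0 := @is_loop_const R; have cp := is_loop_cat c0 lp.
rewrite (cls_cat cp c0) (cls_cat c0 lp) cls_const mul1g mulg1.
exact: clsE.
Qed.

Definition strip_low : R[i] := 2^-1 -i* 1.
Definition left_low : R[i] := (-1) -i* 1.

Lemma strip_lowP : inside strip strip_low /\ inside lower_half strip_low.
Proof. by rewrite /=; split; [split|]; lra. Qed.
Lemma left_lowP : inside left_half left_low /\ inside lower_half left_low.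
Proof. by rewrite /=; split; lra. Qed.

Lemma loop_path (p : @C01_loop R) : is_path p.
Proof. by split; [exact: loop_continuous|exact: loop_in]. Qed.

Lemma spoke_const_path : is_path (spoke right_half b).
Proof. exact: spoke_path (@inside_b R). Qed.

Lemma class_around1 : pi1_class base_point_in (@loop_around1 R) = turn strip lower_half strip_low.
Proof.
pose p : R -> R[i] := @around1_fun R.
have h0 t : 0 <= t <= 8^-1 -> inside right_half (p t).
  by move=> /cos_first_eighth; rewrite /= /around1_fun /=; lra.
have h1 t : 8^-1 <= t <= 3 / 8 -> inside upper_half (p t).
  move=> h; have : 0 < sin (2 * pi * t) :> R by apply: sin_first_half; lra.
  by rewrite /= /around1_fun /=; lra.
have h2 t : 3 / 8 <= t <= 5 / 8 -> inside strip (p t).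
  move=> h; have : cos (2 * pi * t) < 0 :> R by apply: cos_middle; lra.
  have := cos_geN1 (2 * pi * t); rewrite /= /around1_fun /= => *; split; lra.
have h3 t : 5 / 8 <= t <= 7 / 8 -> inside lower_half (p t).
  move=> h; have : sin (2 * pi * t) < 0 :> R by apply: sin_second_half; lra.
  by rewrite /= /around1_fun /=; lra.
have h4 t : 7 / 8 <= t <= 1 -> inside right_half (p t).
  by move=> /cos_last_eighth; rewrite /= /around1_fun /=; lra.
have s01 : spoke right_half b 1 = p 0 by rewrite spoke1 [RHS]around1_0.
have pp : is_path p by exact: (loop_path (@loop_around1 R)).
have sE : spoke right_half b = spoke right_half (p 0) by rewrite /p around1_0.
transitivity (track (spoke right_half b) p right_half 1); first exact: esym (track_loop _).
rewrite (track_cycle spoke_const_path pp (spoke0 _ _) s01 h0 h1 h2 h3 h4 sE).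
have [[a1 a2] [b1 b2] [c1 c2] [d1 d2]] := cycle_corners h0 h1 h2 h3 h4.
rewrite (turn_right (V := upper_half) isT a2 a1).2 mul1g.
rewrite (turn_above (V := upper_half) (W := strip) isT isT b1 b2 b1) mul1g.
rewrite (turn_right (V := lower_half) isT d1 d2).1 mulg1.
have [l1 l2] := strip_lowP; exact: turn_const.
Qed.

Lemma class_around_infty : pi1_class base_point_in (@loop_around_infty R) = turn lower_half left_half left_low.
Proof.
pose p : R -> R[i] := @around_infty_fun R.
have h0 t : 0 <= t <= 8^-1 -> inside right_half (p t).
  by move=> /cos_first_eighth; rewrite /= /around_infty_fun /=; lra.
have h1 t : 8^-1 <= t <= 3 / 8 -> inside lower_half (p t).
  move=> h; have : 0 < sin (2 * pi * t) :> R by apply: sin_first_half; lra.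
  by rewrite /= /around_infty_fun /=; lra.
have h2 t : 3 / 8 <= t <= 5 / 8 -> inside left_half (p t).
  move=> h; have : cos (2 * pi * t) < 0 :> R by apply: cos_middle; lra.
  by rewrite /= /around_infty_fun /=; lra.
have h3 t : 5 / 8 <= t <= 7 / 8 -> inside upper_half (p t).
  move=> h; have : sin (2 * pi * t) < 0 :> R by apply: sin_second_half; lra.
  by rewrite /= /around_infty_fun /=; lra.
have h4 t : 7 / 8 <= t <= 1 -> inside right_half (p t).
  by move=> /cos_last_eighth; rewrite /= /around_infty_fun /=; lra.
have s01 : spoke right_half b 1 = p 0 by rewrite spoke1 [RHS]around_infty_0.
have pp : is_path p by exact: (loop_path (@loop_around_infty R)).
have sE : spoke right_half b = spoke right_half (p 0) by rewrite /p around_infty_0.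
transitivity (track (spoke right_half b) p right_half 1); first exact: esym (track_loop _).
rewrite (track_cycle spoke_const_path pp (spoke0 _ _) s01 h0 h1 h2 h3 h4 sE).
have [[a1 a2] [b1 b2] [c1 c2] [d1 d2]] := cycle_corners h0 h1 h2 h3 h4.
rewrite (turn_right (V := lower_half) isT a2 a1).2 mul1g.
rewrite (turn_above (V := left_half) (W := upper_half) isT isT c1 c2 c2) mulg1.
rewrite (turn_right (V := upper_half) isT d1 d2).1 mulg1.
have [l1 l2] := left_lowP; exact: turn_const.
Qed.

Lemma zero_loop_exists : exists p : @C01_loop R,
  loop_fun p = path_cat (path_cat (spoke strip zero_center) (@zero_circle R))
     (fun t => spoke strip zero_center (1 - t)) /\
  pi1_class base_point_in p = ((pi1_class base_point_in (@loop_around_infty R))^-1 *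
                     (pi1_class base_point_in (@loop_around1 R))^-1)%g.
Proof.
pose p : R -> R[i] := @zero_circle R.
have h0 t : 0 <= t <= 8^-1 -> inside strip (p t).
  move=> /cos_first_eighth; have := cos_le1 (2 * pi * t); rewrite /= /zero_circle /= => *; split; lra.
have h1 t : 8^-1 <= t <= 3 / 8 -> inside upper_half (p t).
  move=> h; have : 0 < sin (2 * pi * t) :> R by apply: sin_first_half; lra.
  by rewrite /= /zero_circle /=; lra.
have h2 t : 3 / 8 <= t <= 5 / 8 -> inside left_half (p t).
  move=> h; have : cos (2 * pi * t) < 0 :> R by apply: cos_middle; lra.
  by rewrite /= /zero_circle /=; lra.
have h3 t : 5 / 8 <= t <= 7 / 8 -> inside lower_half (p t).
  move=> h; have : sin (2 * pi * t) < 0 :> R by apply: sin_second_half; lra.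
  by rewrite /= /zero_circle /=; lra.
have h4 t : 7 / 8 <= t <= 1 -> inside strip (p t).
  move=> /cos_last_eighth; have := cos_le1 (2 * pi * t); rewrite /= /zero_circle /= => *; split; lra.
have zs : inside strip (@zero_center R) by rewrite /zero_center /=; split; lra.
have pz : is_path p.
  split; first exact: zero_circle_continuous.
  move=> t; rewrite /= in_itv /= => /andP[t0 t1].
  have [a|a] := leP t 8^-1; first by apply: (@inside_X _ strip); apply: h0; rewrite t0.
  have [a1|a1] := leP t (3 / 8); first by apply: (@inside_X _ upper_half); apply: h1; rewrite ltW.
  have [a2|a2] := leP t (5 / 8); first by apply: (@inside_X _ left_half); apply: h2; rewrite ltW.
  have [a3|a3] := leP t (7 / 8); first by apply: (@inside_X _ lower_half); apply: h3; rewrite ltW.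
  by apply: (@inside_X _ strip); apply: h4; rewrite ltW.
have ps : is_path (spoke strip (@zero_center R)) by exact: spoke_path.
have s01 : spoke strip zero_center 1 = p 0 by rewrite spoke1 /p zero_circle0.
have L : is_loop (path_cat (path_cat (spoke strip zero_center) (@zero_circle R))
     (fun t => spoke strip zero_center (1 - t))).
  apply: is_loop_path; rewrite ?path_cat0 ?path_cat1 ?subrr ?spoke0//.
  apply: is_path_cat; [exact: is_path_cat|exact: is_path_rev|].
  by rewrite path_cat1 zero_circle1 subr0 spoke1.
exists (mk_loop L); split; first exact: mk_loopE.
rewrite -cls_mk; transitivity (track (spoke strip zero_center) p strip 1).
  rewrite /track {2}/p zero_circle1; congr cls; congr path_cat; congr path_cat.
  by apply/funext => u; rewrite mulr1.
rewrite (track_cycle ps pz (spoke0 _ _) s01 h0 h1 h2 h3 h4); last by rewrite /p zero_circle0.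
have [[a1 a2] [b1 b2] [c1 c2] [d1 d2]] := cycle_corners h0 h1 h2 h3 h4.
rewrite (turn_above (V := strip) (W := upper_half) isT isT a1 a2 a2) mul1g.
rewrite (turn_above (V := upper_half) (W := left_half) isT isT b1 b2 b1) mul1g.
have [l1 l2] := left_lowP; have [r1 r2] := strip_lowP.
rewrite class_around1 class_around_infty (turn_const c1 c2 l1 l2) (turn_const d1 d2 r2 r1).
congr (_ * _)%g; apply/esym.
  by rewrite -[LHS]mulg1 -(turn_inv l2 l1) mulgA mulVg mul1g.
by rewrite -[LHS]mulg1 -(turn_inv r1 r2) mulgA mulVg mul1g.
Qed.

Lemma inside_open V (x : R[i]) : inside V x -> \forall z \near x, inside V z.
Proof.
have E (z : R[i]) (h : R) : modulus (z - x) < h ->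
    `|complex.Re z - complex.Re x| < h /\ `|complex.Im z - complex.Im x| < h.
  move=> zh; split; apply: le_lt_trans zh.
    by apply: le_trans (Re_le_modulus _); case: z; case: x.
  by apply: le_trans (Im_le_modulus _); case: z; case: x.
case: V; rewrite /=.
- move=> h; apply/nbhs_modulusP; exists (complex.Re x - 1) => [|z /E[]]; first by rewrite subr_gt0.
  by rewrite ltr_norml => /andP[? ?] _; rewrite /=; lra.
- move=> h; apply/nbhs_modulusP; exists (complex.Im x) => [//|z /E[_]].
  by rewrite ltr_norml => /andP[? ?]; rewrite /=; lra.
- move=> h; apply/nbhs_modulusP; exists (- complex.Im x) => [|z /E[_]]; first by rewrite oppr_gt0.
  by rewrite ltr_norml => /andP[? ?]; rewrite /=; lra.
- move=> h; apply/nbhs_modulusP; exists (- complex.Re x) => [|z /E[]]; first by rewrite oppr_gt0.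
  by rewrite ltr_norml => /andP[? ?] _; rewrite /=; lra.
- move=> [h1 h2]; apply/nbhs_modulusP; exists (Num.min (complex.Re x) (1 - complex.Re x)).
    by rewrite lt_min h1 subr_gt0.
  move=> z /E[]; rewrite lt_min !ltr_norml => /andP[/andP[? ?] /andP[? ?]] _; rewrite /=; split; lra.
Qed.

(** Two loops generate: follow a loop through the five pieces, and record a turn
    each time that the piece changes. *)
Lemma pi1_generated (S : set (@pi1_C01 R)) : is_subgroup S ->
  S (pi1_class base_point_in (@loop_around_infty R)) -> S (pi1_class base_point_in (@loop_around1 R)) ->
  forall w, S w.
Proof.
move=> [S1 SV] Sr St.
have SI w : S w -> S w^-1%g by move=> Sw; rewrite -[w^-1%g]mul1g; exact: SV.
have SM v w : S v -> S w -> S (v * w)%g by move=> Sv Sw; rewrite -[w]invgK; apply: SV => //; exact: SI.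
rewrite class_around_infty in Sr; rewrite class_around1 in St.
have inv V W x : inside V x -> inside W x -> turn V W x = (turn W V x)^-1%g.
  by move=> Vx Wx; rewrite -[LHS]mulg1 -(mulgV (turn W V x)) mulgA turn_inv// mul1g.
have [l1 l2] := left_lowP; have [r1 r2] := strip_lowP.
have mem V W x : inside V x -> inside W x -> S (turn V W x).
  have LA z : inside lower_half z -> inside left_half z -> S (turn lower_half left_half z).
    by move=> h1 h2; rewrite (turn_const h1 h2 l2 l1).
  have BL z : inside strip z -> inside lower_half z -> S (turn strip lower_half z).
    by move=> h1 h2; rewrite (turn_const h1 h2 r1 r2).
  have IS V' W' : inside V' x -> inside W' x -> S (turn V' W' x) -> S (turn W' V' x).
    by move=> h1 h2 h3; rewrite inv//; exact: SI.
  have E1 V' W' : turn V' W' x = 1%g -> S (turn V' W' x) by move=> ->.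
  case: V => hV; case: W => hW.
  - exact/E1/turn_refl.
  - exact/E1/(turn_right (V := upper_half) isT hW hV).2.
  - exact/E1/(turn_right (V := lower_half) isT hW hV).2.
  - by exfalso; move: hV hW; rewrite /=; lra.
  - by exfalso; move: hV hW; rewrite /=; lra.
  - exact/E1/(turn_right (V := upper_half) isT hV hW).1.
  - exact/E1/turn_refl.
  - by exfalso; move: hV hW; rewrite /=; lra.
  - exact/E1/(turn_above (V := upper_half) (W := left_half) isT isT hV hW hV).
  - exact/E1/(turn_above (V := upper_half) (W := strip) isT isT hV hW hV).
  - exact/E1/(turn_right (V := lower_half) isT hV hW).1.
  - by exfalso; move: hV hW; rewrite /=; lra.
  - exact/E1/turn_refl.
  - exact: LA.
  - exact: IS hW hV (BL x hW hV).
  - by exfalso; move: hV hW; rewrite /=; lra.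
  - exact/E1/(turn_above (V := left_half) (W := upper_half) isT isT hV hW hW).
  - exact: IS hW hV (LA x hW hV).
  - exact/E1/turn_refl.
  - by exfalso; move: hV hW; rewrite /=; lra.
  - by exfalso; move: hV hW; rewrite /=; lra.
  - exact/E1/(turn_above (V := strip) (W := upper_half) isT isT hV hW hW).
  - exact: BL.
  - by exfalso; move: hV hW; rewrite /=; lra.
  - exact/E1/turn_refl.
move=> w; rewrite -(pi1_class_repr w) -track_loop.
set p := repr w; have pp := loop_path p; have ps := spoke_const_path.
have s01 : spoke right_half b 1 = p 0 by rewrite spoke1 loop0.
suff : forall t, I t -> forall V, inside V (p t) -> S (track (spoke right_half b) p V t).
  by apply; [exact: unit_itv1|rewrite loop1; exact: inside_b].
have st (t1 t2 : R) V : t1 <= t2 -> I t1 -> I t2 -> (forall s, t1 <= s <= t2 -> inside V (p s)) ->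
    track (spoke right_half b) p V t1 = track (spoke right_half b) p V t2.
  by move=> h1 h2 h3 h4; exact: (track_stay ps pp (spoke0 _ _) s01 h1 h2 h3 h4).
have tn V W (t : R) : I t -> inside V (p t) -> inside W (p t) -> S (track (spoke right_half b) p W t) ->
    S (track (spoke right_half b) p V t).
  move=> It Vt Wt SW; rewrite (track_turn ps pp (spoke0 _ _) s01 It Vt Wt); apply: SM => //.
  exact: mem.
apply: propagation; last first.
  move=> V V0; apply: (tn V right_half 0 (@unit_itv0 R) V0); first by rewrite loop0; exact: inside_b.
  rewrite (track_start s01)//; first by rewrite loop0; exact: inside_b.
  by rewrite loop0.
move=> t It; have [V Vt] := inside_cover (loop_in p It).
have [d d0 Hd] := path_near pp.1 It (inside_open Vt).
exists d => // t1 t2 I1 I2 a1 a2 H1 W Wt.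
have Vs s : (t1 <= s <= t2) || (t2 <= s <= t1) -> inside V (p s).
  move=> hs; apply: Hd.
    move: I1 I2; rewrite /= !in_itv /= => /andP[? ?] /andP[? ?].
    by case/orP: hs => /andP[? ?]; apply/andP; split; lra.
  move: a1 a2; rewrite !ltr_norml => /andP[? ?] /andP[? ?].
  by case/orP: hs => /andP[? ?]; apply/andP; split; lra.
have V1 : inside V (p t1) by apply: Hd.
have V2 : inside V (p t2) by apply: Hd.
apply: (tn W V t2 I2 Wt V2).
have SV1 := H1 V V1.
have [t12|/ltW t21] := leP t1 t2.
  by rewrite -(st t1 t2 V t12 I1 I2)// => s hs; apply: Vs; rewrite hs.
by rewrite (st t2 t1 V t21 I2 I1)// => s hs; apply: Vs; rewrite hs orbT.
Qed.

End circles.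

(** * Rigidity *)

Section levelt.
Variable F : fieldType.

Lemma det_rank_one n (u : 'cV[F]_n) (v : 'rV[F]_n) : \det (1%:M - u *m v) = 1 - (v *m u) 0 0.
Proof.
pose L1 := block_mx 1%:M u v (1%:M : 'M[F]_1).
have E1 : L1 = block_mx 1%:M 0 v 1%:M *m block_mx 1%:M u 0 (1%:M - v *m u).
  rewrite mulmx_block ?mul1mx ?mul0mx ?mulmx1 ?mulmx0 ?addr0 ?add0r.
  by rewrite addrC subrK.
have E2 : L1 = block_mx 1%:M u 0 1%:M *m block_mx (1%:M - u *m v) 0 v 1%:M.
  rewrite mulmx_block ?mul1mx ?mul0mx ?mulmx1 ?mulmx0 ?add0r ?addr0.
  by rewrite subrK.
have : \det L1 = \det L1 by [].
rewrite {1}E2 E1 !det_mulmx !det_ublock !det_lblock !det1 !mul1r !mulr1 => ->.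
by rewrite det_mx11 !mxE eqxx.
Qed.

Lemma sum_eq0 (V : zmodType) (a b d e k : V) : a + b + d + e + k = 0 -> a = - (b + d + e + k).
Proof. by move=> H; apply/eqP; rewrite -addr_eq0 !addrA; apply/eqP. Qed.

Variable y : F.
Local Notation s1 := (y ^+ 3 - 2 * y).
Local Notation s2 := (y ^+ 4 - 3 * y ^+ 2 + 2).
Local Notation h := (4 + s1).
Local Notation delta := (((y + 2) * (y - 1)) ^+ 2).

Definition row4 (a b c d : F) : 'rV[F]_4 := \row_i nth 0 [:: a; b; c; d] i.

Lemma row4E (v : 'rV[F]_4) : v = row4 (v 0 (inord 0)) (v 0 (inord 1)) (v 0 (inord 2)) (v 0 (inord 3)).
Proof.
apply/rowP => i; rewrite mxE; case: i => [[|[|[|[|i]]]] hi] //=; congr (v 0 _); apply: val_inj;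
  by rewrite /= inordK.
Qed.

Definition mx4 (r0 r1 r2 r3 : 'rV[F]_4) : 'M[F]_4 := \matrix_(i, j) nth 0 [:: r0; r1; r2; r3] i 0 j.

Lemma row4_mul a b c d r0 r1 r2 r3 :
  row4 a b c d *m mx4 r0 r1 r2 r3 = a *: r0 + b *: r1 + c *: r2 + d *: r3.
Proof.
apply/rowP => j; rewrite !mxE !big_ord_recl big_ord0 !mxE /= addr0.
by rewrite !addrA.
Qed.

(** The rotation, up to sign the local monodromy at infinity, and the
    transvection, in the basis of the sequences u(k-2), u(k-1), u(k), u(k+1). *)
Definition model_S := mx4 (row4 0 1 0 0) (row4 0 0 1 0) (row4 0 0 0 1) (row4 (-1) s1 (- s2) s1).
Definition model_H := row4 0 h (2 * h - delta) h.
Definition model_T := 1%:M + (row4 1 0 0 0)^T *m model_H.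

Lemma model_SE a b c d : row4 a b c d *m model_S = row4 (- d) (a + s1 * d) (b - s2 * d) (c + s1 * d).
Proof.
rewrite row4_mul; apply/rowP => i; rewrite !mxE.
by case: i => [[|[|[|[|i]]]] hi] //=; rewrite ?mxE /=; ring.
Qed.

Lemma row4D a b c d a' b' c' d' : row4 a b c d + row4 a' b' c' d' = row4 (a + a') (b + b') (c + c') (d + d').
Proof. by apply/rowP => i; rewrite !mxE; case: i => [[|[|[|[|i]]]] hi]. Qed.

Lemma row4Z k a b c d : k *: row4 a b c d = row4 (k * a) (k * b) (k * c) (k * d).
Proof. by apply/rowP => i; rewrite !mxE; case: i => [[|[|[|[|i]]]] hi]. Qed.

Lemma row4_dot a b c d a' b' c' d' : (row4 a b c d *m (row4 a' b' c' d')^T) 0 0 =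
  a * a' + b * b' + c * c' + d * d'.
Proof. by rewrite mxE !big_ord_recl big_ord0 !mxE /= addr0 !addrA. Qed.

Lemma model_TE (v : 'rV[F]_4) : v *m model_T = v + v 0 (inord 0) *: model_H.
Proof.
rewrite /model_T mulmxDr mulmx1 mulmxA {2}(row4E v) [_ *m (row4 1 0 0 0)^T]mx11_scalar row4_dot.
by rewrite mul_scalar_mx !mulr0 mulr1 !addr0.
Qed.

Variables (g T : 'M[F]_4) (c : 'cV[F]_4) (l : 'rV[F]_4).
Hypothesis TE : T = 1%:M + c *m l.
Local Notation chi x := (x ^+ 4 + s1 * x ^+ 3 + s2 * x ^+ 2 + s1 * x + 1).
Hypothesis CH : g *m g *m g *m g + s1 *: (g *m g *m g) + s2 *: (g *m g) + s1 *: g + 1%:M = 0.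
Hypothesis det_g : forall x, x \in [:: 0; 1; -1; 2] -> \det (x%:M - g) = chi x /\ chi x != 0.
Hypothesis det_Tg : forall x, x \in [:: 0; 1; -1; 2] -> \det (x%:M - T *m g) = (x - 1) ^+ 4.
Hypothesis nz : [/\ (2 : F) != 0, (3 : F) != 0 & delta != 0].

Definition moment (w : 'rV[F]_4) : F := (w *m c) 0 0.
Local Notation m1 := (moment (l *m g)).
Local Notation m2 := (moment (l *m g *m g)).
Local Notation m3 := (moment (l *m g *m g *m g)).
Local Notation m4 := (moment (l *m g *m g *m g *m g)).

Lemma momentD u v : moment (u + v) = moment u + moment v.
Proof. by rewrite /moment mulmxDl mxE. Qed.
Lemma momentZ k u : moment (k *: u) = k * moment u.
Proof. by rewrite /moment -scalemxAl mxE. Qed.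

Lemma resolvent x : x \in [:: 0; 1; -1; 2] ->
  (x - 1) ^+ 4 = chi x - (m4 + (x + s1) * m3 + (x ^+ 2 + s1 * x + s2) * m2 +
                            (x ^+ 3 + s1 * x ^+ 2 + s2 * x + s1) * m1).
Proof.
move=> xs; have [dg chi0] := det_g xs.
have gU : x%:M - g \in unitmx by rewrite unitmxE unitfE dg.
pose B := g *m g *m g + (x + s1) *: (g *m g) + (x ^+ 2 + s1 * x + s2) *: g + (x ^+ 3 + s1 * x ^+ 2 + s2 * x + s1)%:M.
have BE : B *m (x%:M - g) = (chi x)%:M.
  have CH' : g *m g *m g *m g = - (s1 *: (g *m g *m g) + s2 *: (g *m g) + s1 *: g + 1%:M).
    exact: sum_eq0 CH.
  rewrite mulmxBr mul_mx_scalar /B !mulmxDl -!scalemxAl mul_scalar_mx CH' !scalerDr !scalerA.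
  apply/matrixP => i j; rewrite !mxE.
  move: ((g *m g *m g) i j) ((g *m g) i j) (g i j) => a b d.
  by case: (i == j); rewrite ?mulr1n ?mulr0n; ring.
have xT : x%:M - T *m g = (1%:M - (c *m (l *m g)) *m invmx (x%:M - g)) *m (x%:M - g).
  by rewrite mulmxBl mul1mx (mulmxKV gU) TE mulmxDl mul1mx opprD addrA -(mulmxA c).
have inv : invmx (x%:M - g) = (chi x)^-1 *: B.
  apply: (can_inj (mulmxK gU)); rewrite mulVmx// -scalemxAl BE scale_scalar_mx mulVf//.
have := det_Tg xs; rewrite xT det_mulmx dg -mulmxA det_rank_one => <-.
have -> : (l *m g *m invmx (x%:M - g) *m c) 0 0 = (chi x)^-1 * moment (l *m g *m B).
  by rewrite inv -scalemxAr -scalemxAl mxE.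
rewrite mulrBl mul1r mulrAC mulVf// mul1r; congr (_ - _).
rewrite /B !mulmxDr -!scalemxAr mul_mx_scalar !momentD !momentZ !mulmxA.
ring.
Qed.

Lemma moments : [/\ m1 = h, m2 = s2 - 6 - s1 * h, m3 = h - s1 * m2 - s2 * h & moment l = 0].
Proof.
have [n2 n3 _] := nz.
have e0 := resolvent (x := 0); have e1 := resolvent (x := 1); have e2 := resolvent (x := -1).
have e3 := resolvent (x := 2); rewrite !inE !eqxx ?orbT in e0 e1 e2 e3.
move: (e0 isT) (e1 isT) (e2 isT) (e3 isT) => {e0 e1 e2 e3}.
have CHl : m4 + s1 * m3 + s2 * m2 + s1 * m1 + moment l = 0.
  have := congr1 (fun M => moment (l *m M)) CH; rewrite !mulmxDr -!scalemxAr mulmx1 !mulmxA.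
  by rewrite !momentD !momentZ mulmx0 {6}/moment mul0mx mxE.
move: CHl; move: m1 m2 m3 m4 (moment l) => a b d e k CHl e0 e1 e2 e3.
(* The four values determine a polynomial of degree 3. *)
pose k0 := e + s1 * d + s2 * b + s1 * a.
pose k1 := d + s1 * b + s2 * a - h.
pose k2 := b + s1 * a - (s2 - 6).
pose k3 := a - h.
have q x : (x - 1) ^+ 4 = chi x - (e + (x + s1) * d + (x ^+ 2 + s1 * x + s2) * b +
                            (x ^+ 3 + s1 * x ^+ 2 + s2 * x + s1) * a) ->
  k0 + k1 * x + k2 * x ^+ 2 + k3 * x ^+ 3 = 0.
  move=> /eqP; rewrite -subr_eq0 => /eqP H; rewrite -[RHS]H /k0 /k1 /k2 /k3; ring.
have f0 := q _ e0; have f1 := q _ e1; have f2 := q _ e2; have f3 := q _ e3.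
have r0 : k0 = 0 by rewrite -[RHS]f0; ring.
rewrite r0 in f1 f2 f3.
have z2 : k2 = 0.
  apply: (mulfI n2); rewrite mulr0.
  have -> : 2 * k2 = (0 + k1 * 1 + k2 * 1 ^+ 2 + k3 * 1 ^+ 3) +
    (0 + k1 * (-1) + k2 * (-1) ^+ 2 + k3 * (-1) ^+ 3) by ring.
  by rewrite f1 f2 addr0.
have z3 : k3 = 0.
  have : 2 * 3 * k3 = 0.
    have -> : 2 * 3 * k3 = (0 + k1 * 2 + k2 * 2 ^+ 2 + k3 * 2 ^+ 3) -
      2 * (0 + k1 * 1 + k2 * 1 ^+ 2 + k3 * 1 ^+ 3) - 2 * k2 by ring.
    by rewrite f1 f3 z2 !mulr0 !subr0.
  by move/eqP; rewrite !mulf_eq0 (negbTE n2) (negbTE n3) => /eqP.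
have z1 : k1 = 0 by move: f1; rewrite z2 z3 => <-; ring.
have A : a = h by apply/eqP; rewrite -subr_eq0 -/k3 z3.
have Bq : b = s2 - 6 - s1 * h by apply/eqP; rewrite -subr_eq0 -[X in _ == X]z2 /k2 A; apply/eqP; ring.
split=> //.
  by apply/eqP; rewrite -subr_eq0 -[X in _ == X]z1 /k1 A; apply/eqP; ring.
by move: CHl; rewrite -/k0 r0 add0r.
Qed.

(** The coordinates of a vector are moments of its orbit under [g]. *)
Let ep w := moment (w *m g).
Let ga w := - ep (w *m g) - s1 * ep w.
Let be w := - ga (w *m g) + s2 * ep w.
Definition levelt_row w := row4 (moment w) (be w) (ga w) (ep w).

Lemma levelt_S w : levelt_row (w *m g) = - (levelt_row w *m model_S).
Proof.
rewrite model_SE -scaleN1r row4Z /levelt_row; congr row4.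
- by rewrite mulN1r opprK.
- rewrite mulN1r /be /ga /ep.
  have := congr1 (fun M => moment (w *m M)) CH; rewrite !mulmxDr -!scalemxAr mulmx1 !mulmxA.
  rewrite !momentD !momentZ mulmx0 {6}/moment mul0mx mxE => H.
  apply/eqP; rewrite -subr_eq0 -[X in _ == X]H; apply/eqP; ring.
- by rewrite mulN1r /be; ring.
- by rewrite mulN1r /ga; ring.
Qed.

Lemma levelt_l : levelt_row l = model_H.
Proof.
have [E1 E2 E3 E0] := moments.
rewrite /levelt_row /model_H /be /ga /ep; congr row4 => //.
- by rewrite E3 E1; ring.
- by rewrite E2 E1; ring.
Qed.

Lemma levelt_lin : {Q : 'M[F]_4 | forall w, w *m Q = levelt_row w}.
Proof.
exists (\matrix_(i, j) levelt_row (delta_mx 0 i) 0 j) => w.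
have L : linear levelt_row.
  move=> k u v; rewrite /levelt_row row4Z row4D /be /ga /ep !mulmxDl -!scalemxAl !momentD !momentZ.
  by congr row4; ring.
pose f : {linear 'rV[F]_4 -> 'rV[F]_4} := HB.pack levelt_row (GRing.isLinear.Build _ _ _ _ levelt_row L).
rewrite -[RHS]/(f w) -mul_rV_lin1; congr (w *m _).
by apply/matrixP => i j; rewrite !mxE.
Qed.

(** Rigidity: the two characteristic polynomials determine the moments of the
    rotated covectors, hence the action of [g] and [T] on the coordinates in
    which the model is written. *)
Lemma levelt : exists2 Q, Q \in unitmx & g *m Q = Q *m (- model_S) /\ T *m Q = Q *m model_T.
Proof.
have [Q QE] := levelt_lin.
have gQ : g *m Q = Q *m (- model_S).
  apply/row_matrixP => i; rewrite !rowE !mulmxA QE levelt_S -QE.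
  by rewrite mulmxN.
exists Q; last first.
  split=> //; apply/row_matrixP => i; rewrite !rowE !mulmxA.
  set w := delta_mx 0 i; rewrite TE mulmxDr mulmx1 mulmxDl model_TE; congr (_ + _).
  rewrite mulmxA [w *m c]mx11_scalar mul_scalar_mx -scalemxAl QE levelt_l; congr (_ *: _).
  by rewrite QE /levelt_row /row4 [RHS]mxE inordK.
(* The image contains the orbit of [model_H] under the rotation, which spans. *)
have st (w : 'rV[F]_4) : (w <= Q)%MS -> (w *m model_S <= Q)%MS.
  move=> /submxP[u ->]; rewrite -mulmxA; have -> : Q *m model_S = - g *m Q by rewrite mulNmx gQ mulmxN opprK.
  by rewrite mulmxA submxMl.
have H0 : (model_H <= Q)%MS by rewrite -levelt_l -QE submxMl.
have leQ (v w : 'rV[F]_4) : v = w -> (v <= Q)%MS -> (w <= Q)%MS by move=> ->.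
have D k (w : 'rV[F]_4) k' (w' : 'rV[F]_4) : (w <= Q)%MS -> (w' <= Q)%MS -> ((k *: w + k' *: w')%R <= Q)%MS.
  by move=> h1 h2; rewrite addmx_sub// scalemx_sub.
have [n2 n3 d0] := nz.
(* The logarithm of the unipotent [v => ep v *: H - v S] carries [H] to the
   flag spanned by (0,1,2,1) and (1,3,3,1). *)
have nil a b c' d : (row4 a b c' d <= Q)%MS ->
    (row4 (d - a) (d * h - (a + s1 * d) - b) (d * (2 * h - delta) - (b - s2 * d) - c') (d * h - (c' + s1 * d) - d) <= Q)%MS.
  move=> h1; have := D 1 _ (-1) _ (D d _ (-1) _ H0 (st _ h1)) h1.
  rewrite model_SE /model_H !(row4Z, row4D); apply: leQ; congr row4; ring.
have E0 : (row4 0 h (2 * h - delta) h <= Q)%MS by exact: H0.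
have E1 := nil _ _ _ _ E0; have E2 := nil _ _ _ _ E1; have E3 := nil _ _ _ _ E2.
have W3 : (row4 1 3 3 1 <= Q)%MS.
  have -> : row4 1 3 3 1 = delta^-1 *: (delta *: row4 1 3 3 1) by rewrite scalerA mulVf// scale1r.
  apply: scalemx_sub; move: E3; rewrite row4Z; apply: leQ; congr row4; ring.
have W2 : (row4 0 1 2 1 <= Q)%MS.
  have -> : row4 0 1 2 1 = delta^-1 *: (delta *: row4 0 1 2 1) by rewrite scalerA mulVf// scale1r.
  apply: scalemx_sub; have := D 1 _ (- delta) _ E2 W3; rewrite !(row4Z, row4D).
  apply: leQ; congr row4; ring.
rewrite -row_full_unit -sub1mx; apply/row_subP => i; rewrite row1.
have -> : delta_mx 0 i = (delta * delta)^-1 *: ((delta * delta) *: delta_mx 0 i : 'rV[F]_4).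
  have dd : delta * delta != 0 by exact: (mulf_neq0 d0 d0).
  by rewrite scalerA (mulVf dd) scale1r.
apply: scalemx_sub; rewrite (row4E (delta_mx 0 i)).
move: (delta_mx 0 i 0 (inord 0)) (delta_mx 0 i 0 (inord 1)) (delta_mx 0 i 0 (inord 2)) (delta_mx 0 i 0 (inord 3)) => a b c' d.
have X := st _ H0; rewrite model_SE in X.
pose k0 := b + d - c' - a; pose k1 := 2 * a + d - b.
pose kap := 2 * s1 * h + 2 * h - delta + s2 * h.
(* Subtract the multiples of [H] and of its image that match the two forms
   vanishing on the flag. *)
pose r1 := - k1 * delta; pose r0 := k0 * delta + k1 * kap.
pose A3 := delta * delta * a + r1 * h; pose A2 := delta * delta * b - r1 * (s1 * h) - r0 * h - 3 * A3.
have := D 1 _ 1 _ (D r1 _ r0 _ X H0) (D A3 _ A2 _ W3 W2).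
rewrite /model_H !(row4Z, row4D); apply: leQ; congr row4; rewrite /A2 /A3 /r0 /r1 /k0 /k1 /kap; ring.
Qed.

End levelt.

(** * The invariant cone *)

(** Every inequality below is certified by an identity: the polynomial, times a
    power of 3, is a combination with nonnegative coefficients of products of
    quantities known to be nonnegative. The powers of 3 come from
    5 (2 - y) + (5 y - 7) = 3, and the numbers 7/5 and 2 enclose 2 cos (pi / N)
    for N >= 4. *)
Ltac nonneg_using t :=
  match goal with
  | H : is_true (0 <= ?x) |- is_true (0 <= ?x) => exact: H
  | |- is_true (0 <= _%:R) => exact: ler0n
  | |- is_true (0 <= 1) => exact: ler01
  | |- is_true (0 <= _ ^+ 2) => exact: sqr_ge0
  | |- is_true (0 <= _ ^+ _) => apply: exprn_ge0; nonneg_using t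
  | |- is_true (0 <= _ * _) => apply: mulr_ge0; nonneg_using t
  | |- is_true (0 <= _ + _) => first [t | apply: addr_ge0; nonneg_using t]
  | _ => t
  end.
Ltac nonneg := nonneg_using ltac:(fail).

Section cone_certificates.
Variable F : realFieldType.
Variable y : F.
Hypotheses (y7 : 0 <= 5 * y - 7) (y2 : 0 <= 2 - y) (yy2 : 0 <= y ^+ 2 - 2).

Lemma pow3_gt0 k : 0 < 3 ^+ k :> F.
Proof. exact: exprn_gt0. Qed.

Section cubics.
Variables a b : F.
Hypotheses (a0 : 0 <= a) (b0 : 0 <= b).

Lemma poly_nonneg1 : 0 <= y ^+ 4 + y ^+ 3 - 2 * y ^+ 2 - y + 1.
Proof.
rewrite -(pmulr_rge0 _ (pow3_gt0 3)) (_ : 3 ^+ 3 * _ =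
  472 * (2 - y) ^+ 4 + 634 * (5 * y - 7) * (2 - y) ^+ 3 + 309 * (5 * y - 7) ^+ 2 * (2 - y) ^+ 2 + 65 * (5 * y - 7) ^+ 3 * (2 - y) + 5 * (5 * y - 7) ^+ 4); last by ring.
by nonneg.
Qed.

Lemma poly_nonneg2 : 0 <= y + 1.
Proof.
rewrite -(pmulr_rge0 _ (pow3_gt0 0)) (_ : 3 ^+ 0 * _ =
  4 * (2 - y) + (5 * y - 7)); last by ring.
by nonneg.
Qed.

Lemma poly_nonneg3 : 0 <= 4 * y ^+ 4 + 4 * y ^+ 3 - 16 * y ^+ 2 - 8 * y + 16.
Proof.
rewrite -(pmulr_rge0 _ (pow3_gt0 2)) (_ : 3 ^+ 2 * _ =
  (y ^+ 2 - 2) * (136 * (2 - y) ^+ 2 + 100 * (5 * y - 7) * (2 - y) + 16 * (5 * y - 7) ^+ 2)); last by ring.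
by nonneg.
Qed.

Lemma poly_nonneg4 : 0 <= - y ^+ 4 - y ^+ 3 + 2 * y ^+ 2 + 5 * y + 11.
Proof.
rewrite -(pmulr_rge0 _ (pow3_gt0 4)) (_ : 3 ^+ 4 * _ =
  (9 * 1000 + 584) * (2 - y) ^+ 4 + (7 * 1000 + 198) * (5 * y - 7) * (2 - y) ^+ 3 + (1 * 1000 + 893) * (5 * y - 7) ^+ 2 * (2 - y) ^+ 2 + 193 * (5 * y - 7) ^+ 3 * (2 - y) + 5 * (5 * y - 7) ^+ 4); last by ring.
by nonneg.
Qed.

Lemma cubic_nonneg1 : 0 <= (y ^+ 4 + y ^+ 3 - 2 * y ^+ 2 - y + 1) * a ^+ 3 + (- 2 * y ^+ 2 - y + 3) * (a ^+ 2 * b) + (y + 3) * (a * b ^+ 2) + (y + 1) * b ^+ 3.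
Proof.
suff : 0 <= 4 * ((y ^+ 4 + y ^+ 3 - 2 * y ^+ 2 - y + 1) * a ^+ 3 + (- 2 * y ^+ 2 - y + 3) * (a ^+ 2 * b) + (y + 3) * (a * b ^+ 2) + (y + 1) * b ^+ 3) by rewrite pmulr_rge0.
have -> : 4 * ((y ^+ 4 + y ^+ 3 - 2 * y ^+ 2 - y + 1) * a ^+ 3 + (- 2 * y ^+ 2 - y + 3) * (a ^+ 2 * b) + (y + 3) * (a * b ^+ 2) + (y + 1) * b ^+ 3) =
  (y ^+ 4 + y ^+ 3 - 2 * y ^+ 2 - y + 1) * (1 * (a * (2 * a - ((1 : F)) * b) ^+ 2)) +
  (y + 1) * (4 * (b * ((0) * a - 1 * b) ^+ 2)) +
  (4 * y ^+ 4 + 4 * y ^+ 3 - 16 * y ^+ 2 - 8 * y + 16) * (a ^+ 2 * b) +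
  (- y ^+ 4 - y ^+ 3 + 2 * y ^+ 2 + 5 * y + 11) * (a * b ^+ 2) by ring.
by nonneg_using ltac:(first [exact: poly_nonneg1 | exact: poly_nonneg2 | exact: poly_nonneg3 | exact: poly_nonneg4]).
Qed.

Lemma poly_nonneg5 : 0 <= y ^+ 2 - 1.
Proof.
rewrite -(pmulr_rge0 _ (pow3_gt0 1)) (_ : 3 ^+ 1 * _ =
  8 * (2 - y) ^+ 2 + 6 * (5 * y - 7) * (2 - y) + (5 * y - 7) ^+ 2); last by ring.
by nonneg.
Qed.

Lemma poly_nonneg6 : 0 <= 2 * y ^+ 2 - 4.
Proof.
rewrite -(pmulr_rge0 _ (pow3_gt0 0)) (_ : 3 ^+ 0 * _ =
  (y ^+ 2 - 2) * (2)); last by ring.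
by nonneg.
Qed.

Lemma cubic_nonneg2 : 0 <= (y ^+ 2 - 1) * a ^+ 3 + (y ^+ 2 - 3) * (a ^+ 2 * b) + (y ^+ 2 - 3) * (a * b ^+ 2) + (y ^+ 2 - 1) * b ^+ 3.
Proof.
suff : 0 <= 1 * ((y ^+ 2 - 1) * a ^+ 3 + (y ^+ 2 - 3) * (a ^+ 2 * b) + (y ^+ 2 - 3) * (a * b ^+ 2) + (y ^+ 2 - 1) * b ^+ 3) by rewrite pmulr_rge0.
have -> : 1 * ((y ^+ 2 - 1) * a ^+ 3 + (y ^+ 2 - 3) * (a ^+ 2 * b) + (y ^+ 2 - 3) * (a * b ^+ 2) + (y ^+ 2 - 1) * b ^+ 3) =
  (y ^+ 2 - 1) * (1 * (a * (1 * a - ((1 : F)) * b) ^+ 2)) +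
  (y ^+ 2 - 1) * (1 * (b * (((1 : F)) * a - 1 * b) ^+ 2)) +
  (2 * y ^+ 2 - 4) * (a ^+ 2 * b) +
  (2 * y ^+ 2 - 4) * (a * b ^+ 2) by ring.
by nonneg_using ltac:(first [exact: poly_nonneg5 | exact: poly_nonneg6]).
Qed.

Lemma poly_nonneg7 : 0 <= - y ^+ 5 + y ^+ 4 + 5 * y ^+ 3 - y ^+ 2 + 4.
Proof.
rewrite -(pmulr_rge0 _ (pow3_gt0 4)) (_ : 3 ^+ 4 * _ =
  (14 * 1000 + 816) * (2 - y) ^+ 5 + (17 * 1000 + 112) * (5 * y - 7) * (2 - y) ^+ 4 + (7 * 1000 + 828) * (5 * y - 7) ^+ 2 * (2 - y) ^+ 3 + (1 * 1000 + 759) * (5 * y - 7) ^+ 3 * (2 - y) ^+ 2 + 192 * (5 * y - 7) ^+ 4 * (2 - y) + 8 * (5 * y - 7) ^+ 5); last by ring.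
by nonneg.
Qed.

Lemma poly_nonneg8 : 0 <= y ^+ 5 + 3 * y ^+ 4 - y ^+ 3 - 7 * y ^+ 2 + 4.
Proof.
rewrite -(pmulr_rge0 _ (pow3_gt0 4)) (_ : 3 ^+ 4 * _ =
  (4 * 1000 + 624) * (2 - y) ^+ 5 + (7 * 1000 + 956) * (5 * y - 7) * (2 - y) ^+ 4 + (5 * 1000 + 288) * (5 * y - 7) ^+ 2 * (2 - y) ^+ 3 + (1 * 1000 + 697) * (5 * y - 7) ^+ 3 * (2 - y) ^+ 2 + 264 * (5 * y - 7) ^+ 4 * (2 - y) + 16 * (5 * y - 7) ^+ 5); last by ring.
by nonneg.
Qed.

Lemma poly_nonneg9 : 0 <= - 4 * y ^+ 7 + 4 * y ^+ 6 + 28 * y ^+ 5 - 36 * y ^+ 4 - 64 * y ^+ 3 + 88 * y ^+ 2 + 64 * y.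
Proof.
rewrite -(pmulr_rge0 _ (pow3_gt0 7)) (_ : 3 ^+ 7 * _ =
  ((6 * 1000 + 774) * 1000 + 208) * (2 - y) ^+ 7 + ((9 * 1000 + 437) * 1000 + 192) * (5 * y - 7) * (2 - y) ^+ 6 + ((5 * 1000 + 570) * 1000 + 40) * (5 * y - 7) ^+ 2 * (2 - y) ^+ 5 + ((1 * 1000 + 799) * 1000 + 764) * (5 * y - 7) ^+ 3 * (2 - y) ^+ 4 + (340 * 1000 + 664) * (5 * y - 7) ^+ 4 * (2 - y) ^+ 3 + (36 * 1000 + 888) * (5 * y - 7) ^+ 5 * (2 - y) ^+ 2 + (1 * 1000 + 984) * (5 * y - 7) ^+ 6 * (2 - y) + 32 * (5 * y - 7) ^+ 7); last by ring.
by nonneg.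
Qed.

Lemma poly_nonneg10 : 0 <= - 8 * y ^+ 6 - 3 * y ^+ 5 + 59 * y ^+ 4 + 23 * y ^+ 3 - 139 * y ^+ 2 - 32 * y + 108.
Proof.
rewrite -(pmulr_rge0 _ (pow3_gt0 6)) (_ : 3 ^+ 6 * _ =
  (64 * 1000 + 928) * (2 - y) ^+ 6 + (163 * 1000 + 872) * (5 * y - 7) * (2 - y) ^+ 5 + (149 * 1000 + 244) * (5 * y - 7) ^+ 2 * (2 - y) ^+ 4 + (60 * 1000 + 335) * (5 * y - 7) ^+ 3 * (2 - y) ^+ 3 + (11 * 1000 + 295) * (5 * y - 7) ^+ 4 * (2 - y) ^+ 2 + 840 * (5 * y - 7) ^+ 5 * (2 - y) + 8 * (5 * y - 7) ^+ 6); last by ring.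
by nonneg.
Qed.

Lemma cubic_nonneg3 : 0 <= (- y ^+ 5 + y ^+ 4 + 5 * y ^+ 3 - y ^+ 2 + 4) * a ^+ 3 + (- y ^+ 5 - y ^+ 4 + 3 * y ^+ 3 - y ^+ 2 + 12) * (a ^+ 2 * b) + (y ^+ 5 + y ^+ 4 - 3 * y ^+ 3 - 7 * y ^+ 2 + 12) * (a * b ^+ 2) + (y ^+ 5 + 3 * y ^+ 4 - y ^+ 3 - 7 * y ^+ 2 + 4) * b ^+ 3.
Proof.
suff : 0 <= 4 * ((- y ^+ 5 + y ^+ 4 + 5 * y ^+ 3 - y ^+ 2 + 4) * a ^+ 3 + (- y ^+ 5 - y ^+ 4 + 3 * y ^+ 3 - y ^+ 2 + 12) * (a ^+ 2 * b) + (y ^+ 5 + y ^+ 4 - 3 * y ^+ 3 - 7 * y ^+ 2 + 12) * (a * b ^+ 2) + (y ^+ 5 + 3 * y ^+ 4 - y ^+ 3 - 7 * y ^+ 2 + 4) * b ^+ 3) by rewrite pmulr_rge0.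
have -> : 4 * ((- y ^+ 5 + y ^+ 4 + 5 * y ^+ 3 - y ^+ 2 + 4) * a ^+ 3 + (- y ^+ 5 - y ^+ 4 + 3 * y ^+ 3 - y ^+ 2 + 12) * (a ^+ 2 * b) + (y ^+ 5 + y ^+ 4 - 3 * y ^+ 3 - 7 * y ^+ 2 + 12) * (a * b ^+ 2) + (y ^+ 5 + 3 * y ^+ 4 - y ^+ 3 - 7 * y ^+ 2 + 4) * b ^+ 3) =
  (- y ^+ 5 + y ^+ 4 + 5 * y ^+ 3 - y ^+ 2 + 4) * (1 * (a * (2 * a - ((1 : F)) * b) ^+ 2)) +
  (y ^+ 5 + 3 * y ^+ 4 - y ^+ 3 - 7 * y ^+ 2 + 4) * (4 * (b * ((- y + 2) * a - 1 * b) ^+ 2)) +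
  (- 4 * y ^+ 7 + 4 * y ^+ 6 + 28 * y ^+ 5 - 36 * y ^+ 4 - 64 * y ^+ 3 + 88 * y ^+ 2 + 64 * y) * (a ^+ 2 * b) +
  (- 8 * y ^+ 6 - 3 * y ^+ 5 + 59 * y ^+ 4 + 23 * y ^+ 3 - 139 * y ^+ 2 - 32 * y + 108) * (a * b ^+ 2) by ring.
by nonneg_using ltac:(first [exact: poly_nonneg10 | exact: poly_nonneg7 | exact: poly_nonneg8 | exact: poly_nonneg9]).
Qed.

Lemma poly_nonneg11 : 0 <= y ^+ 4 - 3 * y ^+ 2 + 2.
Proof.
rewrite -(pmulr_rge0 _ (pow3_gt0 1)) (_ : 3 ^+ 1 * _ =
  (y ^+ 2 - 2) * (8 * (2 - y) ^+ 2 + 6 * (5 * y - 7) * (2 - y) + (5 * y - 7) ^+ 2)); last by ring.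
by nonneg.
Qed.

Lemma poly_nonneg12 : 0 <= y ^+ 4 - 5 * y ^+ 2 + 8.
Proof.
rewrite -(pmulr_rge0 _ (pow3_gt0 4)) (_ : 3 ^+ 4 * _ =
  (1 * 1000 + 276) * (2 - y) ^+ 4 + 794 * (5 * y - 7) * (2 - y) ^+ 3 + 231 * (5 * y - 7) ^+ 2 * (2 - y) ^+ 2 + 44 * (5 * y - 7) ^+ 3 * (2 - y) + 4 * (5 * y - 7) ^+ 4); last by ring.
by nonneg.
Qed.

Lemma cubic_nonneg4 : 0 <= (y ^+ 4 - 3 * y ^+ 2 + 2) * a ^+ 3 + (- 2 * y ^+ 2 + 6) * (a ^+ 2 * b) + (- 2 * y ^+ 2 + 6) * (a * b ^+ 2) + (y ^+ 4 - 3 * y ^+ 2 + 2) * b ^+ 3.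
Proof.
suff : 0 <= 1 * ((y ^+ 4 - 3 * y ^+ 2 + 2) * a ^+ 3 + (- 2 * y ^+ 2 + 6) * (a ^+ 2 * b) + (- 2 * y ^+ 2 + 6) * (a * b ^+ 2) + (y ^+ 4 - 3 * y ^+ 2 + 2) * b ^+ 3) by rewrite pmulr_rge0.
have -> : 1 * ((y ^+ 4 - 3 * y ^+ 2 + 2) * a ^+ 3 + (- 2 * y ^+ 2 + 6) * (a ^+ 2 * b) + (- 2 * y ^+ 2 + 6) * (a * b ^+ 2) + (y ^+ 4 - 3 * y ^+ 2 + 2) * b ^+ 3) =
  (y ^+ 4 - 3 * y ^+ 2 + 2) * (1 * (a * (1 * a - ((1 : F)) * b) ^+ 2)) +
  (y ^+ 4 - 3 * y ^+ 2 + 2) * (1 * (b * (((1 : F)) * a - 1 * b) ^+ 2)) +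
  (y ^+ 4 - 5 * y ^+ 2 + 8) * (a ^+ 2 * b) +
  (y ^+ 4 - 5 * y ^+ 2 + 8) * (a * b ^+ 2) by ring.
by nonneg_using ltac:(first [exact: poly_nonneg11 | exact: poly_nonneg12]).
Qed.

Lemma cubic_nonneg5 : 0 <= (y + 1) * a ^+ 3 + (y + 3) * (a ^+ 2 * b) + (- 2 * y ^+ 2 - y + 3) * (a * b ^+ 2) + (y ^+ 4 + y ^+ 3 - 2 * y ^+ 2 - y + 1) * b ^+ 3.
Proof.
suff : 0 <= 4 * ((y + 1) * a ^+ 3 + (y + 3) * (a ^+ 2 * b) + (- 2 * y ^+ 2 - y + 3) * (a * b ^+ 2) + (y ^+ 4 + y ^+ 3 - 2 * y ^+ 2 - y + 1) * b ^+ 3) by rewrite pmulr_rge0.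
have -> : 4 * ((y + 1) * a ^+ 3 + (y + 3) * (a ^+ 2 * b) + (- 2 * y ^+ 2 - y + 3) * (a * b ^+ 2) + (y ^+ 4 + y ^+ 3 - 2 * y ^+ 2 - y + 1) * b ^+ 3) =
  (y + 1) * (4 * (a * (1 * a - (0) * b) ^+ 2)) +
  (y ^+ 4 + y ^+ 3 - 2 * y ^+ 2 - y + 1) * (1 * (b * (((1 : F)) * a - 2 * b) ^+ 2)) +
  (- y ^+ 4 - y ^+ 3 + 2 * y ^+ 2 + 5 * y + 11) * (a ^+ 2 * b) +
  (4 * y ^+ 4 + 4 * y ^+ 3 - 16 * y ^+ 2 - 8 * y + 16) * (a * b ^+ 2) by ring.
by nonneg_using ltac:(first [exact: poly_nonneg1 | exact: poly_nonneg2 | exact: poly_nonneg3 | exact: poly_nonneg4]).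
Qed.

Lemma cubic_nonneg6 : 0 <= (y ^+ 5 + 3 * y ^+ 4 - y ^+ 3 - 7 * y ^+ 2 + 4) * a ^+ 3 + (y ^+ 5 + y ^+ 4 - 3 * y ^+ 3 - 7 * y ^+ 2 + 12) * (a ^+ 2 * b) + (- y ^+ 5 - y ^+ 4 + 3 * y ^+ 3 - y ^+ 2 + 12) * (a * b ^+ 2) + (- y ^+ 5 + y ^+ 4 + 5 * y ^+ 3 - y ^+ 2 + 4) * b ^+ 3.
Proof.
suff : 0 <= 4 * ((y ^+ 5 + 3 * y ^+ 4 - y ^+ 3 - 7 * y ^+ 2 + 4) * a ^+ 3 + (y ^+ 5 + y ^+ 4 - 3 * y ^+ 3 - 7 * y ^+ 2 + 12) * (a ^+ 2 * b) + (- y ^+ 5 - y ^+ 4 + 3 * y ^+ 3 - y ^+ 2 + 12) * (a * b ^+ 2) + (- y ^+ 5 + y ^+ 4 + 5 * y ^+ 3 - y ^+ 2 + 4) * b ^+ 3) by rewrite pmulr_rge0.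
have -> : 4 * ((y ^+ 5 + 3 * y ^+ 4 - y ^+ 3 - 7 * y ^+ 2 + 4) * a ^+ 3 + (y ^+ 5 + y ^+ 4 - 3 * y ^+ 3 - 7 * y ^+ 2 + 12) * (a ^+ 2 * b) + (- y ^+ 5 - y ^+ 4 + 3 * y ^+ 3 - y ^+ 2 + 12) * (a * b ^+ 2) + (- y ^+ 5 + y ^+ 4 + 5 * y ^+ 3 - y ^+ 2 + 4) * b ^+ 3) =
  (y ^+ 5 + 3 * y ^+ 4 - y ^+ 3 - 7 * y ^+ 2 + 4) * (4 * (a * (1 * a - (- y + 2) * b) ^+ 2)) +
  (- y ^+ 5 + y ^+ 4 + 5 * y ^+ 3 - y ^+ 2 + 4) * (1 * (b * (((1 : F)) * a - 2 * b) ^+ 2)) +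
  (- 8 * y ^+ 6 - 3 * y ^+ 5 + 59 * y ^+ 4 + 23 * y ^+ 3 - 139 * y ^+ 2 - 32 * y + 108) * (a ^+ 2 * b) +
  (- 4 * y ^+ 7 + 4 * y ^+ 6 + 28 * y ^+ 5 - 36 * y ^+ 4 - 64 * y ^+ 3 + 88 * y ^+ 2 + 64 * y) * (a * b ^+ 2) by ring.
by nonneg_using ltac:(first [exact: poly_nonneg10 | exact: poly_nonneg7 | exact: poly_nonneg8 | exact: poly_nonneg9]).
Qed.

Lemma poly_nonneg13 : 0 <= - 3 * y ^+ 5 + 15 * y ^+ 3 - 4 * y + 16.
Proof.
rewrite -(pmulr_rge0 _ (pow3_gt0 5)) (_ : 3 ^+ 5 * _ =
  (110 * 1000 + 704) * (2 - y) ^+ 5 + (120 * 1000 + 670) * (5 * y - 7) * (2 - y) ^+ 4 + (51 * 1000 + 385) * (5 * y - 7) ^+ 2 * (2 - y) ^+ 3 + (10 * 1000 + 490) * (5 * y - 7) ^+ 3 * (2 - y) ^+ 2 + 992 * (5 * y - 7) ^+ 4 * (2 - y) + 32 * (5 * y - 7) ^+ 5); last by ring.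
by nonneg.
Qed.

Lemma poly_nonneg14 : 0 <= y ^+ 5 - y ^+ 3 + 4 * y ^+ 2 - 4 * y.
Proof.
rewrite -(pmulr_rge0 _ (pow3_gt0 5)) (_ : 3 ^+ 5 * _ =
  (15 * 1000 + 232) * (2 - y) ^+ 5 + (22 * 1000 + 930) * (5 * y - 7) * (2 - y) ^+ 4 + (13 * 1000 + 477) * (5 * y - 7) ^+ 2 * (2 - y) ^+ 3 + (3 * 1000 + 902) * (5 * y - 7) ^+ 3 * (2 - y) ^+ 2 + 560 * (5 * y - 7) ^+ 4 * (2 - y) + 32 * (5 * y - 7) ^+ 5); last by ring.
by nonneg.
Qed.

Lemma cubic_nonneg7 : 0 <= (- y ^+ 5 + y ^+ 4 + 5 * y ^+ 3 - y ^+ 2 + 4) * a ^+ 3 + (- y ^+ 5 - 2 * y ^+ 4 + 5 * y ^+ 3 + 2 * y ^+ 2 - 4 * y + 8) * (a ^+ 2 * b) + (y ^+ 4 + 4 * y ^+ 3 + 3 * y ^+ 2 - 4 * y + 4) * (a * b ^+ 2).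
Proof.
suff : 0 <= 1 * ((- y ^+ 5 + y ^+ 4 + 5 * y ^+ 3 - y ^+ 2 + 4) * a ^+ 3 + (- y ^+ 5 - 2 * y ^+ 4 + 5 * y ^+ 3 + 2 * y ^+ 2 - 4 * y + 8) * (a ^+ 2 * b) + (y ^+ 4 + 4 * y ^+ 3 + 3 * y ^+ 2 - 4 * y + 4) * (a * b ^+ 2)) by rewrite pmulr_rge0.
have -> : 1 * ((- y ^+ 5 + y ^+ 4 + 5 * y ^+ 3 - y ^+ 2 + 4) * a ^+ 3 + (- y ^+ 5 - 2 * y ^+ 4 + 5 * y ^+ 3 + 2 * y ^+ 2 - 4 * y + 8) * (a ^+ 2 * b) + (y ^+ 4 + 4 * y ^+ 3 + 3 * y ^+ 2 - 4 * y + 4) * (a * b ^+ 2)) =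
  (- y ^+ 5 + y ^+ 4 + 5 * y ^+ 3 - y ^+ 2 + 4) * (1 * (a * (1 * a - ((1 : F)) * b) ^+ 2)) +
  (- 3 * y ^+ 5 + 15 * y ^+ 3 - 4 * y + 16) * (a ^+ 2 * b) +
  (y ^+ 5 - y ^+ 3 + 4 * y ^+ 2 - 4 * y) * (a * b ^+ 2) by ring.
by nonneg_using ltac:(first [exact: poly_nonneg13 | exact: poly_nonneg14 | exact: poly_nonneg7]).
Qed.

Lemma poly_nonneg15 : 0 <= 2 * y + 2.
Proof.
rewrite -(pmulr_rge0 _ (pow3_gt0 0)) (_ : 3 ^+ 0 * _ =
  8 * (2 - y) + 2 * (5 * y - 7)); last by ring.
by nonneg.
Qed.

Lemma poly_nonneg16 : 0 <= - y ^+ 4 - y ^+ 3 + 8 * y + 12.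
Proof.
rewrite -(pmulr_rge0 _ (pow3_gt0 4)) (_ : 3 ^+ 4 * _ =
  (10 * 1000 + 384) * (2 - y) ^+ 4 + (7 * 1000 + 643) * (5 * y - 7) * (2 - y) ^+ 3 + (1 * 1000 + 950) * (5 * y - 7) ^+ 2 * (2 - y) ^+ 2 + 188 * (5 * y - 7) ^+ 3 * (2 - y) + 4 * (5 * y - 7) ^+ 4); last by ring.
by nonneg.
Qed.

Lemma poly_nonneg17 : 0 <= y ^+ 4 + y ^+ 3 - 2 * y + 2.
Proof.
rewrite -(pmulr_rge0 _ (pow3_gt0 4)) (_ : 3 ^+ 4 * _ =
  (3 * 1000 + 616) * (2 - y) ^+ 4 + (4 * 1000 + 7) * (5 * y - 7) * (2 - y) ^+ 3 + (1 * 1000 + 680) * (5 * y - 7) ^+ 2 * (2 - y) ^+ 2 + 314 * (5 * y - 7) ^+ 3 * (2 - y) + 22 * (5 * y - 7) ^+ 4); last by ring.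
by nonneg.
Qed.

Lemma cubic_nonneg8 : 0 <= (2 * y + 2) * a ^+ 3 + (- y ^+ 4 - y ^+ 3 + 2 * y + 6) * (a ^+ 2 * b) + (y ^+ 4 + y ^+ 3 + 2 * y + 6) * (a * b ^+ 2) + (2 * y + 2) * b ^+ 3.
Proof.
suff : 0 <= 1 * ((2 * y + 2) * a ^+ 3 + (- y ^+ 4 - y ^+ 3 + 2 * y + 6) * (a ^+ 2 * b) + (y ^+ 4 + y ^+ 3 + 2 * y + 6) * (a * b ^+ 2) + (2 * y + 2) * b ^+ 3) by rewrite pmulr_rge0.
have -> : 1 * ((2 * y + 2) * a ^+ 3 + (- y ^+ 4 - y ^+ 3 + 2 * y + 6) * (a ^+ 2 * b) + (y ^+ 4 + y ^+ 3 + 2 * y + 6) * (a * b ^+ 2) + (2 * y + 2) * b ^+ 3) =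
  (2 * y + 2) * (1 * (a * (1 * a - ((2 : F)) * b) ^+ 2)) +
  (2 * y + 2) * (1 * (b * (((1 : F)) * a - 1 * b) ^+ 2)) +
  (- y ^+ 4 - y ^+ 3 + 8 * y + 12) * (a ^+ 2 * b) +
  (y ^+ 4 + y ^+ 3 - 2 * y + 2) * (a * b ^+ 2) by ring.
by nonneg_using ltac:(first [exact: poly_nonneg15 | exact: poly_nonneg16 | exact: poly_nonneg17]).
Qed.

Lemma poly_nonneg18 : 0 <= - 4 * y ^+ 5 + 4 * y ^+ 4 + 20 * y ^+ 3 - 4 * y ^+ 2 + 16.
Proof.
rewrite -(pmulr_rge0 _ (pow3_gt0 4)) (_ : 3 ^+ 4 * _ =
  (59 * 1000 + 264) * (2 - y) ^+ 5 + (68 * 1000 + 448) * (5 * y - 7) * (2 - y) ^+ 4 + (31 * 1000 + 312) * (5 * y - 7) ^+ 2 * (2 - y) ^+ 3 + (7 * 1000 + 36) * (5 * y - 7) ^+ 3 * (2 - y) ^+ 2 + 768 * (5 * y - 7) ^+ 4 * (2 - y) + 32 * (5 * y - 7) ^+ 5); last by ring.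
by nonneg.
Qed.

Lemma poly_nonneg19 : 0 <= 4 * y ^+ 5 + 12 * y ^+ 4 - 4 * y ^+ 3 - 28 * y ^+ 2 + 16.
Proof.
rewrite -(pmulr_rge0 _ (pow3_gt0 4)) (_ : 3 ^+ 4 * _ =
  (18 * 1000 + 496) * (2 - y) ^+ 5 + (31 * 1000 + 824) * (5 * y - 7) * (2 - y) ^+ 4 + (21 * 1000 + 152) * (5 * y - 7) ^+ 2 * (2 - y) ^+ 3 + (6 * 1000 + 788) * (5 * y - 7) ^+ 3 * (2 - y) ^+ 2 + (1 * 1000 + 56) * (5 * y - 7) ^+ 4 * (2 - y) + 64 * (5 * y - 7) ^+ 5); last by ring.
by nonneg.
Qed.

Lemma poly_nonneg20 : 0 <= 4 * y ^+ 8 - 252 * y ^+ 7 + 220 * y ^+ 6 + (2 * 1000 + 204) * y ^+ 5 - (2 * 1000 + 208) * y ^+ 4 - (5 * 1000 + 792) * y ^+ 3 + (6 * 1000 + 16) * y ^+ 2 + (4 * 1000 + 32) * y - (3 * 1000 + 712).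
Proof.
rewrite -(pmulr_rge0 _ (pow3_gt0 8)) (_ : 3 ^+ 8 * _ =
  ((102 * 1000 + 113) * 1000 + 24) * (2 - y) ^+ 8 + ((119 * 1000 + 963) * 1000 + 456) * (5 * y - 7) * (2 - y) ^+ 7 + ((60 * 1000 + 671) * 1000) * (5 * y - 7) ^+ 2 * (2 - y) ^+ 6 + ((20 * 1000 + 777) * 1000 + 516) * (5 * y - 7) ^+ 3 * (2 - y) ^+ 5 + ((6 * 1000 + 249) * 1000 + 512) * (5 * y - 7) ^+ 4 * (2 - y) ^+ 4 + ((1 * 1000 + 452) * 1000 + 416) * (5 * y - 7) ^+ 5 * (2 - y) ^+ 3 + (198 * 1000 + 464) * (5 * y - 7) ^+ 6 * (2 - y) ^+ 2 + (12 * 1000 + 32) * (5 * y - 7) ^+ 7 * (2 - y) + 128 * (5 * y - 7) ^+ 8); last by ring.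
by nonneg.
Qed.

Lemma poly_nonneg21 : 0 <= 4 * y ^+ 8 + 4 * y ^+ 7 - 164 * y ^+ 6 - 112 * y ^+ 5 + (1 * 1000 + 4) * y ^+ 4 + 540 * y ^+ 3 - (1 * 1000 + 932) * y ^+ 2 - 576 * y + (1 * 1000 + 72).
Proof.
rewrite -(pmulr_rge0 _ (pow3_gt0 8)) (_ : 3 ^+ 8 * _ =
  ((31 * 1000 + 873) * 1000 + 664) * (2 - y) ^+ 8 + ((112 * 1000 + 599) * 1000 + 584) * (5 * y - 7) * (2 - y) ^+ 7 + ((127 * 1000 + 85) * 1000) * (5 * y - 7) ^+ 2 * (2 - y) ^+ 6 + ((69 * 1000 + 976) * 1000 + 616) * (5 * y - 7) ^+ 3 * (2 - y) ^+ 5 + ((21 * 1000 + 429) * 1000 + 164) * (5 * y - 7) ^+ 4 * (2 - y) ^+ 4 + ((3 * 1000 + 744) * 1000 + 980) * (5 * y - 7) ^+ 5 * (2 - y) ^+ 3 + (351 * 1000 + 740) * (5 * y - 7) ^+ 6 * (2 - y) ^+ 2 + (14 * 1000 + 48) * (5 * y - 7) ^+ 7 * (2 - y) + 32 * (5 * y - 7) ^+ 8); last by ring.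
by nonneg.
Qed.

Lemma cubic_nonneg9 : 0 <= (- 4 * y ^+ 5 + 4 * y ^+ 4 + 20 * y ^+ 3 - 4 * y ^+ 2 + 16) * a ^+ 3 + (y ^+ 8 + y ^+ 7 - 9 * y ^+ 6 - 13 * y ^+ 5 + 12 * y ^+ 4 + 28 * y ^+ 3 - 20 * y ^+ 2 - 16 * y + 48) * (a ^+ 2 * b) + (y ^+ 8 + y ^+ 7 - 9 * y ^+ 6 - 5 * y ^+ 5 + 36 * y ^+ 4 + 20 * y ^+ 3 - 44 * y ^+ 2 - 16 * y + 48) * (a * b ^+ 2) + (4 * y ^+ 5 + 12 * y ^+ 4 - 4 * y ^+ 3 - 28 * y ^+ 2 + 16) * b ^+ 3.
Proof.
suff : 0 <= 4 * ((- 4 * y ^+ 5 + 4 * y ^+ 4 + 20 * y ^+ 3 - 4 * y ^+ 2 + 16) * a ^+ 3 + (y ^+ 8 + y ^+ 7 - 9 * y ^+ 6 - 13 * y ^+ 5 + 12 * y ^+ 4 + 28 * y ^+ 3 - 20 * y ^+ 2 - 16 * y + 48) * (a ^+ 2 * b) + (y ^+ 8 + y ^+ 7 - 9 * y ^+ 6 - 5 * y ^+ 5 + 36 * y ^+ 4 + 20 * y ^+ 3 - 44 * y ^+ 2 - 16 * y + 48) * (a * b ^+ 2) + (4 * y ^+ 5 + 12 * y ^+ 4 - 4 * y ^+ 3 - 28 * y ^+ 2 + 16) * b ^+ 3) by rewrite pmulr_rge0.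
have -> : 4 * ((- 4 * y ^+ 5 + 4 * y ^+ 4 + 20 * y ^+ 3 - 4 * y ^+ 2 + 16) * a ^+ 3 + (y ^+ 8 + y ^+ 7 - 9 * y ^+ 6 - 13 * y ^+ 5 + 12 * y ^+ 4 + 28 * y ^+ 3 - 20 * y ^+ 2 - 16 * y + 48) * (a ^+ 2 * b) + (y ^+ 8 + y ^+ 7 - 9 * y ^+ 6 - 5 * y ^+ 5 + 36 * y ^+ 4 + 20 * y ^+ 3 - 44 * y ^+ 2 - 16 * y + 48) * (a * b ^+ 2) + (4 * y ^+ 5 + 12 * y ^+ 4 - 4 * y ^+ 3 - 28 * y ^+ 2 + 16) * b ^+ 3) =
  (- 4 * y ^+ 5 + 4 * y ^+ 4 + 20 * y ^+ 3 - 4 * y ^+ 2 + 16) * (1 * (a * (2 * a - ((3 : F)) * b) ^+ 2)) +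
  (4 * y ^+ 5 + 12 * y ^+ 4 - 4 * y ^+ 3 - 28 * y ^+ 2 + 16) * (4 * (b * ((- 4 * y + 8) * a - 1 * b) ^+ 2)) +
  (4 * y ^+ 8 - 252 * y ^+ 7 + 220 * y ^+ 6 + (2 * 1000 + 204) * y ^+ 5 - (2 * 1000 + 208) * y ^+ 4 - (5 * 1000 + 792) * y ^+ 3 + (6 * 1000 + 16) * y ^+ 2 + (4 * 1000 + 32) * y - (3 * 1000 + 712)) * (a ^+ 2 * b) +
  (4 * y ^+ 8 + 4 * y ^+ 7 - 164 * y ^+ 6 - 112 * y ^+ 5 + (1 * 1000 + 4) * y ^+ 4 + 540 * y ^+ 3 - (1 * 1000 + 932) * y ^+ 2 - 576 * y + (1 * 1000 + 72)) * (a * b ^+ 2) by ring.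
by nonneg_using ltac:(first [exact: poly_nonneg18 | exact: poly_nonneg19 | exact: poly_nonneg20 | exact: poly_nonneg21]).
Qed.

Lemma poly_nonneg22 : 0 <= 4 * y + 4.
Proof.
rewrite -(pmulr_rge0 _ (pow3_gt0 0)) (_ : 3 ^+ 0 * _ =
  16 * (2 - y) + 4 * (5 * y - 7)); last by ring.
by nonneg.
Qed.

Lemma poly_nonneg23 : 0 <= y ^+ 5 + 3 * y ^+ 4 - y ^+ 3 - 7 * y ^+ 2 + 4 * y + 8.
Proof.
rewrite -(pmulr_rge0 _ (pow3_gt0 4)) (_ : 3 ^+ 4 * _ =
  (14 * 1000 + 624) * (2 - y) ^+ 5 + (18 * 1000 + 456) * (5 * y - 7) * (2 - y) ^+ 4 + (9 * 1000 + 688) * (5 * y - 7) ^+ 2 * (2 - y) ^+ 3 + (2 * 1000 + 617) * (5 * y - 7) ^+ 3 * (2 - y) ^+ 2 + 360 * (5 * y - 7) ^+ 4 * (2 - y) + 20 * (5 * y - 7) ^+ 5); last by ring.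
by nonneg.
Qed.

Lemma poly_nonneg24 : 0 <= - 9 * y ^+ 5 - 171 * y ^+ 4 - 567 * y ^+ 3 - 369 * y ^+ 2 + (2 * 1000 + 652) * y + (3 * 1000 + 768).
Proof.
rewrite -(pmulr_rge0 _ (pow3_gt0 3)) (_ : 3 ^+ 3 * _ =
  ((1 * 1000 + 561) * 1000 + 248) * (2 - y) ^+ 5 + ((1 * 1000 + 404) * 1000 + 376) * (5 * y - 7) * (2 - y) ^+ 4 + (473 * 1000 + 960) * (5 * y - 7) ^+ 2 * (2 - y) ^+ 3 + (71 * 1000 + 205) * (5 * y - 7) ^+ 3 * (2 - y) ^+ 2 + (4 * 1000 + 40) * (5 * y - 7) ^+ 4 * (2 - y) + 4 * (5 * y - 7) ^+ 5); last by ring.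
by nonneg.
Qed.

Lemma poly_nonneg25 : 0 <= 216 * y ^+ 5 + 504 * y ^+ 4 - 792 * y ^+ 3 - (1 * 1000 + 944) * y ^+ 2 + 416 * y + (2 * 1000 + 432).
Proof.
rewrite -(pmulr_rge0 _ (pow3_gt0 4)) (_ : 3 ^+ 4 * _ =
  (134 * 1000 + 144) * (2 - y) ^+ 5 + (133 * 1000 + 728) * (5 * y - 7) * (2 - y) ^+ 4 + (152 * 1000 + 80) * (5 * y - 7) ^+ 2 * (2 - y) ^+ 3 + (81 * 1000 + 160) * (5 * y - 7) ^+ 3 * (2 - y) ^+ 2 + (17 * 1000 + 856) * (5 * y - 7) ^+ 4 * (2 - y) + (1 * 1000 + 376) * (5 * y - 7) ^+ 5); last by ring.
by nonneg.
Qed.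

Lemma cubic_nonneg10 : 0 <= (4 * y + 4) * a ^+ 3 + (- y ^+ 4 - 4 * y ^+ 3 - 3 * y ^+ 2 + 8 * y + 16) * (a ^+ 2 * b) + (y ^+ 5 + 2 * y ^+ 4 - 5 * y ^+ 3 - 10 * y ^+ 2 + 8 * y + 20) * (a * b ^+ 2) + (y ^+ 5 + 3 * y ^+ 4 - y ^+ 3 - 7 * y ^+ 2 + 4 * y + 8) * b ^+ 3.
Proof.
suff : 0 <= 144 * ((4 * y + 4) * a ^+ 3 + (- y ^+ 4 - 4 * y ^+ 3 - 3 * y ^+ 2 + 8 * y + 16) * (a ^+ 2 * b) + (y ^+ 5 + 2 * y ^+ 4 - 5 * y ^+ 3 - 10 * y ^+ 2 + 8 * y + 20) * (a * b ^+ 2) + (y ^+ 5 + 3 * y ^+ 4 - y ^+ 3 - 7 * y ^+ 2 + 4 * y + 8) * b ^+ 3) by rewrite pmulr_rge0.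
have -> : 144 * ((4 * y + 4) * a ^+ 3 + (- y ^+ 4 - 4 * y ^+ 3 - 3 * y ^+ 2 + 8 * y + 16) * (a ^+ 2 * b) + (y ^+ 5 + 2 * y ^+ 4 - 5 * y ^+ 3 - 10 * y ^+ 2 + 8 * y + 20) * (a * b ^+ 2) + (y ^+ 5 + 3 * y ^+ 4 - y ^+ 3 - 7 * y ^+ 2 + 4 * y + 8) * b ^+ 3) =
  (4 * y + 4) * (16 * (a * (3 * a - ((4 : F)) * b) ^+ 2)) +
  (y ^+ 5 + 3 * y ^+ 4 - y ^+ 3 - 7 * y ^+ 2 + 4 * y + 8) * (9 * (b * (((1 : F)) * a - 4 * b) ^+ 2)) +
  (- 9 * y ^+ 5 - 171 * y ^+ 4 - 567 * y ^+ 3 - 369 * y ^+ 2 + (2 * 1000 + 652) * y + (3 * 1000 + 768)) * (a ^+ 2 * b) +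
  (216 * y ^+ 5 + 504 * y ^+ 4 - 792 * y ^+ 3 - (1 * 1000 + 944) * y ^+ 2 + 416 * y + (2 * 1000 + 432)) * (a * b ^+ 2) by ring.
by nonneg_using ltac:(first [exact: poly_nonneg22 | exact: poly_nonneg23 | exact: poly_nonneg24 | exact: poly_nonneg25]).
Qed.

Lemma poly_nonneg26 : 0 <= 16 * y + 16.
Proof.
rewrite -(pmulr_rge0 _ (pow3_gt0 0)) (_ : 3 ^+ 0 * _ =
  64 * (2 - y) + 16 * (5 * y - 7)); last by ring.
by nonneg.
Qed.

Lemma poly_nonneg27 : 0 <= - y ^+ 8 - y ^+ 7 + 9 * y ^+ 6 + 9 * y ^+ 5 - 24 * y ^+ 4 - 24 * y ^+ 3 + 16 * y ^+ 2 + 32 * y + 48.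
Proof.
rewrite -(pmulr_rge0 _ (pow3_gt0 8)) (_ : 3 ^+ 8 * _ =
  ((22 * 1000 + 256) * 1000 + 384) * (2 - y) ^+ 8 + ((35 * 1000 + 540) * 1000 + 624) * (5 * y - 7) * (2 - y) ^+ 7 + ((25 * 1000 + 250) * 1000 + 282) * (5 * y - 7) ^+ 2 * (2 - y) ^+ 6 + ((10 * 1000 + 468) * 1000 + 565) * (5 * y - 7) ^+ 3 * (2 - y) ^+ 5 + ((2 * 1000 + 772) * 1000 + 86) * (5 * y - 7) ^+ 4 * (2 - y) ^+ 4 + (477 * 1000 + 776) * (5 * y - 7) ^+ 5 * (2 - y) ^+ 3 + (51 * 1000 + 728) * (5 * y - 7) ^+ 6 * (2 - y) ^+ 2 + (3 * 1000 + 152) * (5 * y - 7) ^+ 7 * (2 - y) + 80 * (5 * y - 7) ^+ 8); last by ring.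
by nonneg.
Qed.

Lemma cubic_nonneg11 : 0 <= (16 * y + 16) * a ^+ 3 + (- y ^+ 8 - y ^+ 7 + 9 * y ^+ 6 + 9 * y ^+ 5 - 24 * y ^+ 4 - 24 * y ^+ 3 + 16 * y ^+ 2 + 32 * y + 48) * (a ^+ 2 * b) + (- y ^+ 8 - y ^+ 7 + 9 * y ^+ 6 + 9 * y ^+ 5 - 24 * y ^+ 4 - 24 * y ^+ 3 + 16 * y ^+ 2 + 32 * y + 48) * (a * b ^+ 2) + (16 * y + 16) * b ^+ 3.
Proof.
suff : 0 <= 1 * ((16 * y + 16) * a ^+ 3 + (- y ^+ 8 - y ^+ 7 + 9 * y ^+ 6 + 9 * y ^+ 5 - 24 * y ^+ 4 - 24 * y ^+ 3 + 16 * y ^+ 2 + 32 * y + 48) * (a ^+ 2 * b) + (- y ^+ 8 - y ^+ 7 + 9 * y ^+ 6 + 9 * y ^+ 5 - 24 * y ^+ 4 - 24 * y ^+ 3 + 16 * y ^+ 2 + 32 * y + 48) * (a * b ^+ 2) + (16 * y + 16) * b ^+ 3) by rewrite pmulr_rge0.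
have -> : 1 * ((16 * y + 16) * a ^+ 3 + (- y ^+ 8 - y ^+ 7 + 9 * y ^+ 6 + 9 * y ^+ 5 - 24 * y ^+ 4 - 24 * y ^+ 3 + 16 * y ^+ 2 + 32 * y + 48) * (a ^+ 2 * b) + (- y ^+ 8 - y ^+ 7 + 9 * y ^+ 6 + 9 * y ^+ 5 - 24 * y ^+ 4 - 24 * y ^+ 3 + 16 * y ^+ 2 + 32 * y + 48) * (a * b ^+ 2) + (16 * y + 16) * b ^+ 3) =
  (16 * y + 16) * (1 * (a * (1 * a - (0) * b) ^+ 2)) +
  (16 * y + 16) * (1 * (b * ((0) * a - 1 * b) ^+ 2)) +
  (- y ^+ 8 - y ^+ 7 + 9 * y ^+ 6 + 9 * y ^+ 5 - 24 * y ^+ 4 - 24 * y ^+ 3 + 16 * y ^+ 2 + 32 * y + 48) * (a ^+ 2 * b) +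
  (- y ^+ 8 - y ^+ 7 + 9 * y ^+ 6 + 9 * y ^+ 5 - 24 * y ^+ 4 - 24 * y ^+ 3 + 16 * y ^+ 2 + 32 * y + 48) * (a * b ^+ 2) by ring.
by nonneg_using ltac:(first [exact: poly_nonneg26 | exact: poly_nonneg27]).
Qed.

Lemma poly_nonneg28 : 0 <= y + 2.
Proof.
rewrite -(pmulr_rge0 _ (pow3_gt0 1)) (_ : 3 ^+ 1 * _ =
  17 * (2 - y) + 4 * (5 * y - 7)); last by ring.
by nonneg.
Qed.

Lemma poly_nonneg29 : 0 <= (1 : F).
Proof.
rewrite -(pmulr_rge0 _ (pow3_gt0 0)) (_ : 3 ^+ 0 * _ =
  1); last by ring.
by nonneg.
Qed.

Lemma cubic_nonneg12 : 0 <= (y + 1) * a ^+ 3 + (y + 2) * (a ^+ 2 * b) + ((1 : F)) * (a * b ^+ 2).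
Proof.
suff : 0 <= 1 * ((y + 1) * a ^+ 3 + (y + 2) * (a ^+ 2 * b) + ((1 : F)) * (a * b ^+ 2)) by rewrite pmulr_rge0.
have -> : 1 * ((y + 1) * a ^+ 3 + (y + 2) * (a ^+ 2 * b) + ((1 : F)) * (a * b ^+ 2)) =
  (y + 1) * (1 * (a * (1 * a - (0) * b) ^+ 2)) +
  (y + 2) * (a ^+ 2 * b) +
  ((1 : F)) * (a * b ^+ 2) by ring.
by nonneg_using ltac:(first [exact: poly_nonneg2 | exact: poly_nonneg28 | exact: poly_nonneg29]).
Qed.

Lemma cubic_nonneg13 : 0 <= ((1 : F)) * (a ^+ 2 * b) + ((1 : F)) * (a * b ^+ 2).
Proof.
suff : 0 <= 1 * (((1 : F)) * (a ^+ 2 * b) + ((1 : F)) * (a * b ^+ 2)) by rewrite pmulr_rge0.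
have -> : 1 * (((1 : F)) * (a ^+ 2 * b) + ((1 : F)) * (a * b ^+ 2)) =
  ((1 : F)) * (a ^+ 2 * b) +
  ((1 : F)) * (a * b ^+ 2) by ring.
by nonneg_using ltac:(first [exact: poly_nonneg29]).
Qed.

Lemma cubic_nonneg14 : 0 <= ((1 : F)) * (a ^+ 2 * b) + (y + 2) * (a * b ^+ 2) + (y + 1) * b ^+ 3.
Proof.
suff : 0 <= 1 * (((1 : F)) * (a ^+ 2 * b) + (y + 2) * (a * b ^+ 2) + (y + 1) * b ^+ 3) by rewrite pmulr_rge0.
have -> : 1 * (((1 : F)) * (a ^+ 2 * b) + (y + 2) * (a * b ^+ 2) + (y + 1) * b ^+ 3) =
  (y + 1) * (1 * (b * ((0) * a - 1 * b) ^+ 2)) +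
  ((1 : F)) * (a ^+ 2 * b) +
  (y + 2) * (a * b ^+ 2) by ring.
by nonneg_using ltac:(first [exact: poly_nonneg2 | exact: poly_nonneg28 | exact: poly_nonneg29]).
Qed.

Lemma poly_nonneg30 : 0 <= 4 * y ^+ 4 + 4 * y ^+ 3 - 10 * y + 6.
Proof.
rewrite -(pmulr_rge0 _ (pow3_gt0 4)) (_ : 3 ^+ 4 * _ =
  (11 * 1000 + 464) * (2 - y) ^+ 4 + (13 * 1000 + 478) * (5 * y - 7) * (2 - y) ^+ 3 + (5 * 1000 + 910) * (5 * y - 7) ^+ 2 * (2 - y) ^+ 2 + (1 * 1000 + 142) * (5 * y - 7) ^+ 3 * (2 - y) + 82 * (5 * y - 7) ^+ 4); last by ring.
by nonneg.
Qed.

Lemma poly_nonneg31 : 0 <= - 4 * y ^+ 4 - 4 * y ^+ 3 + 32 * y + 48.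
Proof.
rewrite -(pmulr_rge0 _ (pow3_gt0 4)) (_ : 3 ^+ 4 * _ =
  (41 * 1000 + 536) * (2 - y) ^+ 4 + (30 * 1000 + 572) * (5 * y - 7) * (2 - y) ^+ 3 + (7 * 1000 + 800) * (5 * y - 7) ^+ 2 * (2 - y) ^+ 2 + 752 * (5 * y - 7) ^+ 3 * (2 - y) + 16 * (5 * y - 7) ^+ 4); last by ring.
by nonneg.
Qed.

Lemma cubic_nonneg15 : 0 <= (2 * y + 2) * a ^+ 3 + (y ^+ 4 + y ^+ 3 + 2 * y + 6) * (a ^+ 2 * b) + (- y ^+ 4 - y ^+ 3 + 2 * y + 6) * (a * b ^+ 2) + (2 * y + 2) * b ^+ 3.
Proof.
suff : 0 <= 4 * ((2 * y + 2) * a ^+ 3 + (y ^+ 4 + y ^+ 3 + 2 * y + 6) * (a ^+ 2 * b) + (- y ^+ 4 - y ^+ 3 + 2 * y + 6) * (a * b ^+ 2) + (2 * y + 2) * b ^+ 3) by rewrite pmulr_rge0.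
have -> : 4 * ((2 * y + 2) * a ^+ 3 + (y ^+ 4 + y ^+ 3 + 2 * y + 6) * (a ^+ 2 * b) + (- y ^+ 4 - y ^+ 3 + 2 * y + 6) * (a * b ^+ 2) + (2 * y + 2) * b ^+ 3) =
  (2 * y + 2) * (4 * (a * (1 * a - (0) * b) ^+ 2)) +
  (2 * y + 2) * (1 * (b * (((3 : F)) * a - 2 * b) ^+ 2)) +
  (4 * y ^+ 4 + 4 * y ^+ 3 - 10 * y + 6) * (a ^+ 2 * b) +
  (- 4 * y ^+ 4 - 4 * y ^+ 3 + 32 * y + 48) * (a * b ^+ 2) by ring.
by nonneg_using ltac:(first [exact: poly_nonneg15 | exact: poly_nonneg30 | exact: poly_nonneg31]).
Qed.

Lemma poly_nonneg32 : 0 <= y ^+ 4 + y ^+ 3 - 2 * y ^+ 2 + 2.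
Proof.
rewrite -(pmulr_rge0 _ (pow3_gt0 2)) (_ : 3 ^+ 2 * _ =
  324 * (2 - y) ^+ 4 + 353 * (5 * y - 7) * (2 - y) ^+ 3 + 148 * (5 * y - 7) ^+ 2 * (2 - y) ^+ 2 + 28 * (5 * y - 7) ^+ 3 * (2 - y) + 2 * (5 * y - 7) ^+ 4); last by ring.
by nonneg.
Qed.

Lemma poly_nonneg33 : 0 <= 6 * y ^+ 4 + 6 * y ^+ 3 - 30 * y ^+ 2 + 48.
Proof.
rewrite -(pmulr_rge0 _ (pow3_gt0 2)) (_ : 3 ^+ 2 * _ =
  (1 * 1000 + 994) * (2 - y) ^+ 4 + (1 * 1000 + 738) * (5 * y - 7) * (2 - y) ^+ 3 + 630 * (5 * y - 7) ^+ 2 * (2 - y) ^+ 2 + 112 * (5 * y - 7) ^+ 3 * (2 - y) + 8 * (5 * y - 7) ^+ 4); last by ring.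
by nonneg.
Qed.

Lemma poly_nonneg34 : 0 <= - y ^+ 4 - y ^+ 3 + 2 * y ^+ 2 + 16.
Proof.
rewrite -(pmulr_rge0 _ (pow3_gt0 2)) (_ : 3 ^+ 2 * _ =
  926 * (2 - y) ^+ 4 + 647 * (5 * y - 7) * (2 - y) ^+ 3 + 152 * (5 * y - 7) ^+ 2 * (2 - y) ^+ 2 + 12 * (5 * y - 7) ^+ 3 * (2 - y)); last by ring.
by nonneg.
Qed.

Lemma cubic_nonneg16 : 0 <= (y ^+ 4 + y ^+ 3 - 2 * y ^+ 2 + 2) * a ^+ 3 + (- 2 * y ^+ 2 + 4) * (a ^+ 2 * b) + ((2 : F)) * (a * b ^+ 2).
Proof.
suff : 0 <= 9 * ((y ^+ 4 + y ^+ 3 - 2 * y ^+ 2 + 2) * a ^+ 3 + (- 2 * y ^+ 2 + 4) * (a ^+ 2 * b) + ((2 : F)) * (a * b ^+ 2)) by rewrite pmulr_rge0.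
have -> : 9 * ((y ^+ 4 + y ^+ 3 - 2 * y ^+ 2 + 2) * a ^+ 3 + (- 2 * y ^+ 2 + 4) * (a ^+ 2 * b) + ((2 : F)) * (a * b ^+ 2)) =
  (y ^+ 4 + y ^+ 3 - 2 * y ^+ 2 + 2) * (1 * (a * (3 * a - ((1 : F)) * b) ^+ 2)) +
  (6 * y ^+ 4 + 6 * y ^+ 3 - 30 * y ^+ 2 + 48) * (a ^+ 2 * b) +
  (- y ^+ 4 - y ^+ 3 + 2 * y ^+ 2 + 16) * (a * b ^+ 2) by ring.
by nonneg_using ltac:(first [exact: poly_nonneg32 | exact: poly_nonneg33 | exact: poly_nonneg34]).
Qed.

Lemma poly_nonneg35 : 0 <= y + 3.
Proof.
rewrite -(pmulr_rge0 _ (pow3_gt0 1)) (_ : 3 ^+ 1 * _ =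
  22 * (2 - y) + 5 * (5 * y - 7)); last by ring.
by nonneg.
Qed.

Lemma cubic_nonneg17 : 0 <= (y + 1) * a ^+ 3 + (y + 3) * (a ^+ 2 * b) + (y + 3) * (a * b ^+ 2) + (y + 1) * b ^+ 3.
Proof.
suff : 0 <= 1 * ((y + 1) * a ^+ 3 + (y + 3) * (a ^+ 2 * b) + (y + 3) * (a * b ^+ 2) + (y + 1) * b ^+ 3) by rewrite pmulr_rge0.
have -> : 1 * ((y + 1) * a ^+ 3 + (y + 3) * (a ^+ 2 * b) + (y + 3) * (a * b ^+ 2) + (y + 1) * b ^+ 3) =
  (y + 1) * (1 * (a * (1 * a - (0) * b) ^+ 2)) +
  (y + 1) * (1 * (b * ((0) * a - 1 * b) ^+ 2)) +
  (y + 3) * (a ^+ 2 * b) +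
  (y + 3) * (a * b ^+ 2) by ring.
by nonneg_using ltac:(first [exact: poly_nonneg2 | exact: poly_nonneg35]).
Qed.

Lemma cubic_nonneg18 : 0 <= (y ^+ 5 + 3 * y ^+ 4 - y ^+ 3 - 7 * y ^+ 2 + 4 * y + 8) * a ^+ 3 + (y ^+ 5 + 2 * y ^+ 4 - 5 * y ^+ 3 - 10 * y ^+ 2 + 8 * y + 20) * (a ^+ 2 * b) + (- y ^+ 4 - 4 * y ^+ 3 - 3 * y ^+ 2 + 8 * y + 16) * (a * b ^+ 2) + (4 * y + 4) * b ^+ 3.
Proof.
suff : 0 <= 144 * ((y ^+ 5 + 3 * y ^+ 4 - y ^+ 3 - 7 * y ^+ 2 + 4 * y + 8) * a ^+ 3 + (y ^+ 5 + 2 * y ^+ 4 - 5 * y ^+ 3 - 10 * y ^+ 2 + 8 * y + 20) * (a ^+ 2 * b) + (- y ^+ 4 - 4 * y ^+ 3 - 3 * y ^+ 2 + 8 * y + 16) * (a * b ^+ 2) + (4 * y + 4) * b ^+ 3) by rewrite pmulr_rge0.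
have -> : 144 * ((y ^+ 5 + 3 * y ^+ 4 - y ^+ 3 - 7 * y ^+ 2 + 4 * y + 8) * a ^+ 3 + (y ^+ 5 + 2 * y ^+ 4 - 5 * y ^+ 3 - 10 * y ^+ 2 + 8 * y + 20) * (a ^+ 2 * b) + (- y ^+ 4 - 4 * y ^+ 3 - 3 * y ^+ 2 + 8 * y + 16) * (a * b ^+ 2) + (4 * y + 4) * b ^+ 3) =
  (y ^+ 5 + 3 * y ^+ 4 - y ^+ 3 - 7 * y ^+ 2 + 4 * y + 8) * (9 * (a * (4 * a - ((1 : F)) * b) ^+ 2)) +
  (4 * y + 4) * (16 * (b * (((4 : F)) * a - 3 * b) ^+ 2)) +
  (216 * y ^+ 5 + 504 * y ^+ 4 - 792 * y ^+ 3 - (1 * 1000 + 944) * y ^+ 2 + 416 * y + (2 * 1000 + 432)) * (a ^+ 2 * b) +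
  (- 9 * y ^+ 5 - 171 * y ^+ 4 - 567 * y ^+ 3 - 369 * y ^+ 2 + (2 * 1000 + 652) * y + (3 * 1000 + 768)) * (a * b ^+ 2) by ring.
by nonneg_using ltac:(first [exact: poly_nonneg22 | exact: poly_nonneg23 | exact: poly_nonneg24 | exact: poly_nonneg25]).
Qed.

Lemma poly_nonneg36 : 0 <= y ^+ 4 + y ^+ 3 - 4 * y ^+ 2 + 8.
Proof.
rewrite -(pmulr_rge0 _ (pow3_gt0 4)) (_ : 3 ^+ 4 * _ =
  (4 * 1000 + 216) * (2 - y) ^+ 4 + (3 * 1000 + 797) * (5 * y - 7) * (2 - y) ^+ 3 + (1 * 1000 + 374) * (5 * y - 7) ^+ 2 * (2 - y) ^+ 2 + 236 * (5 * y - 7) ^+ 3 * (2 - y) + 16 * (5 * y - 7) ^+ 4); last by ring.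
by nonneg.
Qed.

Lemma cubic_nonneg19 : 0 <= (y ^+ 4 + y ^+ 3 - 2 * y ^+ 2 + 2) * a ^+ 3 + (- 2 * y ^+ 2 + 6) * (a ^+ 2 * b) + (- 2 * y ^+ 2 + 6) * (a * b ^+ 2) + (y ^+ 4 + y ^+ 3 - 2 * y ^+ 2 + 2) * b ^+ 3.
Proof.
suff : 0 <= 1 * ((y ^+ 4 + y ^+ 3 - 2 * y ^+ 2 + 2) * a ^+ 3 + (- 2 * y ^+ 2 + 6) * (a ^+ 2 * b) + (- 2 * y ^+ 2 + 6) * (a * b ^+ 2) + (y ^+ 4 + y ^+ 3 - 2 * y ^+ 2 + 2) * b ^+ 3) by rewrite pmulr_rge0.
have -> : 1 * ((y ^+ 4 + y ^+ 3 - 2 * y ^+ 2 + 2) * a ^+ 3 + (- 2 * y ^+ 2 + 6) * (a ^+ 2 * b) + (- 2 * y ^+ 2 + 6) * (a * b ^+ 2) + (y ^+ 4 + y ^+ 3 - 2 * y ^+ 2 + 2) * b ^+ 3) =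
  (y ^+ 4 + y ^+ 3 - 2 * y ^+ 2 + 2) * (1 * (a * (1 * a - ((1 : F)) * b) ^+ 2)) +
  (y ^+ 4 + y ^+ 3 - 2 * y ^+ 2 + 2) * (1 * (b * (((1 : F)) * a - 1 * b) ^+ 2)) +
  (y ^+ 4 + y ^+ 3 - 4 * y ^+ 2 + 8) * (a ^+ 2 * b) +
  (y ^+ 4 + y ^+ 3 - 4 * y ^+ 2 + 8) * (a * b ^+ 2) by ring.
by nonneg_using ltac:(first [exact: poly_nonneg32 | exact: poly_nonneg36]).
Qed.

Lemma poly_nonneg37 : 0 <= - y ^+ 5 + y ^+ 4 + 5 * y ^+ 3 - y ^+ 2 + 4 * y + 8.
Proof.
rewrite -(pmulr_rge0 _ (pow3_gt0 3)) (_ : 3 ^+ 3 * _ =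
  (8 * 1000 + 272) * (2 - y) ^+ 5 + (9 * 1000 + 204) * (5 * y - 7) * (2 - y) ^+ 4 + (4 * 1000 + 76) * (5 * y - 7) ^+ 2 * (2 - y) ^+ 3 + 893 * (5 * y - 7) ^+ 3 * (2 - y) ^+ 2 + 96 * (5 * y - 7) ^+ 4 * (2 - y) + 4 * (5 * y - 7) ^+ 5); last by ring.
by nonneg.
Qed.

Lemma poly_nonneg38 : 0 <= - 3 * y ^+ 5 - y ^+ 4 + 11 * y ^+ 3 - 3 * y ^+ 2 + 12 * y + 40.
Proof.
rewrite -(pmulr_rge0 _ (pow3_gt0 5)) (_ : 3 ^+ 5 * _ =
  (191 * 1000 + 24) * (2 - y) ^+ 5 + (190 * 1000 + 904) * (5 * y - 7) * (2 - y) ^+ 4 + (74 * 1000 + 24) * (5 * y - 7) ^+ 2 * (2 - y) ^+ 3 + (13 * 1000 + 591) * (5 * y - 7) ^+ 3 * (2 - y) ^+ 2 + (1 * 1000 + 120) * (5 * y - 7) ^+ 4 * (2 - y) + 28 * (5 * y - 7) ^+ 5); last by ring.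
by nonneg.
Qed.

Lemma poly_nonneg39 : 0 <= 2 * y ^+ 5 + 2 * y ^+ 4 - 6 * y ^+ 3 - 6 * y ^+ 2 + 16.
Proof.
rewrite -(pmulr_rge0 _ (pow3_gt0 5)) (_ : 3 ^+ 5 * _ =
  (19 * 1000 + 424) * (2 - y) ^+ 5 + (22 * 1000 + 532) * (5 * y - 7) * (2 - y) ^+ 4 + (12 * 1000 + 380) * (5 * y - 7) ^+ 2 * (2 - y) ^+ 3 + (3 * 1000 + 814) * (5 * y - 7) ^+ 3 * (2 - y) ^+ 2 + 616 * (5 * y - 7) ^+ 4 * (2 - y) + 40 * (5 * y - 7) ^+ 5); last by ring.
by nonneg.
Qed.

Lemma cubic_nonneg20 : 0 <= (- y ^+ 5 + y ^+ 4 + 5 * y ^+ 3 - y ^+ 2 + 4 * y + 8) * a ^+ 3 + (- y ^+ 5 - 3 * y ^+ 4 + y ^+ 3 - y ^+ 2 + 4 * y + 24) * (a ^+ 2 * b) + (y ^+ 5 + 3 * y ^+ 4 - y ^+ 3 - 7 * y ^+ 2 + 4 * y + 24) * (a * b ^+ 2) + (y ^+ 5 + 3 * y ^+ 4 - y ^+ 3 - 7 * y ^+ 2 + 4 * y + 8) * b ^+ 3.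
Proof.
suff : 0 <= 1 * ((- y ^+ 5 + y ^+ 4 + 5 * y ^+ 3 - y ^+ 2 + 4 * y + 8) * a ^+ 3 + (- y ^+ 5 - 3 * y ^+ 4 + y ^+ 3 - y ^+ 2 + 4 * y + 24) * (a ^+ 2 * b) + (y ^+ 5 + 3 * y ^+ 4 - y ^+ 3 - 7 * y ^+ 2 + 4 * y + 24) * (a * b ^+ 2) + (y ^+ 5 + 3 * y ^+ 4 - y ^+ 3 - 7 * y ^+ 2 + 4 * y + 8) * b ^+ 3) by rewrite pmulr_rge0.
have -> : 1 * ((- y ^+ 5 + y ^+ 4 + 5 * y ^+ 3 - y ^+ 2 + 4 * y + 8) * a ^+ 3 + (- y ^+ 5 - 3 * y ^+ 4 + y ^+ 3 - y ^+ 2 + 4 * y + 24) * (a ^+ 2 * b) + (y ^+ 5 + 3 * y ^+ 4 - y ^+ 3 - 7 * y ^+ 2 + 4 * y + 24) * (a * b ^+ 2) + (y ^+ 5 + 3 * y ^+ 4 - y ^+ 3 - 7 * y ^+ 2 + 4 * y + 8) * b ^+ 3) =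
  (- y ^+ 5 + y ^+ 4 + 5 * y ^+ 3 - y ^+ 2 + 4 * y + 8) * (1 * (a * (1 * a - ((1 : F)) * b) ^+ 2)) +
  (y ^+ 5 + 3 * y ^+ 4 - y ^+ 3 - 7 * y ^+ 2 + 4 * y + 8) * (1 * (b * ((0) * a - 1 * b) ^+ 2)) +
  (- 3 * y ^+ 5 - y ^+ 4 + 11 * y ^+ 3 - 3 * y ^+ 2 + 12 * y + 40) * (a ^+ 2 * b) +
  (2 * y ^+ 5 + 2 * y ^+ 4 - 6 * y ^+ 3 - 6 * y ^+ 2 + 16) * (a * b ^+ 2) by ring.
by nonneg_using ltac:(first [exact: poly_nonneg23 | exact: poly_nonneg37 | exact: poly_nonneg38 | exact: poly_nonneg39]).
Qed.

Lemma poly_nonneg40 : 0 <= y ^+ 4 + y ^+ 3 - 2 * y ^+ 2 + y + 3.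
Proof.
rewrite -(pmulr_rge0 _ (pow3_gt0 3)) (_ : 3 ^+ 3 * _ =
  (1 * 1000 + 472) * (2 - y) ^+ 4 + (1 * 1000 + 484) * (5 * y - 7) * (2 - y) ^+ 3 + 579 * (5 * y - 7) ^+ 2 * (2 - y) ^+ 2 + 103 * (5 * y - 7) ^+ 3 * (2 - y) + 7 * (5 * y - 7) ^+ 4); last by ring.
by nonneg.
Qed.

Lemma poly_nonneg41 : 0 <= - 2 * y ^+ 2 + y + 7.
Proof.
rewrite -(pmulr_rge0 _ (pow3_gt0 2)) (_ : 3 ^+ 2 * _ =
  112 * (2 - y) ^+ 2 + 31 * (5 * y - 7) * (2 - y) + (5 * y - 7) ^+ 2); last by ring.
by nonneg.
Qed.

Lemma poly_nonneg42 : 0 <= y + 5.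
Proof.
rewrite -(pmulr_rge0 _ (pow3_gt0 1)) (_ : 3 ^+ 1 * _ =
  32 * (2 - y) + 7 * (5 * y - 7)); last by ring.
by nonneg.
Qed.

Lemma cubic_nonneg21 : 0 <= (y ^+ 4 + y ^+ 3 - 2 * y ^+ 2 + y + 3) * a ^+ 3 + (- 2 * y ^+ 2 + y + 7) * (a ^+ 2 * b) + (y + 5) * (a * b ^+ 2) + (y + 1) * b ^+ 3.
Proof.
suff : 0 <= 1 * ((y ^+ 4 + y ^+ 3 - 2 * y ^+ 2 + y + 3) * a ^+ 3 + (- 2 * y ^+ 2 + y + 7) * (a ^+ 2 * b) + (y + 5) * (a * b ^+ 2) + (y + 1) * b ^+ 3) by rewrite pmulr_rge0.
have -> : 1 * ((y ^+ 4 + y ^+ 3 - 2 * y ^+ 2 + y + 3) * a ^+ 3 + (- 2 * y ^+ 2 + y + 7) * (a ^+ 2 * b) + (y + 5) * (a * b ^+ 2) + (y + 1) * b ^+ 3) =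
  (y ^+ 4 + y ^+ 3 - 2 * y ^+ 2 + y + 3) * (1 * (a * (1 * a - (0) * b) ^+ 2)) +
  (y + 1) * (1 * (b * ((0) * a - 1 * b) ^+ 2)) +
  (- 2 * y ^+ 2 + y + 7) * (a ^+ 2 * b) +
  (y + 5) * (a * b ^+ 2) by ring.
by nonneg_using ltac:(first [exact: poly_nonneg2 | exact: poly_nonneg40 | exact: poly_nonneg41 | exact: poly_nonneg42]).
Qed.

End cubics.

End cone_certificates.

Section cone.
Variable F : realFieldType.

Record vec4 := Vec4 { va : F; vb : F; vc : F; vd : F }.

Definition trace1 (y : F) : F := y ^+ 3 - 2 * y.
Definition trace2 (y : F) : F := y ^+ 4 - 3 * y ^+ 2 + 2.
Definition top_H (y : F) : F := 4 + trace1 y.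
Definition delta_of (y : F) : F := ((y + 2) * (y - 1)) ^+ 2.

Definition cone_g0 y := Vec4 0 (top_H y - 2) (2 * top_H y - delta_of y - 4) (top_H y - 2).
Definition cone_g1 y := Vec4 4 (12 - delta_of y) 12 (4 + delta_of y).
Definition cone_g2 of F := Vec4 0 1 2 1.
Definition cone_g3 of F := Vec4 1 3 3 1.

(** Four linear forms; up to positive factors they are dual to the four vectors
    [cone_g0], [cone_g1], [cone_g2], [cone_g3], which span the cone. *)
Definition cone_form (y : F) (i : nat) (v : vec4) : F :=
  let k0 := vb v + vd v - vc v - va v in
  let k1 := 2 * va v + vd v - vb v in
  match i with
  | 0 => k0 | 1 => k1
  | 2 => delta_of y * (vb v + vd v - 4 * va v) - 2 * (top_H y - 2) * k0
  | _ => delta_of y * va v - 2 * k1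
  end.

Definition in_cone y v := forall i, (i < 4)%N -> 0 <= cone_form y i v.
Definition in_open_cone y v := forall i, (i < 4)%N -> 0 < cone_form y i v.

Section step.
Variables y z b : F.

(** With z = s(x) and b = s(x + 1) for a sequence satisfying the three-term
    recurrence with trace [y], these are the products s(k - 1) s(k) s(k + 1) for
    k = x + i - 4. *)
Definition U (i : nat) : F :=
  let sm1 := y * z - b in let sm2 := y * sm1 - z in let sm3 := y * sm2 - sm1 in
  let sm4 := y * sm3 - sm2 in let sm5 := y * sm4 - sm3 in
  let s2 := y * b - z in let s3 := y * s2 - b in let s4 := y * s3 - s2 in
  match i with
  | 0 => sm5 * sm4 * sm3 | 1 => sm4 * sm3 * sm2 | 2 => sm3 * sm2 * sm1 | 3 => sm2 * sm1 * z
  | 4 => sm1 * z * b | 5 => z * b * s2 | 6 => b * s2 * s3 | _ => s2 * s3 * s4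
  end.

Definition at_ (i : nat) (v : vec4) : F :=
  va v * U i + vb v * U i.+1 + vc v * U i.+2 + vd v * U i.+3.
Definition seq_at (k : nat) := at_ (k + 2).

Definition step_of (qm1 q0 q1 q2 : F) : vec4 :=
  Vec4 q0 (top_H y * q0 - (trace1 y * q0 - qm1))
    ((2 * top_H y - delta_of y) * q0 - (q2 - trace1 y * q1)) (top_H y * q0 - q1).

Definition cone_plus v := step_of (at_ 1 v) (at_ 2 v) (at_ 3 v) (at_ 4 v).
Definition cone_minus v := step_of (at_ 3 v) (at_ 2 v) (at_ 1 v) (at_ 0 v).
Local Notation cone_coord := (cone_form y).

(** Expansion of [v] in the generators of the cone; it reduces the invariance of
    the cone to the sixteen coordinates of four images. *)
Lemma coord_step i v : (i < 4)%N ->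
  2 * delta_of y * cone_coord i (cone_plus v) =
  2 * cone_coord 0 v * cone_coord i (cone_plus (cone_g0 y)) + cone_coord 1 v * cone_coord i (cone_plus (cone_g1 y)) +
  cone_coord 2 v * cone_coord i (cone_plus (cone_g2 y)) + 2 * cone_coord 3 v * cone_coord i (cone_plus (cone_g3 y)).
Proof.
rewrite /cone_form /cone_plus /step_of /at_; move: (U) => u.
by case: v => a1 b1 c1 d1; case: i => [|[|[|[|i]]]] //= _; rewrite /delta_of /top_H /trace1; ring.
Qed.

Lemma coord_step_minus i v : (i < 4)%N ->
  2 * delta_of y * cone_coord i (cone_minus v) =
  2 * cone_coord 0 v * cone_coord i (cone_minus (cone_g0 y)) + cone_coord 1 v * cone_coord i (cone_minus (cone_g1 y)) +
  cone_coord 2 v * cone_coord i (cone_minus (cone_g2 y)) + 2 * cone_coord 3 v * cone_coord i (cone_minus (cone_g3 y)).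
Proof.
rewrite /cone_form /cone_minus /step_of /at_; move: (U) => u.
by case: v => a1 b1 c1 d1; case: i => [|[|[|[|i]]]] //= _; rewrite /delta_of /top_H /trace1; ring.
Qed.

Lemma seq_at_gen v : 2 * delta_of y * seq_at 0 v =
  2 * cone_coord 0 v * seq_at 0 (cone_g0 y) + cone_coord 1 v * seq_at 0 (cone_g1 y) +
  cone_coord 2 v * seq_at 0 (cone_g2 y) + 2 * cone_coord 3 v * seq_at 0 (cone_g3 y).
Proof.
rewrite /cone_form /seq_at /at_; move: (U) => u.
by case: v => a1 b1 c1 d1 /=; rewrite /delta_of /top_H /trace1; ring.
Qed.

Hypotheses (y7 : 0 <= 5 * y - 7) (y2 : 0 <= 2 - y) (yy2 : 0 <= y ^+ 2 - 2).
Local Notation a := (y * z - b).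
Hypotheses (a0 : 0 <= a) (b0 : 0 <= b).

Lemma y_pos : 0 < y. Proof. by move: y7; lra. Qed.
Lemma yp2 : 0 <= y + 2. Proof. by move: y7; lra. Qed.
Lemma ym1 : 0 <= y - 1. Proof. by move: y7; lra. Qed.
Let ypos := y_pos. Let yp2' := yp2. Let ym1' := ym1.

Lemma plus_g0_0 : 0 <= cone_coord 0 (cone_plus (cone_g0 y)).
Proof.
suff : 0 <= y ^+ 2 * cone_coord 0 (cone_plus (cone_g0 y)) by rewrite pmulr_rge0 ?exprn_gt0.
have -> : y ^+ 2 * cone_coord 0 (cone_plus (cone_g0 y)) = (y + 2) ^+ 2 * (y - 1) ^+ 3 *
  ((y ^+ 4 + y ^+ 3 - 2 * y ^+ 2 - y + 1) * a ^+ 3 + (- 2 * y ^+ 2 - y + 3) * (a ^+ 2 * b) + (y + 3) * (a * b ^+ 2) + (y + 1) * b ^+ 3) by rewrite /cone_form /cone_plus /step_of /at_ /U /=; rewrite /delta_of /top_H /trace1; ring.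
by nonneg_using ltac:(exact: cubic_nonneg1).
Qed.

Lemma plus_g0_1 : 0 <= cone_coord 1 (cone_plus (cone_g0 y)).
Proof.
suff : 0 <= y ^+ 2 * cone_coord 1 (cone_plus (cone_g0 y)) by rewrite pmulr_rge0 ?exprn_gt0.
have -> : y ^+ 2 * cone_coord 1 (cone_plus (cone_g0 y)) = (y + 2) ^+ 2 * (y - 1) ^+ 2 *
  ((y ^+ 2 - 1) * a ^+ 3 + (y ^+ 2 - 3) * (a ^+ 2 * b) + (y ^+ 2 - 3) * (a * b ^+ 2) + (y ^+ 2 - 1) * b ^+ 3) by rewrite /cone_form /cone_plus /step_of /at_ /U /=; rewrite /delta_of /top_H /trace1; ring.
by nonneg_using ltac:(exact: cubic_nonneg2).
Qed.

Lemma plus_g0_2 : 0 <= cone_coord 2 (cone_plus (cone_g0 y)).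
Proof.
suff : 0 <= y ^+ 2 * cone_coord 2 (cone_plus (cone_g0 y)) by rewrite pmulr_rge0 ?exprn_gt0.
have -> : y ^+ 2 * cone_coord 2 (cone_plus (cone_g0 y)) = (y + 2) ^+ 2 * (y - 1) ^+ 3 *
  ((- y ^+ 5 + y ^+ 4 + 5 * y ^+ 3 - y ^+ 2 + 4) * a ^+ 3 + (- y ^+ 5 - y ^+ 4 + 3 * y ^+ 3 - y ^+ 2 + 12) * (a ^+ 2 * b) + (y ^+ 5 + y ^+ 4 - 3 * y ^+ 3 - 7 * y ^+ 2 + 12) * (a * b ^+ 2) + (y ^+ 5 + 3 * y ^+ 4 - y ^+ 3 - 7 * y ^+ 2 + 4) * b ^+ 3) by rewrite /cone_form /cone_plus /step_of /at_ /U /=; rewrite /delta_of /top_H /trace1; ring.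
by nonneg_using ltac:(exact: cubic_nonneg3).
Qed.

Lemma plus_g0_3 : 0 <= cone_coord 3 (cone_plus (cone_g0 y)).
Proof.
suff : 0 <= y ^+ 1 * cone_coord 3 (cone_plus (cone_g0 y)) by rewrite pmulr_rge0 ?exprn_gt0.
have -> : y ^+ 1 * cone_coord 3 (cone_plus (cone_g0 y)) = (y + 2) ^+ 2 * (y - 1) ^+ 2 *
  ((y ^+ 4 - 3 * y ^+ 2 + 2) * a ^+ 3 + (- 2 * y ^+ 2 + 6) * (a ^+ 2 * b) + (- 2 * y ^+ 2 + 6) * (a * b ^+ 2) + (y ^+ 4 - 3 * y ^+ 2 + 2) * b ^+ 3) by rewrite /cone_form /cone_plus /step_of /at_ /U /=; rewrite /delta_of /top_H /trace1; ring.
by nonneg_using ltac:(exact: cubic_nonneg4).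
Qed.

Lemma minus_g0_0 : 0 <= cone_coord 0 (cone_minus (cone_g0 y)).
Proof.
suff : 0 <= y ^+ 2 * cone_coord 0 (cone_minus (cone_g0 y)) by rewrite pmulr_rge0 ?exprn_gt0.
have -> : y ^+ 2 * cone_coord 0 (cone_minus (cone_g0 y)) = (y + 2) ^+ 2 * (y - 1) ^+ 3 *
  ((y + 1) * a ^+ 3 + (y + 3) * (a ^+ 2 * b) + (- 2 * y ^+ 2 - y + 3) * (a * b ^+ 2) + (y ^+ 4 + y ^+ 3 - 2 * y ^+ 2 - y + 1) * b ^+ 3) by rewrite /cone_form /cone_minus /step_of /at_ /U /=; rewrite /delta_of /top_H /trace1; ring.
by nonneg_using ltac:(exact: cubic_nonneg5).
Qed.

Lemma minus_g0_1 : 0 <= cone_coord 1 (cone_minus (cone_g0 y)).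
Proof.
suff : 0 <= y ^+ 2 * cone_coord 1 (cone_minus (cone_g0 y)) by rewrite pmulr_rge0 ?exprn_gt0.
have -> : y ^+ 2 * cone_coord 1 (cone_minus (cone_g0 y)) = (y + 2) ^+ 2 * (y - 1) ^+ 2 *
  ((y ^+ 2 - 1) * a ^+ 3 + (y ^+ 2 - 3) * (a ^+ 2 * b) + (y ^+ 2 - 3) * (a * b ^+ 2) + (y ^+ 2 - 1) * b ^+ 3) by rewrite /cone_form /cone_minus /step_of /at_ /U /=; rewrite /delta_of /top_H /trace1; ring.
by nonneg_using ltac:(exact: cubic_nonneg2).
Qed.

Lemma minus_g0_2 : 0 <= cone_coord 2 (cone_minus (cone_g0 y)).
Proof.
suff : 0 <= y ^+ 2 * cone_coord 2 (cone_minus (cone_g0 y)) by rewrite pmulr_rge0 ?exprn_gt0.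
have -> : y ^+ 2 * cone_coord 2 (cone_minus (cone_g0 y)) = (y + 2) ^+ 2 * (y - 1) ^+ 3 *
  ((y ^+ 5 + 3 * y ^+ 4 - y ^+ 3 - 7 * y ^+ 2 + 4) * a ^+ 3 + (y ^+ 5 + y ^+ 4 - 3 * y ^+ 3 - 7 * y ^+ 2 + 12) * (a ^+ 2 * b) + (- y ^+ 5 - y ^+ 4 + 3 * y ^+ 3 - y ^+ 2 + 12) * (a * b ^+ 2) + (- y ^+ 5 + y ^+ 4 + 5 * y ^+ 3 - y ^+ 2 + 4) * b ^+ 3) by rewrite /cone_form /cone_minus /step_of /at_ /U /=; rewrite /delta_of /top_H /trace1; ring.
by nonneg_using ltac:(exact: cubic_nonneg6).
Qed.

Lemma minus_g0_3 : 0 <= cone_coord 3 (cone_minus (cone_g0 y)).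
Proof.
suff : 0 <= y ^+ 1 * cone_coord 3 (cone_minus (cone_g0 y)) by rewrite pmulr_rge0 ?exprn_gt0.
have -> : y ^+ 1 * cone_coord 3 (cone_minus (cone_g0 y)) = (y + 2) ^+ 2 * (y - 1) ^+ 2 *
  ((y ^+ 4 - 3 * y ^+ 2 + 2) * a ^+ 3 + (- 2 * y ^+ 2 + 6) * (a ^+ 2 * b) + (- 2 * y ^+ 2 + 6) * (a * b ^+ 2) + (y ^+ 4 - 3 * y ^+ 2 + 2) * b ^+ 3) by rewrite /cone_form /cone_minus /step_of /at_ /U /=; rewrite /delta_of /top_H /trace1; ring.
by nonneg_using ltac:(exact: cubic_nonneg4).
Qed.

Lemma plus_g1_0 : 0 <= cone_coord 0 (cone_plus (cone_g1 y)).
Proof.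
suff : 0 <= y ^+ 2 * cone_coord 0 (cone_plus (cone_g1 y)) by rewrite pmulr_rge0 ?exprn_gt0.
have -> : y ^+ 2 * cone_coord 0 (cone_plus (cone_g1 y)) = (y + 2) ^+ 2 * (y - 1) ^+ 3 *
  ((- y ^+ 5 + y ^+ 4 + 5 * y ^+ 3 - y ^+ 2 + 4) * a ^+ 3 + (- y ^+ 5 - 2 * y ^+ 4 + 5 * y ^+ 3 + 2 * y ^+ 2 - 4 * y + 8) * (a ^+ 2 * b) + (y ^+ 4 + 4 * y ^+ 3 + 3 * y ^+ 2 - 4 * y + 4) * (a * b ^+ 2)) by rewrite /cone_form /cone_plus /step_of /at_ /U /=; rewrite /delta_of /top_H /trace1; ring.
by nonneg_using ltac:(exact: cubic_nonneg7).
Qed.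

Lemma plus_g1_1 : 0 <= cone_coord 1 (cone_plus (cone_g1 y)).
Proof.
suff : 0 <= y ^+ 2 * cone_coord 1 (cone_plus (cone_g1 y)) by rewrite pmulr_rge0 ?exprn_gt0.
have -> : y ^+ 2 * cone_coord 1 (cone_plus (cone_g1 y)) = (y + 2) ^+ 2 * (y - 1) ^+ 3 *
  ((2 * y + 2) * a ^+ 3 + (- y ^+ 4 - y ^+ 3 + 2 * y + 6) * (a ^+ 2 * b) + (y ^+ 4 + y ^+ 3 + 2 * y + 6) * (a * b ^+ 2) + (2 * y + 2) * b ^+ 3) by rewrite /cone_form /cone_plus /step_of /at_ /U /=; rewrite /delta_of /top_H /trace1; ring.
by nonneg_using ltac:(exact: cubic_nonneg8).
Qed.

Lemma plus_g1_2 : 0 <= cone_coord 2 (cone_plus (cone_g1 y)).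
Proof.
suff : 0 <= y ^+ 2 * cone_coord 2 (cone_plus (cone_g1 y)) by rewrite pmulr_rge0 ?exprn_gt0.
have -> : y ^+ 2 * cone_coord 2 (cone_plus (cone_g1 y)) = (y + 2) ^+ 2 * (y - 1) ^+ 3 *
  ((- 4 * y ^+ 5 + 4 * y ^+ 4 + 20 * y ^+ 3 - 4 * y ^+ 2 + 16) * a ^+ 3 + (y ^+ 8 + y ^+ 7 - 9 * y ^+ 6 - 13 * y ^+ 5 + 12 * y ^+ 4 + 28 * y ^+ 3 - 20 * y ^+ 2 - 16 * y + 48) * (a ^+ 2 * b) + (y ^+ 8 + y ^+ 7 - 9 * y ^+ 6 - 5 * y ^+ 5 + 36 * y ^+ 4 + 20 * y ^+ 3 - 44 * y ^+ 2 - 16 * y + 48) * (a * b ^+ 2) + (4 * y ^+ 5 + 12 * y ^+ 4 - 4 * y ^+ 3 - 28 * y ^+ 2 + 16) * b ^+ 3) by rewrite /cone_form /cone_plus /step_of /at_ /U /=; rewrite /delta_of /top_H /trace1; ring.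
by nonneg_using ltac:(exact: cubic_nonneg9).
Qed.

Lemma plus_g1_3 : 0 <= cone_coord 3 (cone_plus (cone_g1 y)).
Proof.
suff : 0 <= y ^+ 2 * cone_coord 3 (cone_plus (cone_g1 y)) by rewrite pmulr_rge0 ?exprn_gt0.
have -> : y ^+ 2 * cone_coord 3 (cone_plus (cone_g1 y)) = (y + 2) ^+ 2 * (y - 1) ^+ 3 *
  ((- y ^+ 5 + y ^+ 4 + 5 * y ^+ 3 - y ^+ 2 + 4) * a ^+ 3 + (- y ^+ 5 - y ^+ 4 + 3 * y ^+ 3 - y ^+ 2 + 12) * (a ^+ 2 * b) + (y ^+ 5 + y ^+ 4 - 3 * y ^+ 3 - 7 * y ^+ 2 + 12) * (a * b ^+ 2) + (y ^+ 5 + 3 * y ^+ 4 - y ^+ 3 - 7 * y ^+ 2 + 4) * b ^+ 3) by rewrite /cone_form /cone_plus /step_of /at_ /U /=; rewrite /delta_of /top_H /trace1; ring.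
by nonneg_using ltac:(exact: cubic_nonneg3).
Qed.

Lemma minus_g1_0 : 0 <= cone_coord 0 (cone_minus (cone_g1 y)).
Proof.
suff : 0 <= y ^+ 2 * cone_coord 0 (cone_minus (cone_g1 y)) by rewrite pmulr_rge0 ?exprn_gt0.
have -> : y ^+ 2 * cone_coord 0 (cone_minus (cone_g1 y)) = (y + 2) ^+ 2 * (y - 1) ^+ 3 *
  ((4 * y + 4) * a ^+ 3 + (- y ^+ 4 - 4 * y ^+ 3 - 3 * y ^+ 2 + 8 * y + 16) * (a ^+ 2 * b) + (y ^+ 5 + 2 * y ^+ 4 - 5 * y ^+ 3 - 10 * y ^+ 2 + 8 * y + 20) * (a * b ^+ 2) + (y ^+ 5 + 3 * y ^+ 4 - y ^+ 3 - 7 * y ^+ 2 + 4 * y + 8) * b ^+ 3) by rewrite /cone_form /cone_minus /step_of /at_ /U /=; rewrite /delta_of /top_H /trace1; ring.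
by nonneg_using ltac:(exact: cubic_nonneg10).
Qed.

Lemma minus_g1_1 : 0 <= cone_coord 1 (cone_minus (cone_g1 y)).
Proof.
suff : 0 <= y ^+ 2 * cone_coord 1 (cone_minus (cone_g1 y)) by rewrite pmulr_rge0 ?exprn_gt0.
have -> : y ^+ 2 * cone_coord 1 (cone_minus (cone_g1 y)) = (y + 2) ^+ 2 * (y - 1) ^+ 3 *
  ((2 * y + 2) * a ^+ 3 + (- y ^+ 4 - y ^+ 3 + 2 * y + 6) * (a ^+ 2 * b) + (y ^+ 4 + y ^+ 3 + 2 * y + 6) * (a * b ^+ 2) + (2 * y + 2) * b ^+ 3) by rewrite /cone_form /cone_minus /step_of /at_ /U /=; rewrite /delta_of /top_H /trace1; ring.
by nonneg_using ltac:(exact: cubic_nonneg8).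
Qed.

Lemma minus_g1_2 : 0 <= cone_coord 2 (cone_minus (cone_g1 y)).
Proof.
suff : 0 <= y ^+ 2 * cone_coord 2 (cone_minus (cone_g1 y)) by rewrite pmulr_rge0 ?exprn_gt0.
have -> : y ^+ 2 * cone_coord 2 (cone_minus (cone_g1 y)) = (y + 2) ^+ 2 * (y - 1) ^+ 3 *
  ((16 * y + 16) * a ^+ 3 + (- y ^+ 8 - y ^+ 7 + 9 * y ^+ 6 + 9 * y ^+ 5 - 24 * y ^+ 4 - 24 * y ^+ 3 + 16 * y ^+ 2 + 32 * y + 48) * (a ^+ 2 * b) + (- y ^+ 8 - y ^+ 7 + 9 * y ^+ 6 + 9 * y ^+ 5 - 24 * y ^+ 4 - 24 * y ^+ 3 + 16 * y ^+ 2 + 32 * y + 48) * (a * b ^+ 2) + (16 * y + 16) * b ^+ 3) by rewrite /cone_form /cone_minus /step_of /at_ /U /=; rewrite /delta_of /top_H /trace1; ring.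
by nonneg_using ltac:(exact: cubic_nonneg11).
Qed.

Lemma minus_g1_3 : 0 <= cone_coord 3 (cone_minus (cone_g1 y)).
Proof.
suff : 0 <= y ^+ 2 * cone_coord 3 (cone_minus (cone_g1 y)) by rewrite pmulr_rge0 ?exprn_gt0.
have -> : y ^+ 2 * cone_coord 3 (cone_minus (cone_g1 y)) = (y + 2) ^+ 2 * (y - 1) ^+ 3 *
  ((- y ^+ 5 + y ^+ 4 + 5 * y ^+ 3 - y ^+ 2 + 4) * a ^+ 3 + (- y ^+ 5 - y ^+ 4 + 3 * y ^+ 3 - y ^+ 2 + 12) * (a ^+ 2 * b) + (y ^+ 5 + y ^+ 4 - 3 * y ^+ 3 - 7 * y ^+ 2 + 12) * (a * b ^+ 2) + (y ^+ 5 + 3 * y ^+ 4 - y ^+ 3 - 7 * y ^+ 2 + 4) * b ^+ 3) by rewrite /cone_form /cone_minus /step_of /at_ /U /=; rewrite /delta_of /top_H /trace1; ring.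
by nonneg_using ltac:(exact: cubic_nonneg3).
Qed.

Lemma plus_g2_0 : 0 <= cone_coord 0 (cone_plus (cone_g2 y)).
Proof.
suff : 0 <= y ^+ 2 * cone_coord 0 (cone_plus (cone_g2 y)) by rewrite pmulr_rge0 ?exprn_gt0.
have -> : y ^+ 2 * cone_coord 0 (cone_plus (cone_g2 y)) = (y + 2) ^+ 2 * (y - 1) ^+ 3 *
  ((y + 1) * a ^+ 3 + (y + 2) * (a ^+ 2 * b) + ((1 : F)) * (a * b ^+ 2)) by rewrite /cone_form /cone_plus /step_of /at_ /U /=; rewrite /delta_of /top_H /trace1; ring.
by nonneg_using ltac:(exact: cubic_nonneg12).
Qed.

Lemma plus_g2_1 : 0 <= cone_coord 1 (cone_plus (cone_g2 y)).
Proof.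
suff : 0 <= y ^+ 1 * cone_coord 1 (cone_plus (cone_g2 y)) by rewrite pmulr_rge0 ?exprn_gt0.
have -> : y ^+ 1 * cone_coord 1 (cone_plus (cone_g2 y)) = (y + 2) ^+ 2 * (y - 1) ^+ 2 *
  (((1 : F)) * (a ^+ 2 * b) + ((1 : F)) * (a * b ^+ 2)) by rewrite /cone_form /cone_plus /step_of /at_ /U /=; rewrite /delta_of /top_H /trace1; ring.
by nonneg_using ltac:(exact: cubic_nonneg13).
Qed.

Lemma plus_g2_2 : 0 <= cone_coord 2 (cone_plus (cone_g2 y)).
Proof.
suff : 0 <= y ^+ 2 * cone_coord 2 (cone_plus (cone_g2 y)) by rewrite pmulr_rge0 ?exprn_gt0.
have -> : y ^+ 2 * cone_coord 2 (cone_plus (cone_g2 y)) = (y + 2) ^+ 2 * (y - 1) ^+ 3 *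
  ((2 * y + 2) * a ^+ 3 + (- y ^+ 4 - y ^+ 3 + 2 * y + 6) * (a ^+ 2 * b) + (y ^+ 4 + y ^+ 3 + 2 * y + 6) * (a * b ^+ 2) + (2 * y + 2) * b ^+ 3) by rewrite /cone_form /cone_plus /step_of /at_ /U /=; rewrite /delta_of /top_H /trace1; ring.
by nonneg_using ltac:(exact: cubic_nonneg8).
Qed.

Lemma plus_g2_3 : 0 <= cone_coord 3 (cone_plus (cone_g2 y)).
Proof.
suff : 0 <= y ^+ 2 * cone_coord 3 (cone_plus (cone_g2 y)) by rewrite pmulr_rge0 ?exprn_gt0.
have -> : y ^+ 2 * cone_coord 3 (cone_plus (cone_g2 y)) = (y + 2) ^+ 2 * (y - 1) ^+ 2 *
  ((y ^+ 2 - 1) * a ^+ 3 + (y ^+ 2 - 3) * (a ^+ 2 * b) + (y ^+ 2 - 3) * (a * b ^+ 2) + (y ^+ 2 - 1) * b ^+ 3) by rewrite /cone_form /cone_plus /step_of /at_ /U /=; rewrite /delta_of /top_H /trace1; ring.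
by nonneg_using ltac:(exact: cubic_nonneg2).
Qed.

Lemma minus_g2_0 : 0 <= cone_coord 0 (cone_minus (cone_g2 y)).
Proof.
suff : 0 <= y ^+ 2 * cone_coord 0 (cone_minus (cone_g2 y)) by rewrite pmulr_rge0 ?exprn_gt0.
have -> : y ^+ 2 * cone_coord 0 (cone_minus (cone_g2 y)) = (y + 2) ^+ 2 * (y - 1) ^+ 3 *
  (((1 : F)) * (a ^+ 2 * b) + (y + 2) * (a * b ^+ 2) + (y + 1) * b ^+ 3) by rewrite /cone_form /cone_minus /step_of /at_ /U /=; rewrite /delta_of /top_H /trace1; ring.
by nonneg_using ltac:(exact: cubic_nonneg14).
Qed.

Lemma minus_g2_1 : 0 <= cone_coord 1 (cone_minus (cone_g2 y)).
Proof.
suff : 0 <= y ^+ 1 * cone_coord 1 (cone_minus (cone_g2 y)) by rewrite pmulr_rge0 ?exprn_gt0.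
have -> : y ^+ 1 * cone_coord 1 (cone_minus (cone_g2 y)) = (y + 2) ^+ 2 * (y - 1) ^+ 2 *
  (((1 : F)) * (a ^+ 2 * b) + ((1 : F)) * (a * b ^+ 2)) by rewrite /cone_form /cone_minus /step_of /at_ /U /=; rewrite /delta_of /top_H /trace1; ring.
by nonneg_using ltac:(exact: cubic_nonneg13).
Qed.

Lemma minus_g2_2 : 0 <= cone_coord 2 (cone_minus (cone_g2 y)).
Proof.
suff : 0 <= y ^+ 2 * cone_coord 2 (cone_minus (cone_g2 y)) by rewrite pmulr_rge0 ?exprn_gt0.
have -> : y ^+ 2 * cone_coord 2 (cone_minus (cone_g2 y)) = (y + 2) ^+ 2 * (y - 1) ^+ 3 *
  ((2 * y + 2) * a ^+ 3 + (y ^+ 4 + y ^+ 3 + 2 * y + 6) * (a ^+ 2 * b) + (- y ^+ 4 - y ^+ 3 + 2 * y + 6) * (a * b ^+ 2) + (2 * y + 2) * b ^+ 3) by rewrite /cone_form /cone_minus /step_of /at_ /U /=; rewrite /delta_of /top_H /trace1; ring.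
by nonneg_using ltac:(exact: cubic_nonneg15).
Qed.

Lemma minus_g2_3 : 0 <= cone_coord 3 (cone_minus (cone_g2 y)).
Proof.
suff : 0 <= y ^+ 2 * cone_coord 3 (cone_minus (cone_g2 y)) by rewrite pmulr_rge0 ?exprn_gt0.
have -> : y ^+ 2 * cone_coord 3 (cone_minus (cone_g2 y)) = (y + 2) ^+ 2 * (y - 1) ^+ 2 *
  ((y ^+ 2 - 1) * a ^+ 3 + (y ^+ 2 - 3) * (a ^+ 2 * b) + (y ^+ 2 - 3) * (a * b ^+ 2) + (y ^+ 2 - 1) * b ^+ 3) by rewrite /cone_form /cone_minus /step_of /at_ /U /=; rewrite /delta_of /top_H /trace1; ring.
by nonneg_using ltac:(exact: cubic_nonneg2).
Qed.

Lemma plus_g3_0 : 0 <= cone_coord 0 (cone_plus (cone_g3 y)).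
Proof.
suff : 0 <= y ^+ 2 * cone_coord 0 (cone_plus (cone_g3 y)) by rewrite pmulr_rge0 ?exprn_gt0.
have -> : y ^+ 2 * cone_coord 0 (cone_plus (cone_g3 y)) = (y + 2) ^+ 2 * (y - 1) ^+ 3 *
  ((y ^+ 4 + y ^+ 3 - 2 * y ^+ 2 + 2) * a ^+ 3 + (- 2 * y ^+ 2 + 4) * (a ^+ 2 * b) + ((2 : F)) * (a * b ^+ 2)) by rewrite /cone_form /cone_plus /step_of /at_ /U /=; rewrite /delta_of /top_H /trace1; ring.
by nonneg_using ltac:(exact: cubic_nonneg16).
Qed.

Lemma plus_g3_1 : 0 <= cone_coord 1 (cone_plus (cone_g3 y)).
Proof.
suff : 0 <= y ^+ 2 * cone_coord 1 (cone_plus (cone_g3 y)) by rewrite pmulr_rge0 ?exprn_gt0.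
have -> : y ^+ 2 * cone_coord 1 (cone_plus (cone_g3 y)) = (y + 2) ^+ 2 * (y - 1) ^+ 3 *
  ((y + 1) * a ^+ 3 + (y + 2) * (a ^+ 2 * b) + ((1 : F)) * (a * b ^+ 2)) by rewrite /cone_form /cone_plus /step_of /at_ /U /=; rewrite /delta_of /top_H /trace1; ring.
by nonneg_using ltac:(exact: cubic_nonneg12).
Qed.

Lemma plus_g3_2 : 0 <= cone_coord 2 (cone_plus (cone_g3 y)).
Proof.
suff : 0 <= y ^+ 2 * cone_coord 2 (cone_plus (cone_g3 y)) by rewrite pmulr_rge0 ?exprn_gt0.
have -> : y ^+ 2 * cone_coord 2 (cone_plus (cone_g3 y)) = (y + 2) ^+ 2 * (y - 1) ^+ 3 *
  ((- y ^+ 5 + y ^+ 4 + 5 * y ^+ 3 - y ^+ 2 + 4) * a ^+ 3 + (- y ^+ 5 - 2 * y ^+ 4 + 5 * y ^+ 3 + 2 * y ^+ 2 - 4 * y + 8) * (a ^+ 2 * b) + (y ^+ 4 + 4 * y ^+ 3 + 3 * y ^+ 2 - 4 * y + 4) * (a * b ^+ 2)) by rewrite /cone_form /cone_plus /step_of /at_ /U /=; rewrite /delta_of /top_H /trace1; ring.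
by nonneg_using ltac:(exact: cubic_nonneg7).
Qed.

Lemma plus_g3_3 : 0 <= cone_coord 3 (cone_plus (cone_g3 y)).
Proof.
suff : 0 <= y ^+ 2 * cone_coord 3 (cone_plus (cone_g3 y)) by rewrite pmulr_rge0 ?exprn_gt0.
have -> : y ^+ 2 * cone_coord 3 (cone_plus (cone_g3 y)) = (y + 2) ^+ 2 * (y - 1) ^+ 3 *
  ((y ^+ 4 + y ^+ 3 - 2 * y ^+ 2 - y + 1) * a ^+ 3 + (- 2 * y ^+ 2 - y + 3) * (a ^+ 2 * b) + (y + 3) * (a * b ^+ 2) + (y + 1) * b ^+ 3) by rewrite /cone_form /cone_plus /step_of /at_ /U /=; rewrite /delta_of /top_H /trace1; ring.
by nonneg_using ltac:(exact: cubic_nonneg1).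
Qed.

Lemma minus_g3_0 : 0 <= cone_coord 0 (cone_minus (cone_g3 y)).
Proof.
suff : 0 <= y ^+ 2 * cone_coord 0 (cone_minus (cone_g3 y)) by rewrite pmulr_rge0 ?exprn_gt0.
have -> : y ^+ 2 * cone_coord 0 (cone_minus (cone_g3 y)) = (y + 2) ^+ 2 * (y - 1) ^+ 3 *
  ((y + 1) * a ^+ 3 + (y + 3) * (a ^+ 2 * b) + (y + 3) * (a * b ^+ 2) + (y + 1) * b ^+ 3) by rewrite /cone_form /cone_minus /step_of /at_ /U /=; rewrite /delta_of /top_H /trace1; ring.
by nonneg_using ltac:(exact: cubic_nonneg17).
Qed.

Lemma minus_g3_1 : 0 <= cone_coord 1 (cone_minus (cone_g3 y)).
Proof.
suff : 0 <= y ^+ 2 * cone_coord 1 (cone_minus (cone_g3 y)) by rewrite pmulr_rge0 ?exprn_gt0.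
have -> : y ^+ 2 * cone_coord 1 (cone_minus (cone_g3 y)) = (y + 2) ^+ 2 * (y - 1) ^+ 3 *
  ((y + 1) * a ^+ 3 + (y + 2) * (a ^+ 2 * b) + ((1 : F)) * (a * b ^+ 2)) by rewrite /cone_form /cone_minus /step_of /at_ /U /=; rewrite /delta_of /top_H /trace1; ring.
by nonneg_using ltac:(exact: cubic_nonneg12).
Qed.

Lemma minus_g3_2 : 0 <= cone_coord 2 (cone_minus (cone_g3 y)).
Proof.
suff : 0 <= y ^+ 2 * cone_coord 2 (cone_minus (cone_g3 y)) by rewrite pmulr_rge0 ?exprn_gt0.
have -> : y ^+ 2 * cone_coord 2 (cone_minus (cone_g3 y)) = (y + 2) ^+ 2 * (y - 1) ^+ 3 *
  ((y ^+ 5 + 3 * y ^+ 4 - y ^+ 3 - 7 * y ^+ 2 + 4 * y + 8) * a ^+ 3 + (y ^+ 5 + 2 * y ^+ 4 - 5 * y ^+ 3 - 10 * y ^+ 2 + 8 * y + 20) * (a ^+ 2 * b) + (- y ^+ 4 - 4 * y ^+ 3 - 3 * y ^+ 2 + 8 * y + 16) * (a * b ^+ 2) + (4 * y + 4) * b ^+ 3) by rewrite /cone_form /cone_minus /step_of /at_ /U /=; rewrite /delta_of /top_H /trace1; ring.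
by nonneg_using ltac:(exact: cubic_nonneg18).
Qed.

Lemma minus_g3_3 : 0 <= cone_coord 3 (cone_minus (cone_g3 y)).
Proof.
suff : 0 <= y ^+ 2 * cone_coord 3 (cone_minus (cone_g3 y)) by rewrite pmulr_rge0 ?exprn_gt0.
have -> : y ^+ 2 * cone_coord 3 (cone_minus (cone_g3 y)) = (y + 2) ^+ 2 * (y - 1) ^+ 3 *
  ((y ^+ 4 + y ^+ 3 - 2 * y ^+ 2 - y + 1) * a ^+ 3 + (- 2 * y ^+ 2 - y + 3) * (a ^+ 2 * b) + (y + 3) * (a * b ^+ 2) + (y + 1) * b ^+ 3) by rewrite /cone_form /cone_minus /step_of /at_ /U /=; rewrite /delta_of /top_H /trace1; ring.
by nonneg_using ltac:(exact: cubic_nonneg1).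
Qed.

Lemma positive_g0 : 0 <= seq_at 0 (cone_g0 y).
Proof.
suff : 0 <= y ^+ 2 * seq_at 0 (cone_g0 y) by rewrite pmulr_rge0 ?exprn_gt0.
have -> : y ^+ 2 * seq_at 0 (cone_g0 y) = (y + 2) ^+ 0 * (y - 1) ^+ 1 *
  ((y ^+ 4 + y ^+ 3 - 2 * y ^+ 2 + 2) * a ^+ 3 + (- 2 * y ^+ 2 + 6) * (a ^+ 2 * b) + (- 2 * y ^+ 2 + 6) * (a * b ^+ 2) + (y ^+ 4 + y ^+ 3 - 2 * y ^+ 2 + 2) * b ^+ 3) by rewrite /seq_at /at_ /U /=; rewrite ?/delta_of ?/top_H ?/trace1; ring.
by nonneg_using ltac:(exact: cubic_nonneg19).
Qed.

Lemma positive_g1 : 0 <= seq_at 0 (cone_g1 y).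
Proof.
suff : 0 <= y ^+ 2 * seq_at 0 (cone_g1 y) by rewrite pmulr_rge0 ?exprn_gt0.
have -> : y ^+ 2 * seq_at 0 (cone_g1 y) = (y + 2) ^+ 0 * (y - 1) ^+ 1 *
  ((- y ^+ 5 + y ^+ 4 + 5 * y ^+ 3 - y ^+ 2 + 4 * y + 8) * a ^+ 3 + (- y ^+ 5 - 3 * y ^+ 4 + y ^+ 3 - y ^+ 2 + 4 * y + 24) * (a ^+ 2 * b) + (y ^+ 5 + 3 * y ^+ 4 - y ^+ 3 - 7 * y ^+ 2 + 4 * y + 24) * (a * b ^+ 2) + (y ^+ 5 + 3 * y ^+ 4 - y ^+ 3 - 7 * y ^+ 2 + 4 * y + 8) * b ^+ 3) by rewrite /seq_at /at_ /U /=; rewrite ?/delta_of ?/top_H ?/trace1; ring.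
by nonneg_using ltac:(exact: cubic_nonneg20).
Qed.

Lemma positive_g2 : 0 <= seq_at 0 (cone_g2 y).
Proof.
suff : 0 <= y ^+ 2 * seq_at 0 (cone_g2 y) by rewrite pmulr_rge0 ?exprn_gt0.
have -> : y ^+ 2 * seq_at 0 (cone_g2 y) = (y + 2) ^+ 0 * (y - 1) ^+ 1 *
  ((y + 1) * a ^+ 3 + (y + 3) * (a ^+ 2 * b) + (y + 3) * (a * b ^+ 2) + (y + 1) * b ^+ 3) by rewrite /seq_at /at_ /U /=; rewrite ?/delta_of ?/top_H ?/trace1; ring.
by nonneg_using ltac:(exact: cubic_nonneg17).
Qed.

Lemma positive_g3 : 0 <= seq_at 0 (cone_g3 y).
Proof.
suff : 0 <= y ^+ 2 * seq_at 0 (cone_g3 y) by rewrite pmulr_rge0 ?exprn_gt0.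
have -> : y ^+ 2 * seq_at 0 (cone_g3 y) = (y + 2) ^+ 0 * (y - 1) ^+ 1 *
  ((y ^+ 4 + y ^+ 3 - 2 * y ^+ 2 + y + 3) * a ^+ 3 + (- 2 * y ^+ 2 + y + 7) * (a ^+ 2 * b) + (y + 5) * (a * b ^+ 2) + (y + 1) * b ^+ 3) by rewrite /seq_at /at_ /U /=; rewrite ?/delta_of ?/top_H ?/trace1; ring.
by nonneg_using ltac:(exact: cubic_nonneg21).
Qed.

Lemma delta_pos : 0 < delta_of y.
Proof. by rewrite exprn_gt0// mulr_gt0//; move: y7; lra. Qed.

Lemma cone_plusP v : in_cone y v -> in_cone y (cone_plus v).
Proof.
move=> kv i i4; have d2 : 0 < 2 * delta_of y by rewrite mulr_gt0 ?delta_pos.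
rewrite -(pmulr_rge0 _ d2) (coord_step _ i4).
have k0 := kv 0%N isT; have k1 := kv 1%N isT; have k2 := kv 2%N isT; have k3 := kv 3%N isT.
have two : (0 : F) <= 2 by [].
have G (g0 g1 g2 g3 : F) : 0 <= g0 -> 0 <= g1 -> 0 <= g2 -> 0 <= g3 ->
    0 <= 2 * cone_form y 0 v * g0 + cone_form y 1 v * g1 + cone_form y 2 v * g2 + 2 * cone_form y 3 v * g3.
  by move=> *; rewrite !addr_ge0// !mulr_ge0.
case: i i4 => [|[|[|[|i]]]] // _; apply: G.
- exact: plus_g0_0. - exact: plus_g1_0. - exact: plus_g2_0. - exact: plus_g3_0.
- exact: plus_g0_1. - exact: plus_g1_1. - exact: plus_g2_1. - exact: plus_g3_1.
- exact: plus_g0_2. - exact: plus_g1_2. - exact: plus_g2_2. - exact: plus_g3_2.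
- exact: plus_g0_3. - exact: plus_g1_3. - exact: plus_g2_3. - exact: plus_g3_3.
Qed.

Lemma cone_minusP v : in_cone y v -> in_cone y (cone_minus v).
Proof.
move=> kv i i4; have d2 : 0 < 2 * delta_of y by rewrite mulr_gt0 ?delta_pos.
rewrite -(pmulr_rge0 _ d2) (coord_step_minus _ i4).
have k0 := kv 0%N isT; have k1 := kv 1%N isT; have k2 := kv 2%N isT; have k3 := kv 3%N isT.
have two : (0 : F) <= 2 by [].
have G (g0 g1 g2 g3 : F) : 0 <= g0 -> 0 <= g1 -> 0 <= g2 -> 0 <= g3 ->
    0 <= 2 * cone_form y 0 v * g0 + cone_form y 1 v * g1 + cone_form y 2 v * g2 + 2 * cone_form y 3 v * g3.
  by move=> *; rewrite !addr_ge0// !mulr_ge0.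
case: i i4 => [|[|[|[|i]]]] // _; apply: G.
- exact: minus_g0_0. - exact: minus_g1_0. - exact: minus_g2_0. - exact: minus_g3_0.
- exact: minus_g0_1. - exact: minus_g1_1. - exact: minus_g2_1. - exact: minus_g3_1.
- exact: minus_g0_2. - exact: minus_g1_2. - exact: minus_g2_2. - exact: minus_g3_2.
- exact: minus_g0_3. - exact: minus_g1_3. - exact: minus_g2_3. - exact: minus_g3_3.
Qed.

Lemma seq_at_ge0 v : in_cone y v -> 0 <= seq_at 0 v.
Proof.
move=> kv; have d2 : 0 < 2 * delta_of y by rewrite mulr_gt0 ?delta_pos.
rewrite -(pmulr_rge0 _ d2) seq_at_gen.
have k0 := kv 0%N isT; have k1 := kv 1%N isT; have k2 := kv 2%N isT; have k3 := kv 3%N isT.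
by rewrite !addr_ge0// !mulr_ge0// ?positive_g0 ?positive_g1 ?positive_g2 ?positive_g3.
Qed.

Lemma seq_at_gt0 v : 0 < z -> in_open_cone y v -> 0 < seq_at 0 v.
Proof.
move=> z0 kv; have d2 : 0 < 2 * delta_of y by rewrite mulr_gt0 ?delta_pos.
rewrite -(pmulr_rgt0 _ d2) seq_at_gen.
have k0 := ltW (kv 0%N isT); have k1 := ltW (kv 1%N isT); have k3 := ltW (kv 3%N isT).
have g2 : 0 < seq_at 0 (cone_g2 y).
  rewrite -(@pmulr_rgt0 _ y)//.
  have -> : y * seq_at 0 (cone_g2 y) = z * ((y ^+ 2 - 1) * (a ^+ 2 + b ^+ 2) + 2 * (y - 1) * (a * b)).
    by rewrite /seq_at /at_ /U /=; ring.
  have ab0 : 0 <= a * b by exact: mulr_ge0.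
  have ab : 0 < a + b by rewrite subrK mulr_gt0.
  have sq : 0 < a ^+ 2 + b ^+ 2.
    have E : 2 * (a ^+ 2 + b ^+ 2) = (a + b) ^+ 2 + (a - b) ^+ 2 by ring.
    by rewrite -(@pmulr_rgt0 _ 2)// E ltr_wpDr ?sqr_ge0 ?exprn_gt0.
  have q1 : 0 < y ^+ 2 - 1 by move: yy2; lra.
  apply: mulr_gt0 => //; apply: ltr_wpDr; last exact: mulr_gt0.
  by apply: mulr_ge0 => //; apply: mulr_ge0.
apply: ltr_wpDr; first by rewrite !mulr_ge0// positive_g3.
apply: ltr_wpDl; last by rewrite mulr_gt0// kv.
by rewrite addr_ge0// !mulr_ge0// ?positive_g0 ?positive_g1.
Qed.

End step.
End cone.

(** * Ping-pong *)

Section dynamics.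
Context {R : realType}.
Variable N : nat.
Hypothesis N4 : (4 <= N)%N.
Local Notation theta := (pi / N%:R : R).
Definition half_trace : R := 2 * cos theta.
Local Notation y := half_trace.
Definition sn (x : R) : R := sin (x * theta).

Lemma N_pos : 0 < N%:R :> R.
Proof. by rewrite ltr0n; exact: leq_trans N4. Qed.

Lemma theta_pos : 0 < theta.
Proof. by rewrite divr_gt0 ?pi_gt0 ?N_pos. Qed.

Lemma theta_le : theta <= pi / 4.
Proof. by rewrite ler_pM2l ?pi_gt0// lef_pV2 ?posrE ?N_pos// ler_nat. Qed.

Lemma y_bounds : [/\ 0 <= 5 * y - 7, 0 <= 2 - y & 0 <= y ^+ 2 - 2].
Proof.
have p := pi_gt0 R; have t0 := theta_pos; have t1 := theta_le.
have c0 : 0 < cos theta by apply: cos_gt0_pihalf; apply/andP; split; lra.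
have c1 := cos_le1 theta.
have c2 : 0 <= cos (theta *+ 2) by apply: cos_ge0_pihalf; rewrite -mulr_natr; apply/andP; split; lra.
have sq : 0 <= y ^+ 2 - 2.
  by move: c2; rewrite cos_mulr2n -mulr_natr /half_trace; move: (cos theta) => c'; nra.
split=> //; last by rewrite /half_trace; lra.
by move: sq c0; rewrite /half_trace; move: (cos theta) => c'; nra.
Qed.

Lemma sn_rec x : sn (x - 1) = y * sn x - sn (x + 1).
Proof.
have e1 : (x - 1) * theta = x * theta - theta by ring.
have e2 : (x + 1) * theta = x * theta + theta by ring.
by rewrite /sn e1 e2 sinB sinD /half_trace; ring.
Qed.

Lemma sn_rec' x : sn (x + 1) = y * sn x - sn (x - 1).
Proof. by rewrite sn_rec; ring. Qed.

Lemma sn_opp x : sn (- x) = - sn x.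
Proof. by rewrite /sn mulNr sinN. Qed.

Lemma sn_gt0 (k : nat) : (0 < k < N)%N -> 0 < sn k%:R.
Proof.
move=> /andP[k0 kN]; apply: sin_gt0_pi; have t0 := theta_pos.
rewrite mulr_gt0 ?ltr0n//=.
have E : N%:R * theta = pi by rewrite mulrC divfK// gt_eqF// N_pos.
by rewrite -[X in _ < X]E ltr_pM2r// ltr_nat.
Qed.

Lemma sn_N x : sn (x + N%:R) = - sn x.
Proof.
rewrite /sn mulrDl [N%:R * _]mulrC divfK ?gt_eqF ?N_pos//.
by rewrite sinDpi.
Qed.

Lemma sn0 : sn 0 = 0. Proof. by rewrite /sn mul0r sin0. Qed.

Definition un (x : R) : R := sn (x - 1) * sn x * sn (x + 1).
Local Notation D := (un 2).

Lemma un_pos : 0 < D.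
Proof.
rewrite /un (_ : 2 - 1 = 1%:R); last by lra.
rewrite (_ : 2 + 1 = 3%:R); last by lra.
by rewrite !mulr_gt0// ?sn_gt0// -?[2]/(2%:R) ?sn_gt0//; apply: (leq_trans _ N4).
Qed.

Lemma un_opp x : un (- x) = - un x.
Proof.
rewrite /un (_ : - x - 1 = - (x + 1)); last by ring.
by rewrite (_ : - x + 1 = - (x - 1)) ?sn_opp; ring.
Qed.

Lemma un_N x : un (x + N%:R) = - un x.
Proof.
rewrite /un (_ : x + N%:R - 1 = (x - 1) + N%:R); last by ring.
rewrite (_ : x + N%:R + 1 = (x + 1) + N%:R); last by ring.
by rewrite !sn_N; ring.
Qed.

Lemma un_rec x : un (x + 2) = trace1 y * un (x + 1) - trace2 y * un x + trace1 y * un (x - 1) - un (x - 2).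
Proof.
rewrite /un /trace1 /trace2.
have -> : x + 2 - 1 = x + 1 by ring.
have -> : x + 1 - 1 = x by ring.
have -> : x - 1 + 1 = x by ring.
have -> : x - 2 + 1 = x - 1 by ring.
have -> : x + 1 + 1 = x + 2 by ring.
have -> : x - 1 - 1 = x - 2 by ring.
have e2 := sn_rec' (x + 1); have e3 := sn_rec' (x + 2); have f2 := sn_rec (x - 1); have f3 := sn_rec (x - 2).
have e1 := sn_rec x.
have a1 : x + 1 + 1 = x + 2 by ring. have a2 : x + 1 - 1 = x by ring.
have a3 : x + 2 - 1 = x + 1 by ring. have a4 : x - 1 + 1 = x by ring.
have a5 : x - 1 - 1 = x - 2 by ring. have a6 : x - 2 + 1 = x - 1 by ring.
rewrite a1 a2 in e2; rewrite a3 in e3; rewrite a4 a5 in f2; rewrite a6 in f3.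
rewrite e3 e2 f3 f2 e1; ring.
Qed.

Lemma un0 : un 0 = 0. Proof. by rewrite /un sn0 mulr0 mul0r. Qed.
Lemma un1 : un 1 = 0. Proof. by rewrite /un subrr sn0 !mul0r. Qed.
Lemma un3 : un 3 = trace1 y * D.
Proof.
have := un_rec 1; rewrite subrr un0 un1 (_ : 1 - 2 = - 1) ?un_opp ?un1; last by ring.
have e1 : 1 + 2 = 3 :> R by ring. have e2 : 1 + 1 = 2 :> R by ring.
by rewrite e1 e2 => ->; ring.
Qed.

Implicit Types w v u : 'rV[R]_4.
Definition al w := w 0 (inord 0).
Definition tv w := Vec4 (w 0 (inord 0)) (w 0 (inord 1)) (w 0 (inord 2)) (w 0 (inord 3)).

(** A vector is a sequence, a combination of four translates of [un]. *)
Definition pq w (x : R) := w 0 (inord 0) * un (x - 2) + w 0 (inord 1) * un (x - 1) +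
  w 0 (inord 2) * un x + w 0 (inord 3) * un (x + 1).

Lemma row4_coord (a b c d : R) : [/\ row4 a b c d 0 (inord 0) = a, row4 a b c d 0 (inord 1) = b,
  row4 a b c d 0 (inord 2) = c & row4 a b c d 0 (inord 3) = d].
Proof. by rewrite /row4; split; rewrite mxE inordK. Qed.

Lemma pq_row4 a b c d x : pq (row4 a b c d) x = a * un (x - 2) + b * un (x - 1) + c * un x + d * un (x + 1).
Proof. by have [e0 e1 e2 e3] := row4_coord a b c d; rewrite /pq e0 e1 e2 e3. Qed.

Lemma tv_row4 a b c d : tv (row4 a b c d) = Vec4 a b c d.
Proof. by have [e0 e1 e2 e3] := row4_coord a b c d; rewrite /tv e0 e1 e2 e3. Qed.

Lemma pqD v w x : pq (v + w) x = pq v x + pq w x. Proof. by rewrite /pq !mxE; ring. Qed.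
Lemma pqZ k w x : pq (k *: w) x = k * pq w x. Proof. by rewrite /pq !mxE; ring. Qed.
Lemma pqN w x : pq (- w) x = - pq w x. Proof. by rewrite /pq !mxE; ring. Qed.

Lemma pq_N w x : pq w (x + N%:R) = - pq w x.
Proof.
rewrite /pq (_ : x + N%:R - 2 = (x - 2) + N%:R); last by ring.
rewrite (_ : x + N%:R - 1 = (x - 1) + N%:R); last by ring.
by rewrite (_ : x + N%:R + 1 = (x + 1) + N%:R) ?un_N; ring.
Qed.

Local Notation S := (model_S y).
Local Notation H := (model_H y).

Lemma pq_S w x : pq (w *m S) x = pq w (x + 1).
Proof.
rewrite (row4E w) model_SE !pq_row4 -/(trace1 y) -/(trace2 y).
have -> : x + 1 - 2 = x - 1 by ring.
have -> : x + 1 - 1 = x by ring.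
have -> : x + 1 + 1 = x + 2 by ring.
rewrite un_rec; ring.
Qed.

Lemma pq_Sn w j x : pq (w *m S ^+ j) x = pq w (x + j%:R).
Proof.
elim: j w x => [|j IH] w x; first by rewrite expr0 mulmx1 addr0.
by rewrite exprS -mulmxE mulmxA IH pq_S -addrA -natr1.
Qed.

Lemma coords w : D *: w = row4 (- pq w 0) (trace1 y * pq w 0 - pq w (- 1)) (pq w 2 - trace1 y * pq w 1) (pq w 1).
Proof.
rewrite {1}(row4E w) row4Z /pq.
have z1 : un (- 1) = 0 by rewrite un_opp un1 oppr0.
have z2 : un (- 2) = - D by rewrite un_opp.
have z3 : un (- 3) = - (trace1 y * D) by rewrite un_opp un3.
have -> : 0 - 2 = - 2 :> R by ring. have -> : 0 - 1 = - 1 :> R by ring.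
have -> : 0 + 1 = 1 :> R by ring. have -> : - 1 - 2 = - 3 :> R by ring.
have -> : - 1 - 1 = - 2 :> R by ring. have -> : - 1 + 1 = 0 :> R by ring.
have -> : 2 - 2 = 0 :> R by ring. have -> : 2 - 1 = 1 :> R by ring.
have -> : 2 + 1 = 3 :> R by ring. have -> : 1 - 2 = - 1 :> R by ring.
have -> : 1 - 1 = 0 :> R by ring. have -> : 1 + 1 = 2 :> R by ring.
rewrite z1 z2 z3 un0 un1 un3; congr row4; ring.
Qed.

Lemma pq_inj v w : (forall x, pq v x = pq w x) -> v = w.
Proof.
move=> vw; have D0 : D != 0 by rewrite gt_eqF// un_pos.
by apply: (scalerI D0); rewrite !coords !vw.
Qed.

Lemma al_pq w : D * al w = - pq w 0.
Proof.
have := congr1 (fun u : 'rV_4 => u 0 (inord 0)) (coords w); rewrite mxE.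
by have [-> _ _ _] := row4_coord (- pq w 0) (trace1 y * pq w 0 - pq w (- 1)) (pq w 2 - trace1 y * pq w 1) (pq w 1).
Qed.

Lemma last_pq w : D * w 0 (inord 3) = pq w 1.
Proof.
have := congr1 (fun u : 'rV_4 => u 0 (inord 3)) (coords w); rewrite mxE.
by have [_ _ _ ->] := row4_coord (- pq w 0) (trace1 y * pq w 0 - pq w (- 1)) (pq w 2 - trace1 y * pq w 1) (pq w 1).
Qed.

(** The reflection that reverses the sequences. *)
Definition refl w : 'rV[R]_4 := row4 (al w) (- w 0 (inord 3) - trace1 y * al w)
  (trace2 y * al w - w 0 (inord 2)) (- w 0 (inord 1) - trace1 y * al w).

Lemma pq_refl w x : pq (refl w) x = pq w (- x).
Proof.
rewrite /refl pq_row4 /pq /al.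
have -> : - x - 2 = - (x + 2) by ring. have -> : - x - 1 = - (x + 1) by ring.
have -> : - x + 1 = - (x - 1) by ring.
rewrite !un_opp un_rec; ring.
Qed.

Lemma reflK w : refl (refl w) = w.
Proof. by apply: pq_inj => x; rewrite !pq_refl opprK. Qed.
Lemma reflN w : refl (- w) = - refl w.
Proof. by apply: pq_inj => x; rewrite pqN !pq_refl pqN. Qed.
Lemma reflD v w : refl (v + w) = refl v + refl w.
Proof. by apply: pq_inj => x; rewrite pqD !pq_refl pqD. Qed.
Lemma reflZ k w : refl (k *: w) = k *: refl w.
Proof. by apply: pq_inj => x; rewrite pqZ !pq_refl pqZ. Qed.

Lemma al_refl w : al (refl w) = al w.
Proof. by rewrite /al /refl; have [-> _ _ _] := row4_coord (al w) (- w 0 (inord 3) - trace1 y * al w)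
  (trace2 y * al w - w 0 (inord 2)) (- w 0 (inord 1) - trace1 y * al w). Qed.

Lemma refl_H : refl H = - H.
Proof.
rewrite /refl /al /model_H.
have [-> -> -> ->] := row4_coord 0 (4 + (y ^+ 3 - 2 * y)) (2 * (4 + (y ^+ 3 - 2 * y)) - ((y + 2) * (y - 1)) ^+ 2) (4 + (y ^+ 3 - 2 * y)).
rewrite -[RHS]scaleN1r row4Z; congr row4; rewrite /trace1 /trace2; ring.
Qed.

Lemma al_H : al H = 0.
Proof. by rewrite /al /model_H; have [-> _ _ _] := row4_coord 0 (4 + (y ^+ 3 - 2 * y)) (2 * (4 + (y ^+ 3 - 2 * y)) - ((y + 2) * (y - 1)) ^+ 2) (4 + (y ^+ 3 - 2 * y)). Qed.

Lemma S_N w : w *m S ^+ N = - w.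
Proof. by apply: pq_inj => x; rewrite pq_Sn pq_N pqN. Qed.

Lemma refl_S j w : (j <= N)%N -> refl w *m S ^+ j = - refl (w *m S ^+ (N - j)).
Proof.
move=> jN; apply: pq_inj => x; rewrite pq_Sn pqN !pq_refl pq_Sn natrB//.
have -> : - x + (N%:R - j%:R) = - (x + j%:R) + N%:R by ring.
by rewrite pq_N opprK.
Qed.

Definition inK w := in_cone y (tv w).
Definition inKo w := in_open_cone y (tv w).
Definition inX w := [\/ inK w, inK (- w), inK (refl w) | inK (- refl w)].

Lemma coordD i v w : cone_form y i (tv (v + w)) = cone_form y i (tv v) + cone_form y i (tv w).
Proof. by rewrite /cone_form /tv !mxE /=; case: i => [|[|[|i]]]; ring. Qed.
Lemma coordZ i k w : cone_form y i (tv (k *: w)) = k * cone_form y i (tv w).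
Proof. by rewrite /cone_form /tv !mxE /=; case: i => [|[|[|i]]]; ring. Qed.

Lemma inKD v w : inK v -> inK w -> inK (v + w).
Proof. by move=> hv hw i i4; rewrite coordD addr_ge0 ?hv ?hw. Qed.
Lemma inKZ k w : 0 <= k -> inK w -> inK (k *: w).
Proof. by move=> k0 hw i i4; rewrite coordZ mulr_ge0 ?hw. Qed.
Lemma inKZ' k w : 0 < k -> inK (k *: w) -> inK w.
Proof. by move=> k0 hw i i4; have := hw i i4; rewrite coordZ pmulr_rge0. Qed.

Lemma inK_H : inK H.
Proof.
have [y7 y2 yy2] := y_bounds.
move=> i i4; rewrite /model_H tv_row4.
have d0 := @delta_pos _ y y7; have d1 := ltW d0.
have h1 : 0 <= 4 * ((y + 2) * (y - 1)) ^+ 2 by rewrite mulr_ge0 ?sqr_ge0.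
case: i i4 => [|[|[|[|i]]]] // _; rewrite /cone_form /= /top_H /delta_of /trace1; move: d1; rewrite /delta_of => d1.
- by apply: (le_trans d1); rewrite le_eqVlt; apply/orP; left; apply/eqP; ring.
- by rewrite le_eqVlt; apply/orP; left; apply/eqP; ring.
- have h2 : 0 <= 4 * ((y + 2) * (y - 1)) ^+ 2 * ((y + 2) * (y - 1)) ^+ 2 by rewrite mulr_ge0 ?sqr_ge0.
  first [by apply: (le_trans h1); rewrite le_eqVlt; apply/orP; left; apply/eqP; ring | by apply: (le_trans h2); rewrite le_eqVlt; apply/orP; left; apply/eqP; ring].
- by rewrite le_eqVlt; apply/orP; left; apply/eqP; ring.
Qed.

Lemma U_center x n : (n < 8)%N -> U y (sn x) (sn (x + 1)) n = un (x + n%:R - 4).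
Proof.
have r1 := sn_rec x; have r2 := sn_rec (x - 1); have r3 := sn_rec (x - 2); have r4 := sn_rec (x - 3).
have r5 := sn_rec (x - 4); have q2 := sn_rec' (x + 1); have q3 := sn_rec' (x + 2); have q4 := sn_rec' (x + 3).
have a1 : x - 1 + 1 = x by ring. have a2 : x - 1 - 1 = x - 2 by ring.
have a3 : x - 2 + 1 = x - 1 by ring. have a4 : x - 2 - 1 = x - 3 by ring.
have a5 : x - 3 + 1 = x - 2 by ring. have a6 : x - 3 - 1 = x - 4 by ring.
have a7 : x - 4 + 1 = x - 3 by ring. have a8 : x - 4 - 1 = x - 5 by ring.
have b1 : x + 1 + 1 = x + 2 by ring. have b2 : x + 1 - 1 = x by ring.
have b3 : x + 2 + 1 = x + 3 by ring. have b4 : x + 2 - 1 = x + 1 by ring.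
have b5 : x + 3 + 1 = x + 4 by ring. have b6 : x + 3 - 1 = x + 2 by ring.
rewrite a1 a2 in r2; rewrite a3 a4 in r3; rewrite a5 a6 in r4; rewrite a7 a8 in r5.
rewrite b1 b2 in q2; rewrite b3 b4 in q3; rewrite b5 b6 in q4.
case: n => [|[|[|[|[|[|[|[|n]]]]]]]] // _; rewrite /U -?r1 -?r2 -?r3 -?r4 -?r5 -?q2 -?q3 -?q4 /un.
- by rewrite addr0 a7 a8; ring.
- by rewrite (_ : x + 1%:R - 4 = x - 3) ?a5 ?a6; ring.
- by rewrite (_ : x + 2%:R - 4 = x - 2) ?a3 ?a4; ring.
- by rewrite (_ : x + 3%:R - 4 = x - 1) ?a1 ?a2; ring.
- by rewrite (_ : x + 4%:R - 4 = x); ring.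
- by rewrite (_ : x + 5%:R - 4 = x + 1) ?b1 ?b2; ring.
- by rewrite (_ : x + 6%:R - 4 = x + 2) ?b3 ?b4; ring.
- by rewrite (_ : x + 7%:R - 4 = x + 3) ?b5 ?b6; ring.
Qed.

Lemma at_pq w x i : (i < 5)%N -> at_ y (sn x) (sn (x + 1)) i (tv w) = pq w (x + i%:R - 2).
Proof.
move=> i5.
have h0 : (i < 8)%N by case: i i5 => [|[|[|[|[|i]]]]].
have h1 : (i.+1 < 8)%N by case: i i5 {h0} => [|[|[|[|[|i]]]]].
have h2 : (i.+2 < 8)%N by case: i i5 {h0 h1} => [|[|[|[|[|i]]]]].
have h3 : (i.+3 < 8)%N by case: i i5 {h0 h1 h2} => [|[|[|[|[|i]]]]].
rewrite /at_ /pq (U_center x h0) (U_center x h1) (U_center x h2) (U_center x h3).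
have en k : k.+1%:R = k%:R + 1 :> R by rewrite natr1.
rewrite (en i.+2) (en i.+1) (en i).
have -> : x + i%:R - 2 - 2 = x + i%:R - 4 by ring.
have -> : x + (i%:R + 1) - 4 = x + i%:R - 2 - 1 by ring.
have -> : x + (i%:R + 1 + 1) - 4 = x + i%:R - 2 by ring.
have -> : x + (i%:R + 1 + 1 + 1) - 4 = x + i%:R - 2 + 1 by ring.
by [].
Qed.

(** Up to sign, the image of [u] under the transvection. *)
Definition recoil u := - al u *: H - u.

Lemma recoil_step u : tv (D *: recoil u) = step_of y (pq u (- 1)) (pq u 0) (pq u 1) (pq u 2).
Proof.
rewrite /recoil scalerBr scalerA coords mulrN al_pq opprK /model_H row4Z -scaleN1r row4Z row4D tv_row4.
rewrite /step_of /top_H /trace1 /delta_of; congr Vec4; ring.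
Qed.

Lemma sn_ge0 (j : nat) : (0 < j < N)%N -> 0 <= y * sn j%:R - sn (j%:R + 1) /\ 0 <= sn (j%:R + 1).
Proof.
move=> /andP[j0 jN]; rewrite -sn_rec natr1; split.
  have -> : j%:R - 1 = j.-1%:R :> R by rewrite -{1}(prednK j0) -natr1 addrK.
  case: j j0 jN => [|[|j]] //= _ jN; first by rewrite sn0.
  by rewrite ltW// sn_gt0//= ltnW.
have [->|ne] := eqVneq j.+1 N; last by rewrite ltW// sn_gt0//= ltn_neqAle ne.
by rewrite -[N%:R]add0r sn_N sn0 oppr0.
Qed.

Lemma recoil_plus w j : (0 < j < N)%N -> inK w -> inK (recoil (w *m S ^+ j)).
Proof.
move=> jN Kw; apply: (inKZ' un_pos); rewrite /inK recoil_step !pq_Sn.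
have [y7 y2 yy2] := y_bounds; have [a0 b0] := sn_ge0 jN.
have := cone_plusP y7 y2 yy2 a0 b0 Kw; rewrite /cone_plus !at_pq//.
have -> : j%:R + 1%:R - 2 = - 1 + j%:R :> R by ring.
have -> : j%:R + 2%:R - 2 = 0 + j%:R :> R by ring.
have -> : j%:R + 3%:R - 2 = 1 + j%:R :> R by ring.
by have -> : j%:R + 4%:R - 2 = 2 + j%:R :> R by ring.
Qed.

Lemma recoil_minus w j : (0 < j < N)%N -> inK w -> inK (recoil (refl (w *m S ^+ j))).
Proof.
move=> jN Kw; apply: (inKZ' un_pos); rewrite /inK recoil_step !pq_refl !pq_Sn opprK.
have [y7 y2 yy2] := y_bounds; have [a0 b0] := sn_ge0 jN.
have := cone_minusP y7 y2 yy2 a0 b0 Kw; rewrite /cone_minus !at_pq//.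
have -> : j%:R + 3%:R - 2 = 1 + j%:R :> R by ring.
have -> : j%:R + 2%:R - 2 = - 0 + j%:R :> R by ring.
have -> : j%:R + 1%:R - 2 = - 1 + j%:R :> R by ring.
by have -> : j%:R + 0%:R - 2 = - 2 + j%:R :> R by ring.
Qed.

Lemma pq_ge0 w j : (0 < j < N)%N -> inK w -> 0 <= pq w j%:R.
Proof.
move=> jN Kw; have [y7 y2 yy2] := y_bounds; have [a0 b0] := sn_ge0 jN.
have := seq_at_ge0 y7 y2 a0 b0 Kw; rewrite /seq_at at_pq//.
by have -> : j%:R + (0 + 2)%:R - 2 = j%:R :> R by rewrite add0n; ring.
Qed.

Lemma pq_gt0 w j : (0 < j < N)%N -> inKo w -> 0 < pq w j%:R.
Proof.
move=> jN Kw; have [y7 y2 yy2] := y_bounds; have [a0 b0] := sn_ge0 jN.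
have := seq_at_gt0 y7 y2 yy2 a0 b0 (sn_gt0 jN) Kw; rewrite /seq_at at_pq//.
by have -> : j%:R + (0 + 2)%:R - 2 = j%:R :> R by rewrite add0n; ring.
Qed.

Lemma inX_N w : inX w -> inX (- w).
Proof.
by case=> h; rewrite /inX reflN !opprK; [apply: Or42|apply: Or41|apply: Or44|apply: Or43].
Qed.

Lemma inX_refl w : inX w -> inX (refl w).
Proof.
by case=> h; rewrite /inX reflK; [apply: Or43|apply: Or44|apply: Or41|apply: Or42].
Qed.

Definition transv (n : R) w := w + (n * al w) *: H.

Lemma S_mod w j : w *m S ^+ j = w *m S ^+ (j %% N) \/ w *m S ^+ j = - (w *m S ^+ (j %% N)).
Proof.
rewrite {1 3}(divn_eq j N); elim: (j %/ N)%N => [|q IH]; first by rewrite mul0n add0n; left.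
have E : w *m S ^+ (q.+1 * N + j %% N) = - (w *m S ^+ (q * N + j %% N)).
  rewrite mulSn -addnA addnC exprD -mulmxE mulmxA S_N; by [].
by rewrite E; case: IH => ->; [right|left; rewrite opprK].
Qed.

Lemma transv_N n w : transv n (- w) = - transv n w.
Proof. by rewrite /transv /al mxE mulrN scaleNr opprD. Qed.

(** The transvection maps a rotated cone into the opposite of the cone, by
    [recoil_plus], and any further positive power only adds a multiple of the
    vector [H] of the cone; negative powers and the other pieces of [inX] reduce
    to this case by the reflection and by the symmetry [v => - v]. *)
Lemma pingpong w j (n : R) : ~~ (N %| j)%N -> 1 <= n \/ n <= -1 -> inX w -> inX (transv n (w *m S ^+ j)).
Proof.
move=> Nj n1 Xw.
have j0 : (0 < j %% N < N)%N by rewrite lt0n -/(dvdn N j) Nj ltn_pmod// (leq_trans _ N4).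
suff G : forall i m v, (0 < i < N)%N -> 1 <= m \/ m <= -1 -> inX v -> inX (transv m (v *m S ^+ i)).
  by case: (S_mod w j) => ->; [|rewrite transv_N; apply: inX_N]; exact: G.
move=> {w j n Nj n1 Xw j0} i m v iN m1 Xv.
have K0 k u : (0 < k < N)%N -> inK u -> forall n : R, 1 <= n \/ n <= -1 -> inX (transv n (u *m S ^+ k)).
  move=> kN Ku n [n1|n1].
    apply: Or42; have -> : - transv n (u *m S ^+ k) = recoil (u *m S ^+ k) + ((n - 1) * - al (u *m S ^+ k)) *: H.
      rewrite /transv /recoil; move: (u *m S ^+ k) => t; move: (al t) H => a' h'.
      by apply/rowP => i'; rewrite !mxE; ring.
    apply: inKD; first exact: recoil_plus.
    apply: inKZ inK_H; apply: mulr_ge0; first by rewrite subr_ge0.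
    by rewrite -(pmulr_rge0 _ un_pos) mulrN al_pq opprK pq_Sn add0r pq_ge0.
  apply: Or44; have -> : - refl (transv n (u *m S ^+ k)) = recoil (refl (u *m S ^+ k)) + ((- n - 1) * - al (u *m S ^+ k)) *: H.
    rewrite /transv /recoil reflD reflZ refl_H al_refl; move: (u *m S ^+ k) => t.
    by move: (al t) (refl t) H => a' t' h'; apply/rowP => i'; rewrite !mxE; ring.
  apply: inKD; first exact: recoil_minus.
  apply: inKZ inK_H; apply: mulr_ge0; first by lra.
  by rewrite -(pmulr_rge0 _ un_pos) mulrN al_pq opprK pq_Sn add0r pq_ge0.
have iN' : (0 < N - i < N)%N.
  by case/andP: iN => i0 i1; rewrite subn_gt0 i1 ltn_subrL i0 (leq_trans _ N4).
have refl_transv n u : transv n (refl u) = refl (transv (- n) u).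
  by rewrite /transv reflD reflZ refl_H al_refl scalerN -scaleNr mulNr opprK.
have E0 u : inK u -> inX (transv m (refl u *m S ^+ i)).
  move=> Ku; rewrite refl_S; last by case/andP: iN => _ /ltnW.
  rewrite transv_N refl_transv; apply/inX_N/inX_refl/K0 => //.
  by case: m1 => ?; [right|left]; lra.
have opp u : inX (transv m (- u *m S ^+ i)) -> inX (transv m (u *m S ^+ i)).
  by rewrite mulNmx transv_N => /inX_N; rewrite opprK.
case: Xv => Kv.
- exact: K0.
- by apply: opp; exact: K0.
- by rewrite -(reflK v); exact: E0.
- by apply: opp; rewrite -(reflK (- v)) reflN; exact: E0.
Qed.

Lemma open_closed w : inKo w -> inK w.
Proof. by move=> Kw i i4; exact/ltW/Kw. Qed.

Lemma first_last w : cone_form y 0 (tv w) * (top_H y - 2) * 2 + cone_form y 1 (tv w) * delta_of y + cone_form y 2 (tv w) = 2 * delta_of y * (w 0 (inord 3) - al w).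
Proof. by rewrite /cone_form /tv /al /=; ring. Qed.

Lemma al_pos w : cone_form y 3 (tv w) + 2 * cone_form y 1 (tv w) = delta_of y * al w.
Proof. by rewrite /cone_form /tv /al /=; ring. Qed.

Lemma top_H_ge2 : 0 <= top_H y - 2.
Proof.
have [y7 y2 yy2] := y_bounds; rewrite /top_H /trace1.
have -> : 4 + (y ^+ 3 - 2 * y) - 2 = y * (y ^+ 2 - 2) + 2 by ring.
by rewrite addr_ge0// mulr_ge0//; lra.
Qed.

(** The value at 0 of the sequence is at most 0 on the cone, and its values at
    0 < j < N are positive on the open cone; this excludes the cone, its
    reflection and, for the value at N, the negative of the cone. The reflected
    negative cone is excluded at j - 1, except for j = 1, where the difference of
    the last and the first coordinates decides. *)
Lemma cells_disjoint w j : inKo w -> ~~ (N %| j)%N -> ~ inX (w *m S ^+ j).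
Proof.
move=> Kw Nj Xw; have [y7 y2 yy2] := y_bounds; have d0 := @delta_pos _ y y7.
have jN : (0 < j %% N < N)%N by rewrite lt0n -/(dvdn N j) Nj ltn_pmod// (leq_trans _ N4).
have : inX (w *m S ^+ (j %% N)).
  by case: (S_mod w j) Xw => -> // /inX_N; rewrite opprK.
move: (j %% N)%N jN => {Nj Xw} {}j jN Xw.
have Dp := un_pos.
have aw : 0 < al w.
  by rewrite -(pmulr_rgt0 _ d0) -al_pos addr_gt0 ?mulr_gt0 ?Kw.
have pj : 0 < pq w j%:R by exact: pq_gt0.
have aS : al (w *m S ^+ j) < 0.
  by rewrite -(pmulr_rlt0 _ Dp) al_pq pq_Sn add0r oppr_lt0.
have Kal v : inK v -> 0 <= al v.
  by move=> Kv; rewrite -(pmulr_rge0 _ d0) -al_pos addr_ge0 ?mulr_ge0 ?Kv.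
case: Xw => K1.
- by have := Kal _ K1; rewrite leNgt aS.
- have jN' : (0 < N - j < N)%N.
    by case/andP: jN => i0 i1; rewrite subn_gt0 i1 ltn_subrL i0 (leq_trans _ N4).
  have := pq_ge0 jN' K1; rewrite pqN pq_Sn -natrD subnK; last by case/andP: jN => _ /ltnW.
  rewrite -[N%:R]add0r pq_N opprK => h.
  by have : 0 < D * al w by [rewrite mulr_gt0]; rewrite al_pq oppr_gt0 ltNge h.
- by have := Kal _ K1; rewrite al_refl leNgt aS.
case: j jN {pj} aS K1 => [|[|j]] // jN aS K1.
  have F v : inK v -> 0 <= v 0 (inord 3) - al v.
    move=> Kv; have dd : 0 < 2 * delta_of y by rewrite mulr_gt0.
    rewrite -(pmulr_rge0 _ dd) -first_last.
    have h := top_H_ge2; have h0 := Kv 0%N isT; have h1 := Kv 1%N isT; have h2 := Kv 2%N isT.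
    have d1 := ltW d0; apply: addr_ge0 h2; apply: addr_ge0; last exact: mulr_ge0.
    by apply: mulr_ge0 => //; exact: mulr_ge0.
  have F' : 0 < w 0 (inord 3) - al w.
    have dd : 0 < 2 * delta_of y by rewrite mulr_gt0.
    rewrite -(pmulr_rgt0 _ dd) -first_last.
    have h := top_H_ge2; have h0 := ltW (Kw 0%N isT); have h1 := ltW (Kw 1%N isT); have h2 := Kw 2%N isT.
    have d1 := ltW d0; apply: ltr_wpDl h2; apply: addr_ge0; last exact: mulr_ge0.
    by apply: mulr_ge0 => //; exact: mulr_ge0.
  have := F _ K1; rewrite -(pmulr_rge0 _ Dp) mulrBr last_pq al_pq !pqN !pq_refl !pq_Sn oppr0 add0r opprK.
  rewrite (_ : - 1 + 1%:R = 0 :> R); last by ring.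
  have := F'; rewrite -(pmulr_rgt0 _ Dp) mulrBr last_pq al_pq opprK.
  by move=> *; lra.
have := @pq_ge0 _ 1 _ K1; rewrite pqN pq_refl pq_Sn => /(_ _) h.
have : 0 < pq w j.+1%:R by apply: pq_gt0 => //=; case/andP: jN => _ /ltnW.
have e : - 1%:R + j.+2%:R = j.+1%:R :> R by rewrite -[j.+2%:R]natr1; ring.
rewrite e in h; rewrite ltNge; have := h _; rewrite oppr_ge0 => -> //.
by rewrite /= (leq_trans _ N4).
Qed.

End dynamics.

(** * Groups given by generators and relations *)

Section morphisms.
Local Open Scope group_scope.
Implicit Types G H : groupType.

Lemma multiplicative_exists G H (f : G -> H) : {morph f : x y / x * y} ->
  exists g : {multiplicative G -> H}, forall x, g x = f x.
Proof.
move=> fM; pose m := isMultiplicative.Build G H f fM.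
by exists (HB.pack_for {multiplicative G -> H} f m).
Qed.

Lemma morph_one G H (f : G -> H) : {morph f : x y / x * y} -> f 1 = 1.
Proof.
move=> fM; have E := fM 1 1; rewrite mulg1 in E.
by have := mulVg (f 1); rewrite {2}E mulgA mulVg mul1g.
Qed.

Lemma morph_inv G H (f : G -> H) : {morph f : x y / x * y} -> forall x, f x^-1 = (f x)^-1.
Proof.
move=> fM x; rewrite -[LHS]mulg1 -(mulgV (f x)) mulgA -fM mulVg (morph_one fM).
by rewrite mul1g.
Qed.

Lemma morph_exp G H (f : G -> H) : {morph f : x y / x * y} -> forall x n, f (x ^+ n) = f x ^+ n.
Proof.
move=> fM x; elim=> [|n IH]; first by rewrite !expg0 (morph_one fM).
by rewrite !expgS fM IH.
Qed.

Lemma quotient_lift G H (S : set G) (h : G -> H) : {morph h : x y / x * y} ->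
  (forall x, S x -> h x = 1) ->
  exists g : {multiplicative quotient_group S -> H}, forall x, g (quotg S x) = h x.
Proof.
move=> hM hS; have h1 := morph_one hM; have hV := morph_inv hM.
have ker x : normal_closure S x -> h x = 1.
  move=> nx; apply: (nx [set x | h x = 1]); split; last by move=> z /hS.
  split; first by split=> //= a b /= ha hb; rewrite hM hV ha hb invg1 mulg1.
  by move=> a b /= ha; rewrite /conjg !hM hV ha mul1g mulVg.
have gE x y : normal_closure S (x^-1 * y) -> h x = h y.
  by move=> /ker; rewrite hM hV => E; rewrite -[LHS]mulg1 -E mulgA mulgV mul1g.
pose g (a : quotient_group S) := h (repr a).
have gq x : g (quotg S x) = h x by apply: gE; apply/quotgP; rewrite quotg_repr.
have gM : {morph g : a b / a * b}.
  by move=> a b; rewrite -[a]quotg_repr -[b]quotg_repr -quotgM !gq hM.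
by have [m mE] := multiplicative_exists gM; exists m => x; rewrite mE gq.
Qed.

Section words.
Context (X : choiceType) (H : groupType) (v : X -> H).
Definition letter_eval (a : X * bool) := if a.2 then v a.1 else (v a.1)^-1.
Definition word_eval (w : seq (X * bool)) := foldr (fun a x => letter_eval a * x) 1 w.

Lemma word_eval_cat u w : word_eval (u ++ w) = word_eval u * word_eval w.
Proof. by elim: u => [|a u IH] /=; rewrite ?mul1g// IH mulgA. Qed.

Lemma word_eval_free u w : free_eq u w -> word_eval u = word_eval w.
Proof.
elim=> [//|? ? _ -> //|? ? ? _ -> _ -> //|u' w' x b].
rewrite !word_eval_cat /= /letter_eval /= mulg1.
by case: b => /=; rewrite ?mulgV ?mulVg mul1g.
Qed.

End words.

Lemma free_classM (X : choiceType) (u w : seq (X * bool)) :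
  free_class u * free_class w = free_class (u ++ w).
Proof. exact: free_mulE. Qed.

Lemma RT_lift N H (a b : H) : a ^+ N = 1 ->
  exists phi : {multiplicative RT_group N -> H},
    phi (RT_gen N letter_R) = a /\ phi (RT_gen N letter_T) = b.
Proof.
move=> aN; pose v (x : RT_letter) := if x is letter_R then a else b.
pose h (x : free_group RT_letter) := word_eval v (repr x).
have hc w : h (free_class w) = word_eval v w.
  by apply: word_eval_free; apply/free_classP; rewrite free_class_repr.
have hM : {morph h : x y / x * y}.
  move=> x y; rewrite -[x]free_class_repr -[y]free_class_repr.
  by rewrite free_classM !hc word_eval_cat.
have hS x : [set (free_gen letter_R ^+ N)] x -> h x = 1.
  by move=> ->; rewrite (morph_exp hM) /free_gen hc /= mulg1.
have [phi E] := quotient_lift hM hS.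
exists (phi : {multiplicative RT_group N -> H}).
by rewrite /RT_gen !E /free_gen !hc /= !mulg1.
Qed.

End morphisms.

Section normal_form.
Local Open Scope group_scope.
Variables (N : nat) (N0 : (0 < N)%N).
Local Notation G := (RT_group N).
Local Notation r := (RT_gen N letter_R).
Local Notation t := (RT_gen N letter_T).

Lemma RT_relation : r ^+ N = 1.
Proof.
rewrite /RT_gen -(morph_exp (@quotgM _ _)) -(morph_one (@quotgM _ [set (free_gen letter_R ^+ N)])).
apply/esym/quotgP; rewrite invg1 mul1g => A [_ SA]; exact: SA.
Qed.

(** Induction on words, from left to right. *)
Lemma RT_word_ind (P : G -> Prop) : P 1 ->
  (forall x l (b : bool), P x -> P (x * (if b then RT_gen N l else (RT_gen N l)^-1))) -> forall x, P x.
Proof.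
move=> P1 PM x; rewrite -[x]quotg_repr -[repr x]free_class_repr.
elim/last_ind: (repr (repr x)) => [|w [l b] IH].
  by have := P1; rewrite -(morph_one (@quotgM _ [set (free_gen letter_R ^+ N)])).
rewrite -cats1 -free_classM quotgM.
have -> : quotg [set (free_gen letter_R ^+ N)] (free_class [:: (l, b)]) = if b then RT_gen N l else (RT_gen N l)^-1.
  case: b => //; rewrite /RT_gen -(morph_inv (@quotgM _ _)); congr quotg.
  by symmetry; rewrite /free_gen; exact: free_invE.
exact: PM.
Qed.

Lemma RT_generated (S : set G) : is_subgroup S -> S r -> S t -> forall x, S x.
Proof.
move=> [S1 SM] Sr St; have SV x : S x -> S x^-1 by move=> /(SM _ _ S1); rewrite mul1g.
apply: RT_word_ind => // x l b Sx; rewrite -[X in x * X]invgK; apply: SM => //; apply: (SV).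
by case: l; case: b => //; exact: (SV).
Qed.

Lemma r_dvd j : (N %| j)%N -> r ^+ j = 1.
Proof. by case/dvdnP => q ->; rewrite mulnC expgnA RT_relation expg1n. Qed.

Lemma r_inv : r^-1 = r ^+ N.-1.
Proof. by rewrite -[RHS]mul1g -(mulVg r) -mulgA -expgS prednK// RT_relation mulg1. Qed.

Definition tl (s : bool) := if s then t else t^-1.
Definition syllable s k := tl s ^+ k.

(** The reduced words of a free product that end in a power of [t]; only the
    innermost power of [r] may be trivial. *)
Inductive Tform : G -> Prop :=
| T_base j s k : Tform (r ^+ j * syllable s k.+1)
| T_step x j s k : Tform x -> ~~ (N %| j)%N -> Tform (x * r ^+ j * syllable s k.+1).

Definition nf x := (exists j, x = r ^+ j) \/ exists z j, Tform z /\ x = z * r ^+ j.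

Lemma nf_T z : Tform z -> nf z.
Proof. by move=> h; right; exists z, 0%N; rewrite expg0 mulg1. Qed.

Lemma nf_r x i : nf x -> nf (x * r ^+ i).
Proof.
case=> [[j ->]|[z [j [Tz ->]]]]; first by left; exists (j + i)%N; rewrite expgnDr.
by right; exists z, (j + i)%N; rewrite expgnDr mulgA.
Qed.

Lemma syl_more s k : syllable s k * tl s = syllable s k.+1.
Proof. by rewrite /syllable expgSr. Qed.

Lemma syl_less s k : syllable s k.+1 * tl (~~ s) = syllable s k.
Proof. by rewrite /syllable expgSr -mulgA; case: s; rewrite /= ?mulgV ?mulVg mulg1. Qed.

Lemma nf_t s x : nf x -> nf (x * tl s).
Proof.
have e : tl s = syllable s 1 by rewrite /syllable expg1.
case=> [[j ->]|[z [j [Tz ->]]]]; first by apply: nf_T; rewrite e; exact: T_base.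
have [Nj|Nj] := boolP (N %| j)%N; last by apply: nf_T; rewrite e; exact: T_step.
rewrite (r_dvd Nj) mulg1; clear e.
case: Tz => {z} [i s' k|z i s' k Tz Ni]; (have [->|ne] := eqVneq s s';
  [by apply: nf_T; rewrite -mulgA syl_more; constructor|
   (have -> : s = ~~ s' by case: s s' ne => [] []); rewrite -mulgA syl_less]).
  case: k => [|k]; last by apply: nf_T; constructor.
  by left; exists i; rewrite /syllable expg0 mulg1.
case: k => [|k]; last by apply: nf_T; constructor.
by right; exists z, i; rewrite /syllable expg0 mulg1.
Qed.

Lemma nf_all x : nf x.
Proof.
elim/RT_word_ind: x => [|x [] b nx]; first by left; exists 0%N; rewrite expg0.
  case: b; first by rewrite -[RT_gen N letter_R]expg1; exact: nf_r.
  by rewrite r_inv; exact: nf_r.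
exact: (nf_t b nx).
Qed.

End normal_form.

(** * The action of the group on the ping-pong table *)

Section projective.
Context {R : realType}.
Implicit Types A B : Sp4 R.
Local Notation opp1 := (@Sp4_opp1 R).

Lemma Sp4_mulE A B : Sp4_mx (A * B)%g = A *m B. Proof. by []. Qed.
Lemma Sp4_oneE : Sp4_mx (1%g : Sp4 R) = 1%:M. Proof. by []. Qed.

Lemma opp1E A : Sp4_mx (opp1 * A)%g = - Sp4_mx A.
Proof. by rewrite Sp4_mulE /= mulNmx mul1mx. Qed.

Lemma opp1C A : (opp1 * A)%g = (A * opp1)%g.
Proof. by apply: val_inj; rewrite /= mulNmx mul1mx mulmxN mulmx1. Qed.

Lemma opp1K : (opp1 * opp1)%g = 1%g.
Proof. by apply: val_inj; rewrite /= mulNmx mul1mx opprK. Qed.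

Lemma opp1V : (opp1^-1)%g = opp1.
Proof. by rewrite -[RHS]mul1g -(mulVg opp1) -mulgA opp1K mulg1. Qed.

Lemma opp1_neq1 : opp1 <> 1%g.
Proof.
move=> /(congr1 (fun A : Sp4 R => Sp4_mx A ord0 ord0)); rewrite /= !mxE /= => h.
by move: h; rewrite ?mulr1n => h; lra.
Qed.

Lemma projM A B : Sp4_proj (A * B)%g = (Sp4_proj A * Sp4_proj B)%g.
Proof. exact: quotgM. Qed.

Lemma proj_opp1 : Sp4_proj opp1 = 1%g.
Proof.
rewrite -(morph_one projM); apply/quotgP; rewrite mulg1.
by apply: normal_closureV => A [_ SA]; exact: SA.
Qed.

Lemma projP A B : Sp4_proj A = Sp4_proj B <-> A = B \/ A = (opp1 * B)%g.
Proof.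
split; last by case=> -> //; rewrite projM proj_opp1 mul1g.
move=> /quotgP nc.
have : [set C : Sp4 R | C = 1%g \/ C = opp1] (A^-1 * B)%g.
  apply: nc; split; last by move=> _ ->; right.
  split; first split; first by left.
    by move=> C D [->|->] [->|->]; [left|right|right|left];
      rewrite ?opp1V ?invg1 ?mulg1 ?mul1g ?opp1K.
  move=> C D [->|->]; [left|right]; first by rewrite /conjg mul1g mulVg.
  by rewrite /conjg opp1C mulgA mulVg mul1g.
move=> [|] E; [left|right].
  by rewrite -[RHS](mul1g B) -(mulgV A) -mulgA E mulg1.
have -> : B = (A * opp1)%g by rewrite -E mulgA mulgV mul1g.
by rewrite -opp1C mulgA opp1K mul1g.
Qed.

Lemma is_subgroup_image (G H : groupType) (h : G -> H) (A : set G) :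
  {morph h : x y / (x * y)%g} -> is_subgroup A -> is_subgroup (h @` A).
Proof.
move=> hM [A1 AM]; split; first by exists 1%g => //; exact: morph_one.
move=> _ _ [a Aa <-] [b Ab <-]; exists (a * b^-1)%g; first exact: AM.
by rewrite hM (morph_inv hM).
Qed.

End projective.

Lemma eq_rowmul (F : fieldType) (A B : 'M[F]_4) : (forall v : 'rV_4, v *m A = v *m B) -> A = B.
Proof. by move=> h; apply/row_matrixP => i; rewrite !rowE h. Qed.

(** Among three consecutive integers each residue condition excludes at most
    one. *)
Lemma avoid_two_residues N a b : (4 <= N)%N ->
  exists m, [/\ (m < N)%N, ~~ (N %| m + a)%N & ~~ (N %| m + b)%N].
Proof.
move=> N4; have nd k : (0 < k < N)%N -> ~~ (N %| k)%N by case/andP => k0 kN; rewrite gtnNdvd.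
have d1 c i j : (i < j)%N -> (j < 3)%N -> (N %| i + c)%N -> (N %| j + c)%N -> False.
  move=> ij j3 h1 h2; have := dvdn_sub h2 h1; rewrite subnDr => h; apply/negP: h; apply: nd.
  by rewrite subn_gt0 ij /= (leq_ltn_trans (leq_subr _ _)) // (leq_trans j3)// ltnW.
have [h0|a0] := boolP (N %| 0 + a)%N; have [g0|b0] := boolP (N %| 0 + b)%N.
- exists 1%N; split; first exact: leq_trans N4.
    by apply/negP => h; exact: (@d1 a 0 1)%N.
  by apply/negP => h; exact: (@d1 b 0 1)%N.
- have [g1|b1] := boolP (N %| 1 + b)%N.
    exists 2%N; split; [exact: leq_trans N4| |]; apply/negP => h.
      exact: (@d1 a 0 2)%N.
    exact: (@d1 b 1 2)%N.
  by exists 1%N; split; [exact: leq_trans N4| |] => //; apply/negP => h; exact: (@d1 a 0 1)%N.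
- have [g1|b1] := boolP (N %| 1 + a)%N.
    exists 2%N; split; [exact: leq_trans N4| |]; apply/negP => h.
      exact: (@d1 a 1 2)%N.
    exact: (@d1 b 0 2)%N.
  by exists 1%N; split; [exact: leq_trans N4| |] => //; apply/negP => h; exact: (@d1 b 0 1)%N.
- by exists 0%N; split => //; exact: leq_trans N4.
Qed.

Lemma pm_sym (V : zmodType) (a b : V) : a = b \/ a = - b -> b = a \/ b = - a.
Proof. by case=> ->; [left|right; rewrite opprK]. Qed.

Lemma pm_trans (V : zmodType) (a b c : V) : a = b \/ a = - b -> b = c \/ b = - c -> a = c \/ a = - c.
Proof. by case=> -> [->|->]; [left|right|right|left; rewrite opprK]. Qed.

Lemma pm_mul (F : fieldType) m n p (A : 'M[F]_(m, n)) (B C : 'M[F]_(n, p)) :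
  B = C \/ B = - C -> A *m B = A *m C \/ A *m B = - (A *m C).
Proof. by case=> ->; [left|right; rewrite mulmxN]. Qed.

Section action.
Context {R : realType}.
Variables (N : nat) (N4 : (4 <= N)%N).
Local Notation y := (@half_trace R N).
Local Notation S := (model_S y).
Local Notation H := (model_H y).
Implicit Types v w : 'rV[R]_4.

Definition Tn (n : R) : 'M[R]_4 := 1%:M + (row4 1 0 0 0)^T *m (n *: H).

Lemma Tn_E n v : v *m Tn n = transv N n v.
Proof.
have := model_TE y v; rewrite /model_T mulmxDr mulmx1 => /addrI E.
by rewrite /Tn mulmxDr mulmx1 -scalemxAr -scalemxAr E scalerA.
Qed.

Lemma Tn1 : Tn 1 = model_T y. Proof. by rewrite /Tn scale1r. Qed.
Lemma Tn0 : Tn 0 = 1%:M. Proof. by rewrite /Tn scale0r mulmx0 addr0. Qed.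

Lemma TnD a b : Tn a *m Tn b = Tn (a + b).
Proof.
apply: eq_rowmul => v; rewrite mulmxA !Tn_E /transv.
have -> : al (v + (a * al v) *: H) = al v by have := al_H (R := R) N; rewrite /al !mxE => ->; rewrite mulr0 addr0.
by rewrite -addrA -scalerDl mulrDl.
Qed.

Variables (Q : 'M[R[i]]_4) (QU : Q \in unitmx).
Local Notation cx := (map_mx (real_complex R)).

(** In the basis given by the rows of the inverse of [Q], the symplectic
    matrix [A] becomes the real matrix [W]. *)
Definition acts (A : Sp4 R) (W : 'M[R]_4) := cx A *m Q = Q *m cx W.

Lemma actsM A B W V : acts A W -> acts B V -> acts (A * B)%g (W *m V).
Proof. by rewrite /acts Sp4_mulE !map_mxM => hA hB; rewrite -mulmxA hB mulmxA hA -mulmxA. Qed.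

Lemma acts1 : acts 1%g 1%:M.
Proof. by rewrite /acts Sp4_oneE !map_mx1 mul1mx mulmx1. Qed.

Lemma actsN A W : acts A W -> acts (Sp4_opp1 * A)%g (- W).
Proof. by rewrite /acts opp1E !map_mxN mulNmx mulmxN => ->. Qed.

Lemma acts_inj A W V : acts A W -> acts A V -> W = V.
Proof.
rewrite /acts => -> E; apply: (@map_mx_inj _ _ (real_complex R)).
by rewrite -[LHS](mulKmx QU) E mulKmx.
Qed.

Lemma acts_faithful A B W : acts A W -> acts B W -> A = B.
Proof.
rewrite /acts => hA hB; apply: val_inj; apply: (@map_mx_inj _ _ (real_complex R)).
by rewrite -[LHS](mulmxK QU) -[RHS](mulmxK QU) hA hB.
Qed.

Lemma actsV A W V : acts A W -> W *m V = 1%:M -> acts A^-1%g V.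
Proof.
move=> hA WV; have E : cx (Sp4_mx A^-1%g) *m cx A = 1%:M.
  by rewrite -map_mxM -Sp4_mulE mulVg Sp4_oneE map_mx1.
rewrite /acts -[Q in LHS]mulmx1 -(map_mx1 (real_complex R)) -WV map_mxM.
by rewrite [Q *m _]mulmxA -hA !mulmxA E mul1mx.
Qed.

Lemma acts_proj A B W V : Sp4_proj A = Sp4_proj B -> acts A W -> acts B V -> W = V \/ W = - V.
Proof.
move=> /projP [->|->] hA hB; [left|right]; first exact: (acts_inj hA hB).
exact: (acts_inj hA (actsN hB)).
Qed.

Variables (gR gT : Sp4 R).
Hypotheses (actR : acts gR (- S)) (actT : acts gT (model_T y)).

Lemma acts_R j : exists W, acts (gR ^+ j)%g W /\ (W = S ^+ j \/ W = - S ^+ j).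
Proof.
elim: j => [|j [W [hW E]]]; first by exists 1%:M; split; [exact: acts1|left].
exists (- S *m W); split; first by rewrite expgS; exact: actsM.
by rewrite exprS mulNmx; case: E => ->; [right|left; rewrite mulmxN opprK].
Qed.

Lemma acts_Tn (s : bool) : acts (if s then gT else gT^-1)%g (Tn (if s then 1 else -1)).
Proof.
case: s; first by rewrite Tn1.
by apply: (actsV actT); rewrite -Tn1 TnD subrr Tn0.
Qed.

Lemma acts_syllable (s : bool) k : exists n : R,
  acts ((if s then gT else gT^-1) ^+ k.+1)%g (Tn n) /\ (1 <= n \/ n <= -1).
Proof.
exists (if s then k.+1%:R else - k.+1%:R); split; last first.
  by case: s; [left|right]; rewrite ?lerN2 ler1n.
elim: k => [|k IH]; first by have := acts_Tn s; case: s.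
rewrite expgSr; have := actsM IH (acts_Tn s); rewrite TnD.
by case: s {IH}; rewrite -?opprD natr1.
Qed.

Lemma mul_Spow v m j : v *m S ^+ m *m S ^+ j = v *m S ^+ (m + j).
Proof. by rewrite exprD -mulmxE mulmxA. Qed.

Lemma S_pow_N v q : v *m S ^+ (q * N) = v \/ v *m S ^+ (q * N) = - v.
Proof. by have := S_mod N4 v (q * N); rewrite modnMl expr0 mulmx1. Qed.

Lemma Sp4_gN : (gR ^+ N)%g = 1%g \/ (gR ^+ N)%g = Sp4_opp1.
Proof.
have [W [hW E]] := acts_R N.
have SN : S ^+ N = - 1%:M by apply: eq_rowmul => v; rewrite S_N// mulmxN mulmx1.
rewrite SN opprK in E; case: E => E; rewrite E in hW; [right|left].
  by apply: (acts_faithful hW); have := actsN acts1; rewrite mulg1.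
exact: (acts_faithful hW acts1).
Qed.

Lemma Sp4_gN_parity : (gR ^+ N)%g = if odd N then 1%g else Sp4_opp1.
Proof.
have SN : S ^+ N = - 1%:M by apply: eq_rowmul => v; rewrite S_N// mulmxN mulmx1.
have h j : acts (gR ^+ j)%g ((-1) ^+ j *: S ^+ j).
  elim: j => [|j IH]; first by rewrite !expr0 scale1r; exact: acts1.
  have := actsM actR IH; rewrite -expgS -scalemxAr mulNmx scalerN -scaleNr -mulN1r -exprS.
  by rewrite [S ^+ j.+1]exprS.
have := h N; rewrite SN -signr_odd; case: (odd N); rewrite ?expr1 ?expr0.
  by rewrite scaleN1r opprK => hW; exact: (acts_faithful hW acts1).
by rewrite scale1r => hW; apply: (acts_faithful hW); have := actsN acts1; rewrite mulg1.
Qed.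

Variable phi : {multiplicative RT_group N -> PSp4 R}.
Hypotheses (phiR : phi (RT_gen N letter_R) = Sp4_proj gR)
           (phiT : phi (RT_gen N letter_T) = Sp4_proj gT).

Lemma phiM : {morph phi : a b / (a * b)%g}. Proof. exact: gmulfM. Qed.

Lemma phi_rot j : phi (RT_gen N letter_R ^+ j)%g = Sp4_proj (gR ^+ j)%g.
Proof. by rewrite (morph_exp phiM) phiR (morph_exp projM). Qed.

Lemma phi_syl s k : phi (syllable N s k) = Sp4_proj ((if s then gT else gT^-1) ^+ k)%g.
Proof.
rewrite /syllable (morph_exp phiM) (morph_exp projM) /tl; congr (_ ^+ _)%g.
by case: s; rewrite ?(morph_inv phiM) ?(morph_inv projM) phiT.
Qed.

Lemma Tform_dyn x : Tform x -> exists A W j0, [/\ acts A W, phi x = Sp4_proj A &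
  forall m v, inX N v -> ~~ (N %| m + j0)%N -> inX N (v *m S ^+ m *m W)].
Proof.
elim=> {x} [j s k|x j s k _ [A [W [j0 [hA pA dyn]]]] Nj].
  have [W [hW E]] := acts_R j; have [n [hn n1]] := acts_syllable s k.
  exists (gR ^+ j * (if s then gT else gT^-1) ^+ k.+1)%g, (W *m Tn n), j; split.
  - exact: actsM.
  - by rewrite phiM projM phi_rot phi_syl.
  - move=> m v Xv Nm; rewrite mulmxA Tn_E.
    have P := pingpong N4 Nm n1 Xv.
    by case: E => ->; rewrite ?mulmxN mul_Spow // transv_N; exact: inX_N.
have [V [hV E]] := acts_R j; have [n [hn n1]] := acts_syllable s k.
exists (A * gR ^+ j * (if s then gT else gT^-1) ^+ k.+1)%g, (W *m V *m Tn n), j0; split.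
- by apply: actsM => //; exact: actsM.
- by rewrite !phiM !projM phi_rot phi_syl pA.
- move=> m v Xv Nm; rewrite mulmxA Tn_E mulmxA.
  have P := pingpong N4 Nj n1 (dyn m v Xv Nm).
  by case: E => ->; rewrite ?mulmxN // transv_N; exact: inX_N.
Qed.

Lemma inX_pm v w : inX N v -> w = v \/ w = - v -> inX N w.
Proof. by move=> Xv [->|->] //; exact: inX_N. Qed.

(** A reduced word throws the rotations of the ping-pong table, with one
    exception, into a single rotation of it, and that one meets the rotated open
    cones of at most one sector; so at least one of the test points is not
    kept in its open cone. *)
Lemma sectors_fixed A W x v0 : acts A W -> phi x = Sp4_proj A -> inKo N v0 ->
  (forall m, (m < N)%N -> exists2 z, inKo N z &
     v0 *m S ^+ m *m W = z *m S ^+ m \/ v0 *m S ^+ m *m W = - (z *m S ^+ m)) ->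
  x = 1%g.
Proof.
move=> hA pA K0 hm; have N0 : (0 < N)%N by exact: leq_trans N4.
have X0 (z : 'rV[R]_4) : inKo N z -> inX N z by move=> Kz; apply: Or41; exact: open_closed.
case: (nf_all N0 x) => [[j xE]|[t [j [Tt xE]]]].
  have [Nj|Nj] := boolP (N %| j)%N; first by rewrite xE r_dvd.
  have [V [hV E]] := acts_R j; exfalso.
  have [z Kz hz] := hm 0%N N0; apply: (cells_disjoint N4 K0 Nj).
  apply: (inX_pm (X0 _ Kz)); move: hz; rewrite expr0 !mulmx1 => hz.
  have WV : W = V \/ W = - V by apply: (acts_proj _ hA hV); rewrite -pA xE phi_rot.
  exact: (pm_trans (pm_mul v0 (pm_sym (pm_trans WV E))) hz).
have [B [V [j0 [hB pB dyn]]]] := Tform_dyn Tt; have [U [hU E]] := acts_R j.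
have [m [mN m1 m2]] := avoid_two_residues j0 (j * N.-1) N4.
have [z Kz hz] := hm m mN; exfalso; apply: (cells_disjoint N4 Kz m2).
have Xu := dyn m v0 (X0 _ K0) m1; set u := v0 *m S ^+ m *m V in Xu.
have : W = V *m U \/ W = - (V *m U).
  by apply: (acts_proj _ hA (actsM hB hU)); rewrite -pA xE phiM projM phi_rot pB.
have zu : z *m S ^+ m = u *m S ^+ j \/ z *m S ^+ m = - (u *m S ^+ j) -> inX N (z *m S ^+ (m + j * N.-1)).
  have jj : (j + j * N.-1 = j * N)%N by rewrite -mulnS prednK.
  rewrite -mul_Spow => -[] ->; rewrite ?mulNmx mul_Spow jj; case: (S_pow_N u j) => ->;
    by rewrite ?opprK //; apply: inX_N.
move=> WE; apply: zu; apply: (pm_trans (pm_sym hz)).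
have := pm_mul (v0 *m S ^+ m) (pm_trans WE (pm_mul V E)).
by rewrite [_ *m (V *m S ^+ j)]mulmxA.
Qed.

Lemma phi_inj v0 : inKo N v0 -> injective phi.
Proof.
move=> K0 a b ab; have E : (a * b^-1)%g = 1%g.
  apply: (sectors_fixed acts1 _ K0).
    by rewrite phiM (morph_inv phiM) ab mulgV (morph_one projM).
  by move=> m _; exists v0 => //; left; rewrite mulmx1.
by rewrite -[a]mulg1 -(mulVg b) mulgA E mul1g.
Qed.

End action.

Local Transparent local_solution germ_eq.

(** * The monodromy representation in the model basis *)

Lemma det_char_poly (F : comNzRingType) n (A : 'M[F]_n) x : \det (x%:M - A) = (char_poly A).[x].
Proof.
rewrite /char_poly -[RHS]/(horner_eval x _) -det_map_mx; congr (\det _).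
apply/matrixP => i j; rewrite !mxE /= /horner_eval.
by case: eqP => _; rewrite ?mulr1n ?mulr0n !hornerE.
Qed.

Lemma rank_one_factor (F : fieldType) n (A : 'M[F]_n) : (\rank A <= 1)%N ->
  exists (c : 'cV[F]_n) (l : 'rV[F]_n), A = c *m l.
Proof.
move=> rA; have [c [l E]] : exists (c : 'M[F]_(n, \rank A)) (l : 'M[F]_(\rank A, n)), A = c *m l.
  by exists (col_base A), (row_base A); rewrite mulmx_base.
move: (\rank A) rA c l E => [|[|r]] // _ c l E; last by exists c, l.
by exists 0, 0; rewrite mul0mx E (flatmx0 l) mulmx0.
Qed.

Lemma map_row4 (F K : fieldType) (h : {rmorphism F -> K}) a b c d :
  map_mx h (row4 a b c d) = row4 (h a) (h b) (h c) (h d).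
Proof. by apply/rowP => i; rewrite !mxE; case: i => [[|[|[|[|i]]]] hi]. Qed.

Lemma map_mx4 (F K : fieldType) (h : {rmorphism F -> K}) r0 r1 r2 r3 :
  map_mx h (mx4 r0 r1 r2 r3) = mx4 (map_mx h r0) (map_mx h r1) (map_mx h r2) (map_mx h r3).
Proof. by apply/matrixP => i j; rewrite !mxE; case: i => [[|[|[|[|i]]]] hi] //=; rewrite mxE. Qed.

Lemma map_model_S (F K : fieldType) (h : {rmorphism F -> K}) y : map_mx h (model_S y) = model_S (h y).
Proof.
rewrite /model_S map_mx4 !map_row4; congr mx4; congr row4;
  by rewrite ?(rmorphN, rmorphD, rmorphM, rmorphXn, rmorph1, rmorph0, rmorph_nat).
Qed.

Lemma map_model_T (F K : fieldType) (h : {rmorphism F -> K}) y : map_mx h (model_T y) = model_T (h y).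
Proof.
rewrite /model_T map_mxD map_mx1 map_mxM -map_trmx /model_H !map_row4.
congr (_ + _ *m _); first by rewrite rmorph1 rmorph0.
by congr row4; rewrite ?(rmorphN, rmorphD, rmorphM, rmorphXn, rmorph1, rmorph0, rmorph_nat).
Qed.

Section spectrum.
Context {R : realType}.
Variables (N : nat) (N4 : (4 <= N)%N).
Local Notation y := (@half_trace R N).
Local Notation Y := (y%:C : R[i]).

Lemma half_trace_lt2 : y < 2.
Proof.
have [_ y2 _] := @y_bounds R N N4; rewrite lt_neqAle andbC; apply/andP; split; first by lra.
have s1 : 0 < sn N 1 :> R by have := @sn_gt0 R N N4 1; apply; rewrite /= (leq_trans _ N4).
apply/eqP => E; have := cos2Dsin2 (pi / N%:R : R).
have -> : cos (pi / N%:R) = 1 :> R by move: E; rewrite /half_trace; lra.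
by move: s1; rewrite /sn mul1r; move: (sin _) => s s1; nra.
Qed.

Lemma omega_pairs : [/\ (omega N 1 : R[i]) + omega N 2 = - Y, (omega N 1 : R[i]) * omega N 2 = 1,
  (omega N 0 : R[i]) + omega N 3 = - (Y ^+ 3 - 3 * Y) & (omega N 0 : R[i]) * omega N 3 = 1].
Proof.
have Nz : N%:R != 0 :> R by rewrite gt_eqF// ltr0n; exact: leq_trans N4.
pose th : R := pi / N%:R.
have a0 : 2 * pi * expoR N 0 = pi - (th + th + th) :> R by rewrite /expoR /th; field.
have a1 : 2 * pi * expoR N 1 = pi - th :> R by rewrite /expoR /th; field.
have a2 : 2 * pi * expoR N 2 = pi + th :> R by rewrite /expoR /th; field.
have a3 : 2 * pi * expoR N 3 = pi + (th + th + th) :> R by rewrite /expoR /th; field.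
have cs := cos2Dsin2 th; have cs3 := cos2Dsin2 (th + th + th).
have cm x : cos (pi - x) = - cos x :> R by rewrite cosB cospi sinpi; ring.
have cp x : cos (pi + x) = - cos x :> R by rewrite cosD cospi sinpi; ring.
have sm x : sin (pi - x) = sin x :> R by rewrite sinB cospi sinpi; ring.
have sp x : sin (pi + x) = - sin x :> R by rewrite sinD cospi sinpi; ring.
have c3 : 2 * cos (th + th + th) = (2 * cos th) ^+ 3 - 3 * (2 * cos th).
  rewrite !cosD sinD.
  have -> : 2 * ((cos th * cos th - sin th * sin th) * cos th - (sin th * cos th + cos th * sin th) * sin th)
     = 2 * cos th ^+ 3 - 6 * (sin th ^+ 2) * cos th by ring.
  have -> : sin th ^+ 2 = 1 - cos th ^+ 2 by rewrite -cs; ring.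
  by ring.
have Y3 : Y ^+ 3 - 3 * Y = ((2 * cos th) ^+ 3 - 3 * (2 * cos th))%:C.
  by rewrite /half_trace -/th !(rmorphB (real_complex R), rmorphXn (real_complex R), rmorphM (real_complex R), rmorph_nat (real_complex R)).
rewrite !omegaE !cexp_i a0 a1 a2 a3 Y3 -c3 !cm !cp !sm !sp /half_trace -/th.
by split; apply/eqP; rewrite eq_complex /=; apply/andP; split; apply/eqP; lra.
Qed.

Lemma char_poly_factor : \prod_(j < 4) ('X - (omega N j : R[i])%:P) =
  'X ^+ 4 + (Y ^+ 3 - 2 * Y)%:P * 'X ^+ 3 + (Y ^+ 4 - 3 * Y ^+ 2 + 2)%:P * 'X ^+ 2 + (Y ^+ 3 - 2 * Y)%:P * 'X + 1.
Proof.
have [e1 e2 e3 e4] := omega_pairs.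
rewrite -(big_mkord xpredT (fun j => 'X - (omega N j : R[i])%:P)) /index_iota subn0 /= !big_cons big_nil mulr1.
have E1 : (omega N 1 : R[i])%:P + (omega N 2)%:P = - Y%:P by rewrite -polyCD e1 polyCN.
have E2 : (omega N 1 : R[i])%:P * (omega N 2)%:P = 1 by rewrite -polyCM e2.
have E3 : (omega N 0 : R[i])%:P + (omega N 3)%:P = - (Y%:P ^+ 3 - 3 * Y%:P).
  by rewrite -polyCD e3 polyCN polyCB polyC_exp polyCM (rmorph_nat (@polyC R[i])).
have E4 : (omega N 0 : R[i])%:P * (omega N 3)%:P = 1 by rewrite -polyCM e4.
have -> : (Y ^+ 3 - 2 * Y)%:P = Y%:P ^+ 3 - 2 * Y%:P :> {poly R[i]}.
  by rewrite polyCB polyC_exp polyCM (rmorph_nat (@polyC R[i])).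
have -> : (Y ^+ 4 - 3 * Y ^+ 2 + 2)%:P = Y%:P ^+ 4 - 3 * Y%:P ^+ 2 + 2 :> {poly R[i]}.
  by rewrite polyCD polyCB polyC_exp polyCM polyC_exp !(rmorph_nat (@polyC R[i])).
move: E1 E2 E3 E4; move: (omega N 0)%:P (omega N 1)%:P (omega N 2)%:P (omega N 3)%:P Y%:P => a0 a1 a2 a3 z E1 E2 E3 E4.
transitivity (('X ^+ 2 - (a1 + a2) * 'X + a1 * a2) * ('X ^+ 2 - (a0 + a3) * 'X + a0 * a3)); first by ring.
by rewrite E1 E2 E3 E4; ring.
Qed.

Lemma chi_neq0 (x : R[i]) : x \in [:: 0; 1; -1; 2] ->
  x ^+ 4 + (Y ^+ 3 - 2 * Y) * x ^+ 3 + (Y ^+ 4 - 3 * Y ^+ 2 + 2) * x ^+ 2 + (Y ^+ 3 - 2 * Y) * x + 1 != 0.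
Proof.
have [y7 _ _] := @y_bounds R N N4; have y2 := half_trace_lt2.
have real (e : R) (z : R[i]) : 0 < e -> z = e%:C -> z != 0.
  by move=> e0 ->; rewrite eq_complex /= negb_and gt_eqF.
rewrite !inE => /or4P[] /eqP ->.
- by apply: (@real 1); [exact: ltr01|rewrite rmorph1; ring].
- apply: (@real ((y + 2) ^+ 2 * (y - 1) ^+ 2)); first by apply: mulr_gt0; apply: exprn_gt0; lra.
  by rewrite !(rmorphXn (real_complex R), rmorphM (real_complex R), rmorphB (real_complex R), rmorphN (real_complex R), rmorphD (real_complex R), rmorph1 (real_complex R), rmorph_nat (real_complex R)); move: Y => z; ring.
- apply: (@real ((2 - y) ^+ 2 * (y + 1) ^+ 2)); first by apply: mulr_gt0; apply: exprn_gt0; lra.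
  by rewrite !(rmorphXn (real_complex R), rmorphM (real_complex R), rmorphB (real_complex R), rmorphN (real_complex R), rmorphD (real_complex R), rmorph1 (real_complex R), rmorph_nat (real_complex R)); move: Y => z; ring.
- apply: (@real ((5 + 2 * y) * (2 * (y - 1) ^+ 2 * (y + 2) + 1))).
    apply: mulr_gt0; first by lra.
    by apply: ltr_wpDl => //; apply: mulr_ge0; [apply: mulr_ge0; [lra|exact: sqr_ge0]|lra].
  by rewrite !(rmorphXn (real_complex R), rmorphM (real_complex R), rmorphB (real_complex R), rmorphN (real_complex R), rmorphD (real_complex R), rmorph1 (real_complex R), rmorph_nat (real_complex R)); move: Y => z; ring.
Qed.

End spectrum.

(** With [a] and [b] the classes of the loops around infinity and around 1, the
    first factor is the monodromy around 0. *)
Lemma det_product_of_unipotent (G : groupType) (K : fieldType) (h : G -> 'M[K]_4) :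
  (forall w v, h (w * v)%g = h w *m h v) -> h 1%g = 1%:M ->
  forall a b, char_poly (h (a^-1 / b)%g) = ('X - 1) ^+ 4 ->
  forall x, \det (x%:M - h b *m h a) = (x - 1) ^+ 4.
Proof.
move=> hM h1 a b cZ x.
have : h (a^-1 / b)%g *m (h b *m h a) = 1%:M by rewrite -!hM -mulgA mulKg mulVg.
move: (h _) cZ (h b *m h a) => Z cZ {h hM h1 a b} G0 ZG.
have dZx u : \det (u%:M - Z) = (u - 1) ^+ 4.
  by rewrite det_char_poly cZ horner_exp hornerD hornerN hornerX hornerC.
have neg (M : 'M[K]_4) : \det (0%:M - M) = \det M.
  have -> : (0%:M : 'M[K]_4) = 0 by rewrite -scalemx1 scale0r.
  by rewrite sub0r -scaleN1r detZ -signr_odd /= expr0 mul1r.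
have m14 : (0 - 1 : K) ^+ 4 = 1 by ring.
have dZ : \det Z = 1 by rewrite -neg dZx m14.
have dG : \det G0 = 1 by have := congr1 determinant ZG; rewrite det_mulmx dZ mul1r det1.
have [->|x0] := eqVneq x 0; first by rewrite neg dG m14.
have -> : x%:M - G0 = (- x) *: ((x^-1%:M - Z) *m G0).
  rewrite mulmxBl ZG mul_scalar_mx scalerBr scalerA mulNr divff// scaleN1r scaleNr opprK.
  by rewrite scalemx1 addrC.
rewrite detZ det_mulmx dG dZx mulr1 -exprMn; congr (_ ^+ 4).
by rewrite mulrBr mulNr divff// mulr1 opprK addrC.
Qed.

Lemma Cayley_Hamilton_quartic (F : fieldType) (g : 'M[F]_4) a b :
  char_poly g = 'X ^+ 4 + a%:P * 'X ^+ 3 + b%:P * 'X ^+ 2 + a%:P * 'X + 1 ->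
  g *m g *m g *m g + a *: (g *m g *m g) + b *: (g *m g) + a *: g + 1%:M = 0.
Proof.
move=> E; have := Cayley_Hamilton g; rewrite E.
rewrite !(rmorphXn (horner_mx g), rmorphM (horner_mx g), rmorphD (horner_mx g), rmorph1 (horner_mx g)).
rewrite /= horner_mx_X !horner_mx_C !exprS expr0 mulr1 -!mulmxE !mul_scalar_mx !mulmxA => H.
exact: H.
Qed.

Section representation.
Context {R : realType}.
Variables (N : nat) (N4 : (4 <= N)%N) (f : 'I_4 -> R[i] -> R[i]).
Hypothesis fb : solution_basis N f.
Local Notation class p := (pi1_class (@base_point_in R) p).
Local Notation y := (@half_trace R N).
Local Notation Y := (y%:C : R[i]).

Definition rep (w : @pi1_C01 R) : 'M[R[i]]_4 := projT1 (cid (mono_exists fb (repr w))).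

Lemma rep_mono w : monodromy_mx N f (repr w) (rep w).
Proof. exact: (projT2 (cid (mono_exists fb (repr w)))). Qed.

Lemma rep_class p M : monodromy_mx N f p M -> rep (class p) = M.
Proof.
move=> HM; have /pi1_classP h : class (repr (class p)) = class p by rewrite pi1_class_repr.
exact: (mono_homotopic fb h (rep_mono _) HM).
Qed.

Lemma mono_rep p : monodromy_mx N f p (rep (class p)).
Proof. by have [M HM] := mono_exists fb p; rewrite (rep_class HM). Qed.

Lemma repM w v : rep (w * v)%g = rep w *m rep v.
Proof.
have -> : (w * v)%g = class (loop_cat (repr w) (repr v)) by [].
by apply: rep_class; apply: mono_cat; exact: rep_mono.
Qed.

Lemma rep1 : rep 1%g = 1%:M.
Proof.
have -> : (1%g : pi1_C01) = class (@loop_const R _ _ _ (@base_point_in R)) by [].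
by apply: rep_class; exact: mono_const.
Qed.

Local Opaque rep.

Local Notation r := (class loop_around_infty).
Local Notation t := (class loop_around1).

Lemma det_product x : \det (x%:M - rep t *m rep r) = (x - 1) ^+ 4.
Proof.
have [p [pE pc]] := @zero_loop_exists R.
have zs : inside strip (@zero_center R) by rewrite /zero_center /=; split; lra.
have [sp_c sp_X] := spoke_path zs.
have cZ := char_poly_zero N4 fb sp_c sp_X (spoke0 _ _) (spoke1 _ _) pE (mono_rep p).
rewrite pc in cZ.
exact: (@det_product_of_unipotent _ _ _ repM rep1 r t cZ x).
Qed.

(** The three local monodromies meet the hypotheses of [levelt]. *)
Lemma model_basis : exists2 Q : 'M[R[i]]_4, Q \in unitmx &
  rep r *m Q = Q *m map_mx (real_complex R) (- model_S y) /\
  rep t *m Q = Q *m map_mx (real_complex R) (model_T y).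
Proof.
rewrite map_mxN map_model_S map_model_T.
have cR := char_poly_infinity N4 fb (mono_rep loop_around_infty); rewrite (char_poly_factor N4) in cR.
have [P Pf PM] := fixed_around1 N4 fb (mono_rep loop_around1).
have [c [l TE]] : exists (c : 'cV[R[i]]_4) (l : 'rV[R[i]]_4), rep t - 1%:M = c *m l.
  apply: rank_one_factor; have P0 : P *m (rep t - 1%:M) = 0 by rewrite mulmxBr PM mulmx1 subrr.
  by have := mulmx0_rank_max P0; rewrite (eqP Pf) -[4%N]/(3 + 1)%N leq_add2l.
apply: (@levelt _ Y _ _ c l).
- by rewrite -TE addrC subrK.
- exact: Cayley_Hamilton_quartic.
- move=> x xs; split; last exact: chi_neq0.
  by rewrite det_char_poly cR !hornerE.
- by move=> x _; exact: det_product.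
- have d0 : 0 < delta_of y by have [y7 _ _] := @y_bounds R N N4; exact: delta_pos.
  split; rewrite ?pnatr_eq0//.
  have -> : ((Y + 2) * (Y - 1)) ^+ 2 = (delta_of y)%:C.
    by rewrite /delta_of !(rmorphXn (real_complex R), rmorphM (real_complex R), rmorphB (real_complex R), rmorphN (real_complex R), rmorphD (real_complex R), rmorph1 (real_complex R), rmorph_nat (real_complex R)).
  by rewrite eq_complex /= negb_and gt_eqF.
Qed.

End representation.

Opaque rep.

(** * An invariant symplectic form *)

Section form.
Variable F : fieldType.

Lemma mx4_mul (r0 r1 r2 r3 : 'rV[F]_4) (B : 'M[F]_4) :
  mx4 r0 r1 r2 r3 *m B = mx4 (r0 *m B) (r1 *m B) (r2 *m B) (r3 *m B).
Proof.
apply/matrixP => i j; rewrite !mxE; case: i => [[|[|[|[|i]]]] hi] //=;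
  by rewrite mxE; apply: eq_bigr => k _; rewrite mxE.
Qed.

Lemma tr_mx4 (a0 a1 a2 a3 b0 b1 b2 b3 c0 c1 c2 c3 d0 d1 d2 d3 : F) :
  (mx4 (row4 a0 a1 a2 a3) (row4 b0 b1 b2 b3) (row4 c0 c1 c2 c3) (row4 d0 d1 d2 d3))^T =
  mx4 (row4 a0 b0 c0 d0) (row4 a1 b1 c1 d1) (row4 a2 b2 c2 d2) (row4 a3 b3 c3 d3).
Proof.
apply/matrixP => i j; rewrite !mxE; case: i => [[|[|[|[|i]]]] hi] //=;
  by rewrite mxE; case: j => [[|[|[|[|j]]]] hj] //=; rewrite mxE.
Qed.

Lemma one_mx4 : 1%:M = mx4 (row4 1 0 0 0) (row4 0 1 0 0) (row4 0 0 1 0) (row4 0 0 0 1) :> 'M[F]_4.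
Proof.
apply/matrixP => i j; rewrite !mxE; case: i => [[|[|[|[|i]]]] hi] //=;
  by rewrite mxE; case: j => [[|[|[|[|j]]]] hj].
Qed.

Variable y : F.
Local Notation s1 := (y ^+ 3 - 2 * y).
Local Notation s2 := (y ^+ 4 - 3 * y ^+ 2 + 2).
Local Notation h := (4 + s1).
Local Notation delta := (((y + 2) * (y - 1)) ^+ 2).
Local Notation h2 := (2 * h - delta).
Local Notation b := (h - s2 * h - s1 * h2).

(** The form for which the transvection is symplectic, so that its first row
    is proportional to [model_H], extended by invariance under [model_S]. *)
Definition model_form := mx4 (row4 0 h h2 h) (row4 (- h) 0 b h2) (row4 (- h2) (- b) 0 h) (row4 (- h) (- h2) (- h) 0).

Lemma model_form_S : (model_S y)^T *m model_form *m model_S y = model_form.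
Proof.
rewrite /model_form /model_S tr_mx4 !mx4_mul !row4_mul !row4Z !row4D !row4_mul !row4Z !row4D.
by congr mx4; congr row4; ring.
Qed.

Lemma model_form_T : (model_T y)^T *m model_form *m model_T y = model_form.
Proof.
have -> : model_T y = mx4 (row4 1 h h2 h) (row4 0 1 0 0) (row4 0 0 1 0) (row4 0 0 0 1).
  rewrite /model_T one_mx4 /model_H; apply/matrixP => i j; rewrite !mxE big_ord1 !mxE.
  case: i => [[|[|[|[|i]]]] hi] //=; rewrite !mxE; by case: j => [[|[|[|[|j]]]] hj] //=; ring.
rewrite /model_form tr_mx4 !mx4_mul !row4_mul !row4Z !row4D !row4_mul !row4Z !row4D.
by congr mx4; congr row4; ring.
Qed.

(** Symplectic Gram-Schmidt. *)
Local Notation kappa := (h + b - h2 ^+ 2 / h).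
Definition darboux := mx4 (row4 0 1 (h2 / h) 1) (row4 0 0 kappa 0) (row4 (- h) 0 b h2) (row4 0 0 0 1).

Hypotheses (h0 : h != 0) (d0 : delta != 0).

Lemma kappa_neq0 : kappa != 0.
Proof.
have E : kappa * h = - delta ^+ 2.
  rewrite mulrBl divfK//; ring.
by apply/eqP => K; move: E; rewrite K mul0r => /esym/eqP; rewrite oppr_eq0 expf_eq0/= (negPf d0).
Qed.

Lemma darboux_unit : darboux \in unitmx.
Proof.
have k0 := kappa_neq0; move: k0 h0; rewrite /darboux.
move: h h2 b => u v w; move: (u + w - v ^+ 2 / u) => k k0 u0.
suff E : mx4 (row4 0 1 (v / u) 1) (row4 0 0 k 0) (row4 (- u) 0 w v) (row4 0 0 0 1) *m
  mx4 (row4 0 (w / (k * u)) (- u^-1) (v / u)) (row4 1 (- (v / u) / k) 0 (-1)) (row4 0 k^-1 0 0) (row4 0 0 0 1) = 1%:M.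
  by case: (mulmx1_unit E).
rewrite one_mx4 !mx4_mul !row4_mul !row4Z !row4D; congr mx4; congr row4; field; by rewrite ?k0 ?u0.
Qed.

End form.

Section symplectic_basis.
Context {R : realType}.

Lemma symplectic_conj (A E W J0 : 'M[R]_4) : E \in unitmx -> A *m E = E *m W ->
  E^T *m symp_form *m E = J0 -> W^T *m J0 *m W = J0 -> Defs.is_symplectic A.
Proof.
move=> EU e JE JW; have ET : E^T \in unitmx by rewrite unitmx_tr.
have key : E^T *m (A^T *m symp_form *m A) *m E = E^T *m symp_form *m E.
  have -> : E^T *m (A^T *m symp_form *m A) *m E = (A *m E)^T *m symp_form *m (A *m E) by rewrite trmx_mul !mulmxA.
  rewrite e trmx_mul.
  have -> : W^T *m E^T *m symp_form *m (E *m W) = W^T *m (E^T *m symp_form *m E) *m W by rewrite !mulmxA.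
  by rewrite JE JW.
apply/eqP; have := congr1 (fun X => invmx E^T *m (X *m invmx E)) key.
by rewrite !mulmxK// !mulKmx.
Qed.

(** Closure under inverses holds because a real isometry of a nondegenerate
    form has a real inverse. *)
Lemma isometries_subgroup (G : groupType) (h : G -> 'M[R[i]]_4) (Q : 'M[R[i]]_4) (J0 : 'M[R]_4) :
  (forall w v, h (w * v)%g = h w *m h v) -> h 1%g = 1%:M -> Q \in unitmx -> J0 \in unitmx ->
  is_subgroup [set w | exists W : 'M[R]_4,
    h w *m Q = Q *m map_mx (real_complex R) W /\ W^T *m J0 *m W = J0].
Proof.
move=> hM h1 QU JU.
split; first by exists 1%:M; rewrite h1 map_mx1 mul1mx mulmx1 trmx1 mul1mx mulmx1.
move=> a c [A [hA JA]] [C [hC JC]].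
pose V := invmx J0 *m C^T *m J0.
have VC : V *m C = 1%:M by rewrite /V -!mulmxA [C^T *m _]mulmxA JC mulVmx.
have CV := mulmx1C VC; exists (A *m V); split.
  have e : h c^-1%g *m h c = 1%:M by rewrite -hM mulVg h1.
  have hV : h c^-1%g *m Q = Q *m map_mx (real_complex R) V.
    rewrite -[Q in LHS]mulmx1 -(map_mx1 (real_complex R)) -CV map_mxM.
    by rewrite [Q *m _]mulmxA -hC !mulmxA e mul1mx.
  by rewrite hM -(mulmxA (h a)) hV (mulmxA (h a)) hA -(mulmxA Q) -map_mxM.
have JV : V^T *m J0 *m V = J0.
  rewrite -[J0 in LHS]JC; have := congr1 trmx CV; rewrite trmx_mul trmx1 => e.
  have -> : V^T *m (C^T *m J0 *m C) *m V = (V^T *m C^T) *m J0 *m (C *m V) by rewrite !mulmxA.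
  by rewrite e CV mul1mx mulmx1.
have -> : (A *m V)^T *m J0 *m (A *m V) = V^T *m (A^T *m J0 *m A) *m V by rewrite trmx_mul !mulmxA.
by rewrite JA JV.
Qed.

Lemma symp_formE : symp_form = mx4 (row4 0 0 1 0) (row4 0 0 0 1) (row4 (-1) 0 0 0) (row4 0 (-1) 0 0) :> 'M[R]_4.
Proof.
have e4 (i : 'I_4) : [\/ i = lshift 2 (0 : 'I_2) :> 'I_(2 + 2), i = lshift 2 (1 : 'I_2) :> 'I_(2 + 2),
    i = rshift 2 (0 : 'I_2) :> 'I_(2 + 2) | i = rshift 2 (1 : 'I_2) :> 'I_(2 + 2)].
  by case: i => [[|[|[|[|i]]]] hi] //; [apply: Or41|apply: Or42|apply: Or43|apply: Or44]; apply: val_inj.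
apply/matrixP => i j; rewrite /symp_form.
by case: (e4 i) => ->; case: (e4 j) => ->;
  rewrite ?(@block_mxEul _ 2 2 2 2) ?(@block_mxEur _ 2 2 2 2) ?(@block_mxEdl _ 2 2 2 2) ?(@block_mxEdr _ 2 2 2 2) !mxE /= ?mxE /= ?mulr1n ?mulr0n ?oppr0.
Qed.

Lemma darboux_form (y : R) : 4 + (y ^+ 3 - 2 * y) != 0 ->
  (darboux y)^T *m symp_form *m darboux y = model_form y.
Proof.
move=> h0; rewrite symp_formE /darboux /model_form tr_mx4 !mx4_mul !row4_mul !row4Z !row4D !row4_mul !row4Z !row4D.
move: h0; move: (4 + (y ^+ 3 - 2 * y)) => h h0.
by congr mx4; congr row4; field.
Qed.

Variables (N : nat) (N4 : (4 <= N)%N) (f : 'I_4 -> R[i] -> R[i]).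
Hypothesis fb : solution_basis N f.
Local Notation y := (@half_trace R N).
Local Notation cx := (map_mx (real_complex R)).
Local Notation J0 := (model_form y).
Local Notation E := (darboux y).

Lemma model_units : 4 + (y ^+ 3 - 2 * y) != 0 /\ E \in unitmx.
Proof.
have [y7 y2 yy2] := @y_bounds R N N4.
have h0 : 4 + (y ^+ 3 - 2 * y) != 0.
  have -> : 4 + (y ^+ 3 - 2 * y) = y * (y ^+ 2 - 2) + 4 by ring.
  by apply: lt0r_neq0; apply: ltr_wpDl => //; apply: mulr_ge0 => //; lra.
split => //; apply: darboux_unit => //; exact: lt0r_neq0 (delta_pos y7).
Qed.

Variables (Q : 'M[R[i]]_4) (QU : Q \in unitmx).
Local Notation r := (pi1_class (@base_point_in R) loop_around_infty).
Local Notation t := (pi1_class (@base_point_in R) loop_around1).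
Hypotheses (Qr : rep fb r *m Q = Q *m cx (- model_S y)) (Qt : rep fb t *m Q = Q *m cx (model_T y)).

Definition isometry_at w := exists W : 'M[R]_4, rep fb w *m Q = Q *m cx W /\ W^T *m J0 *m W = J0.

Lemma all_isometries w : isometry_at w.
Proof.
have [h0 EU] := model_units; have JE := darboux_form h0.
have JU : J0 \in unitmx.
  rewrite -JE !unitmx_mul unitmx_tr EU /= andbT.
  have e : symp_form *m (- symp_form) = 1%:M :> 'M[R]_4 by rewrite mulmxN symp_form_sqr opprK.
  by case: (mulmx1_unit e).
apply: (@pi1_generated R isometry_at).
- exact: (isometries_subgroup (repM fb) (rep1 fb) QU JU).
- exists (- model_S y); split => //; rewrite -[RHS]model_form_S.
  have -> : (- model_S y)^T = - (model_S y)^T by apply/matrixP => i j; rewrite !mxE.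
  by rewrite !mulNmx mulmxN opprK.
- by exists (model_T y); split => //; exact: model_form_T.
Qed.

Lemma lin_row (P : 'M[R[i]]_4) c : lin (fun i => lin f (row i P)) c = lin f (c *m P).
Proof.
by apply/funext => z; exact: lin_lin.
Qed.

(** In the basis given by the rows of [darboux], the model form becomes the
    standard one. *)
Lemma symplectic_basis_exists : exists g : 'I_4 -> R[i] -> R[i], real_symplectic_basis N g.
Proof.
have [h0 EU] := model_units; have JE := darboux_form h0.
pose P := cx E *m invmx Q; have PU : P \in unitmx by rewrite unitmx_mul map_unitmx EU unitmx_inv.
exists (fun i => lin f (row i P)); split; first split.
- by move=> i; exact: (lin_local fb).
- move=> g gs; have [c [gc cu]] := fb.2 g gs; exists (c *m invmx P); split.
    by have := lin_row P (c *m invmx P); rewrite /lin => ->; rewrite mulmxKV.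
  move=> d gd; have := lin_row P d; rewrite /lin => e; rewrite e in gd.
  by rewrite (cu _ gd) mulmxK.
- move=> p; have [W [hW JW]] := all_isometries (pi1_class (@base_point_in R) p).
  pose A := E *m W *m invmx E.
  have As : Defs.is_symplectic A by apply: (symplectic_conj EU _ JE JW); rewrite /A mulmxKV.
  exists (MkSp4 As) => i; have := mono_lin (row i P) (mono_rep fb p).
  have -> : row i P *m rep fb (pi1_class base_point_in p) = row i (cx A) *m P.
    rewrite -!row_mul; congr row; rewrite /P /A !map_mxM map_invmx mulmxA mulmxKV ?map_unitmx//.
    by rewrite -!mulmxA; congr (_ *m _); rewrite -[LHS](mulmxK QU) -[invmx Q *m _ *m Q]mulmxA hW mulKmx.
  rewrite -lin_row; congr (continues N p _ _).
  by apply/funext => z; rewrite /lin; apply: eq_bigr => j _; rewrite !mxE.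
Qed.

End symplectic_basis.

(** * Discreteness *)

Section test_functions.
Context {R : realType}.
Variables (N : nat) (N4 : (4 <= N)%N).
Local Notation y := (@half_trace R N).
Local Notation S := (model_S y).
Local Notation cx := (map_mx (real_complex R)).
Implicit Types M : 'M[R]_4.

(** On a space of matrices a linear form is a combination of entries. *)
Lemma continuous_linear_form (F : 'M[R]_4 -> R) :
  (forall M M', F (M + M') = F M + F M') -> (forall k M, F (k *: M) = k * F M) -> continuous F.
Proof.
move=> FD FZ; have F0 : F 0 = 0 by have := FZ 0 0; rewrite scaler0 mul0r.
have FE M : F M = \sum_i \sum_j F (delta_mx i j) * M i j.
  rewrite {1}(matrix_sum_delta M) (big_morph F FD F0); apply: eq_bigr => i _.
  by rewrite (big_morph F FD F0); apply: eq_bigr => j _; rewrite FZ mulrC.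
rewrite (_ : F = fun M => \sum_i \sum_j F (delta_mx i j) * M i j); last by apply/funext.
have sum_cont (I : Type) (s : seq I) (G : I -> 'M[R]_4 -> R) : (forall i, continuous (G i)) ->
    continuous (fun M => \sum_(i <- s) G i M).
  move=> cG; elim: s => [|i s IH].
    by rewrite (_ : (fun _ => _) = fun=> 0); [exact: continuous_const|apply/funext => M; rewrite big_nil].
  rewrite (_ : (fun _ => _) = fun M => G i M + \sum_(i <- s) G i M).
    exact: continuous_add.
  by apply/funext => M; rewrite big_cons.
apply: (sum_cont) => i; apply: (sum_cont) => j; apply: continuous_scale.
exact: coord_continuous.
Qed.

Lemma inKo_exists : exists v : 'rV[R]_4, inKo N v.
Proof.
have [y7 y2 yy2] := @y_bounds R N N4; have d0 := delta_pos y7.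
pose s := 4 + (2 * (top_H y - 2) + 1) / delta_of y.
exists (row4 1 ((s - delta_of y / 4 + 2) / 2) (s - 2) ((s + delta_of y / 4 - 2) / 2)).
have dn : delta_of y != 0 by exact: lt0r_neq0.
move=> i i4; rewrite tv_row4; case: i i4 => [|[|[|[|i]]]] // _; rewrite /cone_form /=.
- by have -> : forall a b : R, (a - b + 2) / 2 + (a + b - 2) / 2 - (a - 2) - 1 = 1 by move=> a b; field.
- rewrite (_ : _ - _ = delta_of y / 4); first by rewrite divr_gt0.
  by move: s (delta_of y) => a b; field.
- rewrite (_ : _ - _ = 1); first exact: ltr01.
  by rewrite /s; move: dn; move: (delta_of y) (top_H y) => a b a0; field.
- rewrite (_ : _ - _ = delta_of y / 2); first by rewrite divr_gt0.
  by move: s (delta_of y) => a b; field.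
Qed.

Lemma inKo_N (v : 'rV[R]_4) : inKo N v -> ~ inKo N (- v).
Proof.
move=> h1 h2; have := h1 0%N isT; have := h2 0%N isT.
by rewrite -scaleN1r coordZ => a b; lra.
Qed.

Variables (v0 : 'rV[R]_4) (A B : 'M[R[i]]_4).

(** Linear in [M], and equal to the real matrix of [M] when there is one. *)
Definition real_part M : 'M[R]_4 := map_mx (@complex.Re R) (A *m cx M *m B).

(** Since S ^ N = - 1, this is the point whose rotation by [m] is the image under
    [M] of the test point rotated by [m]. *)
Definition sector_point m M := - (v0 *m S ^+ m *m real_part M *m S ^+ (N - m)).
Definition sector_test m i M := cone_form y i (tv (sector_point m M)).

Lemma sector_test_continuous m i : continuous (sector_test m i).
Proof.
have rD M M' : real_part (M + M') = real_part M + real_part M'.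
  rewrite /real_part map_mxD mulmxDr mulmxDl; apply/matrixP => a b; rewrite !mxE.
  by move: (\sum_j _) (\sum_j _) => [p q] [p' q'].
have rZ k M : real_part (k *: M) = k *: real_part M.
  rewrite /real_part map_mxZ -scalemxAr -scalemxAl; apply/matrixP => a b; rewrite !mxE.
  by move: (\sum_j _) => [p q] /=; rewrite mul0r subr0.
apply: continuous_linear_form => [M M'|k M]; rewrite /sector_test /sector_point.
  by rewrite rD mulmxDr mulmxDl opprD coordD.
by rewrite rZ -scalemxAr -scalemxAl -scalerN coordZ.
Qed.

Definition sector_nbhd : set 'M[R]_4 :=
  ([set M | forall (m : 'I_N) (i : 'I_4), 0 < sector_test m i M])°.

Lemma sector_nbhd_in M : (forall (m : 'I_N) (i : 'I_4), 0 < sector_test m i M) -> sector_nbhd M.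
Proof.
move=> h; apply: (@filter_forall _ _ (fun (m : 'I_N) M' => forall i : 'I_4, 0 < sector_test m i M') (nbhs M)) => m.
apply: (@filter_forall _ _ (fun (i : 'I_4) M' => 0 < sector_test m i M') (nbhs M)) => i.
apply: (@open_nbhs_nbhs _ M (sector_test m i @^-1` [set x | 0 < x])); split; last exact: h.
apply: ((continuousP (sector_test m i)).1 (@sector_test_continuous m i)); exact: open_gt.
Qed.

Lemma sector_nbhdP M m i : sector_nbhd M -> (m < N)%N -> (i < 4)%N -> 0 < sector_test m i M.
Proof.
move=> /interior_subset h mN i4; exact: (h (Ordinal mN) (Ordinal i4)).
Qed.

End test_functions.

(** * The monodromy groups *)

Lemma morph_div (G H : groupType) (h : G -> H) : {morph h : a b / (a * b)%g} ->
  forall a b, h (a^-1 * b)%g = ((h a)^-1 * h b)%g.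
Proof. by move=> hM a b; rewrite hM (morph_inv hM). Qed.

Lemma hom_subgroup (G G' H : groupType) (h : G -> H) (k : G' -> H) :
  {morph h : a b / (a * b)%g} -> {morph k : a b / (a * b)%g} ->
  is_subgroup [set w : G' | exists x, h x = k w].
Proof.
move=> hM kM; split; first by exists 1%g; rewrite (morph_one hM) (morph_one kM).
by move=> w v [a ea] [c ec]; exists (a * c^-1)%g; rewrite hM kM (morph_inv hM) (morph_inv kM) ea ec.
Qed.

Lemma realized_subgroup {R : realType} (G : groupType) (Q : 'M[R[i]]_4) (k : G -> Sp4 R) :
  {morph k : a b / (a * b)%g} ->
  is_subgroup [set w : G | exists W V, acts Q (k w) W /\ W *m V = 1%:M].
Proof.
move=> kM; split; first by exists 1%:M, 1%:M; rewrite (morph_one kM) mulmx1; split => //; exact: acts1.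
move=> a b [W [V [hW WV]]] [W' [V' [hW' WV']]]; exists (W *m V'), (W' *m V); split.
  by rewrite kM (morph_inv kM); apply: actsM => //; apply: actsV WV'.
by rewrite mulmxA -(mulmxA W) (mulmx1C WV') mulmx1.
Qed.

Section monodromy_group.
Context {R : realType}.
Variables (N : nat) (N4 : (4 <= N)%N) (f : 'I_4 -> R[i] -> R[i]).
Hypothesis Hf : real_symplectic_basis N f.
Local Notation fb := Hf.1.
Local Notation y := (@half_trace R N).
Local Notation S := (model_S y).
Local Notation cx := (map_mx (real_complex R)).
Local Notation class p := (pi1_class (@base_point_in R) p).
Local Notation r := (class loop_around_infty).
Local Notation t := (class loop_around1).

Lemma sp_exists w : exists A : Sp4 R, cx A = rep fb w.
Proof.
by have [A HA] := Hf.2 (repr w); exists A; rewrite -(rep_class fb HA) pi1_class_repr.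
Qed.

Definition sp w : Sp4 R := projT1 (cid (sp_exists w)).

Lemma spE w : cx (sp w) = rep fb w.
Proof. exact: (projT2 (cid (sp_exists w))). Qed.

Local Opaque sp.

Lemma sp_inj_mx (A B : Sp4 R) : cx A = cx B -> A = B.
Proof. by move=> e; apply: val_inj; exact: (@map_mx_inj _ _ (real_complex R) _ _ _ _ e). Qed.

Lemma spM : {morph sp : w v / (w * v)%g}.
Proof.
move=> w v; apply: sp_inj_mx.
have E : cx (Sp4_mx (sp w * sp v)%g) = cx (sp w) *m cx (sp v) by rewrite -map_mxM.
exact: (etrans (spE (w * v)%g) (etrans (repM fb w v) (etrans (esym (congr2 _ (spE w) (spE v))) (esym E)))).
Qed.

Lemma sp_class p A : monodromy N f p A -> sp (class p) = A.
Proof. by move=> HA; apply: sp_inj_mx; rewrite spE; exact: rep_class. Qed.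

Lemma monodromy_sp w : monodromy N f (repr w) (sp w).
Proof. by rewrite /monodromy spE; exact: rep_mono. Qed.

Lemma Gamma_sp w : Gamma N f (sp w).
Proof. by exists (repr w); exact: monodromy_sp. Qed.

Lemma GammaP A : Gamma N f A -> exists w, A = sp w.
Proof. by move=> [p HA]; exists (class p); rewrite (sp_class HA). Qed.

Lemma PGamma_sp w : PGamma N f (Sp4_proj (sp w)).
Proof. by exists (sp w) => //; exact: Gamma_sp. Qed.

Lemma PGammaP P : PGamma N f P -> exists w, P = Sp4_proj (sp w).
Proof. by move=> [A /GammaP [w ->] <-]; exists w. Qed.

Lemma Gamma_subgroup : is_subgroup (Gamma N f).
Proof.
split; first by rewrite -(morph_one spM); exact: Gamma_sp.
by move=> _ _ /GammaP [w ->] /GammaP [v ->]; rewrite -(morph_inv spM) -spM; exact: Gamma_sp.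
Qed.

Lemma PGamma_subgroup : is_subgroup (PGamma N f).
Proof. by apply: is_subgroup_image Gamma_subgroup; exact: projM. Qed.

Lemma eq_subgroup (G H : groupType) (h k : G -> H) :
  {morph h : a b / (a * b)%g} -> {morph k : a b / (a * b)%g} -> is_subgroup [set x | h x = k x].
Proof.
move=> hM kM; split; first by rewrite /= (morph_one hM) (morph_one kM).
by move=> a b /= ea eb; rewrite hM kM (morph_inv hM) (morph_inv kM) ea eb.
Qed.

Local Notation psp := (fun w => Sp4_proj (sp w)).

Lemma pspM : {morph psp : w v / (w * v)%g}.
Proof. by move=> w v /=; rewrite spM projM. Qed.

Variables (Q : 'M[R[i]]_4) (QU : Q \in unitmx).
Hypotheses (Qr : rep fb r *m Q = Q *m cx (- S)) (Qt : rep fb t *m Q = Q *m cx (model_T y)).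

Lemma actR : acts Q (sp r) (- S). Proof. by rewrite /acts spE. Qed.
Lemma actT : acts Q (sp t) (model_T y). Proof. by rewrite /acts spE. Qed.

Definition realized A := exists W V, acts Q A W /\ W *m V = 1%:M.

Lemma realized_sp w : realized (sp w).
Proof.
apply: (@pi1_generated R [set w | realized (sp w)]); last first.
- exists (model_T y), (Tn N (-1)); split; first exact: actT.
  by rewrite -Tn1 TnD subrr Tn0.
- exists (- S), (S ^+ N.-1); split; first exact: actR.
  have N0 : (0 < N)%N by exact: leq_trans N4.
  rewrite mulNmx mulmxE -exprS prednK//.
  have -> : S ^+ N = - 1%:M by apply: eq_rowmul => v; rewrite S_N// mulmxN mulmx1.
  by rewrite opprK.
exact: (realized_subgroup Q spM).
Qed.

Lemma psp_rN : (Sp4_proj (sp r) ^+ N)%g = 1%g.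
Proof.
rewrite -(morph_exp projM); case: (Sp4_gN N4 QU actR) => ->; last exact: proj_opp1.
exact: morph_one projM.
Qed.

Lemma phi_exists : exists phi : {multiplicative RT_group N -> PSp4 R},
  phi (RT_gen N letter_R) = Sp4_proj (sp r) /\ phi (RT_gen N letter_T) = Sp4_proj (sp t).
Proof. exact: (RT_lift (Sp4_proj (sp t)) psp_rN). Qed.

Section presentation.
Variable phi : {multiplicative RT_group N -> PSp4 R}.
Hypotheses (phiR : phi (RT_gen N letter_R) = Sp4_proj (sp r))
           (phiT : phi (RT_gen N letter_T) = Sp4_proj (sp t)).

Lemma phi_injective : injective phi.
Proof. by have [v Kv] := inKo_exists (R := R) N4; exact: (phi_inj N4 QU actR actT phiR phiT Kv). Qed.

Lemma phi_image x : exists w, phi x = Sp4_proj (sp w).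
Proof.
suff [w e] : exists w, Sp4_proj (sp w) = phi x by exists w; exact: esym e.
apply: (@RT_generated N [set x | exists w, Sp4_proj (sp w) = phi x]).
- exact: (hom_subgroup pspM (phiM phi)).
- by exists r; exact: esym phiR.
- by exists t; exact: esym phiT.
Qed.

Lemma phi_onto w : exists x, phi x = Sp4_proj (sp w).
Proof.
apply: (@pi1_generated R [set w | exists x, phi x = Sp4_proj (sp w)]).
- exact: (hom_subgroup (phiM phi) pspM).
- by exists (RT_gen N letter_R).
- by exists (RT_gen N letter_T).
Qed.

Lemma phi_bij : set_bij setT (PGamma N f) phi.
Proof.
split.
- by move=> x _ /=; have [w ->] := phi_image x; exact: PGamma_sp.
- by move=> a b _ _; exact: phi_injective.
- by move=> P /PGammaP [w ->]; have [x e] := phi_onto w; exists x.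
Qed.

Section near_point.
Variables (v0 : 'rV[R]_4) (Kv : inKo N v0) (A0 : Sp4 R) (GA : Gamma N f A0).

Definition good_nbhd : set 'M[R]_4 := sector_nbhd N v0 (invmx Q *m cx (Sp4_mx A0^-1%g)) Q.

Lemma good_point m (B : Sp4 R) V : acts Q (A0^-1 * B)%g V ->
  sector_point N v0 (invmx Q *m cx (Sp4_mx A0^-1%g)) Q m B = - (v0 *m S ^+ m *m V *m S ^+ (N - m)).
Proof.
rewrite /acts /sector_point /real_part Sp4_mulE map_mxM -!mulmxA => ->; rewrite mulKmx//.
congr (- (_ *m (_ *m (_ *m _)))); apply/matrixP => i j; rewrite !mxE; by [].
Qed.

Lemma good_A0 : good_nbhd A0.
Proof.
apply: sector_nbhd_in => m i; rewrite /sector_test (@good_point _ _ 1%:M); last by rewrite mulVg; exact: acts1.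
rewrite mulmx1 -mulmxA mulmxE -exprD subnKC; last exact: ltnW.
by rewrite S_N// opprK; exact: Kv.
Qed.

(** Near [A0] the quotient by [A0] keeps the test points in their open cones. *)
Lemma good_proj (B : Sp4 R) : good_nbhd B -> PGamma N f (Sp4_proj B) -> Sp4_proj B = Sp4_proj A0.
Proof.
move=> gB /PGammaP [w ew]; have [w0 e0] := GammaP GA.
have [x ex] := phi_onto w; have [x0 ex0] := phi_onto w0.
have [V hV] : exists V, acts Q (A0^-1 * B)%g V.
  have [W [_ [hW _]]] := realized_sp w; have [W0 [V0 [hW0 WV0]]] := realized_sp w0.
  rewrite e0; case/projP: ew => ->.
    by exists (V0 *m W); apply: actsM hW; exact: actsV WV0.
  by exists (V0 *m - W); apply: actsM; [exact: actsV WV0|exact: actsN].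
have hx : phi (x0^-1 * x)%g = Sp4_proj (A0^-1 * B)%g.
  by rewrite (morph_div (phiM phi) x0 x) (morph_div projM A0 B) ex ex0 ew e0.
have x1 : (x0^-1 * x)%g = 1%g.
  apply: (sectors_fixed N4 QU actR actT phiR phiT hV hx Kv) => m mN.
  exists (- (v0 *m S ^+ m *m V *m S ^+ (N - m))).
    by rewrite -(good_point m hV) => i i4; exact: (sector_nbhdP gB mN i4).
  left; rewrite mulNmx -[_ *m S ^+ _ *m S ^+ _]mulmxA mulmxE -exprD subnK; last exact: ltnW.
  by rewrite S_N// opprK.
rewrite x1 (morph_one (phiM phi)) in hx.
rewrite (morph_div projM A0 B) in hx.
by rewrite -[LHS]mul1g -(mulgV (Sp4_proj A0)) -mulgA -hx mulg1.
Qed.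

Lemma good_opp : ~ good_nbhd (Sp4_mx (Sp4_opp1 * A0)%g).
Proof.
move=> g; have N0 : (0 < N)%N by exact: leq_trans N4.
apply: (inKo_N Kv) => i i4; have := sector_nbhdP g N0 i4.
rewrite /sector_test (@good_point _ _ (- 1%:M)).
  by rewrite expr0 mulmx1 subn0 mulmxN mulmx1 mulNmx S_N// opprK.
by rewrite opp1C mulgA mulVg -opp1C; exact: actsN (acts1 Q).
Qed.

Lemma Sp4_mx_open (O : set 'M[R]_4) : open O -> open ((@Sp4_mx R) @^-1` O).
Proof. by move=> oO; exists O. Qed.

Lemma Gamma_isolated : isolated (Gamma N f) A0.
Proof.
split; first by rewrite inE.
exists ((@Sp4_mx R) @^-1` good_nbhd).
  apply: open_nbhs_nbhs; split; last exact: good_A0.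
  by apply: Sp4_mx_open; exact: open_interior.
apply/seteqP; split => [B [gB GB]|_ ->]; last by split => //; exact: good_A0.
have /projP [//|e] := good_proj gB (ex_intro2 _ _ B GB erefl).
by case: good_opp; rewrite -e.
Qed.

Lemma PGamma_isolated : isolated (PGamma N f) (Sp4_proj A0).
Proof.
split; first by rewrite inE; exists A0.
exists (Sp4_proj @` ((@Sp4_mx R) @^-1` good_nbhd)); last first.
  apply/seteqP; split => [P [[B gB <-] PB]|_ ->]; first exact: good_proj.
  by split; exists A0 => //; exact: good_A0.
apply: open_nbhs_nbhs; split; last by exists A0 => //; exact: good_A0.
rewrite PSp4_openE.
rewrite (_ : _ @^-1` _ = (@Sp4_mx R) @^-1` (good_nbhd `|` (fun M => - M) @^-1` good_nbhd)).
  apply: Sp4_mx_open; apply: openU; first exact: open_interior.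
  apply: ((continuousP (fun M : 'M[R]_4 => - M)).1 _ _ (@open_interior _ _)).
  by move=> M; exact: opp_continuous.
apply/seteqP; split => [B [C gC /projP [e|e]]|B [gB|gB]].
- by left; rewrite /= -e.
- by right; rewrite /= -opp1E -e.
- by exists B.
- exists (Sp4_opp1 * B)%g; first exact: (eq_ind_r good_nbhd gB (opp1E B)).
  by apply/projP; right.
Qed.

End near_point.

Lemma Gamma_discrete : is_discrete (Gamma N f).
Proof. by have [v Kv] := inKo_exists (R := R) N4; move=> A GA; exact: (Gamma_isolated Kv). Qed.

Lemma PGamma_discrete : is_discrete (PGamma N f).
Proof. by have [v Kv] := inKo_exists (R := R) N4; move=> _ [A GA <-]; exact: (PGamma_isolated Kv). Qed.

(** The relation R^N = 1 holds in the symplectic group itself, so that the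
    presented group maps onto the full monodromy group, compatibly with [phi];
    an element over - 1 would lie in the kernel of [phi]. *)
Lemma Gamma_odd : odd N -> subgroup_isog (Gamma N f) (PGamma N f).
Proof.
move=> oN; have N0 : (0 < N)%N by exact: leq_trans N4.
have no : ~ Gamma N f Sp4_opp1.
  move=> /GammaP [w e]; have rN := Sp4_gN_parity N4 QU actR; rewrite oN in rN.
  have [psi [psiR psiT]] := RT_lift (sp t) rN.
  have psiM : {morph psi : a b / (a * b)%g} by exact: gmulfM.
  have [x ex] : exists x, psi x = sp w.
    apply: (@pi1_generated R [set w | exists x, psi x = sp w]); [|by exists (RT_gen N letter_R)|by exists (RT_gen N letter_T)].
    exact: (hom_subgroup psiM spM).
  have pE z : Sp4_proj (psi z) = phi z.
    have ppM : {morph (fun z => Sp4_proj (psi z)) : a b / (a * b)%g} by move=> a b; rewrite /= psiM projM.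
    apply: (@RT_generated N [set z | Sp4_proj (psi z) = phi z]).
    - exact: (eq_subgroup ppM (phiM phi)).
    - exact: etrans (congr1 Sp4_proj psiR) (esym phiR).
    - exact: etrans (congr1 Sp4_proj psiT) (esym phiT).
  have x1 : x = 1%g.
    by apply: phi_injective; rewrite -pE ex -e proj_opp1 (morph_one (phiM phi)).
  by apply: (@opp1_neq1 R); rewrite e -ex x1 (morph_one psiM).
exists Sp4_proj; first by move=> a b _ _; exact: projM.
split.
- by move=> A GA; exists A.
- move=> A B; rewrite !inE => GA GB /projP [//|e]; exfalso; apply: no.
  by have := Gamma_subgroup.2 _ _ GA GB; rewrite e mulgK.
- by move=> P [A GA <-]; exists A.
Qed.

Lemma Gamma_even : ~~ odd N -> is_Z2_central_extension Sp4_proj (Gamma N f) (PGamma N f).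
Proof.
move=> oN; split => //; first by move=> a b _ _; exact: projM.
have rN := Sp4_gN_parity N4 QU actR; rewrite (negPf oN) in rN.
have Go : Gamma N f Sp4_opp1 by rewrite -rN -(morph_exp spM r N); exact: Gamma_sp.
exists Sp4_opp1; split.
- by apply/eqP; exact: opp1_neq1.
- apply/seteqP; split => [A [GA /= e]|A [->|->]] /=.
  + have /projP : Sp4_proj A = Sp4_proj 1%g by rewrite e (morph_one projM).
    by rewrite mulg1 => -[->|->]; [left|right].
  + by split; [exact: Gamma_subgroup.1|exact: morph_one projM].
  + by split; [exact: Go|exact: proj_opp1].
- by move=> A _; exact: opp1C.
Qed.

Definition orb (w : @pi1_C01 R) : pi1_orb R N := quotg _ w.

Lemma orbM : {morph orb : a b / (a * b)%g}.
Proof. by move=> a b; exact: quotgM. Qed.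

Lemma orb_repr (u : pi1_orb R N) : orb (repr u) = u.
Proof. exact: quotg_repr. Qed.

Lemma orb_relation : (orb r ^+ N)%g = 1%g.
Proof.
rewrite -(morph_exp orbM r N) -(morph_one orbM); apply/quotgP; rewrite mulg1.
by apply: normal_closureV => A [_ SA]; exact: SA.
Qed.

Lemma orb_lift : exists rho : {multiplicative pi1_orb R N -> PSp4 R},
  forall w, rho (orb w) = Sp4_proj (sp w).
Proof.
have hS x : [set (r ^+ N)%g] x -> psp x = 1%g.
  by move=> -> /=; rewrite (morph_exp spM r N) (morph_exp projM) psp_rN.
have [rho E] := quotient_lift pspM hS.
by exists rho => w; exact: E.
Qed.

Lemma orb_onto (psi : {multiplicative RT_group N -> pi1_orb R N}) :
  psi (RT_gen N letter_R) = orb r -> psi (RT_gen N letter_T) = orb t -> forall u, exists x, psi x = u.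
Proof.
move=> psiR psiT u; rewrite -[u]orb_repr.
apply: (@pi1_generated R [set w | exists x, psi x = orb w]);
  [|by exists (RT_gen N letter_R)|by exists (RT_gen N letter_T)].
have psiM : {morph psi : a b / (a * b)%g} by exact: gmulfM.
exact: (hom_subgroup psiM orbM).
Qed.

Lemma orb_triangle (psi : {multiplicative RT_group N -> pi1_orb R N}) (rho : {multiplicative pi1_orb R N -> PSp4 R}) :
  psi (RT_gen N letter_R) = orb r -> psi (RT_gen N letter_T) = orb t ->
  (forall w, rho (orb w) = Sp4_proj (sp w)) -> forall z, rho (psi z) = phi z.
Proof.
move=> psiR psiT rhoq.
have psiM : {morph psi : a b / (a * b)%g} by exact: gmulfM.
have rhoM : {morph rho : a b / (a * b)%g} by exact: gmulfM.
have ppM : {morph (fun z => rho (psi z)) : a b / (a * b)%g} by move=> a b; rewrite /= psiM rhoM.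
apply: (@RT_generated N [set z | rho (psi z) = phi z]).
- exact: (eq_subgroup ppM (phiM phi)).
- exact: etrans (congr1 rho psiR) (etrans (rhoq r) (esym phiR)).
- exact: etrans (congr1 rho psiT) (etrans (rhoq t) (esym phiT)).
Qed.

(** Injectivity follows from that of [phi], which factors through the orbifold
    group by a surjection. *)
Lemma orbifold_isomorphism : exists rho : {multiplicative pi1_orb R N -> PSp4 R},
  (forall (p : C01_loop) (A : Sp4 R), monodromy N f p A -> rho (pi1_orb_class N p) = Sp4_proj A) /\
  set_bij setT (PGamma N f) rho.
Proof.
have [rho rhoq] := orb_lift.
have [psi [psiR psiT]] := RT_lift (orb t) orb_relation.
have onto := orb_onto psiR psiT; have tri := orb_triangle psiR psiT rhoq.
exists rho; split.
  by move=> p A HA; apply: etrans (rhoq (class p)) _; rewrite (sp_class HA).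
split.
- move=> u _; rewrite /= -[u]orb_repr rhoq; exact: PGamma_sp.
- move=> u v _ _ e; have [x ex] := onto u; have [z ez] := onto v.
  by move: e; rewrite -ex -ez !tri => /phi_injective ->.
- by move=> P /PGammaP [w ->]; exists (orb w); [exact: I|exact: rhoq].
Qed.

End presentation.
End monodromy_group.

Theorem theoremA (R : realType) (N : nat) (hN : (4 <= N)%N) :
  (exists f : 'I_4 -> R[i] -> R[i], real_symplectic_basis N f) /\
  forall f : 'I_4 -> R[i] -> R[i], real_symplectic_basis N f ->
  [/\ (forall gR gT : Sp4 R,
         monodromy N f loop_around_infty gR -> monodromy N f loop_around1 gT ->
         exists phi : {multiplicative RT_group N -> PSp4 R},
           [/\ phi (RT_gen N letter_R) = Sp4_proj gR,
               phi (RT_gen N letter_T) = Sp4_proj gT &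
               set_bij setT (PGamma N f) phi]) /\
      is_subgroup (PGamma N f) /\ is_discrete (PGamma N f),
      [/\ odd N -> subgroup_isog (Gamma N f) (PGamma N f),
          ~~ odd N ->
            is_Z2_central_extension Sp4_proj (Gamma N f) (PGamma N f),
          is_subgroup (Gamma N f) &
          is_discrete (Gamma N f)] &
      exists rho : {multiplicative pi1_orb R N -> PSp4 R},
        (forall (p : C01_loop) (A : Sp4 R), monodromy N f p A ->
           rho (pi1_orb_class N p) = Sp4_proj A) /\
        set_bij setT (PGamma N f) rho].
Proof.
split.
  have [f fb] := @solution_basis_exists R N; have [Q QU [Qr Qt]] := model_basis hN fb.
  exact: (symplectic_basis_exists hN QU Qr Qt).
move=> f Hf; have [Q QU [Qr Qt]] := model_basis hN Hf.1.
have [phi [phiR phiT]] := phi_exists hN QU Qr.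
split; last exact: (orbifold_isomorphism hN QU Qr Qt phiR phiT).
- split; last by split; [exact: PGamma_subgroup|exact: (PGamma_discrete hN QU Qr Qt phiR phiT)].
  move=> gR gT HR HT; exists phi; rewrite phiR phiT (sp_class Hf HR) (sp_class Hf HT).
  by split => //; exact: (phi_bij hN QU Qr Qt phiR phiT).
- split; [exact: (Gamma_odd hN QU Qr Qt phiR phiT)|exact: (Gamma_even hN QU Qr)|exact: Gamma_subgroup|].
  exact: (Gamma_discrete hN QU Qr Qt phiR phiT).
Qed.
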